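(* Let $(M,\phi_\alpha,\xi_\alpha,\eta_\alpha,g)$, $\alpha\in\{1,2,3\}$, be a $3$-quasi-Sasakian manifold of dimension $4n+3$ and rank $4l+3$. Then $M$ admits a canonical transversal hyper-K\''ahler structure given by a foliation whose leaves are $3$-$\alpha$-Sasakian manifolds. Explicitly: the distribution $\mathcal{E}^{4l+3}$ is integrable; its leaves, with the structure induced by restriction, are $3$-$\alpha$-Sasakian manifolds; and $\phi_1,\phi_2,\phi_3$ and $g$, restricted to $\mathcal{E}^{4m}$, project to a hyper-K\''ahler structure on the (local) space of leaves of the foliation defined by $\mathcal{E}^{4l+3}$.
   Context: Conventions: for a $1$-form $\eta$, $2d\eta(X,Y)=X(\eta(Y))-Y(\eta(X))-\eta([X,Y])$. An almost contact metric structure $(\phi,\xi,\eta,g)$ consists of a $(1,1)$-tensor $\phi$, a vector field $\xi$, a $1$-form $\eta$ and a Riemannian metric $g$ with $\phi^2=-I+\eta\otimes\xi$, $\eta(\xi)=1$, $g(\phi X,\phi Y)=g(X,Y)-\eta(X)\eta(Y)$. Its fundamental $2$-form is $\Phi(X,Y)=g(X,\phi Y)$. It is normal if $[\phi,\phi]+2d\eta\otimes\xi=0$ ($[\phi,\phi]$ the Nijenhuis torsion), quasi-Sasakian if it is normal and $d\Phi=0$, and $\alpha$-Sasakian, for a real constant $\alpha\ne0$, if it is normal and $d\eta=\alpha\Phi$. A quasi-Sasakian structure has rank $2p+1$ if $\eta\wedge(d\eta)^p\neq0$ and $(d\eta)^{p+1}=0$ on $M$; only structures of constant rank are considered. An almost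 $3$-contact metric manifold is a $(4n+3)$-dimensional manifold with three almost contact metric structures $(\phi_\alpha,\xi_\alpha,\eta_\alpha,g)$, $\alpha=1,2,3$, with the same metric $g$, such that for every even permutation $(\alpha,\beta,\gamma)$ of $\{1,2,3\}$: $\phi_\gamma=\phi_\alpha\phi_\beta-\eta_\beta\otimes\xi_\alpha=-\phi_\beta\phi_\alpha+\eta_\alpha\otimes\xi_\beta$, $\xi_\gamma=\phi_\alpha\xi_\beta=-\phi_\beta\xi_\alpha$, $\eta_\gamma=\eta_\alpha\circ\phi_\beta=-\eta_\beta\circ\phi_\alpha$. It is $3$-quasi-Sasakian if each structure is quasi-Sasakian, and $3$-$\alpha$-Sasakian if each structure is $\alpha$-Sasakian (with the same real constant $\alpha\ne0$). On a $3$-quasi-Sasakian manifold it is known that $\eta_1,\eta_2,\eta_3$ have the same rank, called the rank of $M$, of the form $4l+1$ or $4l+3$ for some $0\le l\le n$. Put $m=n-l$, $\mathcal{V}=\langle\xi_1,\xi_2,\xi_3\rangle$, $\mathcal{H}=\bigcap_{\alpha=1}^3\ker\eta_\alpha=\mathcal{V}^\perp$. Let $\mathcal{E}^{4m}=\{X\in\mathcal{H}: i_Xd\eta_\alpha=0\text{ for some }\alpha\}$ (equivalently, for all $\alpha$), a distribution of rank $4m$, let $\mathcal{E}^{4l}$ be its orthogonal complement in $\mathcal{H}$, and $\mathcal{E}^{4l+3}=\mathcal{E}^{4l}\oplus\mathcal{V}$. Both $\mathcal{E}^{4m}$ and $\mathcal{E}^{4l}$ are invariant under each $\phi_\alpha$.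 The normal bundle of the foliation is identified with $\mathcal{E}^{4m}$, and the ''space of leaves'' is understood locally, i.e. as the base of local submersions defining the foliation. *)

(* Defs.v *)
From HB Require Import structures.
From mathcomp Require Import all_boot all_order all_algebra.
From mathcomp Require Import fingroup perm.
From mathcomp Require Import ring.
From mathcomp Require Import all_classical all_reals all_analysis.

Set Implicit Arguments.
Unset Strict Implicit.
Unset Printing Implicit Defensive.

Import Order.TTheory GRing.Theory Num.Theory.
Import numFieldNormedType.Exports.

Local Open Scope classical_set_scope.
Local Open Scope ring_scope.

Section Smooth.
Variables (R : realType) (N : nat).
Implicit Types (V : set 'rV[R]_N) (f g : 'rV[R]_N -> R).

Fixpoint Ck (k : nat) V f : Prop :=
  (forall x, V x -> {for x, continuous f}) /\
  if k is k'.+1 then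
    (forall x v, V x -> derivable f x v) /\ (forall v, Ck k' V ('D_v f))
  else True.

Definition Csmooth V f := forall k, Ck k V f.

Lemma Ck_sub k V W f : W `<=` V -> Ck k V f -> Ck k W f.
Proof.
move=> WV; elim: k f => [|k IH] f /= [cf Hf]; split => //.
- by move=> x /WV; exact: cf.
- by move=> x /WV; exact: cf.
- case: Hf => df Df; split; first by move=> x v /WV; exact: df.
  by move=> v; apply: IH.
Qed.

Lemma Ck_ext k V f g : open V -> (forall x, V x -> f x = g x) ->
  Ck k V f -> Ck k V g.
Proof.
move=> oV; elim: k f g => [|k IH] f g fg /= [cf Hf].
all: have nfg x : V x -> \forall y \near x, f y = g y
  by move=> Vx; apply: filterS (open_nbhs_nbhs (conj oV Vx)) => y; exact: fg.
all: have cg x : V x -> {for x, continuous g}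
  by move=> Vx; move: (cf x Vx); rewrite /prop_for /continuous_at -(fg _ Vx) => H;
     apply: cvg_trans H; exact: (@near_eq_cvg _ _ (nbhs x) _ f g (nfg x Vx)).
- by split.
- split => //; case: Hf => df Df; split.
  + move=> x v Vx; apply: near_eq_derivable (df x v Vx); exact: nfg.
  + move=> v; apply: (IH ('D_v f)) => // x Vx; apply: near_eq_derive; exact: nfg.
Qed.

Lemma Ck_lin k V (a : R) f g : open V -> Ck k V f -> Ck k V g ->
  Ck k V (fun x => a * f x + g x).
Proof.
move=> oV; elim: k f g => [|k IH] f g /= [cf Hf] [cg Hg].
all: have cfg x : V x -> {for x, continuous (fun x => a * f x + g x)}
  by move=> Vx; exact: (cvgD (cvgM (cvg_cst a) (cf x Vx)) (cg x Vx)).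
- by split.
- split => //; case: Hf Hg => df Df [dg Dg]; split.
  + move=> x v Vx; apply: derivableD; last exact: dg.
    by apply: derivableZ; exact: df.
  + move=> v; apply: (@Ck_ext _ _ (fun x => a * 'D_v f x + 'D_v g x)) => //.
      move=> x Vx; have := @deriveD _ _ _ (a \*: f) g x v.
      by move=> ->; [rewrite deriveZ//; exact: df|apply: derivableZ; exact: df
                    |exact: dg].
    exact: IH.
Qed.

Lemma Ck_pred k V f : Ck k.+1 V f -> Ck k V f.
Proof.
elim: k f => [|k IH] f; first by case.
by move=> [cf [df Df]]; split => //; split => // v; apply: IH.
Qed.

Lemma Ck_cont k V f x : Ck k V f -> V x -> {for x, continuous f}.
Proof. by case: k => [|k] [cf _]; exact: cf. Qed.

Lemma Ck_mul k V f g : open V -> Ck k V f -> Ck k V g ->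
  Ck k V (fun x => f x * g x).
Proof.
move=> oV; elim: k f g => [|k IH] f g Hf Hg.
all: have cfg x : V x -> {for x, continuous (fun x => f x * g x)}
  by move=> Vx; exact: (cvgM (Ck_cont Hf Vx) (Ck_cont Hg Vx)).
- by split.
- split => //; have [_ [df Df]] := Hf; have [_ [dg Dg]] := Hg; split.
  + by move=> x v Vx; apply: derivableM; [exact: df|exact: dg].
  + move=> v; apply: (@Ck_ext _ _ (fun x => 1 * (f x * 'D_v g x) + g x * 'D_v f x)).
    * exact: oV.
    * move=> x Vx; have := @deriveM _ _ f g x v (df _ _ Vx) (dg _ _ Vx).
      by move=> ->; rewrite mul1r.
    * by apply: Ck_lin => //; [exact: IH (Ck_pred Hf) (Dg v)|exact: IH (Ck_pred Hg) (Df v)].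
Qed.

End Smooth.

Record chart (R : realType) (N : nat) (T : topologicalType) := Chart {
  cdom : set T;
  ccod : set 'rV[R]_N;
  cfun : T -> 'rV[R]_N;
  cinv : 'rV[R]_N -> T;
  cdom_open : open cdom;
  ccod_open : open ccod;
  cfun_cod : forall x, cdom x -> ccod (cfun x);
  cinv_dom : forall y, ccod y -> cdom (cinv y);
  cfunK : forall x, cdom x -> cinv (cfun x) = x;
  cinvK : forall y, ccod y -> cfun (cinv y) = y;
  cfun_cont : forall x, cdom x -> {for x, continuous cfun};
  cinv_cont : forall y, ccod y -> {for y, continuous cinv} }.

(* Manifolds are not assumed to be connected. *)
Record manifold (R : realType) (N : nat) := Manifold {
  mcarrier :> topologicalType;
  atlas : set (chart R N mcarrier);
  mhausdorff : hausdorff_space mcarrier;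
  mcountable : @second_countable mcarrier;
  atlas_cover : forall p : mcarrier, exists2 c, atlas c & cdom c p;
  atlas_smooth : forall c c', atlas c -> atlas c' -> forall i : 'I_N,
    Csmooth [set y | ccod c y /\ cdom c' (cinv c y)]
            (fun y => cfun c' (cinv c y) ord0 i) }.

Section Tangent.
Variables (R : realType) (N : nat) (M : manifold R N).
Implicit Types (f g : M -> R) (p q : M).

Definition smooth_on (U : set M) f := forall c, atlas c ->
  Csmooth [set y | ccod c y /\ U (cinv c y)] (f \o cinv c).

Definition smooth_at f p := exists U, [/\ open U, U p & smooth_on U f].

Lemma open_chart_img (c : chart R N M) (U : set M) : open U ->
  open [set y | ccod c y /\ U (cinv c y)].
Proof.
move=> oU; rewrite openE => y [cy Uy]; rewrite /interior.
have h1 : \forall z \near y, ccod c z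
  by apply: open_nbhs_nbhs; split => //; exact: ccod_open.
have h2 : \forall z \near y, U (cinv c z)
  by apply: (cinv_cont cy); apply: open_nbhs_nbhs.
by near=> z; split; near: z.
Unshelve. all: by end_near. Qed.

Lemma smooth_near f p : smooth_at f p -> \forall q \near p, smooth_at f q.
Proof.
move=> [U [oU Up fU]]; apply: filterS (open_nbhs_nbhs (conj oU Up)) => q Uq.
by exists U.
Qed.

Lemma smooth_ext f g p : (\forall q \near p, f q = g q) ->
  smooth_at f p -> smooth_at g p.
Proof.
move=> fg; have := fg : nbhs p (fun q => f q = g q).
rewrite nbhsE => -[W [oW Wp] Wfg] [U [oU Up fU]].
exists (U `&` W); split; [exact: openI|by []|] => c cM k.
have oV := open_chart_img (c := c) (openI oU oW).
apply: (@Ck_ext _ _ _ _ (f \o cinv c)) => //.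
  by move=> y [_ [_ Wy]] /=; exact: Wfg.
by apply: Ck_sub (fU c cM k) => y [? []].
Qed.

Lemma smooth_lin (a : R) f g p : smooth_at f p -> smooth_at g p ->
  smooth_at (fun q => a * f q + g q) p.
Proof.
move=> [U [oU Up fU]] [W [oW Wp gW]].
exists (U `&` W); split; [exact: openI|by []|] => c cM k.
have oV := open_chart_img (c := c) (openI oU oW).
apply: (@Ck_lin _ _ _ _ a (f \o cinv c) (g \o cinv c)) => //.
  by apply: Ck_sub (fU c cM k) => y [? []].
by apply: Ck_sub (gW c cM k) => y [? []].
Qed.

Lemma smooth_mul f g p : smooth_at f p -> smooth_at g p ->
  smooth_at (fun q => f q * g q) p.
Proof.
move=> [U [oU Up fU]] [W [oW Wp gW]].
exists (U `&` W); split; [exact: openI|by []|] => c cM k.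
have oV := open_chart_img (c := c) (openI oU oW).
apply: (@Ck_mul _ _ _ _ (f \o cinv c) (g \o cinv c)) => //.
  by apply: Ck_sub (fU c cM k) => y [? []].
by apply: Ck_sub (gW c cM k) => y [? []].
Qed.

(* Derivations at p of the algebra of germs of smooth functions at p.  They
   are total on M -> R; the first clause fixes the value outside the functions
   smooth at p, so that equality of derivations is equality of functions. *)
Definition derivation_at p (v : (M -> R) -> R^o) : Prop :=
  [/\ forall f, ~ smooth_at f p -> v f = 0,
      forall f g, smooth_at f p -> (\forall q \near p, f q = g q) -> v f = v g,
      forall (a : R) f g, smooth_at f p -> smooth_at g p ->
        v (fun q => a * f q + g q) = a * v f + v g
    & forall f g, smooth_at f p -> smooth_at g p ->
        v (fun q => f q * g q) = f p * v g + g p * v f].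

Definition derivations p : {pred (M -> R) -> R^o} :=
  fun v => `[< derivation_at p v >].

Lemma derivations_submod p : submod_closed (derivations p).
Proof.
split.
  by apply/asboolP; split => // *; rewrite ?mulr0 ?addr0.
move=> a u v /asboolP[u0 ul uD uM] /asboolP[v0 vl vD vM]; apply/asboolP; split.
- move=> f nf; have -> : (a *: u + v) f = a * u f + v f by [].
  by rewrite u0// v0// mulr0 addr0.
- move=> f g sf fg; have E h : (a *: u + v) h = a * u h + v h by [].
  by rewrite !E (ul f g)// (vl f g).
- move=> b f g sf sg; have E h : (a *: u + v) h = a * u h + v h by [].
  by rewrite !E uD// vD// !mulrDr !mulrA (mulrC a b) addrACA.
- move=> f g sf sg; have E h : (a *: u + v) h = a * u h + v h by [].
  rewrite !E uM// vM// !mulrDr !mulrA.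
  by rewrite (mulrC a (f p)) (mulrC a (g p)) addrACA.
Qed.

HB.instance Definition _ p :=
  GRing.isSubmodClosed.Build R _ (derivations p) (derivations_submod p).

Record tangent p := Tangent {
  tval :> (M -> R) -> R^o;
  tvalP : tval \in derivations p }.

HB.instance Definition _ p := [isSub for @tval p].
HB.instance Definition _ p := [Choice of tangent p by <:].
HB.instance Definition _ p := [SubChoice_isSubLmodule of tangent p by <:].

Lemma tangentP p (v : tangent p) : derivation_at p v.
Proof. by have /asboolP := tvalP v. Qed.

Definition vfield := forall p, tangent p.

Implicit Types X Y Z : vfield.

(* Applied to coordinate functions, this makes the components of X smooth on a
   neighbourhood of p. *)
Definition vsmooth_at X p :=
  forall f, smooth_at f p -> smooth_at (fun q => X q f) p.

Definition vsmooth X := forall p, vsmooth_at X p.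

Definition bracket_val X Y p : (M -> R) -> R^o := fun f =>
  if `[< [/\ smooth_at f p, vsmooth_at X p & vsmooth_at Y p] >]
  then X p (fun q => Y q f) - Y p (fun q => X q f) else 0.

Lemma bracket_valP X Y p : bracket_val X Y p \in derivations p.
Proof.
apply/asboolP; rewrite /bracket_val.
have [[sX sY]|nXY] := pselect (vsmooth_at X p /\ vsmooth_at Y p); last first.
  have E f : `[< [/\ smooth_at f p, vsmooth_at X p & vsmooth_at Y p] >] = false
    by apply/asboolP => -[_ ? ?]; apply: nXY.
  by split => *; rewrite ?E// ?mulr0 ?addr0.
pose w f := X p (fun q => Y q f) - Y p (fun q => X q f).
have E f : smooth_at f p ->
  (if `[< [/\ smooth_at f p, vsmooth_at X p & vsmooth_at Y p] >]
   then w f else 0) = w f by move=> sf; rewrite asboolT.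
have loc (Z : vfield) (f g : M -> R) : smooth_at f p ->
    (\forall q \near p, f q = g q) -> \forall q \near p, Z q f = Z q g.
  move=> sf fg; have fg' := near_join fg.
  have sf' := smooth_near sf; near=> q.
  by have [_ l _ _] := tangentP (Z q); apply: l; near: q.
have lin (Z : vfield) (a : R) (f g : M -> R) : smooth_at f p -> smooth_at g p ->
    \forall q \near p, a * Z q f + Z q g = Z q (fun q => a * f q + g q).
  move=> sf sg; have sf' := smooth_near sf; have sg' := smooth_near sg.
  by near=> q; have [_ _ l _] := tangentP (Z q); rewrite l//; near: q.
have lei (Z : vfield) (f g : M -> R) : smooth_at f p -> smooth_at g p ->
    \forall q \near p, 1 * (f q * Z q g) + g q * Z q f = Z q (fun q => f q * g q).
  move=> sf sg; have sf' := smooth_near sf; have sg' := smooth_near sg.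
  by near=> q; have [_ _ _ l] := tangentP (Z q); rewrite l// ?mul1r//; near: q.
have [X0 Xl XD XM] := tangentP (X p); have [Y0 Yl YD YM] := tangentP (Y p).
split.
- by move=> f nf; rewrite asboolF// => -[].
- move=> f g sf fg; have sg := smooth_ext fg sf.
  rewrite (E _ sf) (E _ sg) /w; congr (_ - _).
    by apply: Xl; [exact: sY|exact: loc].
  by apply: Yl; [exact: sX|exact: loc].
- move=> a f g sf sg; have sfg := smooth_lin a sf sg.
  rewrite (E _ sf) (E _ sg) (E _ sfg) /w.
  rewrite -(Xl _ _ _ (lin Y a f g sf sg)); last by apply: smooth_lin; exact: sY.
  rewrite -(Yl _ _ _ (lin X a f g sf sg)); last by apply: smooth_lin; exact: sX.
  rewrite XD; [|exact: sY..]; rewrite YD; [|exact: sX..].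
  by rewrite mulrBr opprD addrACA.
- move=> f g sf sg; have sfg := smooth_mul sf sg.
  have sXf := sX _ sf; have sXg := sX _ sg; have sYf := sY _ sf.
  have sYg := sY _ sg.
  rewrite (E _ sf) (E _ sg) (E _ sfg) /w.
  rewrite -(Xl _ _ _ (lei Y f g sf sg)); last first.
    by apply: smooth_lin; exact: smooth_mul.
  rewrite -(Yl _ _ _ (lei X f g sf sg)); last first.
    by apply: smooth_lin; exact: smooth_mul.
  rewrite XD; [|exact: smooth_mul..]; rewrite YD; [|exact: smooth_mul..].
  rewrite !XM// !YM//.
  ring.
Unshelve. all: by end_near. Qed.

(* The Lie bracket at p, defined to be 0 unless both fields are smooth near p *)
Definition bracket X Y : vfield := fun p => Tangent (bracket_valP X Y p).

Definition tensor11 := forall p, tangent p -> tangent p.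

Definition tapp (T : tensor11) X : vfield := fun p => T p (X p).

Definition smooth_tensor11 (T : tensor11) :=
  forall p, linear (T p) /\ (forall X, vsmooth_at X p -> vsmooth_at (tapp T X) p).

Definition oneform := forall p, tangent p -> R.

Definition smooth_oneform (eta : oneform) :=
  forall p, scalar (eta p) /\
    (forall X, vsmooth_at X p -> smooth_at (fun q => eta q (X q)) p).

Definition bilform := forall p, tangent p -> tangent p -> R.

Definition riemannian_metric (g : bilform) := forall p,
  [/\ forall v w, g p v w = g p w v,
      forall v, scalar (g p v),
      forall v, v != 0 -> 0 < g p v v
    & forall X Y, vsmooth_at X p -> vsmooth_at Y p ->
        smooth_at (fun q => g q (X q) (Y q)) p].

(* A k-form is represented by its values on k-tuples of vector fields; only
   fields that are smooth near the point of evaluation matter. *)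
Definition kform k := ('I_k -> vfield) -> M -> R.

(* (2 d eta)(X,Y) = X(eta(Y)) - Y(eta(X)) - eta([X,Y]) *)
Definition d1 (eta : oneform) X Y p : R :=
  2^-1 * (X p (fun q => eta q (Y q)) - Y p (fun q => eta q (X q))
          - eta p (bracket X Y p)).

(* 3 dw(X,Y,Z) = cyclic sum of X(w(Y,Z)) - w([X,Y],Z) *)
Definition d2 (w : bilform) X Y Z p : R :=
  3^-1 * (X p (fun q => w q (Y q) (Z q)) + Y p (fun q => w q (Z q) (X q))
          + Z p (fun q => w q (X q) (Y q))
          - w p (bracket X Y p) (Z p) - w p (bracket Y Z p) (X p)
          - w p (bracket Z X p) (Y p)).

Definition closed2 (w : bilform) := forall p X Y Z,
  vsmooth_at X p -> vsmooth_at Y p -> vsmooth_at Z p -> d2 w X Y Z p = 0.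

Definition nijenhuis (T : tensor11) X Y p : tangent p :=
  T p (T p (bracket X Y p)) + bracket (tapp T X) (tapp T Y) p
  - T p (bracket (tapp T X) Y p) - T p (bracket X (tapp T Y) p).

Definition form1 (eta : oneform) : kform 1 :=
  fun Xs p => eta p (Xs ord0 p).

Definition form_d1 (eta : oneform) : kform 2 :=
  fun Xs p => d1 eta (Xs ord0) (Xs ord_max) p.

Definition wedge k l (a : kform k) (b : kform l) : kform (k + l) :=
  fun Xs p => ((k + l)`!%:R)^-1 *
    \sum_(s : 'S_(k + l)) (-1) ^+ odd_perm s
      * a (fun i => Xs (s (lshift l i))) p * b (fun j => Xs (s (rshift k j))) p.

Fixpoint wedge_exp (w : kform 2) (r : nat) : kform (r * 2) :=
  if r is r'.+1 return kform (r * 2) then wedge w (@wedge_exp w r')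
  else fun _ _ => 1.

Arguments wedge_exp : clear implicits.

Definition nonzero_form_at k (a : kform k) p :=
  exists Xs : 'I_k -> vfield, (forall i, vsmooth_at (Xs i) p) /\ a Xs p != 0.

Record acm := Acm {
  acm_phi : tensor11;
  acm_xi : vfield;
  acm_eta : oneform;
  acm_g : bilform }.

Arguments acm_phi : clear implicits.
Arguments acm_xi : clear implicits.
Arguments acm_eta : clear implicits.
Arguments acm_g : clear implicits.

Definition almost_contact_metric (A : acm) :=
  let: Acm phi xi eta g := A in
  [/\ smooth_tensor11 phi, vsmooth xi, smooth_oneform eta,
      riemannian_metric g &
  forall p,
  [/\ forall v, phi p (phi p v) = - v + eta p v *: xi p,
      eta p (xi p) = 1
    & forall v w, g p (phi p v) (phi p w) = g p v w - eta p v * eta p w]].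

Definition fundamental_form (A : acm) : bilform :=
  fun p v w => acm_g A p v (acm_phi A p w).
Arguments fundamental_form : clear implicits.

Definition normal_acm (A : acm) := forall p X Y,
  vsmooth_at X p -> vsmooth_at Y p ->
  nijenhuis (acm_phi A) X Y p + (2 * d1 (acm_eta A) X Y p) *: acm_xi A p = 0.

Definition quasi_Sasakian (A : acm) :=
  [/\ almost_contact_metric A, normal_acm A & closed2 (fundamental_form A)].

Definition alpha_Sasakian (a : R) (A : acm) :=
  [/\ a != 0, almost_contact_metric A, normal_acm A &
    forall p X Y, vsmooth_at X p -> vsmooth_at Y p ->
      d1 (acm_eta A) X Y p = a * fundamental_form A p (X p) (Y p)].

(* eta /\ (d eta)^r <> 0 is read as "nowhere zero": the rank is constant. *)
Definition has_rank (A : acm) (k : nat) := exists r : nat,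
  [/\ k = (2 * r + 1)%N,
      forall p, nonzero_form_at
        (wedge (form1 (acm_eta A)) (wedge_exp (form_d1 (acm_eta A)) r)) p
    & forall p, ~ nonzero_form_at (wedge_exp (form_d1 (acm_eta A)) r.+1) p].

(* The index set {1,2,3} is represented by 'I_3 = {0,1,2}. *)

Record acm3 := Acm3 {
  phi3 : 'I_3 -> tensor11;
  xi3 : 'I_3 -> vfield;
  eta3 : 'I_3 -> oneform;
  g3 : bilform }.

Arguments phi3 : clear implicits.
Arguments xi3 : clear implicits.
Arguments eta3 : clear implicits.
Arguments g3 : clear implicits.

Definition acm_of (S : acm3) (a : 'I_3) : acm :=
  Acm (phi3 S a) (xi3 S a) (eta3 S a) (g3 S).

Definition three_contact_relations (S : acm3) :=
  let: Acm3 phi xi eta _ := S in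
  forall s : 'S_3, ~~ odd_perm s ->
  let a := s (inord 0) in let b := s (inord 1) in let c := s (inord 2) in
  forall p,
  [/\ forall v, phi c p v = phi a p (phi b p v) - eta b p v *: xi a p,
      forall v, phi c p v = - phi b p (phi a p v) + eta a p v *: xi b p,
      xi c p = phi a p (xi b p) /\ xi c p = - phi b p (xi a p)
    & forall v, eta c p v = eta a p (phi b p v) /\
                eta c p v = - eta b p (phi a p v)].

Definition distribution := forall p, set (tangent p).

Definition distV (S : acm3) : distribution := fun p =>
  [set v | exists c : 'I_3 -> R, v = \sum_(a < 3) c a *: xi3 S a p].
Arguments distV : clear implicits.

Definition distH (S : acm3) : distribution := fun p =>
  [set v | forall a, eta3 S a p v = 0].
Arguments distH : clear implicits.

(* i_v (d eta) = 0, evaluated through arbitrary smooth extensions of v *)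
Definition in_ker_d (eta : oneform) p (v : tangent p) := forall X Y,
  vsmooth_at X p -> vsmooth_at Y p -> X p = v -> d1 eta X Y p = 0.

Definition distE4m (S : acm3) : distribution := fun p =>
  [set v | distH S p v /\ exists a, in_ker_d (eta3 S a) v].
Arguments distE4m : clear implicits.

Definition distE4l (S : acm3) : distribution := fun p =>
  [set v | distH S p v /\ forall w, distE4m S p w -> g3 S p v w = 0].
Arguments distE4l : clear implicits.

Definition distE4l3 (S : acm3) : distribution := fun p =>
  [set v | exists u w, [/\ distE4l S p u, distV S p w & v = u + w]].

Definition kahler (J : tensor11) (h : bilform) :=
  [/\ smooth_tensor11 J,
      riemannian_metric h,
      forall p v, J p (J p v) = - v,
      forall p v w, h p (J p v) (J p w) = h p v w &
      (forall p X Y, vsmooth_at X p -> vsmooth_at Y p -> nijenhuis J X Y p = 0)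
      /\ closed2 (fun p v w => h p v (J p w))].

Definition hyper_kahler (J : 'I_3 -> tensor11) (h : bilform) :=
  (forall a, kahler (J a) h) /\
  forall s : 'S_3, ~~ odd_perm s ->
  let a := s (inord 0) in let b := s (inord 1) in let c := s (inord 2) in
  forall p v, J c p v = J a p (J b p v) /\ J c p v = - J b p (J a p v).

End Tangent.

Arguments phi3 {R N M}.
Arguments xi3 {R N M}.
Arguments eta3 {R N M}.
Arguments g3 {R N M}.
Arguments distE4m {R N M}.
Arguments distE4l3 {R N M}.

Definition almost_3_contact_metric (R : realType) (n : nat)
    (M : manifold R (4 * n + 3)) (S : acm3 M) :=
  (forall a, almost_contact_metric (acm_of S a)) /\ three_contact_relations S.

Definition three_quasi_Sasakian (R : realType) (n : nat)
    (M : manifold R (4 * n + 3)) (S : acm3 M) :=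
  almost_3_contact_metric S /\ forall a, quasi_Sasakian (acm_of S a).

Definition three_alpha_Sasakian (R : realType) (n : nat) (alpha : R)
    (M : manifold R (4 * n + 3)) (S : acm3 M) :=
  almost_3_contact_metric S /\ forall a, alpha_Sasakian alpha (acm_of S a).

Section Maps.
Variables (R : realType) (N1 N2 : nat) (M1 : manifold R N1) (M2 : manifold R N2).

(* For a continuous map, pulling smooth germs back to smooth germs is smoothness
   in charts. *)
Definition smooth_map_at (F : M1 -> M2) p :=
  {for p, continuous F} /\
  forall h, smooth_at h (F p) -> smooth_at (h \o F) p.

Definition tmap_val (F : M1 -> M2) p (v : tangent p) : (M2 -> R) -> R^o :=
  fun h => if `[< smooth_map_at F p /\ smooth_at h (F p) >]
           then v (h \o F) else 0.

Lemma tmap_valP (F : M1 -> M2) p (v : tangent p) :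
  tmap_val F v \in derivations (F p).
Proof.
apply/asboolP; rewrite /tmap_val.
have [sF|nF] := pselect (smooth_map_at F p); last first.
  have E h : `[< smooth_map_at F p /\ smooth_at h (F p) >] = false
    by apply/asboolP => -[].
  by split => *; rewrite ?E// ?mulr0 ?addr0.
have E h : smooth_at h (F p) ->
  (if `[< smooth_map_at F p /\ smooth_at h (F p) >] then v (h \o F) else 0)
  = v (h \o F) by move=> sh; rewrite asboolT.
have [v0 vl vD vM] := tangentP v; have [cF pF] := sF; split.
- by move=> h nh; rewrite asboolF// => -[].
- move=> f g sf fg; rewrite E// E; last exact: smooth_ext sf.
  by apply: (vl _ _ (pF _ sf)); have := cF _ (fg : nbhs (F p) (fun q => f q = g q)).
- move=> a f g sf sg; rewrite (E f)// (E g)// E; last exact: smooth_lin.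
  exact: (vD a _ _ (pF _ sf) (pF _ sg)).
- move=> f g sf sg; rewrite (E f)// (E g)// E; last exact: smooth_mul.
  exact: (vM _ _ (pF _ sf) (pF _ sg)).
Qed.

(* The tangent map of F at p, defined to be 0 unless F is smooth near p *)
Definition tmap (F : M1 -> M2) p (v : tangent p) : tangent (F p) :=
  Tangent (tmap_valP F v).

Definition smooth_map (F : M1 -> M2) := forall p, smooth_map_at F p.

Definition integral_manifold (D : distribution M2) (F : M1 -> M2) :=
  [/\ connected [set: M1], injective F, smooth_map F,
      forall p, injective (@tmap F p)
    & forall p, range (@tmap F p) = D (F p)].

(* With connected fibres, the points of M2 are the leaves of D in U.  The values
   of pi outside U are irrelevant. *)
Definition defining_submersion (D : distribution M1) (U : set M1)
    (pi : M1 -> M2) :=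
  [/\ open U,
      forall p, U p -> smooth_map_at pi p,
      forall p, U p -> range (@tmap pi p) = setT /\
                       D p = [set v | tmap pi v = 0],
      pi @` U = setT
    & forall b, connected (U `&` pi @^-1` [set b])].

Definition induced_structure (F : M1 -> M2) (S : acm3 M2) (S' : acm3 M1) :=
  forall p,
  [/\ forall a (v : tangent p), tmap F (phi3 S' a p v) = phi3 S a (F p) (tmap F v),
      forall a, tmap F (xi3 S' a p) = xi3 S a (F p),
      forall a (v : tangent p), eta3 S' a p v = eta3 S a (F p) (tmap F v)
    & forall v w : tangent p, g3 S' p v w = g3 S (F p) (tmap F v) (tmap F w)].

Definition projects_to (U : set M1) (pi : M1 -> M2) (S : acm3 M1)
    (J : 'I_3 -> tensor11 M2) (h : bilform M2) :=
  forall p, U p -> forall v w : tangent p, distE4m S p v -> distE4m S p w ->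
    (forall a, tmap pi (phi3 S a p v) = J a (pi p) (tmap pi v)) /\
    g3 S p v w = h (pi p) (tmap pi v) (tmap pi w).

End Maps.

Definition leaf (R : realType) (N d : nat) (M : manifold R N)
    (D : distribution M) (L : manifold R d) (F : L -> M) :=
  [/\ [set: L] !=set0, integral_manifold D F &
    forall (L' : manifold R d) (F' : L' -> M),
      integral_manifold D F' -> range F `<=` range F' -> range F' `<=` range F].

(* D of corank q is integrable: it is locally the vertical distribution of a
   submersion onto a q-dimensional manifold *)
Definition integrable_corank (R : realType) (N : nat) (q : nat)
    (M : manifold R N) (D : distribution M) :=
  forall p : M, exists (B : manifold R q) (U : set M) (pi : M -> B),
    U p /\ defining_submersion D U pi.

(* Main.v *)
(* For (a, b, c) cyclic let psi_c be the Lie derivative of phi_b along xi_a, so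
   that 2 d eta_c = g(., psi_c .).  The structure equations give
   [xi_a, xi_b] = f xi_c with f locally constant, and psi_c^2 = f phi_c psi_c.
   The rank forces f to be nowhere zero, hence the orthogonal projector onto
   E^{4m} is f^{-1} phi_c psi_c + 1 - eta_c xi_c, for every c, and on E^{4l+3} we
   have psi_c = f phi_c, that is d eta_c = (f / 2) Phi_c: the leaves are
   3-alpha-Sasakian with alpha = f / 2.  E^{4l+3} is the kernel of the closed form
   d eta_c - (f / 2) Phi_c, so it is involutive, and Frobenius' theorem applies.
   For Z in E^{4l+3}, closedness of the three forms Phi_a makes the Lie
   derivatives along Z of g and of all phi_a vanish on E^{4m} (Hitchin's argument
   for hyper-Kaehler structures), so that these tensors are constant along the
   connected fibres and descend; on horizontal lifts the Nijenhuis tensor of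
   phi_a is vertical by normality, and Phi_a is closed.  Smooth dependence of
   flows on the initial value gives local inversion and Frobenius' theorem. *)

Require Import Defs.
From HB Require Import structures.
From mathcomp Require Import all_boot all_order all_algebra.
From mathcomp Require Import fingroup perm.
From mathcomp Require Import ring lra.
From mathcomp Require Import zify.
From mathcomp Require Import all_classical all_reals all_analysis.

Set Implicit Arguments.
Unset Strict Implicit.
Unset Printing Implicit Defensive.

Import Order.TTheory GRing.Theory Num.Theory.
Import numFieldNormedType.Exports.

Local Open Scope classical_set_scope.
Local Open Scope ring_scope.

(** * Functions of class C^k *)

(** The analysis rests on one statement, [steering]: a system c' = u A(c), linear in a constant
    control u, is solved up to time one, smoothly in u and in the starting point. With A the inverse
    Jacobian of h and u = x - h(y0), the endpoint is a preimage of x; with A a commuting frame in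
    echelon form and u minus the echelon coordinates, it is the retraction onto a slice. The
    differential geometry is algebra: on an open set inside a chart, fields form a faithful
    Lie-Rinehart algebra over the reduced ring of functions; identities for d eta, Phi and the Lie
    derivatives are proved there and then evaluated at points. The relation psi_c^2 = f phi_c psi_c
    comes from differentiating along xi_a the equality phi_a psi_a = phi_b psi_b on H. Pfaffians of
    the Gram matrix of d eta turn the wedge hypotheses into a matrix rank, which yields both f != 0
    and the corank 4(n - l). Tangent spaces at different points of a fibre are compared through
    scalar functions: metric products, and derivatives of pulled-back functions. *)

Section RowNorm.
Variables (R : realType) (N : nat).
Implicit Types x y : 'rV[R]_N.

Lemma norm_coord x i : `|x 0 i| <= `|x|.
Proof.
by rewrite [leRHS]/Num.Def.normr /= mx_normrE; apply: (le_bigmax _ _ (0, i)).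
Qed.

Lemma rV_norm_le x (e : R) : 0 <= e -> (forall i, `|x 0 i| <= e) -> `|x| <= e.
Proof.
move=> e0 xe; rewrite [leLHS]/Num.Def.normr /= mx_normrE bigmax_le//= => -[i j] _ /=.
by rewrite (ord1 i).
Qed.

Lemma rV_norm_lt x (e : R) : 0 < e -> (forall i, `|x 0 i| < e) -> `|x| < e.
Proof.
move=> e0 xe; rewrite [ltLHS]/Num.Def.normr /= mx_normrE; apply/bigmax_ltP; split => //=.
by move=> [i j] _ /=; rewrite (ord1 i).
Qed.

Lemma rowZE (a : R) x i : (a *: x) 0 i = a * x 0 i.
Proof. by rewrite mxE. Qed.

Lemma rowBE x y i : (x - y) 0 i = x 0 i - y 0 i.
Proof. by rewrite !mxE. Qed.

Lemma rV_sum x : x = \sum_i x 0 i *: delta_mx 0 i.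
Proof. exact: row_sum_delta. Qed.

Lemma rV_cvgP (T : Type) (F : set_system T) {FF : Filter F} (f : T -> 'rV[R]_N)
    (l : 'rV[R]_N) :
  (forall i, f t 0 i @[t --> F] --> l 0 i) -> f @ F --> l.
Proof.
move=> H; apply/cvgrPdist_lt => e e0; near=> t.
apply: rV_norm_lt => // i; rewrite !mxE; move: i; near: t.
by apply: filter_forall => i; move/cvgrPdist_lt : (H i); exact.
Unshelve. all: by end_near. Qed.

End RowNorm.

Section Rays.
Variables (R : realType) (W : normedModType R).
Implicit Types (f : W -> R).

Lemma is_derive_ray f (u w : W) (t : R) : derivable f (u + t *: w) w ->
  is_derive t (1 : R) (fun s : R => f (u + s *: w)) ('D_w f (u + t *: w)).
Proof.
move=> df.
have E : (fun h => h^-1 *: ((f \o shift (u + t *: w)) (h *: w) - f (u + t *: w))) =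
  (fun h => h^-1 *: (((fun s => f (u + s *: w)) \o shift t) (h *: (1 : R)) - f (u + t *: w))).
  apply/funext => h /=; congr (_ *: (f _ - _)).
  by rewrite [h%:A]mulr1 scalerDl addrCA.
by apply: DeriveDef; rewrite /derivable /derive -?E.
Qed.

Lemma ray_mvt f (u w : W) :
  (forall t : R, 0 <= t <= 1 -> derivable f (u + t *: w) w) ->
  exists2 t : R, 0 <= t <= 1 & f (u + w) - f u = 'D_w f (u + t *: w).
Proof.
move=> df; pose g (s : R) := f (u + s *: w).
have dg (t : R) : 0 <= t <= 1 -> is_derive t (1 : R) g ('D_w f (u + t *: w)).
  by move=> t01; apply: is_derive_ray; exact: df.
have [||c c01 Ec] := @MVT_segment R g (fun t => 'D_w f (u + t *: w)) 0 1 ler01.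
- move=> t; rewrite in_itv /= => /andP[t0 t1]; apply: dg.
  by rewrite (ltW t0) (ltW t1).
- apply: derivable_within_continuous => t; rewrite in_itv /= => t01.
  by have := dg t t01 => -[].
exists c; first by move: c01; rewrite in_itv.
by move: Ec; rewrite /g scale1r scale0r addr0 subr0 mulr1.
Qed.

End Rays.

Section Ck.
Variables (R : realType) (N : nat).
Implicit Types (V : set 'rV[R]_N) (f g : 'rV[R]_N -> R).

Definition partial (i : 'I_N) f := 'D_(delta_mx 0 i) f.

Lemma Ck_derivable k V f x v : Ck k.+1 V f -> V x -> derivable f x v.
Proof. by move=> [_ [df _]] Vx; exact: df. Qed.

Lemma Ck_le k k' V f : (k <= k')%N -> Ck k' V f -> Ck k V f.
Proof.
move=> /subnK <-; elim: (k' - k)%N => [//|n IH] /Ck_pred; exact: IH.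
Qed.

Lemma Ck_partial k V f i : Ck k.+1 V f -> Ck k V (partial i f).
Proof. by move=> [_ [_ Df]]; exact: Df. Qed.

(** The increment is telescoped one coordinate at a time; the mean value theorem handles each step,
    and continuity of the partial derivatives at x controls the error. *)
Lemma C1_expansion V f x (e : R) : open V -> Ck 1 V f -> V x -> 0 < e ->
  \forall h \near (0 : 'rV[R]_N),
    `|f (x + h) - f x - \sum_i h 0 i * partial i f x| <= e * `|h|.
Proof.
move=> oV Hf Vx e0.
(* Dividing by [N.+1] leaves room for the sum of [N] coordinate errors, also when [N] is 0. *)
have [d d0 dV] : exists2 d : R, 0 < d & forall y, `|x - y| < d ->
    V y /\ forall i, `|partial i f x - partial i f y| <= e / N.+1%:R.
  have : \forall y \near x, V y /\ forall i,
      `|partial i f x - partial i f y| <= e / N.+1%:R.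
    near=> y; split.
      by near: y; exact: open_nbhs_nbhs.
    move=> i; move: i; near: y; apply: filter_forall => i.
    have /cvgrPdist_le := Ck_cont (Ck_partial i Hf) Vx.
    by apply; rewrite divr_gt0.
  move=> /nbhs_normP[d d0 dV]; exists d => // y xy; exact: dV.
near=> h.
have hd : `|h| < d by near: h; exact: (@nbhs0_lt _ 'rV[R]_N).
(* [tr k] keeps the first k coordinates of h; in the sup norm every intermediate point stays within
   |h| of x. *)
pose tr k : 'rV[R]_N := \row_j (if (j < k)%N then h 0 j else 0).
have step (i : 'I_N) : exists2 y, `|x - y| < d &
    f (x + tr i.+1) - f (x + tr i) = h 0 i * partial i f y.
  have E : x + tr i.+1 = (x + tr i) + h 0 i *: delta_mx 0 i.
    rewrite -addrA; congr (_ + _); apply/rowP => j; rewrite !mxE eqxx /= ltnS.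
    have [->|ji] := eqVneq i j; first by rewrite leqnn ltnn mulr1 add0r.
    by rewrite mulr0 addr0 leq_eqVlt (inj_eq val_inj) eq_sym (negbTE ji).
  have nr (t : R) : 0 <= t <= 1 -> `|x - (x + tr i + t *: (h 0 i *: delta_mx 0 i))| < d.
    move=> /andP[t0 t1]; apply: le_lt_trans hd.
    rewrite opprD addrA opprD addrA subrr sub0r -opprD normrN.
    apply: rV_norm_le => // j; rewrite !mxE eqxx /=.
    have [<-|ji] := eqVneq i j.
      rewrite ltnn add0r mulr1 normrM ger0_norm//.
      by apply: le_trans (norm_coord h i); rewrite ler_piMl.
    by rewrite !mulr0 addr0; case: ifP; rewrite ?normr0// norm_coord.
  have [t t01 Et] : exists2 t : R, 0 <= t <= 1 & f (x + tr i + h 0 i *: delta_mx 0 i) - f (x + tr i) =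
     'D_(h 0 i *: delta_mx 0 i) f (x + tr i + t *: (h 0 i *: delta_mx 0 i)).
    apply: ray_mvt => t t01; exact: (Ck_derivable Hf (dV _ (nr t t01)).1).
  exists (x + tr i + t *: (h 0 i *: delta_mx 0 i)); first exact: nr.
  rewrite E Et; set y := x + tr i + _.
  have Vy : V y by have [] := dV _ (nr t t01).
  rewrite /partial.
  have [->|hi] := eqVneq (h 0 i) 0; first by rewrite scale0r derive0 mul0r.
  have := @is_derive_ray R _ f y (h 0 i *: delta_mx 0 i) 0.
  rewrite scale0r addr0 => /(_ (Ck_derivable Hf Vy)) [_ <-].
  have d1 : derivable f y (delta_mx 0 i) := Ck_derivable Hf Vy.
  have id1 : is_derive (0 : R) (1 : R) (fun s => f (y + s *: delta_mx 0 i))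
     ('D_(delta_mx 0 i) f y).
    have := @is_derive_ray R _ f y (delta_mx 0 i) 0.
    by rewrite scale0r addr0; apply.
  have -> : (fun s : R => f (y + s *: (h 0 i *: delta_mx 0 i))) =
     (fun s => f (y + s *: delta_mx 0 i)) \o (fun s : R => h 0 i * s).
    by apply/funext => s /=; rewrite scalerA mulrC.
  rewrite -derive1E derive1_comp.
  + rewrite mulr0 !derive1E; have [_ ->] := id1.
    by rewrite deriveZ// derive_id /GRing.scale /= mulr1 mulrC.
  + by apply: derivableZ; exact: derivable_id.
  + by rewrite mulr0; case: id1.
have tr0 : x + tr 0%N = x.
  by rewrite -[RHS]addr0; congr (_ + _); apply/rowP => j; rewrite !mxE.
have trN : x + tr N = x + h.
  by congr (_ + _); apply/rowP => j; rewrite !mxE ltn_ord.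
have := telescope_sumr (fun k => f (x + tr k)) (leq0n N).
rewrite trN tr0 big_mkord => <-; rewrite -sumrB.
apply: (le_trans (ler_norm_sum _ _ _)).
apply: (@le_trans _ _ (\sum_(i < N) (e / N.+1%:R * `|h|))).
  apply: ler_sum => i _; have [y yd ->] := step i.
  rewrite -mulrBr normrM mulrC; apply: ler_pM => //; last exact: norm_coord.
  by rewrite distrC; have [_] := dV y yd; exact.
rewrite sumr_const card_ord -[_ *+ N]mulr_natl mulrA ler_wpM2r// mulrCA.
apply: ler_piMr; first exact: ltW.
by rewrite ler_pdivrMr// mul1r ler_nat.
Unshelve. all: by end_near. Qed.

(** [Ck] speaks of directional derivatives; continuity of the partials upgrades this to Frechet
    differentiability, on which the chain rule rests. *)
Lemma C1_differentiable V f x : open V -> Ck 1 V f -> V x ->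
  differentiable f x /\ forall v, 'D_v f x = \sum_i v 0 i * partial i f x.
Proof.
move=> oV Hf Vx.
pose L (h : 'rV[R]_N) : R := \sum_i h 0 i * partial i f x.
have Llin : linear L.
  move=> a u v; rewrite /L scaler_sumr -big_split /=; apply: eq_bigr => i _.
  by rewrite !mxE mulrDl /GRing.scale /= mulrA.
pose LL := GRing.isLinear.Build _ _ _ _ L Llin.
pose L' : {linear 'rV[R]_N -> R} := HB.pack L LL.
have cL : continuous L'.
  move=> h; apply: differentiable_continuous.
  have -> : (L' : _ -> _) = \sum_i (fun h : 'rV[R]_N => h 0 i * partial i f x).
    by apply/funext => y; rewrite fct_sumE.
  apply: differentiable_sum => i; apply: differentiableM => //.
  exact: differentiable_coord.
have exp : f \o shift x = cst (f x) + L' +o_ (0 : 'rV[R]_N) id.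
  apply/eqaddoP => _/posnumP[e]; near=> h.
  rewrite /= /cst /= -[(_ - _) h]/(f (h + x) - (f x + L h)) opprD addrA (addrC h).
  by near: h; exact: (C1_expansion oV Hf Vx).
have dE := diff_unique cL exp.
have df : differentiable f x by apply/diff_locallyP; rewrite dE.
by split => // v; rewrite deriveE // dE.
Unshelve. all: by end_near. Qed.

Lemma derive_partial k V f x v : open V -> Ck k.+1 V f -> V x ->
  'D_v f x = \sum_i v 0 i * partial i f x.
Proof.
move=> oV Hf Vx; have [] // := @C1_differentiable V f x oV _ Vx.
exact: Ck_le Hf.
Qed.

Lemma Ck_cst k V (a : R) : Ck k V (cst a).
Proof.
elim: k a => [|k IH] a /=; split => //; try by move=> x _; exact: cst_continuous.
split; first by move=> x v _; exact: derivable_cst.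
move=> v; have -> : 'D_v (cst a) = cst (0 : R); last exact: IH.
by apply/funext => x; rewrite derive_cst.
Qed.

Lemma Ck_add k V f g : open V -> Ck k V f -> Ck k V g ->
  Ck k V (fun x => f x + g x).
Proof.
move=> oV Hf Hg; apply: Ck_ext (Ck_lin 1 oV Hf Hg) => // x _; by rewrite mul1r.
Qed.

Lemma Ck_scale k V (a : R) f : open V -> Ck k V f -> Ck k V (fun x => a * f x).
Proof. by move=> oV; apply: Ck_mul => //; exact: Ck_cst. Qed.

Lemma Ck_opp k V f : open V -> Ck k V f -> Ck k V (fun x => - f x).
Proof.
move=> oV Hf; apply: Ck_ext (Ck_scale (-1) oV Hf) => // x _; by rewrite mulN1r.
Qed.

Lemma Ck_sub_fun k V f g : open V -> Ck k V f -> Ck k V g ->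
  Ck k V (fun x => f x - g x).
Proof. by move=> oV Hf Hg; apply: Ck_add => //; exact: Ck_opp. Qed.

Lemma Ck_sum k V (I : Type) (r : seq I) (P : pred I) (F : I -> 'rV[R]_N -> R) :
  open V -> (forall i, P i -> Ck k V (F i)) ->
  Ck k V (fun x => \sum_(i <- r | P i) F i x).
Proof.
move=> oV HF; elim: r => [|i r IH].
  by apply: Ck_ext (Ck_cst k V 0) => // x _; rewrite big_nil.
case Pi : (P i).
  apply: Ck_ext (Ck_add oV (HF i Pi) IH) => // x _; by rewrite big_cons Pi.
by apply: Ck_ext IH => // x _; rewrite big_cons Pi.
Qed.

Lemma Ck_prod k V (I : Type) (r : seq I) (P : pred I) (F : I -> 'rV[R]_N -> R) :
  open V -> (forall i, P i -> Ck k V (F i)) ->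
  Ck k V (fun x => \prod_(i <- r | P i) F i x).
Proof.
move=> oV HF; elim: r => [|i r IH].
  by apply: Ck_ext (Ck_cst k V 1) => // x _; rewrite big_nil.
case Pi : (P i).
  apply: Ck_ext (Ck_mul oV (HF i Pi) IH) => // x _; by rewrite big_cons Pi.
by apply: Ck_ext IH => // x _; rewrite big_cons Pi.
Qed.

Lemma Ck_inv k V f : open V -> (forall x, V x -> f x != 0) -> Ck k V f ->
  Ck k V (fun x => (f x)^-1).
Proof.
move=> oV f0; elim: k => [|k IH] Hf.
  by split => // x Vx; exact: (cvgV (f0 x Vx) (Ck_cont Hf Vx)).
have Hfi := IH (Ck_pred Hf).
split; first by move=> x Vx; exact: (cvgV (f0 x Vx) (Ck_cont Hf Vx)).
split=> [x v Vx|v].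
  by apply: derivableV; [exact: f0|exact: (Ck_derivable Hf Vx)].
have [_ [_ Df]] := Hf.
apply: (@Ck_ext _ _ _ _ (fun x => - ((f x)^-1 * (f x)^-1) * 'D_v f x)) => //.
  move=> x Vx; rewrite deriveV//; [|exact: f0|exact: (Ck_derivable Hf Vx)].
  by rewrite /GRing.scale /= expr2 invfM.
exact: (Ck_mul oV (Ck_opp oV (Ck_mul oV Hfi Hfi)) (Df v)).
Qed.

Lemma Ck_local k V f :
  (forall x, V x -> exists W, [/\ open W, W x & Ck k W f]) -> Ck k V f.
Proof.
elim: k f => [|k IH] f H.
  by split => // x /H[W [oW Wx Hf]]; exact: (Ck_cont Hf).
split; first by move=> x /H[W [oW Wx Hf]]; exact: (Ck_cont Hf).
split; first by move=> x v /H[W [oW Wx Hf]]; exact: (Ck_derivable Hf Wx).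
move=> v; apply: IH => x /H[W [oW Wx [_ [_ Hf]]]]; exists W; split => //.
exact: Hf.
Qed.

Lemma Ck_coord k V i : Ck k V (fun x => x 0 i).
Proof.
have cc x : {for x, continuous (fun x : 'rV[R]_N => x 0 i)} by exact: coord_continuous.
have dE (x v : 'rV[R]_N) : is_derive x v (fun x => x 0 i) (v 0 i).
  apply: DeriveDef.
    by apply/diff_derivable/differentiable_coord.
  rewrite /derive; apply: cvg_lim => //.
  have -> : (fun h : R => h^-1 *: (((fun x : 'rV[R]_N => x 0 i) \o shift x) (h *: v) - x 0 i)) =
     fun h : R => (h^-1 * h) * v 0 i.
    by apply/funext => h /=; rewrite !mxE addrK /GRing.scale /= mulrA.
  apply: cvg_near_cst; near=> h; rewrite mulVf ?mul1r//.
  by near: h; exact: nbhs_dnbhs_neq.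
case: k => [|k]; split => //; split; first by move=> x v _; have [] := dE x v.
move=> v; have -> : 'D_v (fun x : 'rV[R]_N => x 0 i) = cst (v 0 i); last exact: Ck_cst.
by apply/funext => x; have [_ ->] := dE x v.
Unshelve. all: by end_near. Qed.

Lemma partial_coord i j (x : 'rV[R]_N) : partial i (fun x => x 0 j) x = (j == i)%:R.
Proof.
rewrite /partial; have [_ [dc _]] := Ck_coord 1 [set: 'rV[R]_N] j.
have := @is_derive_ray R _ (fun x : 'rV[R]_N => x 0 j) x (delta_mx 0 i) 0.
rewrite scale0r addr0 => /(_ (dc _ _ I)) [_ <-].
have -> : (fun s : R => (x + s *: delta_mx 0 i) 0 j) = (fun s : R => s * (j == i)%:R + x 0 j).
  by apply/funext => s; rewrite !mxE eqxx addrC.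
rewrite deriveD ?derive_cst ?addr0; [|exact: derivableM|exact: derivable_cst].
by rewrite -derive1E derive1Mr ?derive1_id ?mul1r//.
Qed.

Lemma is_derive_coord (x v : 'rV[R]_N) i : is_derive x v (fun y : 'rV[R]_N => y 0 i) (v 0 i).
Proof.
have [_ [dc _]] := Ck_coord 1 [set: 'rV[R]_N] i.
apply: DeriveDef; first exact: dc.
rewrite (derive_partial _ openT (Ck_coord 1 _ i))//.
rewrite (bigD1 i)//= partial_coord eqxx mulr1 big1 ?addr0// => j ji.
by rewrite partial_coord eq_sym (negbTE ji) mulr0.
Qed.

End Ck.
Arguments partial {R N}.

Section Compose.
Variables (R : realType) (m n : nat).
Implicit Types (V : set 'rV[R]_m) (W : set 'rV[R]_n).

Lemma derive_comp_partial V W (F : 'rV[R]_m -> 'rV[R]_n) (f : 'rV[R]_n -> R) x v :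
  open V -> open W -> (forall y, V y -> W (F y)) ->
  (forall i, Ck 1 V (fun y => F y 0 i)) -> Ck 1 W f -> V x ->
  is_derive x v (f \o F) (\sum_i partial i f (F x) * 'D_v (fun y => F y 0 i) x).
Proof.
move=> oV oW FW HF Hf Vx.
have dF : differentiable F x.
  have -> : F = (fun y => \sum_i F y 0 i *: (delta_mx 0 i : 'rV[R]_n)).
    by apply/funext => y; rewrite -rV_sum.
  have -> : (fun y => \sum_i F y 0 i *: (delta_mx 0 i : 'rV[R]_n)) =
     \sum_i (fun y => F y 0 i *: (delta_mx 0 i : 'rV[R]_n)).
    by apply/funext => y; rewrite fct_sumE.
  apply: differentiable_sum => i; apply: differentiableZl.
  exact: (C1_differentiable oV (HF i) Vx).1.
have [df Df] := C1_differentiable oW Hf (FW _ Vx).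
apply: DeriveDef.
  by apply: diff_derivable; exact: differentiable_comp.
rewrite deriveE; last exact: differentiable_comp.
rewrite diff_comp //= -deriveE // Df; apply: eq_bigr => i _; rewrite mulrC; congr (_ * _).
have dFi := (C1_differentiable oV (HF i) Vx).1.
have := derive_mx (diff_derivable (v := v) dF); rewrite -deriveE // => ->.
by rewrite !mxE.
Qed.

Lemma Ck_comp k V W (F : 'rV[R]_m -> 'rV[R]_n) (f : 'rV[R]_n -> R) :
  open V -> open W -> (forall y, V y -> W (F y)) ->
  (forall i, Ck k V (fun y => F y 0 i)) -> Ck k W f -> Ck k V (f \o F).
Proof.
move=> oV oW FW.
have cont k' f' : (forall i, Ck k' V (fun y => F y 0 i)) -> Ck k' W f' ->
    forall x, V x -> {for x, continuous (f' \o F)}.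
  move=> HF Hf x Vx; apply: continuous_comp; last exact: (Ck_cont Hf (FW _ Vx)).
  apply: (rV_cvgP (FF := nbhs_filter x)) => i; exact: (Ck_cont (HF i) Vx).
elim: k f => [|k IH] f HF Hf; first by split => //; exact: (cont 0%N).
split; first exact: (cont k.+1).
have D x v : V x -> is_derive x v (f \o F)
    (\sum_i partial i f (F x) * 'D_v (fun y => F y 0 i) x).
  move=> Vx; apply: (derive_comp_partial v oV oW FW _ _ Vx).
    by move=> i; apply: Ck_le (HF i).
  by apply: Ck_le Hf.
split; first by move=> x v Vx; case: (D x v Vx).
move=> v; apply: (@Ck_ext _ _ _ _
  (fun x => \sum_i partial i f (F x) * 'D_v (fun y => F y 0 i) x)) => //.
  by move=> x Vx; have [_ ->] := D x v Vx.
apply: Ck_sum => // i _; apply: Ck_mul => //.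
  apply: (IH (partial i f)); last exact: Ck_partial.
  by move=> j; exact: Ck_pred.
by have [_ [_ H]] := HF i; exact: H.
Qed.

Lemma derivable_curve W (F : R -> 'rV[R]_n) (f : 'rV[R]_n -> R) (t : R) (dF : 'rV[R]_n) :
  open W -> W (F t) -> (forall i, is_derive t (1 : R) (fun s => F s 0 i) (dF 0 i)) ->
  Ck 1 W f -> is_derive t (1 : R) (f \o F) (\sum_i dF 0 i * partial i f (F t)).
Proof.
move=> oW WF HF Hf.
have dFm : derivable F t 1.
  by apply/derivable_mxP => i j; rewrite (ord1 i); case: (HF j).
have [df Df] := C1_differentiable oW Hf WF.
have dFd : differentiable F t by exact/derivable1_diffP.
apply: DeriveDef.
  by apply: diff_derivable; exact: differentiable_comp.
rewrite deriveE; last exact: differentiable_comp.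
rewrite diff_comp //= -deriveE // Df; apply: eq_bigr => i _; congr (_ * _).
rewrite -deriveE // derive_mx // !mxE; by case: (HF i).
Qed.

End Compose.

Section MatrixCk.
Variables (R : realType) (N : nat).
Implicit Types (V : set 'rV[R]_N).

Definition Ckmx k V (p q : nat) (A : 'rV[R]_N -> 'M[R]_(p, q)) :=
  forall i j, Ck k V (fun x => A x i j).

Lemma Ckmx_mul k V p q r (A : 'rV[R]_N -> 'M[R]_(p, q)) (B : 'rV[R]_N -> 'M[R]_(q, r)) :
  open V -> Ckmx k V A -> Ckmx k V B -> Ckmx k V (fun x => A x *m B x).
Proof.
move=> oV HA HB i j; apply: (@Ck_ext _ _ _ _ (fun x => \sum_h A x i h * B x h j)) => //.
  by move=> x _; rewrite mxE.
by apply: Ck_sum => // h _; apply: Ck_mul.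
Qed.

Lemma Ckmx_cst k V p q (A : 'M[R]_(p, q)) : Ckmx k V (fun=> A).
Proof. by move=> i j; exact: Ck_cst. Qed.

Lemma Ck_det k V p (A : 'rV[R]_N -> 'M[R]_p) :
  open V -> Ckmx k V A -> Ck k V (fun x => \det (A x)).
Proof.
move=> oV HA; apply: Ck_sum => // s _; apply: Ck_mul => //; first exact: Ck_cst.
by apply: Ck_prod => // i _; exact: HA.
Qed.

Lemma Ckmx_inv k V p (A : 'rV[R]_N -> 'M[R]_p) :
  open V -> (forall x, V x -> A x \in unitmx) -> Ckmx k V A ->
  Ckmx k V (fun x => invmx (A x)).
Proof.
move=> oV uA HA i j.
apply: (@Ck_ext _ _ _ _ (fun x => (\det (A x))^-1 * cofactor (A x) j i)) => //.
  by move=> x Vx; rewrite /invmx (uA x Vx) !mxE.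
apply: Ck_mul => //.
  apply: Ck_inv => //; last exact: Ck_det.
  by move=> x Vx; have := uA x Vx; rewrite unitmxE unitfE.
rewrite /cofactor; apply: Ck_mul => //; first exact: Ck_cst.
apply: Ck_det => // i' j'.
apply: (@Ck_ext _ _ _ _ (fun x => A x (lift j i') (lift i j'))) => //.
by move=> x _; rewrite !mxE.
Qed.

Lemma unitmx_near p (A : 'rV[R]_N -> 'M[R]_p) V x : open V -> V x ->
  Ckmx 0 V A -> A x \in unitmx -> \forall y \near x, A y \in unitmx.
Proof.
move=> oV Vx HA; rewrite unitmxE unitfE => dA.
have /(_ _ Vx) c := Ck_cont (Ck_det oV HA).
near=> y; rewrite unitmxE unitfE; near: y.
by apply: cvgr_neq0 dA; exact: c.
Unshelve. all: by end_near. Qed.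

End MatrixCk.

(** * Ordinary differential equations *)

Section Clamp.
Variable R : realType.

(** Freezing a curve outside [0, T] makes it continuous on the whole line, so that no curve on a
    subinterval has to be handled. *)
Definition clamp (T s : R) : R := Num.min T (Num.max 0 s).

Lemma clamp_in T s : 0 <= T -> 0 <= clamp T s <= T.
Proof. by move=> T0; rewrite /clamp le_min T0 /= le_max lexx /= ge_min lexx. Qed.

Lemma clamp_id T s : 0 <= s <= T -> clamp T s = s.
Proof. by move=> /andP[s0 sT]; rewrite /clamp (max_idPr s0) (min_idPr sT). Qed.

Lemma clamp_continuous T : continuous (clamp T).
Proof.
move=> s; apply: continuous_min; first exact: cvg_cst.
by apply: continuous_max; [exact: cvg_cst|exact: cvg_id].
Qed.

End Clamp.

Section Antiderivative.
Variable R : realType.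

Lemma antiderivative (f : R -> R) (T : R) : continuous f ->
  exists2 G : R -> R, G 0 = 0 &
    forall s, 0 <= s <= T -> is_derive s (1 : R) G (f s).
Proof.
(* Integrating from -1 makes 0 an interior point, so the derivative at the left end is two-sided. *)
move=> cf; pose F (x : R) := (\int[@lebesgue_measure R]_(t in [set` `[(-1 : R), x]]) f t)%R.
exists (fun s => F s - F 0); first by rewrite subrr.
move=> s /andP[s0 sT].
have [|||dF EF] := @continuous_FTC1_closed R f (-1) s (s + 1) _ _ _ (cf s).
- by rewrite ltrDl.
- apply: continuous_compact_integrable; first exact: segment_compact.
  exact: continuous_subspaceT.
- by rewrite (lt_le_trans _ s0)// ltrN10.
have dF' : is_derive s (1 : R) F (f s) by rewrite -EF derive1E; exact: derivableP.
by have H := is_deriveB dF' (is_derive_cst (F 0) s (1 : R)); rewrite subr0 in H.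
Qed.

End Antiderivative.

Section VectorCurves.
Variables (R : realType) (n : nat).
Implicit Types (y dy u du : R -> 'rV[R]_n) (T L b : R).

(** Derivatives are two-sided at 0 and T as well: y lives on the whole line, but only its values on
    [0, T] obey an equation. *)
Definition has_deriv T y dy := forall s, 0 <= s <= T ->
  forall i, is_derive s (1 : R) (fun s => y s 0 i) (dy s 0 i).

Lemma has_deriv_cont T y dy s : has_deriv T y dy -> 0 <= s <= T ->
  {for s, continuous y}.
Proof.
move=> Hy sT; apply: (rV_cvgP (FF := nbhs_filter s)) => i.
have [dyi _] := Hy s sT i.
by apply: (@differentiable_continuous _ _ _ _ (fun s => y s 0 i)); apply/derivable1_diffP.
Qed.

Lemma has_deriv_clamp_cont T y dy : 0 <= T -> has_deriv T y dy ->
  continuous (y \o clamp T).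
Proof.
move=> T0 Hy s; apply: continuous_comp; first exact: clamp_continuous.
exact: has_deriv_cont Hy (clamp_in s T0).
Qed.

Lemma has_deriv_mvt T y dy b : has_deriv T y dy -> 0 <= b ->
  (forall s, 0 <= s <= T -> `|dy s| <= b) ->
  forall s, 0 <= s <= T -> `|y s - y 0| <= s * b.
Proof.
move=> Hy b0 Hb s /andP[s0 sT]; apply: rV_norm_le; first exact: mulr_ge0.
move=> i; rewrite !mxE.
have Hs x : 0 <= x <= s -> 0 <= x <= T by move=> /andP[-> /le_trans]; apply.
have [||c c0s ->] := @MVT_segment R (fun s => y s 0 i) (fun s => dy s 0 i) 0 s s0.
- move=> x; rewrite in_itv /= => /andP[x0 xs]; apply: Hy; apply: Hs.
  by rewrite !ltW.
- apply: derivable_within_continuous => x; rewrite in_itv /= => /Hs /Hy /(_ i).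
  by case.
rewrite subr0 normrM (ger0_norm s0) mulrC ler_wpM2l//.
apply: le_trans (norm_coord _ _) (Hb _ (Hs _ _)); by move: c0s; rewrite in_itv.
Qed.

(** On an interval with T L <= 1/2 no exponential appears: at most half of the maximum of |u| shows
    up on the right and is absorbed on the left. *)
Lemma small_gronwall T L b u du : 0 <= T -> 0 <= L -> 0 <= b -> T * L <= 2^-1 ->
  has_deriv T u du ->
  (forall s, 0 <= s <= T -> `|du s| <= L * `|u s| + b) ->
  forall s, 0 <= s <= T -> `|u s| <= 2 * (`|u 0| + T * b).
Proof.
move=> T0 L0 b0 TL Hu Hb.
have [|c c0T cmax] := @EVT_max R (fun s => `|u s|) 0 T T0.
  apply: continuous_in_subspaceT => s; rewrite inE /= in_itv /= => sT.
  apply: cvg_norm; exact: has_deriv_cont Hu sT.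
have {}c0T : 0 <= c <= T by move: c0T; rewrite in_itv.
have bound s : 0 <= s <= T -> `|u s| <= `|u c|.
  by move=> sT; apply: cmax; rewrite in_itv.
have B0 : 0 <= L * `|u c| + b by rewrite addr_ge0 ?mulr_ge0.
have := has_deriv_mvt Hu B0 _ c0T.
have Hd s : 0 <= s <= T -> `|du s| <= L * `|u c| + b.
  by move=> sT; apply: (le_trans (Hb s sT)); rewrite lerD2r ler_wpM2l// bound.
move=> /(_ Hd) H1.
have H2 : `|u c| <= `|u 0| + c * (L * `|u c| + b).
  rewrite -[u c in leLHS](subrK (u 0)) addrC.
  by apply: (le_trans (ler_normD _ _)); rewrite lerD2l.
have H3 : c * (L * `|u c| + b) <= 2^-1 * `|u c| + T * b.
  have /andP[c0 cT] := c0T.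
  apply: (@le_trans _ _ (T * (L * `|u c| + b))); first by rewrite ler_wpM2r.
  by rewrite mulrDr lerD2r mulrA ler_wpM2r.
move=> s sT; apply: (le_trans (bound s sT)).
have H4 := le_trans H2 (lerD (lexx _) H3).
move: H4; move: `|u c| `|u 0| (T * b) => x y z; lra.
Qed.

End VectorCurves.

(** * Picard iteration in a closed set *)

Section Picard.
Variables (R : realType) (n : nat) (T L : R) (K : set 'rV[R]_n) (z : 'rV[R]_n).
Variable g : R -> 'rV[R]_n -> 'rV[R]_n.
Hypotheses (T0 : 0 <= T) (L0 : 0 <= L) (TL : T * L <= 2^-1).
Hypotheses (cK : closed K) (Kz : K z).
Hypothesis g_cont : forall y : R -> 'rV[R]_n, continuous y -> (forall s, K (y s)) ->
  continuous (fun s => g (clamp T s) (y s)).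
Hypothesis g_lip : forall s a b, 0 <= s <= T -> K a -> K b ->
  `|g s a - g s b| <= L * `|a - b|.
(** Keeps the iterates inside [K]. For an autonomous field a bound on the speed times [T] supplies
    it; for a linear equation [K] is the whole space. *)
Hypothesis g_inv : forall y Y : R -> 'rV[R]_n, (forall s, K (y s)) -> Y 0 = z ->
  has_deriv T Y (fun s => g s (y s)) -> forall s, 0 <= s <= T -> K (Y s).

Let good (y : R -> 'rV[R]_n) := continuous y /\ forall s, K (y s).

Let step_ex (y : R -> 'rV[R]_n) : good y -> exists Y : R -> 'rV[R]_n,
  Y 0 = z /\ has_deriv T Y (fun s => g s (y s)).
Proof.
move=> [cy Ky].
have /choice[G HG] : forall i : 'I_n, exists G : R -> R, G 0 = 0 /\
    forall s, 0 <= s <= T -> is_derive s (1 : R) G (g (clamp T s) (y s) 0 i).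
  move=> i; have [|G G0 HG] := @antiderivative R (fun s => g (clamp T s) (y s) 0 i) T.
    move=> s; apply: (@continuous_comp _ _ _ (fun s => g (clamp T s) (y s)) (fun v => v 0 i)).
      exact: g_cont.
    exact: coord_continuous.
  by exists G.
exists (fun s => z + \row_i G i s); split.
  by apply/rowP => i; rewrite !mxE (HG i).1 addr0.
move=> s sT i; have := (HG i).2 s sT; rewrite clamp_id// => dG.
have -> : (fun s => (z + \row_i G i s) 0 i) = (fun s => cst (z 0 i) s + G i s).
  by apply/funext => r; rewrite !mxE.
by rewrite -[g s _ _ _]add0r; exact: is_deriveD.
Qed.

Let step (y : R -> 'rV[R]_n) : R -> 'rV[R]_n :=
  if pselect (good y) is left gy then
    (sval (cid (step_ex gy))) \o clamp T else y.

Let stepP y : good y -> exists Y, [/\ step y = Y \o clamp T, Y 0 = z &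
  has_deriv T Y (fun s => g s (y s))].
Proof.
move=> gy; rewrite /step; case: pselect => // gy'.
by case: cid => Y /= [Y0 dY]; exists Y.
Qed.

Let step_good y : good y -> good (step y).
Proof.
move=> gy; have [Y [-> Y0 dY]] := stepP gy; split.
  exact: has_deriv_clamp_cont dY.
move=> s; apply: (g_inv _ Y0 dY); last exact: clamp_in.
by case: gy.
Qed.

Let step_contr y1 y2 b : good y1 -> good y2 -> 0 <= b ->
  (forall s, 0 <= s <= T -> `|y1 s - y2 s| <= b) ->
  forall s, `|step y1 s - step y2 s| <= 2^-1 * b.
Proof.
move=> g1 g2 b0 Hb s.
have [Y1 [-> Y10 dY1]] := stepP g1; have [Y2 [-> Y20 dY2]] := stepP g2 => /=.
have dY : has_deriv T (fun s => Y1 s - Y2 s) (fun s => g s (y1 s) - g s (y2 s)).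
  move=> r rT i.
  have -> : (fun s => (Y1 s - Y2 s) 0 i) = (fun s => Y1 s 0 i) - (fun s => Y2 s 0 i).
    by apply/funext => x; rewrite !mxE.
  by rewrite !mxE; apply: is_deriveB; [exact: dY1|exact: dY2].
have := has_deriv_mvt dY (mulr_ge0 L0 b0) _ (clamp_in s T0).
rewrite Y10 Y20 subrr subr0 => H; apply: le_trans (H _) _; last first.
  have /andP[c0 cT] := clamp_in s T0.
  rewrite mulrA ler_wpM2r//; apply: le_trans TL; by rewrite ler_wpM2r.
move=> r rT; apply: (le_trans (g_lip rT _ _)); [by case: g1|by case: g2|].
by rewrite ler_wpM2l// Hb.
Qed.

Let ys k : R -> 'rV[R]_n := iter k step (fun=> z).

Let ys_good k : good (ys k).
Proof.
elim: k => [|k IH]; last exact: step_good.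
by split => // s; exact: cvg_cst.
Qed.

Let ys_dist : exists2 C : R, 0 <= C &
  forall k s, `|ys k.+1 s - ys k s| <= C * 2^-1 ^+ k.
Proof.
have [Y [EY Y0 dY]] := stepP (ys_good 0).
have [|c c0T cmax] := @EVT_max R (fun s => `|Y s - z|) 0 T T0.
  apply: continuous_in_subspaceT => s; rewrite inE /= in_itv /= => sT.
  apply: cvg_norm; apply: cvgB; last exact: cvg_cst.
  exact: has_deriv_cont dY sT.
exists `|Y c - z| => // k; elim: k => [|k IH] s.
  rewrite expr0 mulr1 /ys /= EY /=; apply: cmax.
  by rewrite in_itv /=; exact: clamp_in.
rewrite exprS mulrCA; by apply: (step_contr (ys_good k.+1) (ys_good k)) => //; rewrite mulr_ge0// exprn_ge0// invr_ge0.
Qed.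

(** Since T L <= 1/2 the iteration halves sup distances, so the iterates converge uniformly at a
    geometric rate, and closedness of [K] passes to the limit. *)
Lemma picard : exists y : R -> 'rV[R]_n, [/\ y 0 = z,
  forall s, 0 <= s <= T -> K (y s) & has_deriv T y (fun s => g s (y s))].
Proof.
have [C C0 HC] := ys_dist.
(* The last factor is that of a partial sum of the geometric series, which makes the induction on m
   close. *)
have tail k m s : `|ys (m + k)%N s - ys k s| <= 2 * C * 2^-1 ^+ k * (1 - 2^-1 ^+ m).
  elim: m => [|m IH]; first by rewrite subrr normr0 expr0 subrr mulr0.
  rewrite addSn -(subrK (ys (m + k)%N s) (ys _.+1 s)) -addrA.
  apply: (le_trans (ler_normD _ _)); apply: (le_trans (lerD (HC _ _) IH)).
  rewrite exprD exprS; have : (0 : R) < 2^-1 ^+ m by rewrite exprn_gt0// invr_gt0.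
  have : (0 : R) < 2^-1 ^+ k by rewrite exprn_gt0// invr_gt0.
  move: (2^-1 ^+ m) (2^-1 ^+ k) => x y x0 y0; lra.
have geo : (fun k => 2 * C * 2^-1 ^+ k : R) @ \oo --> (0 : R).
  have := @cvg_geometric R (2 * C) 2^-1; rewrite /geometric /=; apply.
  by rewrite ger0_norm ?invr_ge0// invf_lt1// ltr1n.
have tail' k k' s : (k <= k')%N -> `|ys k' s - ys k s| <= 2 * C * 2^-1 ^+ k.
  move=> kk'; rewrite -(subnK kk'); apply: (le_trans (tail _ _ _)).
  apply: ler_piMr; first by rewrite !mulr_ge0// exprn_ge0// invr_ge0.
  by rewrite gerBl exprn_ge0// invr_ge0.
have ycvg s : cvg (ys k s @[k --> \oo]).
  apply/cauchy_cvgP; apply: cauchy_exP => e e0.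
  have /cvgrPdist_lt /(_ _ e0) [k _ Hk] := geo.
  exists (ys k s); exists k => // k' /= kk'; rewrite -ball_normE /=.
  rewrite distrC; apply: (le_lt_trans (tail' _ _ _ kk')).
  have := Hk k (leqnn k); rewrite sub0r normrN ger0_norm//.
  by rewrite !mulr_ge0// exprn_ge0// invr_ge0.
pose y s := lim (ys k s @[k --> \oo]).
have ydist k s : `|y s - ys k s| <= 2 * C * 2^-1 ^+ k.
  have c : `|ys k' s - ys k s| @[k' --> \oo] --> `|y s - ys k s|.
    apply: cvg_norm; apply: cvgB; [exact: ycvg|exact: cvg_cst].
  apply: (@cvgr_to_le _ _ _ _ _ _ _ c).
  by exists k => // k' /= kk'; exact: tail'.
have gy : good y; first split.
- move=> s; apply/cvgrPdist_lt => e e0.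
  have e3 : 0 < e / 3 by rewrite divr_gt0.
  have /cvgrPdist_lt /(_ _ e3) [k _ Hk] := geo.
  have Ck r : `|y r - ys k r| < e / 3.
    apply: (le_lt_trans (ydist k r)); have := Hk k (leqnn k).
    by rewrite sub0r normrN ger0_norm// !mulr_ge0// exprn_ge0// invr_ge0.
  have [cyk _] := ys_good k.
  near=> t.
  rewrite (_ : y s - y t = (y s - ys k s) + (ys k s - ys k t) + (ys k t - y t)); last first.
    by rewrite !subrKA.
  have H1 : `|ys k s - ys k t| < e / 3.
    by near: t; have /cvgrPdist_lt := cyk s; apply.
  have H2 := Ck t; rewrite distrC in H2; have H3 := Ck s.
  apply: (le_lt_trans (ler_normD _ _)); apply: (le_lt_trans (lerD (ler_normD _ _) (lexx _))).
  move: H1 H2 H3; move: `|_ - ys k t| `|ys k t - _| `|y s - _| => a b c; lra.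
- move=> s; apply: (@closed_cvg _ _ _ _ _ K cK _ (y s) (ycvg s)).
  by near=> k; case: (ys_good k).
have fix_y : step y = y.
  apply/funext => s; apply/eqP; rewrite -subr_eq0 -normr_le0.
  have H k : `|step y s - y s| <= 2 * (2 * C * 2^-1 ^+ k).
    rewrite -(subrK (ys k.+1 s) (step y s)) -addrA.
    apply: (le_trans (ler_normD _ _)).
    have b0 : 0 <= 2 * C * 2^-1 ^+ k by rewrite !mulr_ge0// exprn_ge0// invr_ge0.
    have H1 := step_contr gy (ys_good k) b0 (fun s _ => ydist k s) s.
    have H2 := ydist k.+1 s; rewrite distrC in H2.
    apply: (le_trans (lerD H1 H2)).
    rewrite exprS; move: b0; move: (2^-1 ^+ k) => x; lra.
  have c : (fun k => 2 * (2 * C * 2^-1 ^+ k)) @ \oo --> (2 * 0 : R).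
    by apply: cvgM => //; exact: cvg_cst.
  rewrite -(mulr0 2); apply: (@cvgr_to_ge _ _ _ _ _ _ _ c).
  by near=> k; exact: H.
(* The fixed point is clamped and may fail to be differentiable at 0 and [T]; the unclamped [Y]
   agrees with it on the interval and has two-sided derivatives. *)
have [Y [EY Y0 dY]] := stepP gy.
have yY s : 0 <= s <= T -> y s = Y s.
  by move=> sT; rewrite -fix_y EY /= clamp_id.
exists Y; split => //.
  by move=> s sT; rewrite -yY//; case: gy.
by move=> s sT i; rewrite -yY//; exact: dY.
Unshelve. all: by end_near. Qed.

End Picard.

Section Bounds.
Variables (R : realType) (n : nat).
Implicit Types (K V : set 'rV[R]_n).

Definition convex_set (K : set 'rV[R]_n) := forall a b t, K a -> K b -> 0 <= t <= 1 ->
  K (a + t *: (b - a)).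

Lemma compact_bound (f : 'rV[R]_n -> R) K : compact K ->
  (forall x, K x -> {for x, continuous f}) ->
  exists2 B : R, 0 <= B & forall x, K x -> `|f x| <= B.
Proof.
move=> cK cf; have [->|K0] := eqVneq K set0.
  by exists 0 => // x.
move/set0P in K0; have [|c Kc Hc] := @compact_EVT_max _ R (fun x => `|f x|) K K0 cK.
  apply: continuous_in_subspaceT => x; rewrite inE => Kx.
  by apply: (cvg_norm (cf x Kx)).
by exists `|f c| => // x Kx; apply: Hc; rewrite inE.
Qed.

Lemma compact_bound_fin (I : finType) (f : I -> 'rV[R]_n -> R) K : compact K ->
  (forall i x, K x -> {for x, continuous (f i)}) ->
  exists2 B : R, 0 <= B & forall i x, K x -> `|f i x| <= B.
Proof.
move=> cK cf.
have /choice[B HB] : forall i, exists B : R, 0 <= B /\ forall x, K x -> `|f i x| <= B.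
  by move=> i; have [B B0 HB] := compact_bound cK (cf i); exists B.
exists (\sum_i B i); first by apply: sumr_ge0 => i _; case: (HB i).
move=> i x Kx; apply: (le_trans ((HB i).2 x Kx)).
by rewrite (bigD1 i)//= lerDl sumr_ge0// => j _; case: (HB j).
Qed.

Lemma convex_mvt f K V a b : open V -> K `<=` V -> convex_set K -> Ck 1 V f -> K a -> K b ->
  exists2 c, K c & f b - f a = \sum_i (b - a) 0 i * partial i f c.
Proof.
move=> oV KV cvK Hf Ka Kb.
have [t t01|t t01 E] := @ray_mvt R _ f a (b - a).
  by apply: (Ck_derivable Hf); apply: KV; exact: cvK.
have Kc : K (a + t *: (b - a)) by exact: cvK.
by exists (a + t *: (b - a)) => //; rewrite -(derive_partial _ oV Hf (KV _ Kc)) -E subrKC.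
Qed.

Lemma convex_lip_fin (I : finType) (f : I -> 'rV[R]_n -> R) K V : open V ->
  K `<=` V -> compact K -> convex_set K -> (forall i, Ck 1 V (f i)) ->
  exists2 C : R, 0 <= C &
    forall i a b, K a -> K b -> `|f i b - f i a| <= C * `|b - a|.
Proof.
move=> oV KV cK cvK Hf.
have [|B B0 HB] := @compact_bound_fin (I * 'I_n)%type (fun ij => partial ij.2 (f ij.1)) K cK.
  by move=> [i j] x Kx /=; apply: (Ck_cont (Ck_partial j (Hf i))); exact: KV.
exists (n%:R * B); first by rewrite mulr_ge0.
move=> i a b Ka Kb; have [c Kc ->] := convex_mvt oV KV cvK (Hf i) Ka Kb.
apply: (le_trans (ler_norm_sum _ _ _)).
apply: (@le_trans _ _ (\sum_(j < n) (B * `|b - a|))).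
  apply: ler_sum => j _; rewrite normrM mulrC ler_pM//; last exact: norm_coord.
  exact: (HB (i, j)).
by rewrite sumr_const card_ord -mulrA mulr_natl.
Qed.

End Bounds.

Section Jacobian.
Variables (R : realType) (n : nat).
Implicit Types (F : 'rV[R]_n -> 'rV[R]_n) (K V : set 'rV[R]_n).

(** Row-vector convention: [v *m jac F x] is the derivative of F along v, so this is the transpose
    of the usual Jacobian. *)
Definition jac F x : 'M[R]_n := \matrix_(i, j) partial i (fun y => F y 0 j) x.

Lemma jac_lip F K V L : open V -> K `<=` V -> convex_set K ->
  (forall j, Ck 1 V (fun y => F y 0 j)) -> 0 <= L ->
  (forall (y v : 'rV[R]_n), K y -> `|v *m jac F y| <= L * `|v|) ->
  forall a b, K a -> K b -> `|F b - F a| <= L * `|b - a|.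
Proof.
move=> oV KV cvK HF L0 HL a b Ka Kb; apply: rV_norm_le; first exact: mulr_ge0.
move=> j; rewrite !mxE; have [c Kc E] := convex_mvt oV KV cvK (HF j) Ka Kb.
rewrite E; have := norm_coord ((b - a) *m jac F c) j.
rewrite mxE; under eq_bigr do rewrite [jac _ _ _ _]mxE.
by move=> /le_trans; apply; exact: HL.
Qed.

(** The Lipschitz bound on the Jacobian comes first; by the mean value theorem each coordinate of
    the remainder is (b - a) applied to a difference of Jacobians at a and at a point between a and
    b. *)
Lemma jac_quad F K V : open V -> K `<=` V -> compact K -> convex_set K ->
  (forall j, Ck 2 V (fun y => F y 0 j)) ->
  exists2 C : R, 0 <= C & 
    (forall a b (w : 'rV[R]_n), K a -> K b -> `|w *m jac F b - w *m jac F a| <= C * `|b - a| * `|w|) /\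
    forall a b, K a -> K b -> `|F b - F a - (b - a) *m jac F a| <= C * `|b - a| ^+ 2.
Proof.
move=> oV KV cK cvK HF.
have [|C C0 HC] := @convex_lip_fin R n ('I_n * 'I_n)%type
  (fun ij => partial ij.1 (fun y => F y 0 ij.2)) K V oV KV cK cvK.
  by move=> [i j]; exact: Ck_partial.
have key (a b w : 'rV[R]_n) : K a -> K b -> forall j,
  `|\sum_i w 0 i * (partial i (fun y => F y 0 j) b - partial i (fun y => F y 0 j) a)|
     <= n%:R * C * `|b - a| * `|w|.
  move=> Ka Kb j; apply: (le_trans (ler_norm_sum _ _ _)).
  apply: (@le_trans _ _ (\sum_(i < n) (C * `|b - a| * `|w|))).
    apply: ler_sum => i _; rewrite normrM mulrC ler_pM//; last exact: norm_coord.
    exact: (HC (i, j)).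
  by rewrite sumr_const card_ord -!mulrA mulr_natl.
exists (n%:R * C); first by rewrite mulr_ge0.
split.
  move=> a b w Ka Kb; apply: rV_norm_le; first by rewrite !mulr_ge0.
  move=> j; rewrite !mxE -sumrB; under eq_bigr do rewrite !mxE -mulrBr.
  exact: key.
move=> a b Ka Kb; apply: rV_norm_le; first by rewrite !mulr_ge0// exprn_ge0.
move=> j; have HF1 : Ck 1 V (fun y => F y 0 j) by exact: Ck_pred.
have [t t01|t t01 E] := @ray_mvt R _ (fun y => F y 0 j) a (b - a).
  by apply: (Ck_derivable HF1); apply: KV; exact: cvK.
set c := a + t *: (b - a) in E; have Kc : K c by exact: cvK.
rewrite (derive_partial _ oV HF1 (KV _ Kc)) subrKC in E.
rewrite !mxE E -sumrB; under eq_bigr do rewrite !mxE -mulrBr.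
have -> : \sum_(i < n) (b 0 i - a 0 i) * (partial i (fun y => F y 0 j) c - partial i (fun y => F y 0 j) a)
   = \sum_i (b - a) 0 i * (partial i (fun y => F y 0 j) c - partial i (fun y => F y 0 j) a).
  by apply: eq_bigr => i _; rewrite !mxE.
apply: (le_trans (key a c (b - a) Ka Kc j)).
rewrite expr2 !mulrA ler_wpM2r// -!mulrA ler_wpM2l// ler_wpM2l//.
rewrite /c addrC addKr normrZ; have /andP[t0 t1] := t01.
by rewrite ger0_norm// ler_piMl.
Qed.

End Jacobian.

Section LinearODE.
Variables (R : realType) (n : nat).

Lemma lin_ode_exists (T L : R) (A : R -> 'M[R]_n) (v : 'rV[R]_n) :
  0 <= T -> 0 <= L -> T * L <= 2^-1 ->
  (forall i j, continuous (fun s => A (clamp T s) i j)) ->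
  (forall s (w : 'rV[R]_n), 0 <= s <= T -> `|w *m A s| <= L * `|w|) ->
  exists w : R -> 'rV[R]_n, w 0 = v /\ has_deriv T w (fun s => w s *m A s).
Proof.
move=> T0 L0 TL cA HA.
have [|||w [w0 _ dw]] := @picard R n T L setT v (fun s a => a *m A s) T0 L0 TL closedT I.
- move=> y cy _ s; apply: (rV_cvgP (FF := nbhs_filter s)) => j.
  have -> : (fun t => (y t *m A (clamp T t)) 0 j) =
     \sum_i ((fun t => y t 0 i) * (fun t => A (clamp T t) i j)).
    by apply/funext => t; rewrite mxE fct_sumE.
  rewrite mxE.
  have -> : \sum_j0 y s 0 j0 * A (clamp T s) j0 j =
    (\sum_i ((fun t => y t 0 i) * (fun t => A (clamp T t) i j))) s by rewrite fct_sumE.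
  elim/big_ind : _ => [|f g cf cg|i _]; first exact: cvg_cst.
    exact: cvgD.
  apply: cvgM; last exact: cA.
  apply: (@continuous_comp _ _ _ y (fun v => v 0 i)); first exact: cy.
  exact: coord_continuous.
- by move=> s a b sT _ _; rewrite -mulmxBl; exact: HA.
- by [].
by exists w.
Qed.

End LinearODE.

(** * Differentiability of flows in the initial value *)

Section FlowDerivative.
Variables (R : realType) (n : nat) (F : 'rV[R]_n -> 'rV[R]_n).
Variables (V K U : set 'rV[R]_n) (T L : R) (phi : 'rV[R]_n -> R -> 'rV[R]_n).
Hypotheses (oV : open V) (KV : K `<=` V) (cK : compact K) (cvK : convex_set K).
Hypothesis HF : forall j, Ck 2 V (fun y => F y 0 j).
Hypotheses (T0 : 0 <= T) (L0 : 0 <= L) (TL : T * L <= 2^-1).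
Hypothesis HL : forall (y v : 'rV[R]_n), K y -> `|v *m jac F y| <= L * `|v|.
Hypothesis oU : open U.
Hypothesis phi0 : forall z, U z -> phi z 0 = z.
Hypothesis phiK : forall z s, U z -> 0 <= s <= T -> K (phi z s).
Hypothesis phiD : forall z, U z -> has_deriv T (phi z) (fun s => F (phi z s)).

Lemma flow_lip z z' s : U z -> U z' -> 0 <= s <= T ->
  `|phi z' s - phi z s| <= 2 * `|z' - z|.
Proof.
move=> Uz Uz' sT.
have HF1 j : Ck 1 V (fun y => F y 0 j) by exact: Ck_pred.
have dd : has_deriv T (fun s => phi z' s - phi z s) (fun s => F (phi z' s) - F (phi z s)).
  move=> r rT i.
  have -> : (fun s => (phi z' s - phi z s) 0 i) = (fun s => phi z' s 0 i) - (fun s => phi z s 0 i).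
    by apply/funext => x; rewrite !mxE.
  by rewrite !mxE; apply: is_deriveB; exact: phiD.
have := small_gronwall T0 L0 (lexx 0) TL dd.
rewrite !phi0// mulr0 addr0; apply => // r rT; rewrite addr0.
by apply: (jac_lip oV KV cvK HF1 L0 HL); exact: phiK.
Qed.

Lemma flow_continuous s j z : U z -> 0 <= s <= T ->
  {for z, continuous (fun z => phi z s 0 j)}.
Proof.
move=> Uz sT; apply/(@cvgrPdist_le _ _ _ (nbhs z) (nbhs_filter z)) => e e0; near=> z'.
have Uz' : U z' by near: z'; exact: open_nbhs_nbhs.
have := norm_coord (phi z' s - phi z s) j; rewrite !mxE distrC => /le_trans; apply.
apply: (le_trans (flow_lip Uz Uz' sT)).
rewrite mulrC -ler_pdivlMr// distrC; near: z'.
by apply: (@cvgr_dist_le _ _ _ _ (nbhs_filter z) id z); [exact: cvg_id|rewrite divr_gt0].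
Unshelve. all: by end_near. Qed.

Lemma variation_exists z v : U z -> exists w : R -> 'rV[R]_n,
  w 0 = v /\ has_deriv T w (fun s => w s *m jac F (phi z s)).
Proof.
move=> Uz; apply: (lin_ode_exists v T0 L0 TL).
  move=> i j s; have sT := clamp_in s T0.
  have -> : (fun s => jac F (phi z (clamp T s)) i j) =
    (partial i (fun y => F y 0 j)) \o (phi z \o clamp T).
    by apply/funext => t; rewrite mxE.
  apply: continuous_comp; first exact: (has_deriv_clamp_cont T0 (phiD Uz)).
  by apply: (Ck_cont (Ck_partial i (HF j))); apply: KV; exact: phiK.
by move=> s w sT; apply: HL; exact: phiK.
Qed.

Lemma variation_bound z w s : U z ->
  has_deriv T w (fun s => w s *m jac F (phi z s)) -> 0 <= s <= T ->
  `|w s| <= 2 * `|w 0|.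
Proof.
move=> Uz dw sT; have := small_gronwall T0 L0 (lexx 0) TL dw.
rewrite mulr0 addr0; apply => // r rT; rewrite addr0; apply: HL; exact: phiK.
Qed.

(** The difference quotient minus the solution [w] of the variational equation starts at 0 and
    satisfies a linear differential inequality whose inhomogeneity is O(|h|) by [jac_quad]; Gronwall
    makes it O(|h|). *)
Lemma flow_derive z v w s j : U z -> w 0 = v ->
  has_deriv T w (fun s => w s *m jac F (phi z s)) -> 0 <= s <= T ->
  is_derive z v (fun z => phi z s 0 j) (w s 0 j).
Proof.
move=> Uz w0 dw sT.
have [C C0 [_ HC]] := jac_quad oV KV cK cvK HF.
(* The 8 is the factor 2 of [small_gronwall] times the square of the Lipschitz constant 2 of the
   flow. *)
have key h : h != 0 -> U (h *: v + z) ->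
    `|h^-1 *: (phi (h *: v + z) s - phi z s) - w s| <= 8 * (T * C * `|v| ^+ 2) * `|h|.
  move=> h0 Uh; set z' := h *: v + z.
  have de : has_deriv T (fun s => h^-1 *: (phi z' s - phi z s) - w s)
      (fun s => h^-1 *: (F (phi z' s) - F (phi z s)) - w s *m jac F (phi z s)).
    move=> r rT i.
    have -> : (fun s => (h^-1 *: (phi z' s - phi z s) - w s) 0 i) =
       h^-1 \*: ((fun s => phi z' s 0 i) - (fun s => phi z s 0 i)) - (fun s => w s 0 i).
      by apply/funext => x; rewrite !mxE.
    have -> : (h^-1 *: (F (phi z' r) - F (phi z r)) - w r *m jac F (phi z r)) 0 i =
       h^-1 *: (F (phi z' r) 0 i - F (phi z r) 0 i) - (w r *m jac F (phi z r)) 0 i.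
      by rewrite [LHS]mxE [X in X + _]mxE [X in _ * X + _]mxE [X in _ * (_ + X)]mxE [X in _ + X]mxE.
    apply: is_deriveB; last exact: dw.
    apply: is_deriveZ; apply: is_deriveB; exact: phiD.
  have b0 : 0 <= C * (4 * `|v| ^+ 2 * `|h|) by rewrite !mulr_ge0// exprn_ge0.
  have := small_gronwall T0 L0 b0 TL de.
  rewrite !phi0// w0 addrK scalerA mulVf// scale1r subrr normr0 add0r => H.
  apply: (le_trans (H _ s sT)); last by rewrite le_eqVlt; apply/orP; left; apply/eqP; ring.
  move=> r rT; set a := phi z r; set b := phi z' r.
  have -> : h^-1 *: (F b - F a) - w r *m jac F a =
     h^-1 *: (F b - F a - (b - a) *m jac F a) + (h^-1 *: (b - a) - w r) *m jac F a.
    by rewrite (mulmxBl (h^-1 *: (b - a))) -scalemxAl [in RHS]scalerBr addrA subrK.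
  apply: (le_trans (ler_normD _ _)); rewrite addrC; apply: lerD.
    by apply: HL; exact: phiK.
  rewrite normrZ normfV ler_pdivrMl ?normr_gt0//.
  have Kb : K b by exact: phiK.
  have Ka : K a by exact: phiK.
  apply: (le_trans (HC _ _ Ka Kb)); rewrite [leRHS]mulrCA ler_wpM2l//.
  have Hl : `|b - a| <= 2 * (`|h| * `|v|).
    by apply: (le_trans (flow_lip Uz Uh rT)); rewrite addrK normrZ.
  apply: (@le_trans _ _ ((2 * (`|h| * `|v|)) ^+ 2)).
    by rewrite ler_pXn2r// nnegrE.
  by rewrite le_eqVlt; apply/orP; left; apply/eqP; ring.
have lim : h^-1 *: (phi (h *: v + z) s 0 j - phi z s 0 j) @[h --> 0^'] --> w s 0 j.
  apply/cvgrPdist_le => e e0.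
  have C1 : 0 < 8 * (T * C * `|v| ^+ 2) + 1.
    by rewrite ltr_wpDl// !mulr_ge0// exprn_ge0.
  near=> h.
  have h0 : h != 0 by near: h; exact: nbhs_dnbhs_neq.
  have Uh : U (h *: v + z).
    near: h; apply: nbhs_dnbhs.
    have : (fun h : R => h *: v + z) @ 0 --> (0 : R) *: v + z.
      apply: cvgD; last exact: cvg_cst.
      by apply: cvgZr_tmp; exact: cvg_id.
    by apply; rewrite scale0r add0r; exact: open_nbhs_nbhs.
  have := norm_coord (h^-1 *: (phi (h *: v + z) s - phi z s) - w s) j.
  rewrite !mxE distrC => /le_trans; apply; apply: (le_trans (key h h0 Uh)).
  have hs : `|h| <= e / (8 * (T * C * `|v| ^+ 2) + 1).
    by near: h; apply: dnbhs0_le; rewrite divr_gt0.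
  apply: (@le_trans _ _ ((8 * (T * C * `|v| ^+ 2) + 1) * `|h|)).
    by rewrite ler_wpM2r// lerDl.
  by rewrite mulrC -ler_pdivlMr.
apply: DeriveDef.
  by apply/cvg_ex; exists (w s 0 j).
exact: cvg_lim.
Unshelve. all: by end_near. Qed.

End FlowDerivative.

Section RowBlocks.
Variables (R : realType) (m n : nat).
Implicit Types (x v : 'rV[R]_(m + n)).

Lemma norm_lsubmx x : `|lsubmx x| <= `|x|.
Proof. by apply: rV_norm_le => // i; rewrite mxE; exact: norm_coord. Qed.

Lemma norm_rsubmx x : `|rsubmx x| <= `|x|.
Proof. by apply: rV_norm_le => // i; rewrite mxE; exact: norm_coord. Qed.

Lemma norm_row_mx_le (a : 'rV[R]_m) (b : 'rV[R]_n) (e : R) : 0 <= e ->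
  `|a| <= e -> `|b| <= e -> `|row_mx a b| <= e.
Proof.
move=> e0 ae be; apply: rV_norm_le => // i; case: (split_ordP i) => j ->.
  by rewrite row_mxEl; exact: le_trans (norm_coord _ _) ae.
by rewrite row_mxEr; exact: le_trans (norm_coord _ _) be.
Qed.

Lemma lsubmx_continuous : continuous (@lsubmx R 1 m n).
Proof. by move=> x; apply: differentiable_continuous; exact: differentiable_lsubmx. Qed.

Lemma rsubmx_continuous : continuous (@rsubmx R 1 m n).
Proof. by move=> x; apply: differentiable_continuous; exact: differentiable_rsubmx. Qed.

Lemma open_lsubmx (V : set 'rV[R]_m) : open V -> open [set x : 'rV[R]_(m + n) | V (lsubmx x)].
Proof. by move=> oV; apply: (open_comp _ oV) => x _; exact: lsubmx_continuous. Qed.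

Lemma open_rsubmx (V : set 'rV[R]_n) : open V -> open [set x : 'rV[R]_(m + n) | V (rsubmx x)].
Proof. by move=> oV; apply: (open_comp _ oV) => x _; exact: rsubmx_continuous. Qed.

Lemma Ck_lsubmx k (V : set 'rV[R]_m) (f : 'rV[R]_m -> R) : open V -> Ck k V f ->
  Ck k [set x : 'rV[R]_(m + n) | V (lsubmx x)] (fun x => f (lsubmx x)).
Proof.
move=> oV Hf; apply: (@Ck_comp _ _ _ _ _ V (fun x => lsubmx x) f) => //.
  exact: open_lsubmx.
move=> i; have -> : (fun y : 'rV[R]_(m + n) => lsubmx y 0 i) = (fun y => y 0 (lshift n i)).
  by apply/funext => y; rewrite mxE.
exact: Ck_coord.
Qed.

Lemma Ck_rsubmx k (V : set 'rV[R]_n) (f : 'rV[R]_n -> R) : open V -> Ck k V f ->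
  Ck k [set x : 'rV[R]_(m + n) | V (rsubmx x)] (fun x => f (rsubmx x)).
Proof.
move=> oV Hf; apply: (@Ck_comp _ _ _ _ _ V (fun x => rsubmx x) f) => //.
  exact: open_rsubmx.
move=> i; have -> : (fun y : 'rV[R]_(m + n) => rsubmx y 0 i) = (fun y => y 0 (rshift m i)).
  by apply/funext => y; rewrite mxE.
exact: Ck_coord.
Qed.

Lemma is_derive_lsubmx (V : set 'rV[R]_m) (f : 'rV[R]_m -> R) x v : open V -> Ck 1 V f ->
  V (lsubmx x) -> is_derive x v (fun x => f (lsubmx x))
    (\sum_i partial i f (lsubmx x) * lsubmx v 0 i).
Proof.
move=> oV Hf Vx.
have cc i : Ck 1 [set x : 'rV[R]_(m + n) | V (lsubmx x)] (fun y => lsubmx y 0 i).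
  have -> : (fun y : 'rV[R]_(m + n) => lsubmx y 0 i) = (fun y => y 0 (lshift n i)).
    by apply/funext => y; rewrite mxE.
  exact: Ck_coord.
have [] := derive_comp_partial v (open_lsubmx oV) oV (fun _ H => H) cc Hf Vx.
move=> H1 H2; apply: DeriveDef; first exact: H1.
rewrite -[LHS]/('D_v (f \o @lsubmx R 1 m n) x) H2; apply: eq_bigr => i _; congr (_ * _).
have -> : (fun y : 'rV[R]_(m + n) => lsubmx y 0 i) = (fun y => y 0 (lshift n i)).
  by apply/funext => y; rewrite mxE.
by have [_ ->] := is_derive_coord x v (lshift n i); rewrite mxE.
Qed.

Lemma Ck_row_mxl k (V : set 'rV[R]_m) (b : 'rV[R]_n) (W : set 'rV[R]_(m + n)) (f : 'rV[R]_(m + n) -> R) :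
  open V -> open W -> (forall z, V z -> W (row_mx z b)) -> Ck k W f ->
  Ck k V (fun z => f (row_mx z b)).
Proof.
move=> oV oW VW Hf; apply: (@Ck_comp _ _ _ _ V W (fun z => row_mx z b) f) => // i.
case: (split_ordP i) => j ->.
  have -> : (fun y : 'rV[R]_m => row_mx y b 0 (lshift n j)) = (fun y => y 0 j).
    by apply/funext => y; rewrite row_mxEl.
  exact: Ck_coord.
have -> : (fun y : 'rV[R]_m => row_mx y b 0 (rshift m j)) = cst (b 0 j).
  by apply/funext => y; rewrite row_mxEr.
exact: Ck_cst.
Qed.

End RowBlocks.

(** * Higher differentiability of flows *)

Section FlowSmooth.
Variable R : realType.

Lemma jacE n (F : 'rV[R]_n -> 'rV[R]_n) V x v j : open V ->
  (forall j, Ck 1 V (fun y => F y 0 j)) -> V x ->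
  (v *m jac F x) 0 j = 'D_v (fun y => F y 0 j) x.
Proof.
move=> oV HF Vx; rewrite (derive_partial _ oV (HF j) Vx) mxE.
by apply: eq_bigr => i _; rewrite mxE.
Qed.

(** The complete lift of F to the tangent bundle R^n x R^n. *)
Definition tangent_field n (F : 'rV[R]_n -> 'rV[R]_n) (x : 'rV[R]_(n + n)) : 'rV[R]_(n + n) :=
  row_mx (F (lsubmx x)) (rsubmx x *m jac F (lsubmx x)).

Lemma tangent_field_smooth n (F : 'rV[R]_n -> 'rV[R]_n) V j : open V ->
  (forall j, Csmooth V (fun y => F y 0 j)) ->
  Csmooth [set x : 'rV[R]_(n + n) | V (lsubmx x)] (fun x => tangent_field F x 0 j).
Proof.
move=> oV HF k; have oV2 := @open_lsubmx R n n V oV.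
case: (split_ordP j) => i ->.
  apply: Ck_ext (Ck_lsubmx n oV (HF i k)) => // x _.
  by rewrite /tangent_field row_mxEl.
apply: (@Ck_ext _ _ _ _ (fun x => \sum_l x 0 (rshift n l) * partial l (fun y => F y 0 i) (lsubmx x))) => //.
  move=> x _; rewrite /tangent_field row_mxEr mxE; apply: eq_bigr => l _.
  by rewrite !mxE.
apply: Ck_sum => // l _; apply: Ck_mul => //; first exact: Ck_coord.
by apply: (@Ck_lsubmx _ _ _ _ _ (partial l (fun y => F y 0 i))) => //; apply: Ck_partial; exact: (HF i k.+1).
Qed.

Lemma tangent_field_jac n (F : 'rV[R]_n -> 'rV[R]_n) V (x v : 'rV[R]_(n + n)) i : open V ->
  (forall j, Csmooth V (fun y => F y 0 j)) -> V (lsubmx x) ->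
  (v *m jac (tangent_field F) x) 0 (lshift n i) = (lsubmx v *m jac F (lsubmx x)) 0 i /\
  (v *m jac (tangent_field F) x) 0 (rshift n i) = (rsubmx v *m jac F (lsubmx x)) 0 i +
     \sum_l \sum_h lsubmx v 0 h * rsubmx x 0 l * partial h (partial l (fun y => F y 0 i)) (lsubmx x).
Proof.
move=> oV HF Vx; have oV2 := @open_lsubmx R n n V oV.
have HF2 j : Ck 1 [set x : 'rV[R]_(n + n) | V (lsubmx x)] (fun y => tangent_field F y 0 j).
  exact: tangent_field_smooth.
rewrite !(jacE _ _ oV2 HF2)//; split.
  have -> : (fun y => tangent_field F y 0 (lshift n i)) = (fun y => F (lsubmx y) 0 i).
    by apply/funext => y; rewrite /tangent_field row_mxEl.
  have [_ ->] := is_derive_lsubmx v oV (HF i 1) Vx.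
  by rewrite mxE; apply: eq_bigr => l _; rewrite [jac _ _ _ _]mxE mulrC.
have -> : (fun y => tangent_field F y 0 (rshift n i)) =
   \sum_l ((fun y : 'rV[R]_(n + n) => y 0 (rshift n l)) * (fun y => partial l (fun y => F y 0 i) (lsubmx y))).
  apply/funext => y; rewrite /tangent_field row_mxEr mxE fct_sumE; apply: eq_bigr => l _.
  by rewrite !mxE.
have D l : is_derive x v ((fun y : 'rV[R]_(n + n) => y 0 (rshift n l)) * (fun y => partial l (fun y => F y 0 i) (lsubmx y)))
   (x 0 (rshift n l) *: (\sum_h partial h (partial l (fun y => F y 0 i)) (lsubmx x) * lsubmx v 0 h) +
    partial l (fun y => F y 0 i) (lsubmx x) *: v 0 (rshift n l)).
  apply: is_deriveM; first exact: is_derive_coord.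
  apply: (is_derive_lsubmx v oV _ Vx); apply: Ck_partial; exact: (HF i 2).
have [_ ->] := is_derive_sum D.
rewrite mxE -big_split /=; apply: eq_bigr => l _; rewrite addrC !mxE /GRing.scale /= [X in X + _ = _]mulrC; congr (_ + _).
  by rewrite mulr_suml; apply: eq_bigr => h _; rewrite !mxE; ring.
by rewrite mulrC.
Qed.

(** In the Jacobian of the lift the second derivatives of F come multiplied by the fibre coordinate.
    Near the zero section the bound is therefore as close to that of F as desired. *)
Lemma tangent_field_bound n (F : 'rV[R]_n -> 'rV[R]_n) (V K : set 'rV[R]_n) : open V ->
  K `<=` V -> compact K -> (forall j, Csmooth V (fun y => F y 0 j)) ->
  exists2 C : R, 0 <= C & forall (L e : R) x (v : 'rV[R]_(n + n)), 0 <= L -> 0 <= e ->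
    (forall (y v : 'rV[R]_n), K y -> `|v *m jac F y| <= L * `|v|) ->
    K (lsubmx x) -> `|rsubmx x| <= e ->
    `|v *m jac (tangent_field F) x| <= (L + C * e) * `|v|.
Proof.
move=> oV KV cK HF.
have [|B B0 HB] := @compact_bound_fin R n ('I_n * 'I_n * 'I_n)%type
   (fun t => partial t.1.1 (partial t.1.2 (fun y => F y 0 t.2))) K cK.
  move=> [[h l] i] x Kx /=; apply: (@Ck_cont _ _ 0 V); last exact: KV.
  by do 2 apply: Ck_partial; exact: (HF i 2).
exists (n%:R * (n%:R * B)); first by rewrite !mulr_ge0.
move=> L e x v L0 e0 HL Kx xe.
have LC0 : 0 <= L + n%:R * (n%:R * B) * e by rewrite addr_ge0// !mulr_ge0.
apply: rV_norm_le; first by rewrite mulr_ge0.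
move=> j; case: (split_ordP j) => i ->; have [E1 E2] := tangent_field_jac v i oV HF (KV _ Kx).
  rewrite E1; apply: (le_trans (norm_coord _ _)); apply: (le_trans (HL _ _ Kx)).
  apply: ler_pM => //; last exact: norm_lsubmx.
  by rewrite lerDl !mulr_ge0.
rewrite E2; apply: (le_trans (ler_normD _ _)); rewrite mulrDl; apply: lerD.
  apply: (le_trans (norm_coord _ _)); apply: (le_trans (HL _ _ Kx)).
  by rewrite ler_wpM2l// norm_rsubmx.
apply: (le_trans (ler_norm_sum _ _ _)).
apply: (@le_trans _ _ (\sum_(l < n) (n%:R * B * e * `|v|))); last first.
  by rewrite sumr_const card_ord -[_ *+ n]mulr_natl !mulrA.
apply: ler_sum => l _; apply: (le_trans (ler_norm_sum _ _ _)).
apply: (@le_trans _ _ (\sum_(h < n) (B * e * `|v|))); last first.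
  by rewrite sumr_const card_ord -[_ *+ n]mulr_natl !mulrA.
apply: ler_sum => h _; rewrite !normrM mulrC -!mulrA; apply: ler_pM => //.
  exact: (HB (h, l, i)).
rewrite mulrC; apply: ler_pM => //; first exact: le_trans (norm_coord _ _) xe.
exact: le_trans (norm_coord _ _) (norm_lsubmx _).
Qed.

(* The flow of F and its spatial derivative form the flow of [tangent_field F],
   which satisfies the same hypotheses near the zero section: hence the
   induction on k. *)
Lemma flow_Ck k n (F : 'rV[R]_n -> 'rV[R]_n) (V K U : set 'rV[R]_n) (T L : R)
    (phi : 'rV[R]_n -> R -> 'rV[R]_n) :
  open V -> K `<=` V -> compact K -> convex_set K ->
  (forall j, Csmooth V (fun y => F y 0 j)) -> 0 <= T -> 0 <= L -> T * L < 2^-1 ->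
  (forall (y v : 'rV[R]_n), K y -> `|v *m jac F y| <= L * `|v|) ->
  open U -> (forall z, U z -> phi z 0 = z) ->
  (forall z s, U z -> 0 <= s <= T -> K (phi z s)) ->
  (forall z, U z -> has_deriv T (phi z) (fun s => F (phi z s))) ->
  forall s j, 0 <= s <= T -> Ck k U (fun z => phi z s 0 j).
Proof.
elim: k n F V K U T L phi => [|k IH] n F V K U T L phi oV KV cK cvK HF T0 L0 TL HL oU
  phi0 phiK phiD s j sT.
all: have HF2 : forall j, Ck 2 V (fun y => F y 0 j) by move=> i; exact: HF.
all: have TL' := ltW TL.
all: have cphi (z : 'rV[R]_n) (Uz : U z) : {for z, continuous (fun z => phi z s 0 j)} by refine (@flow_continuous R n F V K U T L phi oV KV cvK HF2 T0 L0 TL' HL oU phi0 phiK phiD s j z Uz sT).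
- by split.
have FD z v w := @flow_derive R n F V K U T L phi oV KV cK cvK HF2 T0 L0 TL' HL oU phi0 phiK phiD z v w s j.
have VE z v := @variation_exists R n F V K U T L phi KV HF2 T0 L0 TL' HL phiK phiD z v.
split => //; split.
  by move=> z v Uz; have [w [w0 dw]] := VE z v Uz; have [] := FD z v w Uz w0 dw sT.
move=> v.
have [C C0 HC] := tangent_field_bound oV KV cK HF.
(* The strict inequality T L < 1/2 leaves slack, and this width around the zero section keeps T (L +
   C e) < 1/2: the time [T] stays the same at every order of differentiation. *)
pose e : R := (2^-1 - T * L) / (T * C + 1) / 2.
have TC0 : 0 <= T * C by exact: mulr_ge0.
have TC1 : 0 < T * C + 1 by rewrite ltr_wpDl.
have e0 : 0 < e by rewrite !divr_gt0// subr_gt0.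
have TL2 : T * (L + C * e) < 2^-1.
  rewrite mulrDr -ltrBrDl mulrA /e.
  apply: (@le_lt_trans _ _ ((2^-1 - T * L) / 2)); last first.
    by rewrite ltr_pdivrMr// ltr_pMr ?subr_gt0// ltr1n.
  rewrite !mulrA ler_pM2r// ler_pdivrMr// mulrC ler_pM2l ?subr_gt0//.
  by rewrite lerDl.
clearbody e.
pose V2 := [set x : 'rV[R]_(n + n) | V (lsubmx x)].
pose K2 := [set x : 'rV[R]_(n + n) | K (lsubmx x) /\ `|rsubmx x| <= e].
(* Half the width, since a solution of the variational equation may double in norm over [0, T]. *)
pose U2 := [set x : 'rV[R]_(n + n) | U (lsubmx x) /\ `|rsubmx x| < e / 2].
have oV2 : open V2 by exact: open_lsubmx.
have KV2 : K2 `<=` V2 by move=> x [Kx _]; exact: KV.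
have cK2 : compact K2.
  apply: bounded_closed_compact.
    have [M [Mr HM]] := compact_bounded cK.
    exists (Num.max M e); split; first by rewrite max_real// gtr0_real.
    move=> t; rewrite gt_max => /andP[Mt et] x [Kx xe].
    rewrite -[x]hsubmxK; apply: norm_row_mx_le.
    - by apply: ltW; exact: lt_trans et.
    - exact: HM.
    - by apply: (le_trans xe); exact: ltW.
  apply: closedI.
    apply: (@preimage_closed _ _ (@lsubmx R 1 n n)); first by move=> x _; exact: lsubmx_continuous.
    by apply: compact_closed cK; exact: norm_hausdorff.
  apply: (@preimage_closed _ _ (fun x : 'rV[R]_(n + n) => `|rsubmx x|) [set t : R | t <= e]); last exact: closed_le.
  by move=> x _; apply: (cvg_norm (@rsubmx_continuous R n n x)).
have cvK2 : convex_set K2.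
  move=> a b t [Ka ae] [Kb be] t01; split.
    by rewrite linearD linearZ linearB /=; exact: cvK.
  rewrite linearD linearZ linearB /=.
  have -> : rsubmx a + t *: (rsubmx b - rsubmx a) = (1 - t) *: rsubmx a + t *: rsubmx b.
    by rewrite scalerBl scale1r scalerBr addrA addrAC.
  have /andP[t0 t1] := t01; apply: (le_trans (ler_normD _ _)).
  rewrite !normrZ (ger0_norm t0) ger0_norm ?subr_ge0//.
  apply: (@le_trans _ _ ((1 - t) * e + t * e)); last by rewrite -mulrDl subrK mul1r.
  by apply: lerD; apply: ler_wpM2l => //; rewrite subr_ge0.
have oU2 : open U2.
  apply: openI; first exact: open_lsubmx.
  apply: (@open_rsubmx R n n [set y | `|y| < e / 2]).
  have -> : [set y : 'rV[R]_n | `|y| < e / 2] = ball 0 (e / 2).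
    by apply/seteqP; split => y; rewrite -ball_normE /= sub0r normrN.
  by apply: ball_open; rewrite divr_gt0.
have /choice[W HW] : forall x : 'rV[R]_(n + n), exists w : R -> 'rV[R]_n, U2 x ->
    w 0 = rsubmx x /\ has_deriv T w (fun s => w s *m jac F (phi (lsubmx x) s)).
  move=> x; have [[Ux _]|nU] := pselect (U2 x); last by exists (fun=> 0).
  by have [w Hw] := VE _ (rsubmx x) Ux; exists w.
pose psi x s := row_mx (phi (lsubmx x) s) (W x s).
have psiCk := IH (n + n)%N (tangent_field F) V2 K2 U2 T (L + C * e) psi oV2 KV2 cK2 cvK2 _ T0 _ TL2 _ oU2 _ _ _ s _ sT.
have {}psiCk i : Ck k U2 (fun x => psi x s 0 i).
  apply: psiCk.
  - by move=> i'; exact: tangent_field_smooth.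
  - by rewrite addr_ge0// mulr_ge0// ltW.
  - by move=> y u [Ky ye]; apply: HC => //; exact: ltW.
  - by move=> x U2x; have [W0 _] := HW x U2x; rewrite /psi W0 phi0 ?hsubmxK//; case: U2x.
  - move=> x r U2x rT; split; rewrite /psi ?row_mxKl ?row_mxKr; first by apply: phiK => //; case: U2x.
    have [W0 dW] := HW x U2x; have [Ux xe] := U2x.
    apply: (le_trans (variation_bound T0 L0 TL' HL phiK Ux dW rT)).
    by rewrite W0 mulrC -ler_pdivlMr// ltW.
  - move=> x U2x r rT i'; have [W0 dW] := HW x U2x; have [Ux _] := U2x.
    case: (split_ordP i') => l ->; rewrite /psi /tangent_field ?row_mxEl ?row_mxEr row_mxKl ?row_mxKr.
      have -> : (fun s => row_mx (phi (lsubmx x) s) (W x s) 0 (lshift n l)) = (fun s => phi (lsubmx x) s 0 l).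
        by apply/funext => t; rewrite row_mxEl.
      exact: phiD.
    have -> : (fun s => row_mx (phi (lsubmx x) s) (W x s) 0 (rshift n l)) = (fun s => W x s 0 l).
      by apply/funext => t; rewrite row_mxEr.
    exact: dW.
(* A large v leaves the fibre part of [U2]; the derivative is linear in v, so it is computed at
   [lam *: v] and divided by [lam]. *)
pose lam : R := e / 2 / (`|v| + 1).
have v1 : 0 < `|v| + 1 by rewrite ltr_wpDl.
have lam0 : 0 < lam by rewrite !divr_gt0.
have lamv : `|lam *: v| < e / 2.
  rewrite normrZ gtr0_norm// /lam mulrAC ltr_pdivrMr// ltr_pM2l ?divr_gt0//.
  by rewrite ltrDl.
have U2z z : U z -> U2 (row_mx z (lam *: v)).
  by move=> Uz; split; rewrite ?row_mxKl ?row_mxKr.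
apply: (@Ck_ext _ _ _ _ (fun z => lam^-1 * psi (row_mx z (lam *: v)) s 0 (rshift n j))) => //.
  move=> z Uz; rewrite /psi row_mxEr.
  have [W0 dW] := HW _ (U2z z Uz); rewrite row_mxKr in W0; rewrite row_mxKl in dW.
  have [||_ ->] := FD z v (fun s => lam^-1 *: W (row_mx z (lam *: v)) s) Uz _ _ sT.
  - by rewrite W0 scalerA mulVf ?scale1r// gt_eqF.
  - move=> r rT i; rewrite -scalemxAl rowZE.
    have -> : (fun s => (lam^-1 *: W (row_mx z (lam *: v)) s) 0 i) =
       lam^-1 \*: (fun s => W (row_mx z (lam *: v)) s 0 i).
      by apply/funext => t; rewrite mxE.
    by apply: is_deriveZ; exact: dW.
  - by rewrite mxE.
apply: Ck_scale => //.
exact: (@Ck_row_mxl _ _ _ _ U (lam *: v) U2 (fun x => psi x s 0 (rshift n j))).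
Unshelve. all: by end_near. Qed.

End FlowSmooth.

Section LocalFlow.
Variable R : realType.

(** The derivative in the initial value is recorded with its variational equation, on which the
    endpoint computation in [steering] rests. *)
Record local_flow n (F : 'rV[R]_n -> 'rV[R]_n) (V : set 'rV[R]_n) (T L : R)
    (U : set 'rV[R]_n) (phi : 'rV[R]_n -> R -> 'rV[R]_n) : Prop := LocalFlow {
  lf_T : 0 < T;
  lf_L : 0 <= L;
  lf_TL : T * L <= 2^-1;
  lf_open : open U;
  lf_0 : forall z, U z -> phi z 0 = z;
  lf_V : forall z s, U z -> 0 <= s <= T -> V (phi z s);
  lf_deriv : forall z, U z -> has_deriv T (phi z) (fun s => F (phi z s));
  lf_smooth : forall s j, 0 <= s <= T -> Csmooth U (fun z => phi z s 0 j);
  lf_bound : forall z s (v : 'rV[R]_n), U z -> 0 <= s <= T ->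
    `|v *m jac F (phi z s)| <= L * `|v|;
  lf_var : forall z v, U z -> exists w : R -> 'rV[R]_n, [/\ w 0 = v,
    has_deriv T w (fun s => w s *m jac F (phi z s)) &
    forall s j, 0 <= s <= T -> is_derive z v (fun z => phi z s 0 j) (w s 0 j)] }.

Lemma local_flow_exists n (F : 'rV[R]_n -> 'rV[R]_n) (V : set 'rV[R]_n) z0 :
  open V -> V z0 -> (forall j, Csmooth V (fun y => F y 0 j)) ->
  exists T L U phi, local_flow F V T L U phi /\ U z0.
Proof.
move=> oV Vz0 HF.
have [r r0 rV] : exists2 r : R, 0 < r & forall y, `|y - z0| <= 2 * r -> V y.
  have : nbhs z0 V by exact: open_nbhs_nbhs.
  move=> /nbhs_normP[d /= d0 dV]; exists (d / 4); first by rewrite divr_gt0.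
  move=> y yr; apply: dV => /=; rewrite distrC; apply: (le_lt_trans yr).
  by have : 0 < d by []; lra.
pose K := [set y : 'rV[R]_n | `|y - z0| <= 2 * r].
have KV : K `<=` V by move=> y; exact: rV.
have nrm_cont (c : 'rV[R]_n) : continuous (fun y : 'rV[R]_n => `|y - c|).
  move=> y; apply: (@continuous_comp _ _ _ (fun y : 'rV[R]_n => y - c) Num.norm); last exact: norm_continuous.
  apply: differentiable_continuous; apply: differentiableB; first exact: ex_diff.
  exact: differentiable_cst.
have clK (c : 'rV[R]_n) (e : R) : closed [set y : 'rV[R]_n | `|y - c| <= e].
  apply: (@preimage_closed _ _ (fun y : 'rV[R]_n => `|y - c|) [set t : R | t <= e]); last exact: closed_le.
  by move=> y _; exact: nrm_cont.
have cK : compact K.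
  apply: bounded_closed_compact; last exact: clK.
  exists (2 * r + `|z0|); split; first by rewrite num_real.
  move=> t rt y Ky; apply: ltW; apply: le_lt_trans rt.
  by rewrite -[y](subrK z0); apply: (le_trans (ler_normD _ _)); rewrite lerD2r.
have cvK : convex_set K.
  move=> a b t Ka Kb /andP[t0 t1]; rewrite /K /=.
  have -> : a + t *: (b - a) - z0 = (1 - t) *: (a - z0) + t *: (b - z0).
    by apply/rowP => i; rewrite !mxE; ring.
  apply: (le_trans (ler_normD _ _)).
  rewrite !normrZ (ger0_norm t0) ger0_norm ?subr_ge0//.
  apply: (@le_trans _ _ ((1 - t) * (2 * r) + t * (2 * r))); last by rewrite -mulrDl subrK mul1r.
  by apply: lerD; apply: ler_wpM2l => //; rewrite subr_ge0.
have [|M M0 HM] := @compact_bound_fin R n 'I_n (fun j y => F y 0 j) K cK.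
  by move=> i x Kx; apply: (Ck_cont (HF i 0)); exact: KV.
have FM y : K y -> `|F y| <= M by move=> Ky; apply: rV_norm_le => // i; exact: HM.
have [|B B0 HB] := @compact_bound_fin R n ('I_n * 'I_n)%type
    (fun ij => partial ij.1 (fun y => F y 0 ij.2)) K cK.
  by move=> [i j] x Kx; apply: (Ck_cont (Ck_partial i (HF j 1))); exact: KV.
pose L := n%:R * B.
have L0 : 0 <= L by rewrite mulr_ge0.
have HL (y v : 'rV[R]_n) : K y -> `|v *m jac F y| <= L * `|v|.
  move=> Ky; apply: rV_norm_le; first by rewrite mulr_ge0.
  move=> j; rewrite mxE; apply: (le_trans (ler_norm_sum _ _ _)).
  apply: (@le_trans _ _ (\sum_(i < n) (B * `|v|))).
    apply: ler_sum => i _; rewrite normrM mulrC ler_pM//; last exact: norm_coord.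
    by rewrite mxE; exact: (HB (i, j)).
  by rewrite sumr_const card_ord -mulrA mulr_natl.
(* At speed at most M the first bound keeps a solution within r of its start, hence within 2 r of
   [z0]; the second gives T L < 1/2. *)
pose T := Num.min (r / (M + 1)) (4^-1 / (L + 1)).
have M1 : 0 < M + 1 by rewrite ltr_wpDl.
have L1 : 0 < L + 1 by rewrite ltr_wpDl.
have T0 : 0 < T by rewrite lt_min !divr_gt0// invr_gt0.
have TM : T * M <= r.
  apply: (@le_trans _ _ (r / (M + 1) * M)); first by rewrite ler_wpM2r// ge_min lexx.
  rewrite mulrAC ler_pdivrMr//; apply: ler_wpM2l; first exact: ltW.
  by rewrite lerDl.
have TL : T * L < 2^-1.
  apply: (@le_lt_trans _ _ (4^-1 / (L + 1) * L)).
    by rewrite ler_wpM2r// ge_min lexx orbT.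
  rewrite mulrAC ltr_pdivrMr//.
  lra.
have HF1 j : Ck 1 V (fun y => F y 0 j) by exact: HF.
pose U := [set z : 'rV[R]_n | `|z - z0| < r].
have oU : open U.
  have -> : U = ball z0 r by apply/seteqP; split => y; rewrite -ball_normE /= distrC.
  exact: ball_open.
have /choice[phi Hphi] : forall z, exists y : R -> 'rV[R]_n, U z -> [/\ y 0 = z,
    forall s, 0 <= s <= T -> K (y s) & has_deriv T y (fun s => F (y s))].
  move=> z; have [Uz|nU] := pselect (U z); last by exists (fun=> 0).
  pose K' := [set y : 'rV[R]_n | `|y - z| <= r].
  have K'K : K' `<=` K.
    move=> y K'y; rewrite /K /= -[y](subrK z) -addrA; apply: (le_trans (ler_normD _ _)).
    have : `|y - z| <= r by []. have : `|z - z0| < r by [].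
    by move: `|y - z| `|z - z0| => a b; lra.
  have K'z : K' z by rewrite /K' /= subrr normr0 ltW.
  have [|||y [y0 yK dy]] := @picard R n T L K' z (fun _ a => F a) (ltW T0) L0 (ltW TL) (clK z r) K'z.
  - move=> y cy Ky s; apply: (rV_cvgP (FF := nbhs_filter s)) => j.
    apply: (@continuous_comp _ _ _ y (fun v => F v 0 j)); first exact: cy.
    by apply: (Ck_cont (HF j 0)); apply: KV; exact: K'K.
  - move=> s a b _ Ka Kb; apply: (jac_lip oV KV cvK HF1 L0 HL); exact: K'K.
  - move=> y Y Ky Y0 dY s sT; rewrite /K' /= -Y0.
    have := has_deriv_mvt dY M0 _ sT => H; apply: le_trans (H _) _.
      by move=> t _; apply: FM; exact: K'K.
    by apply: le_trans TM; rewrite ler_wpM2r//; case/andP: sT.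
  by exists y => _; split => // s sT; apply: K'K; exact: yK.
have phi0 z : U z -> phi z 0 = z by move=> /Hphi[].
have phiK z s : U z -> 0 <= s <= T -> K (phi z s) by move=> /Hphi[_ H _]; exact: H.
have phiD z : U z -> has_deriv T (phi z) (fun s => F (phi z s)) by move=> /Hphi[].
have HF2 j : Ck 2 V (fun y => F y 0 j) by exact: HF.
exists T, L, U, phi; split; last by rewrite /U /= subrr normr0.
split => //.
- exact: ltW.
- by move=> z s Uz sT; apply: KV; exact: phiK.
- by move=> s j sT k; refine (@flow_Ck _ k n F V K U T L phi oV KV cK cvK HF (ltW T0) L0 TL HL oU phi0 phiK phiD s j sT).
- by move=> z s v Uz sT; apply: HL; exact: phiK.
- move=> z v Uz.
  have [w [w0 dw]] := @variation_exists R n F V K U T L phi KV HF2 (ltW T0) L0 (ltW TL) HL phiK phiD z v Uz.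
  exists w; split => // s j sT.
  exact: (@flow_derive R n F V K U T L phi oV KV cK cvK HF2 (ltW T0) L0 (ltW TL) HL oU phi0 phiK phiD z v w s j Uz w0 dw sT).
Qed.

End LocalFlow.

(** * Systems linear in the control *)

Section Steering.
Variables (R : realType) (k N : nat) (A : 'rV[R]_N -> 'M[R]_(k, N)).

Lemma has_deriv_rescale n (T : R) (y dy : R -> 'rV[R]_n) : 0 < T -> has_deriv T y dy ->
  has_deriv 1 (fun s => y (T * s)) (fun s => T *: dy (T * s)).
Proof.
move=> T0 Hy s /andP[s0 s1] i.
have sT : 0 <= T * s <= T by have T0' := ltW T0; rewrite mulr_ge0//= ler_piMr.
have [d1 E1] := Hy _ sT i.
have dm : derivable (fun s : R => T * s) s 1 by apply: derivableM => //; exact: derivable_id.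
apply: DeriveDef.
  apply/derivable1_diffP; apply: (@differentiable_comp _ _ _ _ (fun s : R => T * s) (fun s => y s 0 i)).
    exact/derivable1_diffP.
  exact/derivable1_diffP.
rewrite -derive1E (@derive1_comp _ (fun s => T * s) (fun s => y s 0 i))//.
rewrite derive1E E1 mxE mulrC; congr (_ * _).
rewrite derive1E (_ : (fun s : R => T * s) = T \*: id); last by [].
by rewrite deriveZ// derive_id /GRing.scale /= mulr1.
Qed.

(** The control is carried as a state variable with zero velocity, so that smooth dependence on it
    becomes smooth dependence on the initial value. *)
Let F (z : 'rV[R]_(k + N)) : 'rV[R]_(k + N) := row_mx 0 (lsubmx z *m A (rsubmx z)).

Lemma steer_field_smooth V j : open V -> (forall m, Ckmx m V A) ->
  Csmooth [set z : 'rV[R]_(k + N) | V (rsubmx z)] (fun z => F z 0 j).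
Proof.
move=> oV HA m; have oV2 := @open_rsubmx R k N V oV.
case: (split_ordP j) => i ->.
  apply: (@Ck_ext _ _ _ _ (cst 0)) => //; last exact: Ck_cst.
  by move=> x _; rewrite /F row_mxEl mxE.
apply: (@Ck_ext _ _ _ _ (fun z => \sum_l z 0 (lshift N l) * A (rsubmx z) l i)) => //.
  by move=> x _; rewrite /F row_mxEr mxE; apply: eq_bigr => l _; rewrite mxE.
apply: Ck_sum => // l _; apply: Ck_mul => //; first exact: Ck_coord.
by apply: (@Ck_rsubmx _ _ _ _ V (fun x => A x l i)) => //; exact: HA.
Qed.

(* Moving an endpoint along one of the commuting fields e *m A while correcting
   the control by -e does not change the endpoint: the variation is
   (1 - s) e *m A (c s), which vanishes at s = 1. *)
Lemma steering V x0 : open V -> V x0 -> (forall m, Ckmx m V A) ->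
  exists (d : R) (U : set 'rV[R]_N) (c : 'rV[R]_k -> 'rV[R]_N -> R -> 'rV[R]_N),
  [/\ 0 < d, open U, U x0,
    forall u x, `|u| < d -> U x -> [/\ c u x 0 = x,
      forall s, 0 <= s <= 1 -> V (c u x s) &
      has_deriv 1 (c u x) (fun s => u *m A (c u x s))] &
    (forall m s j, 0 <= s <= 1 ->
       Ck m [set z : 'rV[R]_(k + N) | `|lsubmx z| < d /\ U (rsubmx z)]
         (fun z => c (lsubmx z) (rsubmx z) s 0 j)) /\
    ((forall x (u e : 'rV[R]_k) j, V x ->
        'D_(u *m A x) (fun y => (e *m A y) 0 j) x =
        'D_(e *m A x) (fun y => (u *m A y) 0 j) x) ->
     forall u x e j, `|u| < d -> U x ->
       is_derive (row_mx u x) (row_mx (- e) (e *m A x))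
         (fun z => c (lsubmx z) (rsubmx z) 1 0 j) 0)].
Proof.
move=> oV Vx0 HA.
pose V' := [set z : 'rV[R]_(k + N) | V (rsubmx z)].
have oV' : open V' by exact: open_rsubmx.
have HF j : Csmooth V' (fun z => F z 0 j) by exact: steer_field_smooth.
have V'0 : V' (row_mx 0 x0) by rewrite /V' /= row_mxKr.
have [T [L [U' [phi [lf U'0]]]]] := local_flow_exists oV' V'0 HF.
have [d0 [d00 dU]] : exists d0 : R, 0 < d0 /\ forall (u : 'rV[R]_k) x, `|u| < d0 -> `|x - x0| < d0 ->
    U' (row_mx u x).
  have : nbhs (row_mx 0 x0) U' by apply: open_nbhs_nbhs; split => //; exact: lf_open lf.
  move=> /nbhs_normP[d0 /= d00 dU]; exists d0; split => // u x ud xd; apply: dU => /=.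
  rewrite distrC opp_row_mx add_row_mx subr0.
  apply: rV_norm_lt => // i; case: (split_ordP i) => l ->.
    by rewrite row_mxEl; apply: le_lt_trans ud; exact: norm_coord.
  by rewrite row_mxEr; apply: le_lt_trans xd; exact: norm_coord.
have T0 := lf_T lf; have Tn0 : T != 0 by rewrite gt_eqF.
have unT (s : R) : 0 <= s <= 1 -> 0 <= T * s <= T.
  by move=> /andP[s0 s1]; have T0' := ltW T0; rewrite mulr_ge0//= ler_piMr.
pose U := [set x : 'rV[R]_N | `|x - x0| < d0].
pose d := T * d0.
(* Time is rescaled: running the control u / T up to time T amounts to running u up to time 1. *)
pose c (u : 'rV[R]_k) (x : 'rV[R]_N) (s : R) := rsubmx (phi (row_mx (T^-1 *: u) x) (T * s)).
have dpos : 0 < d by exact: mulr_gt0.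
have oU : open U.
  have -> : U = ball x0 d0 by apply/seteqP; split => y; rewrite -ball_normE /= distrC.
  exact: ball_open.
have UU' u x : `|u| < d -> U x -> U' (row_mx (T^-1 *: u) x).
  move=> ud Ux; apply: dU => //; rewrite normrZ gtr0_norm ?invr_gt0//.
  by rewrite ltr_pdivrMl.
have lphi z s : U' z -> 0 <= s <= T -> lsubmx (phi z s) = lsubmx z.
  move=> U'z sT; have dl : has_deriv T (fun s => lsubmx (phi z s)) (fun=> 0).
    move=> r rT i; have := lf_deriv lf U'z rT (lshift N i).
    have -> : (fun s => lsubmx (phi z s) 0 i) = (fun s => phi z s 0 (lshift N i)).
      by apply/funext => t; rewrite mxE.
    by rewrite /F row_mxEl mxE.
  have := has_deriv_mvt dl (lexx 0) _ sT; rewrite (lf_0 lf U'z) mulr0 => H.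
  apply/eqP; rewrite -subr_eq0 -normr_le0; apply: H => t _; by rewrite normr0.
have cderiv u x : `|u| < d -> U x -> has_deriv 1 (c u x) (fun s => u *m A (c u x s)).
  move=> ud Ux; have U'z := UU' _ _ ud Ux.
  have := has_deriv_rescale T0 (lf_deriv lf U'z) => H s s1 i.
  have := H s s1 (rshift k i); rewrite /F -/(F _).
  have -> : (fun s => phi (row_mx (T^-1 *: u) x) (T * s) 0 (rshift k i)) = (fun s => c u x s 0 i).
    by apply/funext => t; rewrite /c mxE.
  rewrite mxE /F row_mxEr lphi ?unT// row_mxKl -scalemxAl mxE mulrA divff// mul1r.
  by [].
exists d, U, c; split => //.
- by rewrite /U /= subrr normr0.
- move=> u x ud Ux; have U'z := UU' _ _ ud Ux; split.
  + by rewrite /c mulr0 (lf_0 lf U'z) row_mxKr.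
  + by move=> s s1; exact: (lf_V lf U'z (unT _ s1)).
  + exact: cderiv.
pose S (z : 'rV[R]_(k + N)) : 'rV[R]_(k + N) := row_mx (T^-1 *: lsubmx z) (rsubmx z).
pose W := [set z : 'rV[R]_(k + N) | `|lsubmx z| < d /\ U (rsubmx z)].
have oW : open W.
  apply: openI; last exact: open_rsubmx.
  apply: (@open_lsubmx R k N [set y | `|y| < d]).
  have -> : [set y : 'rV[R]_k | `|y| < d] = ball 0 d.
    by apply/seteqP; split => y; rewrite -ball_normE /= sub0r normrN.
  exact: ball_open.
have WS z : W z -> U' (S z) by move=> [zd Uz]; exact: UU'.
have SCk m i : Ck m W (fun z => S z 0 i).
  case: (split_ordP i) => l ->.
    apply: (@Ck_ext _ _ _ _ (fun z => T^-1 * z 0 (lshift N l))) => //.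
      by move=> z _; rewrite /S row_mxEl !mxE.
    by apply: Ck_scale => //; exact: Ck_coord.
  apply: (@Ck_ext _ _ _ _ (fun z => z 0 (rshift k l))) => //.
    by move=> z _; rewrite /S row_mxEr !mxE.
  exact: Ck_coord.
have cS s j : (fun z => c (lsubmx z) (rsubmx z) s 0 j) = (fun z => phi z (T * s) 0 (rshift k j)) \o S.
  by apply/funext => z /=; rewrite /c /S mxE.
split.
  move=> m s j s1; rewrite cS; apply: (@Ck_comp _ _ _ _ W U' S) => //.
    exact: lf_open lf.
  exact: (lf_smooth lf _ (unT _ s1)).
move=> comm u x e j ud Ux.
have Wz : W (row_mx u x) by split; rewrite ?row_mxKl ?row_mxKr.
have U'z := UU' _ _ ud Ux; set z := row_mx (T^-1 *: u) x in U'z.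
have Sz : S (row_mx u x) = z by rewrite /S row_mxKl row_mxKr.
have [w [w0 dw Dw]] := lf_var lf (row_mx (- (T^-1 *: e)) (e *m A x)) U'z.
have HFV i : Ck 1 V' (fun z => F z 0 i) by exact: HF.
(* [E] is the variation minus its predicted value (1 - s/T) e A. It solves a homogeneous linear
   equation starting from 0, hence vanishes, and at s = T the prediction itself is 0. *)
pose E s : 'rV[R]_N := rsubmx (w s) - (T^-1 * (T - s)) *: (e *m A (rsubmx (phi z s))).
have lw s : 0 <= s <= T -> lsubmx (w s) = - (T^-1 *: e).
  move=> sT; have dl : has_deriv T (fun s => lsubmx (w s)) (fun=> 0).
    move=> r rT i; have [d1 d2] := dw r rT (lshift N i).
    have -> : (fun s => lsubmx (w s) 0 i) = (fun s => w s 0 (lshift N i)).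
      by apply/funext => t; rewrite mxE.
    apply: DeriveDef; first exact: d1.
    rewrite d2 (jacE _ _ oV' HFV); last exact: (lf_V lf).
    have -> : (fun y => F y 0 (lshift N i)) = cst 0 by apply/funext => t; rewrite /F row_mxEl mxE.
    by rewrite derive_cst mxE.
  have := has_deriv_mvt dl (lexx 0) _ sT; rewrite w0 row_mxKl mulr0 => H.
  apply/eqP; rewrite -subr_eq0 -normr_le0; apply: H => t _; by rewrite normr0.
have HAe (e' : 'rV[R]_k) i : Ck 1 V (fun y => (e' *m A y) 0 i).
  apply: (@Ck_ext _ _ _ _ (fun y => \sum_l e' 0 l * A y l i)) => //.
    by move=> y _; rewrite mxE.
  by apply: Ck_sum => // l _; apply: Ck_scale => //; exact: (HA 1 l i).
have jF s i (v : 'rV[R]_(k + N)) : 0 <= s <= T ->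
    (v *m jac F (phi z s)) 0 (rshift k i) =
    (lsubmx v *m A (rsubmx (phi z s))) 0 i +
    'D_(rsubmx v) (fun y => ((T^-1 *: u) *m A y) 0 i) (rsubmx (phi z s)).
  move=> sT; have Vp : V' (phi z s) := lf_V lf U'z sT.
  rewrite (jacE _ _ oV' HFV)//; set p := phi z s in Vp *.
  have -> : (fun y => F y 0 (rshift k i)) = \sum_l ((fun y : 'rV[R]_(k + N) => y 0 (lshift N l)) *
      (fun y => A (rsubmx y) l i)).
    apply/funext => y; rewrite /F row_mxEr mxE fct_sumE; apply: eq_bigr => l _.
    by rewrite mxE.
  have dA l : is_derive p v (fun y => A (rsubmx y) l i) ('D_(rsubmx v) (fun y => A y l i) (rsubmx p)).
    have cc h : Ck 1 V' (fun y => rsubmx y 0 h).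
      have -> : (fun y : 'rV[R]_(k + N) => rsubmx y 0 h) = (fun y => y 0 (rshift k h)).
        by apply/funext => y; rewrite mxE.
      exact: Ck_coord.
    have [H1 H2] := derive_comp_partial v oV' oV (fun _ H => H) cc (HA 1 l i) Vp.
    apply: DeriveDef; first exact: H1.
    rewrite -[LHS]/('D_v ((fun y => A y l i) \o @rsubmx R 1 k N) p) H2.
    rewrite (derive_partial _ oV (HA 1 l i))//; apply: eq_bigr => h _; rewrite mulrC; congr (_ * _).
    have -> : (fun y : 'rV[R]_(k + N) => rsubmx y 0 h) = (fun y => y 0 (rshift k h)).
      by apply/funext => y; rewrite mxE.
    by have [_ ->] := is_derive_coord p v (rshift k h); rewrite mxE.
  have D l : is_derive p v ((fun y : 'rV[R]_(k + N) => y 0 (lshift N l)) * (fun y => A (rsubmx y) l i))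
     (p 0 (lshift N l) *: 'D_(rsubmx v) (fun y => A y l i) (rsubmx p) + A (rsubmx p) l i *: v 0 (lshift N l)).
    by apply: is_deriveM; exact: is_derive_coord.
  have [_ ->] := is_derive_sum D.
  rewrite big_split /= [LHS]addrC mxE; congr (_ + _).
    by apply: eq_bigr => l _; rewrite mxE mulrC.
  have D2 l : is_derive (rsubmx p) (rsubmx v) ((T^-1 *: u) 0 l \*: (fun y => A y l i))
     ((T^-1 *: u) 0 l *: 'D_(rsubmx v) (fun y => A y l i) (rsubmx p)).
    by apply: is_deriveZ; apply: derivableP; exact: (Ck_derivable (HA 1 l i)).
  have -> : (fun y => ((T^-1 *: u) *m A y) 0 i) = \sum_l ((T^-1 *: u) 0 l \*: (fun y => A y l i)).
    by apply/funext => y; rewrite mxE fct_sumE.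
  have [_ ->] := is_derive_sum D2; apply: eq_bigr => l _; congr (_ *: _).
  by have := lphi z s U'z sT => /rowP /(_ l); rewrite /z row_mxKl mxE => ->.
have dE : has_deriv T E (fun s => rsubmx (row_mx 0 (E s) *m jac F (phi z s))).
  move=> s sT i; set p := rsubmx (phi z s).
  have Vp : V p := lf_V lf U'z sT.
  have dp l : is_derive s (1 : R) (fun s => rsubmx (phi z s) 0 l) ((T^-1 *: u *m A p) 0 l).
    have := lf_deriv lf U'z sT (rshift k l).
    have -> : (fun s => phi z s 0 (rshift k l)) = (fun s => rsubmx (phi z s) 0 l).
      by apply/funext => t; rewrite mxE.
    by rewrite /F row_mxEr lphi// row_mxKl.
  have dAp : is_derive s (1 : R) (fun s => (e *m A (rsubmx (phi z s))) 0 i)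
      ('D_(T^-1 *: u *m A p) (fun y => (e *m A y) 0 i) p).
    have := derivable_curve oV Vp dp (HAe e i).
    by rewrite -(derive_partial _ oV (HAe e i)).
  have dlin : is_derive s (1 : R) (fun s : R => T^-1 * (T - s)) (- T^-1).
    have -> : (fun s : R => T^-1 * (T - s)) = T^-1 \*: (cst T - id) by [].
    have := is_deriveZ T^-1 (is_deriveB (is_derive_cst T s (1 : R)) (is_derive_id s (1 : R))).
    by rewrite sub0r /GRing.scale /= mulrN mulr1.
  have dwi : is_derive s (1 : R) (fun s => rsubmx (w s) 0 i) ((w s *m jac F (phi z s)) 0 (rshift k i)).
    have -> : (fun s => rsubmx (w s) 0 i) = (fun s => w s 0 (rshift k i)).
      by apply/funext => t; rewrite mxE.
    exact: dw.
  have := is_deriveB dwi (is_deriveM dlin dAp).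
  have -> : (fun s => rsubmx (w s) 0 i) - (fun s : R => T^-1 * (T - s)) * (fun s => (e *m A (rsubmx (phi z s))) 0 i)
     = (fun s => E s 0 i).
    by apply/funext => t; rewrite /E rowBE rowZE.
  move=> H; apply: is_derive_eq H _.
  have -> : rsubmx (row_mx 0 (E s) *m jac F (phi z s)) 0 i =
      'D_(E s) (fun y => (T^-1 *: u *m A y) 0 i) p.
    by rewrite mxE jF// row_mxKl row_mxKr mul0mx mxE add0r.
  (* Commutation replaces the derivative of e A along u A by that of u A along e A; both remaining
     terms are then derivatives of u A, along the variation and along its predicted value. *)
  rewrite (jF _ _ _ sT) lw// -/p comm//.
  have dlinD (a : R) (v1 v2 : 'rV[R]_N) : 'D_(v1 - a *: v2) (fun y => (T^-1 *: u *m A y) 0 i) p =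
     'D_v1 (fun y => (T^-1 *: u *m A y) 0 i) p - a * 'D_v2 (fun y => (T^-1 *: u *m A y) 0 i) p.
    rewrite !(derive_partial _ oV (HAe _ i))// mulr_sumr -sumrB.
    by apply: eq_bigr => h _; rewrite !mxE; ring.
  rewrite /E dlinD -/p -scaleNr -scalemxAl rowZE /GRing.scale /=; ring.
have E0 : E 0 = 0.
  rewrite /E subr0 mulVf// scale1r w0 row_mxKr (lf_0 lf U'z) /z row_mxKr; exact: subrr.
have Ez : E T = 0.
  have TT : 0 <= T <= T by rewrite lexx ltW.
  have := small_gronwall (ltW T0) (lf_L lf) (lexx 0) (lf_TL lf) dE _ TT.
  rewrite E0 normr0 mulr0 addr0 mulr0 normr_le0 => H; apply/eqP; apply: H => s sT.
  rewrite addr0; apply: (le_trans (norm_rsubmx _)); apply: (le_trans (lf_bound lf _ U'z sT)).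
  apply: ler_wpM2l; first exact: lf_L lf.
  by apply: norm_row_mx_le => //; rewrite normr0.
have wT : rsubmx (w T) = 0.
  by move: Ez; rewrite /E subrr mulr0 scale0r subr0.
have TT : 0 <= T <= T by rewrite lexx ltW.
rewrite cS mulr1.
have Sd (i : 'I_(k + N)) : 'D_(row_mx (- e) (e *m A x)) (fun y => S y 0 i) (row_mx u x) =
   (row_mx (- (T^-1 *: e)) (e *m A x)) 0 i.
  case: (split_ordP i) => l ->.
    have -> : (fun y => S y 0 (lshift N l)) = T^-1 \*: (fun y : 'rV[R]_(k + N) => y 0 (lshift N l)).
      by apply/funext => y; rewrite /S row_mxEl !mxE.
    have [_ ->] := is_deriveZ T^-1 (is_derive_coord (row_mx u x) (row_mx (- e) (e *m A x)) (lshift N l)).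
    by rewrite !row_mxEl !mxE /GRing.scale /= mulrN.
  have -> : (fun y => S y 0 (rshift k l)) = (fun y : 'rV[R]_(k + N) => y 0 (rshift k l)).
    by apply/funext => y; rewrite /S row_mxEr !mxE.
  have [_ ->] := is_derive_coord (row_mx u x) (row_mx (- e) (e *m A x)) (rshift k l).
  by rewrite !row_mxEr.
have := derive_comp_partial (row_mx (- e) (e *m A x)) oW (lf_open lf) WS (SCk 1%N) (lf_smooth lf (rshift k j) TT 1) Wz.
move=> H; apply: is_derive_eq H _; rewrite Sz.
under eq_bigr do rewrite Sd mulrC.
rewrite -(derive_partial _ (lf_open lf) (lf_smooth lf (rshift k j) TT 1) U'z).
have [_ ->] := Dw T (rshift k j) TT.
by have /rowP /(_ j) := wT; rewrite !mxE.
Unshelve. all: by end_near. Qed.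

End Steering.

(** * Local inversion and foliations *)

Section Consequences.
Variable R : realType.

Lemma unit_itv1 : 0 <= (1 : R) <= 1.
Proof. by rewrite ler01 lexx. Qed.

Lemma deriv0_const (h : R -> R) (a b : R) : a <= b ->
  (forall s, a <= s <= b -> is_derive s (1 : R) h 0) -> h b = h a.
Proof.
move=> ab dh; have [||c _] := @MVT_segment R h (fun=> 0) a b ab.
- by move=> x; rewrite in_itv /= => /andP[ax xb]; apply: dh; rewrite !ltW.
- apply: derivable_within_continuous => x; rewrite in_itv /= => /dh.
  by case.
by rewrite mul0r => /eqP; rewrite subr_eq0 => /eqP.
Qed.

Lemma const_speed (h : R -> R) (a : R) :
  (forall s : R, 0 <= s <= 1 -> is_derive s (1 : R) h a) -> h 1 = h 0 + a.
Proof.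
move=> dh; have [||c _] := @MVT_segment R h (fun=> a) 0 1 ler01.
- by move=> x; rewrite in_itv /= => /andP[ax xb]; apply: dh; rewrite !ltW.
- apply: derivable_within_continuous => x; rewrite in_itv /= => /dh.
  by case.
by rewrite subr0 mulr1 => /eqP; rewrite subr_eq addrC => /eqP.
Qed.

Lemma same_deriv (f g df : R -> R) :
  (forall s : R, 0 <= s <= 1 -> is_derive s (1 : R) f (df s)) ->
  (forall s : R, 0 <= s <= 1 -> is_derive s (1 : R) g (df s)) -> f 1 - f 0 = g 1 - g 0.
Proof.
move=> Hf Hg; have : (f - g) 1 = (f - g) 0.
  apply: deriv0_const => // s s1; rewrite -[X in is_derive _ _ _ X](subrr (df s)).
  by apply: is_deriveB; [exact: Hf|exact: Hg].
rewrite -[(f - g) 1]/(f 1 - g 1) -[(f - g) 0]/(f 0 - g 0); lra.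
Qed.

Lemma mulmx_bound m n (B : 'M[R]_(m, n)) :
  exists2 C : R, 0 <= C & forall v : 'rV[R]_m, `|v *m B| <= C * `|v|.
Proof.
exists (\sum_i \sum_j `|B i j|); first by do 2 apply: sumr_ge0 => ? _.
move=> v; apply: rV_norm_le; first by rewrite mulr_ge0//; do 2 apply: sumr_ge0 => ? _.
move=> j; rewrite mxE; apply: (le_trans (ler_norm_sum _ _ _)).
rewrite mulr_suml; apply: ler_sum => i _; rewrite normrM mulrC; apply: ler_pM => //.
  by rewrite (bigD1 j)//= lerDl sumr_ge0.
exact: norm_coord.
Qed.

Lemma ballE n (x : 'rV[R]_n) (e : R) : [set y | `|y - x| < e] = ball x e.
Proof. by apply/seteqP; split => y; rewrite -ball_normE /= distrC. Qed.

Lemma ball_open' n (x : 'rV[R]_n) (e : R) : open [set y : 'rV[R]_n | `|y - x| < e].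
Proof. by rewrite ballE; exact: ball_open. Qed.

Lemma open_ball_in n (V : set 'rV[R]_n) x : open V -> V x ->
  exists2 e : R, 0 < e & forall y, `|y - x| < e -> V y.
Proof.
move=> oV Vx; have : nbhs x V by exact: open_nbhs_nbhs.
by move=> /nbhs_normP[d /= d0 dV]; exists d => // y; rewrite distrC; exact: dV.
Qed.

(* Running the control system rho' = x - p, w' = grad f (rho) for unit time
   gives w(1) = \int_0^1 grad f (p + s (x - p)) ds. *)
Lemma hadamard n (f : 'rV[R]_n -> R) (V : set 'rV[R]_n) p : open V -> V p -> Csmooth V f ->
  exists (W : set 'rV[R]_n) (G : 'I_n -> 'rV[R]_n -> R), [/\ open W, W p, W `<=` V,
    forall i, Csmooth W (G i) &
    forall x, W x -> f x = f p + \sum_i (x - p) 0 i * G i x].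
Proof.
move=> oV Vp Hf.
pose grad y : 'rV[R]_n := \row_i partial i f y.
(* The state is (rho, w) and the control (x - p, t0): the first block moves rho along the segment,
   the second accumulates in w the gradient of f at rho. *)
pose A (z : 'rV[R]_(n + n)) : 'M[R]_(n + 1, n + n) := block_mx 1%:M 0 0 (grad (lsubmx z)).
pose V' := [set z : 'rV[R]_(n + n) | V (lsubmx z)].
have oV' : open V' by exact: open_lsubmx.
have HA m : Ckmx m V' A.
  move=> i j; case: (split_ordP i) => i' ->; case: (split_ordP j) => j' ->.
  - apply: (@Ck_ext _ _ _ _ (cst ((1%:M : 'M[R]_n) i' j'))) => //; last exact: Ck_cst.
    by move=> x _; rewrite /A block_mxEul.
  - apply: (@Ck_ext _ _ _ _ (cst 0)) => //; last exact: Ck_cst.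
    by move=> x _; rewrite /A block_mxEur mxE.
  - apply: (@Ck_ext _ _ _ _ (cst 0)) => //; last exact: Ck_cst.
    by move=> x _; rewrite /A block_mxEdl mxE.
  - apply: (@Ck_ext _ _ _ _ (fun x => partial j' f (lsubmx x))) => //.
      by move=> x _; rewrite /A block_mxEdr mxE.
    by apply: (@Ck_lsubmx _ _ _ _ _ (partial j' f)) => //; apply: Ck_partial; exact: Hf.
have V'p : V' (row_mx p 0) by rewrite /V' /= row_mxKl.
have [d [U [c [d0 oU Up HC [CS _]]]]] := steering oV' V'p HA.
(* Controls must have norm below d, so the gradient is accumulated at speed [t0], and [G] divides by
   it. *)
pose t0 := d / 2; have t00 : 0 < t0 by rewrite divr_gt0.
have t0d : t0 < d by rewrite /t0 ltr_pdivrMr// ltr_pMr// ltr1n.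
have t0n : t0 != 0 by rewrite gt_eqF.
clearbody t0.
pose ctl x : 'rV[R]_(n + 1) := row_mx (x - p) (const_mx t0).
pose W := [set x : 'rV[R]_n | `|x - p| < t0] `&` V.
pose G i x := t0^-1 * c (ctl x) (row_mx p 0) 1 0 (rshift n i).
have oW : open W by apply: openI => //; exact: ball_open'.
have ctld x : W x -> `|ctl x| < d.
  move=> [xt _]; apply: le_lt_trans t0d; apply: norm_row_mx_le; first exact: ltW.
    exact: ltW.
  apply: rV_norm_le; first exact: ltW.
  by move=> i; rewrite mxE gtr0_norm.
exists W, G; split => //.
- by split => //=; rewrite subrr normr0.
- by move=> x [].
- move=> i m; apply: Ck_scale => //.
  have h11 := unit_itv1.
  have -> : (fun x => c (ctl x) (row_mx p 0) 1 0 (rshift n i)) =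
     (fun z => c (lsubmx z) (rsubmx z) 1 0 (rshift n i)) \o (fun x => row_mx (ctl x) (row_mx p 0)).
    by apply/funext => x /=; rewrite row_mxKl row_mxKr.
  apply: (@Ck_comp _ _ _ _ W [set z : 'rV[R]_((n + 1) + (n + n)) | `|lsubmx z| < d /\ U (rsubmx z)]) => //.
  + apply: openI; last exact: open_rsubmx.
    apply: (@open_lsubmx R _ _ [set y | `|y| < d]).
    by rewrite -(_ : [set y | `|y - 0| < d] = [set y | `|y| < d]); [exact: ball_open'|apply/seteqP; split => y /=; rewrite subr0].
  + by move=> x Wx /=; rewrite row_mxKl row_mxKr; split => //; exact: ctld.
  + move=> j; case: (split_ordP j) => j' ->.
      case: (split_ordP j') => j'' ->.
        apply: (@Ck_ext _ _ _ _ (fun x => x 0 j'' - p 0 j'')) => //.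
          by move=> x _; rewrite row_mxEl /ctl row_mxEl rowBE.
        by apply: Ck_sub_fun => //; [exact: Ck_coord|exact: Ck_cst].
      apply: (@Ck_ext _ _ _ _ (cst t0)) => //; last exact: Ck_cst.
      by move=> x _; rewrite row_mxEl /ctl row_mxEr mxE.
    apply: (@Ck_ext _ _ _ _ (cst ((row_mx p 0 : 'rV[R]_(n + n)) 0 j'))) => //; last exact: Ck_cst.
    by move=> x _; rewrite row_mxEr.
  exact: CS.
move=> x Wx; have [c0 cV dc] := HC _ _ (ctld x Wx) Up.
set cx := c (ctl x) (row_mx p 0) in c0 cV dc.
have drho (s : R) i : 0 <= s <= 1 -> is_derive s (1 : R) (fun s => cx s 0 (lshift n i)) ((x - p) 0 i).
  move=> s1; have := dc s s1 (lshift n i).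
  by rewrite /ctl /A mul_row_block row_mxEl mulmx1 mulmx0 addr0.
have dw (s : R) i : 0 <= s <= 1 -> is_derive s (1 : R) (fun s => cx s 0 (rshift n i)) (t0 * partial i f (lsubmx (cx s))).
  move=> s1; have := dc s s1 (rshift n i).
  by rewrite /ctl /A mul_row_block row_mxEr mulmx0 add0r mxE big_ord1 !mxE.
have rho1 : lsubmx (cx 1) = x.
  apply/rowP => i; rewrite mxE.
  rewrite (const_speed (fun s s1 => drho s i s1)) c0 row_mxEl rowBE.
  by rewrite subrKC.
have df (s : R) : 0 <= s <= 1 -> is_derive s (1 : R) (fun s => f (lsubmx (cx s)))
    (\sum_i (x - p) 0 i * partial i f (lsubmx (cx s))).
  move=> s1; apply: (derivable_curve (F := fun s => lsubmx (cx s)) oV (cV s s1)); last exact: (Hf 1).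
  move=> i; have := drho s i s1.
  by have -> : (fun s => cx s 0 (lshift n i)) = (fun s => lsubmx (cx s) 0 i); [apply/funext => t; rewrite mxE|].
have dG (s : R) : 0 <= s <= 1 -> is_derive s (1 : R) (\sum_i (((x - p) 0 i * t0^-1) \*: (fun s => cx s 0 (rshift n i))))
    (\sum_i (x - p) 0 i * partial i f (lsubmx (cx s))).
  move=> s1; have -> : \sum_i (x - p) 0 i * partial i f (lsubmx (cx s)) =
      \sum_i (((x - p) 0 i * t0^-1) *: (t0 * partial i f (lsubmx (cx s)))).
    by apply: eq_bigr => i _; rewrite /GRing.scale /= mulrA -(mulrA _ t0^-1) mulVf// mulr1.
  by apply: is_derive_sum => i; apply: is_deriveZ; exact: dw.
have := same_deriv df dG; rewrite !fct_sumE rho1 c0 row_mxKl /=.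
have -> : \sum_(i < n) ((x - p) 0 i / t0) *: cx 1 0 (rshift n i) = \sum_i (x - p) 0 i * G i x.
  by apply: eq_bigr => i _; rewrite /G /GRing.scale /= mulrA.
rewrite [X in _ = _ - X -> _]big1 ?subr0; last by move=> i _; rewrite c0 row_mxEr (_ : (0 : 'rV[R]_n) 0 i = 0) ?scaler0// mxE.
by move=> <-; rewrite subrKC.
Qed.

(** The segment from h(y0) to x is lifted through the inverse Jacobian: along the solution of c' =
    (x - h(y0)) (Dh)^-1 from y0, the image h(c) has constant velocity x - h(y0), so the endpoint is
    a preimage of x, smooth in the control. *)
Lemma inverse_right n (h : 'rV[R]_n -> 'rV[R]_n) (V : set 'rV[R]_n) y0 : open V -> V y0 ->
  (forall j, Csmooth V (fun y => h y 0 j)) -> jac h y0 \in unitmx ->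
  exists (W : set 'rV[R]_n) (tau : 'rV[R]_n -> 'rV[R]_n), [/\ open W, W (h y0),
    forall j, Csmooth W (fun x => tau x 0 j), tau (h y0) = y0 &
    forall x, W x -> V (tau x) /\ h (tau x) = x].
Proof.
move=> oV Vy0 Hh uJ.
have CJ m : Ckmx m V (jac h).
  move=> i j; apply: (@Ck_ext _ _ _ _ (partial i (fun y => h y 0 j))) => //.
    by move=> x _; rewrite mxE.
  by apply: Ck_partial; exact: Hh.
pose V1 := V `&` [set y | jac h y \in unitmx].
have oV1 : open V1.
  rewrite openE => y [Vy uy]; rewrite /interior.
  have H1 := unitmx_near oV Vy (CJ 0%N) uy.
  have H2 : \forall z \near y, V z by exact: open_nbhs_nbhs.
  by near=> z; split; near: z.
pose A y := invmx (jac h y).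
have HA m : Ckmx m V1 A.
  apply: Ckmx_inv => //; first by move=> x [].
  by move=> i j; apply: Ck_sub (CJ m i j) => x [].
have [d [U [c [d0 oU Uy HC [CS _]]]]] := steering oV1 (conj Vy0 uJ) HA.
exists [set x | `|x - h y0| < d], (fun x => c (x - h y0) y0 1); split.
- exact: ball_open'.
- by rewrite /= subrr normr0.
- move=> j m.
  have h11 := unit_itv1.
  have -> : (fun x => c (x - h y0) y0 1 0 j) =
     (fun z => c (lsubmx z) (rsubmx z) 1 0 j) \o (fun x => row_mx (x - h y0) y0).
    by apply/funext => x /=; rewrite row_mxKl row_mxKr.
  apply: (@Ck_comp _ _ _ _ _ [set z : 'rV[R]_(n + n) | `|lsubmx z| < d /\ U (rsubmx z)]).
  + exact: ball_open'.
  + apply: openI; last exact: open_rsubmx.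
    apply: (@open_lsubmx R _ _ [set y | `|y| < d]).
    by rewrite -(_ : [set y | `|y - 0| < d] = [set y | `|y| < d]); [exact: ball_open'|apply/seteqP; split => y /=; rewrite subr0].
  + by move=> x Wx /=; rewrite row_mxKl row_mxKr; split.
  + move=> i; case: (split_ordP i) => i' ->.
      apply: (@Ck_ext _ _ _ _ (fun x => x 0 i' - h y0 0 i')); first exact: ball_open'.
        by move=> x _; rewrite row_mxEl rowBE.
      by apply: Ck_sub_fun; [exact: ball_open'|exact: Ck_coord|exact: Ck_cst].
    apply: (@Ck_ext _ _ _ _ (cst (y0 0 i'))); first exact: ball_open'.
      by move=> x _; rewrite row_mxEr.
    exact: Ck_cst.
  exact: CS.
- have [|c0 cV dc] := HC 0 y0 _ Uy; first by rewrite normr0.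
  rewrite subrr; have h11 := unit_itv1.
  have := has_deriv_mvt dc (lexx 0) _ h11; rewrite c0 mulr0 => H.
  apply/eqP; rewrite -subr_eq0 -normr_le0; apply: H => s _; by rewrite mul0mx normr0.
move=> x xd; have [c0 cV dc] := HC _ _ xd Uy.
have h11 := unit_itv1.
split; first by case: (cV 1 h11).
apply/rowP => j.
suff dh (s : R) : 0 <= s <= 1 -> is_derive s (1 : R) (fun s => h (c (x - h y0) y0 s) 0 j) ((x - h y0) 0 j).
  by rewrite (const_speed dh) c0 rowBE subrKC.
move=> s1.
have [Vc uc] := cV s s1.
have D := derivable_curve oV Vc (dc s s1) (Hh j 1%N).
have E : \sum_i ((x - h y0) *m A (c (x - h y0) y0 s)) 0 i * partial i (fun y => h y 0 j) (c (x - h y0) y0 s) =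
   (x - h y0) 0 j.
  have := mulmxKV uc (x - h y0) => /rowP /(_ j); rewrite [LHS]mxE => <-.
  by apply: eq_bigr => i _; rewrite [jac _ _ _ _]mxE.
by rewrite E in D.
Unshelve. all: by end_near. Qed.

(** If h a = h b, then (b - a) Dh(y0) is of second order in the size of the ball, while
    invertibility bounds |b - a| by its norm; on a small ball this gives |b - a| <= 3/4 |b - a|. *)
Lemma local_injective n (h : 'rV[R]_n -> 'rV[R]_n) (V : set 'rV[R]_n) y0 : open V -> V y0 ->
  (forall j, Csmooth V (fun y => h y 0 j)) -> jac h y0 \in unitmx ->
  exists U : set 'rV[R]_n, [/\ open U, U y0, U `<=` V &
    forall a b, U a -> U b -> h a = h b -> a = b].
Proof.
move=> oV Vy0 Hh uJ.
have [r r0 rV] := open_ball_in oV Vy0.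
pose K := [set y : 'rV[R]_n | `|y - y0| <= r / 2].
have r2 : r / 2 < r by rewrite ltr_pdivrMr// ltr_pMr// ltr1n.
have KV : K `<=` V by move=> y Ky; apply: rV; exact: le_lt_trans r2.
have cK : compact K.
  apply: bounded_closed_compact.
    exists (r / 2 + `|y0|); split; first by rewrite num_real.
    move=> t rt y Ky; apply: ltW; apply: le_lt_trans rt.
    by rewrite -[y](subrK y0); apply: (le_trans (ler_normD _ _)); rewrite lerD2r.
  apply: (@preimage_closed _ _ (fun y : 'rV[R]_n => `|y - y0|) [set t : R | t <= r / 2]); last exact: closed_le.
  move=> y _; apply: (@continuous_comp _ _ _ (fun y : 'rV[R]_n => y - y0) Num.norm); last exact: norm_continuous.
  apply: differentiable_continuous; apply: differentiableB; first exact: ex_diff.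
  exact: differentiable_cst.
have cvK : convex_set K.
  move=> a b t Ka Kb /andP[t0 t1]; rewrite /K /=.
  have -> : a + t *: (b - a) - y0 = (1 - t) *: (a - y0) + t *: (b - y0).
    by apply/rowP => i; rewrite !mxE; ring.
  apply: (le_trans (ler_normD _ _)).
  rewrite !normrZ (ger0_norm t0) ger0_norm ?subr_ge0//.
  apply: (@le_trans _ _ ((1 - t) * (r / 2) + t * (r / 2))); last by rewrite -mulrDl subrK mul1r.
  by apply: lerD; apply: ler_wpM2l => //; rewrite subr_ge0.
have H2 j : Ck 2 V (fun y => h y 0 j) by exact: Hh.
have [C C0 [HC1 HC2]] := jac_quad oV KV cK cvK H2.
have [C' C'0 HC'] := mulmx_bound (invmx (jac h y0)).
(* The quarter beats the factor 3 below, made of 2 from |b - a| <= 2 e and 1 from |a - y0| <= e. *)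
pose e := Num.min (r / 2) (4^-1 / (C' * C + 1)).
have CC : 0 < C' * C + 1 by rewrite ltr_wpDl// mulr_ge0.
have e0 : 0 < e by rewrite lt_min !divr_gt0// invr_gt0.
have er : e <= r / 2 by rewrite ge_min lexx.
have eC : C' * C * e <= 4^-1.
  have H : e <= 4^-1 / (C' * C + 1) by rewrite ge_min lexx orbT.
  apply: (le_trans (ler_wpM2l (mulr_ge0 C'0 C0) H)); rewrite mulrA ler_pdivrMr//.
  by rewrite mulrC ler_pM2l ?invr_gt0// lerDl.
clearbody e.
exists [set y | `|y - y0| < e]; split.
- exact: ball_open'.
- by rewrite /= subrr normr0.
- by move=> y ye; apply: KV; apply: ltW; exact: lt_le_trans er.
move=> a b ae be hab.
have Ka : K a by apply: ltW; exact: lt_le_trans er.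
have Kb : K b by apply: ltW; exact: lt_le_trans er.
have Ky : K y0 by rewrite /K /= subrr normr0 divr_ge0// ltW.
have E1 := HC2 a b Ka Kb; rewrite hab subrr sub0r normrN in E1.
have E2 := HC1 y0 a (b - a) Ky Ka.
have E3 : `|(b - a) *m jac h y0| <= C * `|b - a| ^+ 2 + C * `|a - y0| * `|b - a|.
  rewrite -[X in `|X|](subKr ((b - a) *m jac h a)).
  exact: (le_trans (ler_normB _ _) (lerD E1 E2)).
have E4 : `|b - a| <= C' * `|(b - a) *m jac h y0|.
  by have := HC' ((b - a) *m jac h y0); rewrite mulmxK.
have ba : `|b - a| <= 2 * e.
  rewrite -(subrKA y0); apply: (le_trans (ler_normD _ _)).
  rewrite [`|y0 - a|]distrC; have : `|b - y0| < e by []. have : `|a - y0| < e by [].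
  by move: `|b - y0| `|a - y0| => x y; lra.
have E5 : `|b - a| <= (C' * C * e) * 3 * `|b - a|.
  apply: (le_trans E4); apply: (le_trans (ler_wpM2l C'0 E3)).
  have ae' : `|a - y0| <= e by exact: ltW.
  have n0 : 0 <= `|b - a| by [].
  have q1 : `|b - a| ^+ 2 <= 2 * e * `|b - a| by rewrite expr2; exact: ler_wpM2r.
  have q2 : `|a - y0| * `|b - a| <= e * `|b - a| by exact: ler_wpM2r.
  have q3 := ler_wpM2l C0 q1; have q4 := ler_wpM2l C0 q2.
  have q5 : C * `|b - a| ^+ 2 + C * `|a - y0| * `|b - a| <= C * e * 3 * `|b - a|.
    rewrite -mulrA; apply: (le_trans (lerD q3 q4)).
    by rewrite le_eqVlt; apply/orP; left; apply/eqP; ring.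
  have := ler_wpM2l C'0 q5; by rewrite !mulrA.
apply/eqP; rewrite eq_sym -subr_eq0 -normr_le0.
have n0 : 0 <= `|b - a| by [].
have : (C' * C * e) * 3 * `|b - a| <= 4^-1 * 3 * `|b - a|.
  by apply: ler_wpM2r => //; apply: ler_wpM2r.
move: E5; move: (`|b - a|) (C' * C * e * 3 * _) => x y; lra.
Qed.

End Consequences.

(** * Foliations by commuting fields *)

Section Foliation.
Variable R : realType.

Lemma rowNE n (x : 'rV[R]_n) i : (- x) 0 i = - x 0 i.
Proof. by rewrite mxE. Qed.

Lemma mulmx_coord n k (X : 'M[R]_(n, k)) (x v : 'rV[R]_n) j :
  is_derive x v (fun y : 'rV[R]_n => (y *m X) 0 j) ((v *m X) 0 j).
Proof.
have -> : (fun y : 'rV[R]_n => (y *m X) 0 j) = \sum_i (X i j \*: (fun y : 'rV[R]_n => y 0 i)).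
  by apply/funext => y; rewrite mxE fct_sumE; apply: eq_bigr => i _; rewrite mulrC.
rewrite mxE.
have -> : \sum_j0 v 0 j0 * X j0 j = \sum_i X i j *: v 0 i.
  by apply: eq_bigr => i _; rewrite mulrC.
by apply: is_derive_sum => i; apply: is_deriveZ; exact: is_derive_coord.
Qed.

Lemma Ck_mulmx n k m (V : set 'rV[R]_n) (g : 'rV[R]_n -> 'rV[R]_k) p (X : 'M[R]_(k, p)) j :
  open V -> (forall i, Ck m V (fun y => g y 0 i)) -> Ck m V (fun y => (g y *m X) 0 j).
Proof.
move=> oV Hg; apply: (@Ck_ext _ _ _ _ (fun y => \sum_i X i j * g y 0 i)) => //.
  by move=> y _; rewrite mxE; apply: eq_bigr => i _; rewrite mulrC.
by apply: Ck_sum => // i _; apply: Ck_scale.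
Qed.

Lemma jac_mulmx n k (g : 'rV[R]_n -> 'rV[R]_n) (Y : 'M[R]_(n, k)) (V : set 'rV[R]_n) x v j :
  open V -> (forall i, Ck 1 V (fun y => g y 0 i)) -> V x ->
  is_derive x v (fun y => (g y *m Y) 0 j) ((v *m jac g x *m Y) 0 j).
Proof.
move=> oV Hg Vx.
have -> : (fun y => (g y *m Y) 0 j) = \sum_i (Y i j \*: (fun y => g y 0 i)).
  by apply/funext => y; rewrite mxE fct_sumE; apply: eq_bigr => i _; rewrite mulrC.
rewrite mxE.
have -> : \sum_i (v *m jac g x) 0 i * Y i j = \sum_i Y i j *: 'D_v (fun y => g y 0 i) x.
  by apply: eq_bigr => i _; rewrite (jacE _ _ oV Hg Vx) mulrC.
apply: is_derive_sum => i; apply: is_deriveZ; apply: derivableP.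
exact: (Ck_derivable (Hg i)).
Qed.

(* A family of commuting fields e *m A(x), in echelon form with respect to the
   coordinates (x - x0) *m X, foliates a neighbourhood U of x0; r retracts U
   onto the slice {(x - x0) *m X = 0} along the leaves, and g x is a path from
   x to r x inside the leaf. *)
Record foliated (k q N : nat) (A : 'rV[R]_N -> 'M[R]_(k, N)) (V : set 'rV[R]_N) x0
    (X : 'M[R]_(N, k)) (C : 'M[R]_(q, N)) (Y : 'M[R]_(N, q)) (rho : R)
    (U : set 'rV[R]_N) (r : 'rV[R]_N -> 'rV[R]_N) (g : 'rV[R]_N -> R -> 'rV[R]_N) : Prop :=
  Foliated {
  fo_rho : 0 < rho;
  fo_open : open U;
  fo_sub : U `<=` V;
  fo_smooth : forall j, Csmooth U (fun x => r x 0 j);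
  fo_slice : forall x, U x -> (r x - x0) *m X = 0 /\ `|r x - x0| < rho;
  fo_id : forall z, (z - x0) *m X = 0 -> `|z - x0| < rho -> U z /\ r z = z;
  fo_path0 : forall x, U x -> g x 0 = x;
  fo_path1 : forall x, U x -> g x 1 = r x;
  fo_path : forall x s, U x -> 0 <= s <= 1 -> U (g x s) /\ r (g x s) = r x;
  fo_pathD : forall x, U x -> has_deriv 1 (g x) (fun s => - ((x - x0) *m X) *m A (g x s));
  fo_leaf : forall x e j, U x -> is_derive x (e *m A x) (fun y => r y 0 j) 0;
  fo_trans : forall x, U x -> C *m jac r x *m Y \in unitmx }.

(** Since A X = 1, the field u A moves the leaf coordinates (x - x0) X with velocity u; taking u to
    be minus these coordinates carries x to the slice in unit time. Commutation gives this endpoint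
    zero derivative along the leaves. *)
Lemma foliation_exists k q N (A : 'rV[R]_N -> 'M[R]_(k, N)) (V : set 'rV[R]_N) x0
    (K : 'M[R]_(k, N)) (X : 'M[R]_(N, k)) (C : 'M[R]_(q, N)) (Y : 'M[R]_(N, q)) :
  open V -> V x0 -> (forall m, Ckmx m V A) -> C *m X = 0 -> C *m Y = 1%:M ->
  X *m K + Y *m C = 1%:M -> (forall x, V x -> A x *m X = 1%:M) ->
  (forall x (u e : 'rV[R]_k) j, V x ->
        'D_(u *m A x) (fun y => (e *m A y) 0 j) x =
        'D_(e *m A x) (fun y => (u *m A y) 0 j) x) ->
  exists rho U r g, foliated A V x0 X C Y rho U r g /\ U x0.
Proof.
move=> oV Vx0 HA CX CY XKYC AX comm.
(* shrink V to a ball on which A is bounded *)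
have [r0 r00 r0V] := open_ball_in oV Vx0.
pose Kc := [set y : 'rV[R]_N | `|y - x0| <= r0 / 2].
have r2 : r0 / 2 < r0 by rewrite ltr_pdivrMr// ltr_pMr// ltr1n.
have cK : compact Kc.
  apply: bounded_closed_compact.
    exists (r0 / 2 + `|x0|); split; first by rewrite num_real.
    move=> t rt y Ky; apply: ltW; apply: le_lt_trans rt.
    by rewrite -[y](subrK x0); apply: (le_trans (ler_normD _ _)); rewrite lerD2r.
  apply: (@preimage_closed _ _ (fun y : 'rV[R]_N => `|y - x0|) [set t : R | t <= r0 / 2]); last exact: closed_le.
  move=> y _; apply: (@continuous_comp _ _ _ (fun y : 'rV[R]_N => y - x0) Num.norm); last exact: norm_continuous.
  apply: differentiable_continuous; apply: differentiableB; first exact: ex_diff.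
  exact: differentiable_cst.
have [|B B0 HB] := @compact_bound_fin R N ('I_k * 'I_N)%type (fun ij x => A x ij.1 ij.2) Kc cK.
  move=> [i j] x Kx; apply: (Ck_cont (HA 0%N i j)); apply: r0V; exact: le_lt_trans r2.
pose V' := [set y : 'rV[R]_N | `|y - x0| < r0 / 2].
have oV' : open V' by exact: ball_open'.
have V'V : V' `<=` V by move=> y y2; apply: r0V; exact: lt_trans r2.
have V'0 : V' x0 by rewrite /V' /= subrr normr0 divr_gt0.
pose M := k%:R * B.
have M0 : 0 <= M by rewrite mulr_ge0.
have HM (u : 'rV[R]_k) x : V' x -> `|u *m A x| <= M * `|u|.
  move=> V'x; apply: rV_norm_le; first by rewrite mulr_ge0.
  move=> j; rewrite mxE; apply: (le_trans (ler_norm_sum _ _ _)).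
  apply: (@le_trans _ _ (\sum_(i < k) (B * `|u|))).
    apply: ler_sum => i _; rewrite normrM mulrC ler_pM//; last exact: norm_coord.
    by apply: (HB (i, j)); exact: ltW.
  by rewrite sumr_const card_ord -mulrA mulr_natl.
have HA' m : Ckmx m V' A by move=> i j; exact: Ck_sub (HA m i j).
have comm' x (u e : 'rV[R]_k) j : V' x ->
    'D_(u *m A x) (fun y => (e *m A y) 0 j) x = 'D_(e *m A x) (fun y => (u *m A y) 0 j) x.
  by move=> V'x; apply: comm; exact: V'V.
have [d [U1 [c [d0 oU1 U1x0 HC [CS HD]]]]] := steering oV' V'0 HA'.
have {}HD := HD comm'.
have [r1 r10 r1U] := open_ball_in oU1 U1x0.
pose xi x := (x - x0) *m X.
pose r x := c (- xi x) x 1.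
pose g x := c (- xi x) x.
have h11 := unit_itv1 R.
pose Z := [set x : 'rV[R]_N | `|x - x0| < r1 /\ `|xi x| < d].
have xiC m j : Ck m [set: 'rV[R]_N] (fun x => xi x 0 j).
  rewrite /xi; apply: (Ck_mulmx (g := fun x => x - x0)); first exact: openT.
  move=> i; apply: (@Ck_ext _ _ _ _ (fun x => x 0 i - x0 0 i)); first exact: openT.
    by move=> x _; rewrite rowBE.
  by apply: Ck_sub_fun; [exact: openT|exact: Ck_coord|exact: Ck_cst].
have xi_cont : continuous xi.
  by move=> x; apply: (rV_cvgP (FF := nbhs_filter x)) => j; exact: (Ck_cont (xiC 0%N j) I).
have oZ : open Z.
  apply: openI; first exact: ball_open'.
  apply: (@open_comp _ _ xi [set u | `|u| < d]); first by move=> x _; exact: xi_cont.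
  by rewrite -(_ : [set y | `|y - 0| < d] = [set y | `|y| < d]); [exact: ball_open'|apply/seteqP; split => y /=; rewrite subr0].
have Zok x : Z x -> [/\ g x 0 = x, forall s, 0 <= s <= 1 -> V' (g x s) &
    has_deriv 1 (g x) (fun s => - xi x *m A (g x s))].
  by move=> [xr xd]; apply: HC; [rewrite normrN|exact: r1U].
have S_map m : forall j, Ck m Z (fun x => (row_mx (- xi x) x) 0 j).
  move=> j; case: (split_ordP j) => j' ->.
    apply: (@Ck_ext _ _ _ _ (fun x => - xi x 0 j')) => //.
      by move=> x _; rewrite row_mxEl rowNE.
    by apply: Ck_opp => //; apply: Ck_sub (xiC m j').
  apply: (@Ck_ext _ _ _ _ (fun x => x 0 j')) => //; last exact: Ck_coord.
  by move=> x _; rewrite row_mxEr.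
pose W := [set z : 'rV[R]_(k + N) | `|lsubmx z| < d /\ U1 (rsubmx z)].
have oW : open W.
  apply: openI; last exact: open_rsubmx.
  apply: (@open_lsubmx R _ _ [set y | `|y| < d]).
  by rewrite -(_ : [set y | `|y - 0| < d] = [set y | `|y| < d]); [exact: ball_open'|apply/seteqP; split => y /=; rewrite subr0].
have ZW x : Z x -> W (row_mx (- xi x) x).
  by move=> [xr xd]; split; rewrite ?row_mxKl ?row_mxKr ?normrN//; exact: r1U.
have rE j : (fun x => r x 0 j) = (fun z => c (lsubmx z) (rsubmx z) 1 0 j) \o (fun x => row_mx (- xi x) x).
  by apply/funext => x /=; rewrite row_mxKl row_mxKr.
have rC m j : Ck m Z (fun x => r x 0 j).
  by rewrite rE; exact: (Ck_comp oZ oW ZW (S_map m) (CS m 1 j h11)).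
have rleaf x e j : Z x -> is_derive x (e *m A x) (fun y => r y 0 j) 0.
  move=> Zx; rewrite rE.
  have := derive_comp_partial (e *m A x) oZ oW ZW (S_map 1%N) (CS 1%N 1 j h11) Zx.
  move=> H; apply: is_derive_eq H _.
  have [xr xd] := Zx; have V'x : V' x.
    have [gx0 H _] := Zok x Zx; rewrite -gx0; apply: H.
    by rewrite lexx ler01.
  have [_ E0] := HD (- xi x) x e j ltac:(by rewrite normrN) (r1U _ xr).
  rewrite (derive_partial _ oW (CS 1%N 1 j h11)) in E0; last exact: ZW.
  rewrite -[RHS]E0.
  apply: eq_bigr => i _; rewrite mulrC; congr (_ * _).
  case: (split_ordP i) => l ->.
    rewrite row_mxEl.
    have -> : (fun y => row_mx (- xi y) y 0 (lshift N l)) = - (fun y => (y *m X) 0 l) + cst ((x0 *m X) 0 l).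
      by apply/funext => y; rewrite row_mxEl rowNE /xi mulmxBl rowBE opprB [LHS]addrC.
    have [_ ->] := is_deriveD (is_deriveN (mulmx_coord X x (e *m A x) l)) (is_derive_cst ((x0 *m X) 0 l) x (e *m A x)).
    by rewrite addr0 -mulmxA AX ?mulmx1 ?rowNE//; exact: V'V.
  rewrite row_mxEr.
  have -> : (fun y => row_mx (- xi y) y 0 (rshift k l)) = (fun y => y 0 l).
    by apply/funext => y; rewrite row_mxEr.
  by have [_ ->] := is_derive_coord x (e *m A x) l.
have gxi x s : Z x -> 0 <= s <= 1 -> xi (g x s) = (1 - s) *: xi x.
  move=> Zx /andP[s0 s1]; have [g0 gV dg] := Zok x Zx; apply/rowP => j.
  pose hh t := xi (g x t) 0 j + t * xi x 0 j.
  suff : hh s = hh 0.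
    by rewrite /hh g0 mul0r addr0 rowZE mulrBl mul1r => /eqP; rewrite -subr_eq0 => H; apply/eqP; rewrite -subr_eq0 opprB addrA.
  apply: deriv0_const => // t /andP[t0 ts].
  have t1 : 0 <= t <= 1 by rewrite t0 (le_trans ts).
  have Dg := derivable_curve oV' (gV t t1) (dg t t1) (Ck_sub (subsetT V') (xiC 1%N j)).
  rewrite -(derive_partial _ oV' (Ck_sub (subsetT V') (xiC 1%N j)) (gV t t1)) in Dg.
  have E : 'D_(- xi x *m A (g x t)) (fun y => xi y 0 j) (g x t) = - xi x 0 j.
    have -> : (fun y => xi y 0 j) = (fun y => (y *m X) 0 j) + cst (- (x0 *m X) 0 j).
      by apply/funext => y; rewrite /xi mulmxBl rowBE.
    have [_ ->] := is_deriveD (mulmx_coord X (g x t) (- xi x *m A (g x t)) j) (is_derive_cst (- (x0 *m X) 0 j) (g x t) (- xi x *m A (g x t))).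
    by rewrite addr0 -mulmxA AX ?mulmx1 ?rowNE//; apply: V'V; exact: gV.
  rewrite E in Dg.
  have := is_deriveD Dg (is_deriveZ (xi x 0 j) (is_derive_id t (1 : R))).
  rewrite /GRing.scale /= mulr1 addNr.
  have -> // : ((fun y => xi y 0 j) \o g x) + (fun y : R => xi x 0 j * y) = hh.
  by apply/funext => y; rewrite /hh mulrC.
have gmove x s : Z x -> 0 <= s <= 1 -> `|g x s - r x| <= M * `|xi x|.
  move=> Zx /andP[s0 s1]; have [g0 gV dg] := Zok x Zx.
  apply: rV_norm_le; first by rewrite mulr_ge0.
  move=> j; rewrite rowBE distrC.
  have [||t ts ->] := @MVT_segment R (fun s => g x s 0 j) (fun s => (- xi x *m A (g x s)) 0 j) s 1 s1.
  - move=> t; rewrite in_itv /= => /andP[t0 t1]; apply: dg.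
    by rewrite (ltW t1) (ltW (le_lt_trans s0 t0)).
  - apply: derivable_within_continuous => t; rewrite in_itv /= => /andP[t0 t1].
    by have [] := dg t ltac:(by rewrite t1 (le_trans s0)) j.
  move: ts; rewrite in_itv /= => /andP[t0 t1].
  have t01 : 0 <= t <= 1 by rewrite t1 (le_trans s0).
  rewrite normrM -[leRHS]mulr1; apply: ler_pM => //.
    by apply: (le_trans (norm_coord _ _)); rewrite -[`|xi x|]normrN; apply: HM; exact: gV.
  rewrite ger0_norm ?subr_ge0//; lra.
have rg_const x : Z x -> (forall s, 0 <= s <= 1 -> Z (g x s)) -> forall s, 0 <= s <= 1 -> r (g x s) = r x.
  move=> Zx Zg s /andP[s0 s1]; have [g0 gV dg] := Zok x Zx; apply/rowP => j.
  have : r (g x s) 0 j = r (g x 0) 0 j; last by rewrite g0.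
  apply: (@deriv0_const R (fun t => r (g x t) 0 j)) => // t /andP[t0 ts].
  have t1 : 0 <= t <= 1 by rewrite t0 (le_trans ts).
  have Dg := derivable_curve oZ (Zg t t1) (dg t t1) (rC 1%N j).
  rewrite -(derive_partial _ oZ (rC 1%N j) (Zg t t1)) in Dg.
  by have [_ E] := rleaf (g x t) (- xi x) j (Zg t t1); rewrite E in Dg.
have Zx0 : Z x0 by split; rewrite /= ?/xi subrr ?mul0mx normr0.
have rid z : Z z -> xi z = 0 -> r z = z.
  move=> Zz xz; have [g0 gV dg] := Zok z Zz.
  have := has_deriv_mvt dg (lexx 0) _ h11; rewrite g0 mulr0 => H.
  apply/eqP; rewrite -subr_eq0 -normr_le0; apply: H => s _; by rewrite xz oppr0 mul0mx normr0.
have rxi x : Z x -> xi (r x) = 0.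
  by move=> Zx; rewrite -[r x]/(g x 1) gxi// subrr scale0r.
have jC m : Ckmx m Z (fun x => C *m jac r x *m Y).
  apply: Ckmx_mul => //; last exact: Ckmx_cst.
  apply: Ckmx_mul => //; first exact: Ckmx_cst.
  move=> i j; apply: (@Ck_ext _ _ _ _ (partial i (fun y => r y 0 j))) => //.
    by move=> x _; rewrite mxE.
  by apply: Ck_partial; exact: rC.
(* The rows of C are tangent to the slice, on which r is the identity; so the matrix is C Y = 1 at
   [x0] and stays invertible nearby. *)
have j0 : C *m jac r x0 *m Y = 1%:M.
  rewrite -CY; congr (_ *m _); apply/row_matrixP => i; rewrite row_mul.
  set b := row i C; have bX : b *m X = 0 by rewrite -row_mul CX row0.
  apply/rowP => j; rewrite (jacE _ _ oZ (rC 1%N) Zx0).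
  have dr := @is_derive_ray R _ (fun y => r y 0 j) x0 b 0.
  rewrite scale0r addr0 in dr; have [_ <-] := dr (Ck_derivable (rC 1%N j) Zx0).
  have dl := @is_derive_ray R _ (fun y : 'rV[R]_N => y 0 j) x0 b 0.
  rewrite scale0r addr0 in dl.
  have [dc Ec] := is_derive_coord x0 b j.
  rewrite -Ec; have [_ <-] := dl dc.
  apply: near_eq_derive; near=> s; apply: (f_equal (fun v : 'rV[R]_N => v 0 j)); apply: rid.
    near: s.
    have : (fun s : R => x0 + s *: b) @ 0 --> x0 + (0 : R) *: b.
      apply: cvgD; first exact: cvg_cst.
      by apply: cvgZr_tmp; exact: cvg_id.
    by apply; rewrite scale0r addr0; exact: open_nbhs_nbhs.
  by rewrite /xi addrC addKr -scalemxAl bX scaler0.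
have [r3 r30 r3U] : exists2 r3 : R, 0 < r3 & forall y, `|y - x0| < r3 -> C *m jac r y *m Y \in unitmx.
  have : \forall y \near x0, C *m jac r y *m Y \in unitmx.
    by apply: (unitmx_near oZ Zx0 (jC 0%N)); rewrite j0 unitmx1.
  by move=> /nbhs_normP[e /= e0 eU]; exists e => // y; rewrite distrC; exact: eU.
pose rho := Num.min (Num.min (r1 / 2) (r3 / 2)) (r0 / 4).
have rho0 : 0 < rho by rewrite !lt_min !divr_gt0.
have rr1 : 2 * rho <= r1.
  have : rho <= r1 / 2 by rewrite /rho !ge_min lexx. lra.
have rr3 : 2 * rho <= r3.
  have : rho <= r3 / 2 by rewrite /rho !ge_min lexx orbT. lra.
have rr0 : 2 * rho <= r0 / 2.
  have : rho <= r0 / 4 by rewrite /rho !ge_min lexx !orbT. lra.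
clearbody rho.
(* A leaf path moves by at most M |xi x|, so this bound keeps the whole path of x within 2 rho of
   [x0]. *)
pose eps := Num.min d (rho / (M + 1)).
have M1 : 0 < M + 1 by rewrite ltr_wpDl.
have eps0 : 0 < eps by rewrite lt_min d0 divr_gt0.
have epsd : eps <= d by rewrite ge_min lexx.
have epsM t : t < eps -> 0 <= t -> M * t < rho.
  move=> te t0; have : t < rho / (M + 1) by apply: (lt_le_trans te); rewrite ge_min lexx orbT.
  rewrite ltr_pdivlMr// mulrDr mulr1 mulrC => H; apply: le_lt_trans H; lra.
clearbody eps.
pose Z0 := [set x : 'rV[R]_N | `|x - x0| < 2 * rho /\ `|xi x| < eps].
have Z0Z : Z0 `<=` Z.
  by move=> x [xr xe]; split; [exact: lt_le_trans rr1|exact: lt_le_trans epsd].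
have oZ0 : open Z0.
  apply: openI; first exact: ball_open'.
  apply: (@open_comp _ _ xi [set u | `|u| < eps]); first by move=> x _; exact: xi_cont.
  by rewrite -(_ : [set y | `|y - 0| < eps] = [set y | `|y| < eps]); [exact: ball_open'|apply/seteqP; split => y /=; rewrite subr0].
(* The condition on r x, which is constant along the paths, makes [U] stable under them. *)
pose U := [set x | Z0 x /\ `|r x - x0| < rho].
have oU : open U.
  rewrite openE => x [Z0x rx]; rewrite /interior.
  have rcont : {for x, continuous r}.
    apply: (rV_cvgP (FF := nbhs_filter x)) => j; exact: (Ck_cont (rC 0%N j) (Z0Z _ Z0x)).
  have H1 : \forall y \near x, Z0 y by exact: open_nbhs_nbhs.
  have H2 : \forall y \near x, `|r y - x0| < rho.
    apply: (rcont [set y : 'rV[R]_N | `|y - x0| < rho]).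
    by apply: open_nbhs_nbhs; split => //; exact: ball_open'.
  by near=> y; split; near: y.
have UZ x : U x -> Z x by move=> [/Z0Z].
have pathZ0 x s : U x -> 0 <= s <= 1 -> Z0 (g x s).
  move=> Ux s1; have Zx := UZ _ Ux; have [[xr xe] rx] := Ux; split.
    rewrite -(subrKA (r x)); apply: (le_lt_trans (ler_normD _ _)).
    have := gmove x s Zx s1; have := epsM _ xe (normr_ge0 _).
    by move: rx; move: `|r x - x0| `|g x s - r x| (M * _) => a b e; lra.
  rewrite gxi// normrZ; apply: le_lt_trans xe; apply: ler_piMl => //.
  by have /andP[s0 s1'] := s1; rewrite ger0_norm ?subr_ge0// gerBl.
have rg x s : U x -> 0 <= s <= 1 -> r (g x s) = r x.
  move=> Ux; apply: rg_const; first exact: UZ.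
  by move=> t t1; apply: Z0Z; exact: pathZ0.
exists rho, U, r, g; split; last first.
  split; first by split; rewrite /= ?/xi subrr ?mul0mx normr0// mulr_gt0.
  by rewrite rid ?subrr ?normr0 ?/xi ?subrr ?mul0mx.
split => //.
- move=> x Ux; apply: V'V; have [[xr _] _] := Ux; exact: lt_le_trans rr0.
- by move=> j m; apply: Ck_sub (rC m j) => x /UZ.
- by move=> x Ux; split; [exact: rxi (UZ _ Ux)|case: Ux].
- move=> z xz zr; have Z0z : Z0 z.
    split => /=; last by rewrite /xi xz normr0.
    by apply: (lt_trans zr); lra.
  have rz := rid z (Z0Z _ Z0z) xz.
  by split => //; split => //; rewrite rz.
- by move=> x /UZ /Zok[].
- move=> x s Ux s1; have rgs := rg x s Ux s1; split => //; split; first exact: pathZ0.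
  by rewrite rgs; case: Ux.
- by move=> x /UZ /Zok[].
- by move=> x e j /UZ; exact: rleaf.
- move=> x [[xr _] _]; apply: r3U; exact: lt_le_trans rr3.
Unshelve. all: by end_near. Qed.

End Foliation.

(** * Charts and tangent vectors *)

Section Charts.
Variables (R : realType) (N : nat) (M : manifold R N).
Implicit Types (c : chart R N M) (f g : M -> R) (p q : M).

Lemma open_chart_preimage c (V : set 'rV[R]_N) : open V ->
  open [set q | cdom c q /\ V (cfun c q)].
Proof.
move=> oV; rewrite openE => q [cq Vq]; rewrite /interior.
have h1 : \forall z \near q, cdom c z
  by apply: open_nbhs_nbhs; split => //; exact: cdom_open.
have h2 : \forall z \near q, V (cfun c z)
  by apply: (cfun_cont cq); apply: open_nbhs_nbhs.
by near=> z; split; near: z.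
Unshelve. all: by end_near. Qed.

(** Transition maps are smooth, so checking one chart at p is enough. *)
Lemma smooth_at_chart c p f (V : set 'rV[R]_N) : atlas c -> cdom c p -> open V ->
  V (cfun c p) -> Csmooth V (f \o cinv c) -> smooth_at f p.
Proof.
move=> ac cp oV Vp Hf.
pose U := [set q | cdom c q /\ V (cfun c q)].
have oU : open U by exact: open_chart_preimage.
exists U; split => // c' ac' k.
have oW := open_chart_img (c := c') oU.
apply: (@Ck_ext _ _ _ _ ((f \o cinv c) \o (fun y => cfun c (cinv c' y)))) => //.
  by move=> y [_ [cy _]] /=; rewrite cfunK.
apply: (@Ck_comp _ _ _ _ _ V) => //; first by move=> y [_ []].
move=> i; apply: Ck_sub (atlas_smooth ac' ac i k) => y [cy [cy' _]].
by split.
Qed.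

Lemma smooth_at_inv c p f : atlas c -> cdom c p -> smooth_at f p ->
  exists V, [/\ open V, V (cfun c p), V `<=` ccod c & Csmooth V (f \o cinv c)].
Proof.
move=> ac cp [U [oU Up Hf]].
exists [set y | ccod c y /\ U (cinv c y)]; split.
- exact: open_chart_img.
- by split; [exact: cfun_cod|rewrite cfunK].
- by move=> y [].
- exact: Hf.
Qed.

Lemma smooth_at_cont p f : smooth_at f p -> {for p, continuous f}.
Proof.
move=> sf; have [c ac cp] := atlas_cover p.
have [V [oV Vp Vc Hf]] := smooth_at_inv ac cp sf.
have cf : {for p, continuous ((f \o cinv c) \o cfun c)}.
  apply: continuous_comp; first exact: cfun_cont.
  exact: (Ck_cont (Hf 0%N) Vp).
have E : \forall q \near p, (f \o cinv c \o cfun c) q = f q.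
  near=> q; rewrite /= cfunK//; near: q.
  by apply: open_nbhs_nbhs; split => //; exact: cdom_open.
rewrite /prop_for /continuous_at -(nbhs_singleton E).
exact: cvg_trans (near_eq_cvg E) cf.
Unshelve. all: by end_near. Qed.

Definition coord c i : M -> R := fun q => cfun c q 0 i.

Lemma smooth_coord c i q : atlas c -> cdom c q -> smooth_at (coord c i) q.
Proof.
move=> ac cq; apply: (smooth_at_chart ac cq (ccod_open (c := c)) (cfun_cod cq)) => k.
apply: (@Ck_ext _ _ _ _ (fun y => y 0 i)); first exact: ccod_open.
  by move=> y cy; rewrite /coord /= cinvK.
exact: Ck_coord.
Qed.

Lemma smooth_cst (a : R) q : smooth_at (fun=> a) q.
Proof.
have [c ac cq] := atlas_cover q.
apply: (smooth_at_chart ac cq (ccod_open (c := c)) (cfun_cod cq)) => k.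
exact: Ck_cst.
Qed.

Lemma smooth_add f g q : smooth_at f q -> smooth_at g q -> smooth_at (fun x => f x + g x) q.
Proof.
move=> sf sg; apply: smooth_ext (smooth_lin 1 sf sg).
by near=> x; rewrite mul1r.
Unshelve. all: by end_near. Qed.

Lemma smooth_scale (a : R) f q : smooth_at f q -> smooth_at (fun x => a * f x) q.
Proof. by move=> sf; apply: smooth_mul => //; exact: smooth_cst. Qed.

Lemma smooth_opp f q : smooth_at f q -> smooth_at (fun x => - f x) q.
Proof.
move=> sf; apply: smooth_ext (smooth_scale (-1) sf); near=> x; by rewrite mulN1r.
Unshelve. all: by end_near. Qed.

Lemma smooth_sub f g q : smooth_at f q -> smooth_at g q -> smooth_at (fun x => f x - g x) q.
Proof. by move=> sf sg; apply: smooth_add => //; exact: smooth_opp. Qed.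

Lemma smooth_sum (I : Type) (r : seq I) (P : pred I) (F : I -> M -> R) q :
  (forall i, P i -> smooth_at (F i) q) -> smooth_at (fun x => \sum_(i <- r | P i) F i x) q.
Proof.
move=> HF; elim: r => [|i r IH].
  have -> : (fun x => \sum_(i <- [::] | P i) F i x) = (fun=> 0).
    by apply/funext => x; rewrite big_nil.
  exact: smooth_cst.
case Pi : (P i).
  have -> : (fun x => \sum_(i <- i :: r | P i) F i x) = (fun x => F i x + \sum_(i <- r | P i) F i x).
    by apply/funext => x; rewrite big_cons Pi.
  by apply: smooth_add => //; exact: HF.
have -> // : (fun x => \sum_(i <- i :: r | P i) F i x) = (fun x => \sum_(i <- r | P i) F i x).
by apply/funext => x; rewrite big_cons Pi.
Qed.

Lemma smooth_prod (I : Type) (r : seq I) (P : pred I) (F : I -> M -> R) q :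
  (forall i, P i -> smooth_at (F i) q) -> smooth_at (fun x => \prod_(i <- r | P i) F i x) q.
Proof.
move=> HF; elim: r => [|i r IH].
  have -> : (fun x => \prod_(i <- [::] | P i) F i x) = (fun=> 1).
    by apply/funext => x; rewrite big_nil.
  exact: smooth_cst.
case Pi : (P i).
  have -> : (fun x => \prod_(i <- i :: r | P i) F i x) = (fun x => F i x * \prod_(i <- r | P i) F i x).
    by apply/funext => x; rewrite big_cons Pi.
  by apply: smooth_mul => //; exact: HF.
have -> // : (fun x => \prod_(i <- i :: r | P i) F i x) = (fun x => \prod_(i <- r | P i) F i x).
by apply/funext => x; rewrite big_cons Pi.
Qed.

Lemma smooth_inv f q : smooth_at f q -> f q != 0 -> smooth_at (fun x => (f x)^-1) q.
Proof.
move=> sf fq; have [c ac cq] := atlas_cover q.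
have [V [oV Vp Vc Hf]] := smooth_at_inv ac cq sf.
pose V' := V `&` [set y | f (cinv c y) != 0].
have oV' : open V'.
  rewrite openE => y [Vy fy]; rewrite /interior.
  have H1 : \forall z \near y, V z by exact: open_nbhs_nbhs.
  have H2 : \forall z \near y, (f \o cinv c) z != 0.
    by apply: cvgr_neq0 (Ck_cont (Hf 0%N) Vy) _.
  by near=> z; split; near: z.
apply: (smooth_at_chart ac cq oV').
  by split => //=; rewrite cfunK.
move=> k; apply: (@Ck_inv _ _ _ _ (f \o cinv c)) => //; first by move=> x [].
by apply: Ck_sub (Hf k) => x [].
Unshelve. all: by end_near. Qed.

Lemma smooth_comp n (F : M -> 'rV[R]_n) (h : 'rV[R]_n -> R) (W : set 'rV[R]_n) q :
  (forall i, smooth_at (fun x => F x 0 i) q) -> open W -> W (F q) -> Csmooth W h ->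
  smooth_at (h \o F) q.
Proof.
move=> sF oW Wq Hh; have [c ac cq] := atlas_cover q.
have /choice[V HV] : forall i, exists V, [/\ open V, V (cfun c q), V `<=` ccod c &
    Csmooth V ((fun x => F x 0 i) \o cinv c)].
  by move=> i; exact: smooth_at_inv.
have cF y : (forall i, V i y) -> {for y, continuous (F \o cinv c)}.
  move=> Vy; apply: (rV_cvgP (FF := nbhs_filter y)) => i.
  have [_ _ _ H] := HV i; exact: (Ck_cont (H 0%N) (Vy i)).
pose V' := [set y | ccod c y /\ forall i, V i y] `&` [set y | W (F (cinv c y))].
have oV' : open V'.
  rewrite openE => y [[cy Vy] Wy]; rewrite /interior.
  have H0 : \forall z \near y, ccod c z.
    by apply: open_nbhs_nbhs; split => //; exact: ccod_open.
  have H1 : \forall z \near y, forall i, V i z.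
    apply: (@filter_forall _ _ V _ (nbhs_filter y)) => i.
    by apply: open_nbhs_nbhs; split => //; case: (HV i).
  have H2 : \forall z \near y, W ((F \o cinv c) z).
    by apply: (cF y Vy); exact: open_nbhs_nbhs.
  by near=> z; split; [split|]; near: z.
apply: (smooth_at_chart ac cq oV').
  split; last by rewrite /= cfunK.
  by split; [exact: cfun_cod|move=> i; case: (HV i)].
move=> k; apply: (@Ck_comp _ _ _ _ _ W (F \o cinv c) h) => //.
  by move=> y [].
move=> i; have [_ _ _ H] := HV i; apply: Ck_sub (H k) => y [[_ +] _]; exact.
Unshelve. all: by end_near. Qed.

End Charts.

Section Tangents.
Variables (R : realType) (N : nat) (M : manifold R N).
Implicit Types (c : chart R N M) (f g : M -> R) (p q : M).

Lemma tangent_ext p (v w : tangent p) :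
  (forall f, smooth_at f p -> v f = w f) -> v = w.
Proof.
move=> H; apply: val_inj; apply/funext => f.
have [/H//|nf] := pselect (smooth_at f p).
by have [v0 _ _ _] := tangentP v; have [w0 _ _ _] := tangentP w; rewrite /= v0// w0.
Qed.

Lemma tangentDE p (v w : tangent p) f : (v + w) f = v f + w f.
Proof. by []. Qed.

Lemma tangentZE p (a : R) (v : tangent p) f : (a *: v) f = a * v f.
Proof. by []. Qed.

Lemma tangentNE p (v : tangent p) f : (- v) f = - v f.
Proof. by []. Qed.

Lemma tangent0E p f : (0 : tangent p) f = 0.
Proof. by []. Qed.

Lemma tangent_sumE p (I : Type) (r : seq I) (P : pred I) (F : I -> tangent p) f :
  (\sum_(i <- r | P i) F i) f = \sum_(i <- r | P i) F i f.
Proof. by elim/big_rec2 : _ => // i y1 y2 _ <-. Qed.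

Lemma tangent_near p (v : tangent p) f g : smooth_at f p ->
  (\forall q \near p, f q = g q) -> v f = v g.
Proof. by have [_ l _ _] := tangentP v; exact: l. Qed.

Lemma tangent_lin p (v : tangent p) (a : R) f g : smooth_at f p -> smooth_at g p ->
  v (fun q => a * f q + g q) = a * v f + v g.
Proof. by have [_ _ l _] := tangentP v; exact: l. Qed.

Lemma tangent_mul p (v : tangent p) f g : smooth_at f p -> smooth_at g p ->
  v (fun q => f q * g q) = f p * v g + g p * v f.
Proof. by have [_ _ _ l] := tangentP v; exact: l. Qed.

Lemma tangent_add p (v : tangent p) f g : smooth_at f p -> smooth_at g p ->
  v (fun q => f q + g q) = v f + v g.
Proof.
move=> sf sg; rewrite -[v f]mul1r -tangent_lin//; congr (Defs.tval v _).
by apply/funext => x; rewrite mul1r.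
Qed.

Lemma tangent_cst p (v : tangent p) (a : R) : v (fun=> a) = 0.
Proof.
have s1 := smooth_cst 1 p.
have v1 : v (fun=> 1) = 0.
  have := tangent_mul v s1 s1; rewrite !mul1r => /eqP.
  by rewrite -subr_eq0 opprD addrA subrr sub0r oppr_eq0 => /eqP.
have := tangent_lin v a s1 (smooth_cst 0 p).
have -> : (fun q : M => a * (1 : R) + 0) = (fun=> a).
  by apply/funext => x; rewrite mulr1 addr0.
have v0 : v (fun=> 0) = 0.
  have := tangent_add v (smooth_cst 0 p) (smooth_cst 0 p).
  rewrite (_ : (fun=> 0 + 0) = (fun=> 0)); last by apply/funext => x; rewrite addr0.
  by move=> /eqP; rewrite -subr_eq0 opprD addrA subrr sub0r oppr_eq0 => /eqP.
by rewrite v1 v0 mulr0 addr0.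
Qed.

Lemma tangent_scale p (v : tangent p) (a : R) f : smooth_at f p ->
  v (fun q => a * f q) = a * v f.
Proof.
move=> sf; rewrite tangent_mul//; last exact: smooth_cst.
by rewrite tangent_cst mulr0 addr0.
Qed.

Lemma tangent_opp p (v : tangent p) f : smooth_at f p -> v (fun q => - f q) = - v f.
Proof.
move=> sf; rewrite -mulN1r -tangent_scale//; congr (Defs.tval v _).
by apply/funext => x; rewrite mulN1r.
Qed.

Lemma tangent_sub p (v : tangent p) f g : smooth_at f p -> smooth_at g p ->
  v (fun q => f q - g q) = v f - v g.
Proof.
by move=> sf sg; rewrite tangent_add ?tangent_opp//; exact: smooth_opp.
Qed.

Lemma tangent_sum p (v : tangent p) (I : Type) (r : seq I) (P : pred I) (F : I -> M -> R) :
  (forall i, P i -> smooth_at (F i) p) ->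
  v (fun x => \sum_(i <- r | P i) F i x) = \sum_(i <- r | P i) v (F i).
Proof.
move=> HF; elim: r => [|i r IH].
  rewrite big_nil -[RHS](tangent_cst v 0); congr (Defs.tval v _).
  by apply/funext => x; rewrite big_nil.
rewrite big_cons; case Pi : (P i).
  rewrite -IH -tangent_add; [|exact: HF|exact: smooth_sum].
  by congr (Defs.tval v _); apply/funext => x; rewrite big_cons Pi.
by rewrite -IH; congr (Defs.tval v _); apply/funext => x; rewrite big_cons Pi.
Qed.

Definition tcoord c p (v : tangent p) : 'rV[R]_N := \row_i v (coord c i).

Lemma tcoord_linear c p : linear (@tcoord c p).
Proof. by move=> a u v; apply/rowP => i; rewrite !mxE. Qed.

HB.instance Definition _ c p :=
  GRing.isLinear.Build R (tangent p) 'rV[R]_N _ (@tcoord c p) (@tcoord_linear c p).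

(* By Hadamard's lemma, f differs from its value at p by a combination of the coordinates. *)
Lemma tangent_expand c p (v : tangent p) f : atlas c -> cdom c p -> smooth_at f p ->
  v f = \sum_i tcoord c v 0 i * partial i (f \o cinv c) (cfun c p).
Proof.
move=> ac cp sf; have [V [oV Vp Vc Hf]] := smooth_at_inv ac cp sf.
have [W [G [oW Wp WV HG EG]]] := hadamard oV Vp Hf.
set y0 := cfun c p in Vp Wp EG *.
pose F i q := (coord c i q - y0 0 i) * G i (cfun c q).
have sG i : smooth_at (fun q => G i (cfun c q)) p.
  apply: (smooth_at_chart ac cp oW Wp) => k.
  by apply: Ck_ext (HG i k) => // y Wy /=; rewrite cinvK//; exact: Vc (WV _ Wy).
have sc i : smooth_at (fun q => coord c i q - y0 0 i) p.
  by apply: smooth_sub; [exact: smooth_coord|exact: smooth_cst].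
have sF i : smooth_at (F i) p by exact: smooth_mul.
have Ef : \forall q \near p, f q = f p + \sum_i F i q.
  have H : \forall q \near p, [set q | cdom c q /\ W (cfun c q)] q.
    by apply: open_nbhs_nbhs; split => //; exact: open_chart_preimage.
  apply: filterS H => q [cq Wq].
  have := EG _ Wq; rewrite /= cfunK// cfunK// => ->; congr (_ + _).
  by apply: eq_bigr => i _; rewrite rowBE.
rewrite (tangent_near v sf Ef) tangent_add; [|exact: smooth_cst|exact: smooth_sum].
rewrite tangent_cst add0r tangent_sum//; apply: eq_bigr => i _.
rewrite tangent_mul// {1}/coord subrr mul0r add0r tangent_sub; [|exact: smooth_coord|exact: smooth_cst].
rewrite tangent_cst subr0 mxE mulrC; congr (_ * _).
have D j : is_derive y0 (delta_mx 0 i) ((fun y : 'rV[R]_N => y 0 j - y0 0 j) * G j)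
    ((y0 0 j - y0 0 j) *: partial i (G j) y0 + G j y0 *: ((delta_mx 0 i : 'rV[R]_N) 0 j - 0)).
  apply: is_deriveM; last by apply: derivableP; exact: (Ck_derivable (HG j 1%N)).
  exact: (is_deriveB (is_derive_coord y0 (delta_mx 0 i) j) (is_derive_cst (y0 0 j) y0 (delta_mx 0 i))).
have [_ Es] := is_derive_sum D.
have E2 : \forall y \near y0, (f \o cinv c) y = (cst (f p) + \sum_j ((fun y : 'rV[R]_N => y 0 j - y0 0 j) * G j)) y.
  near=> y; have Wy : W y by near: y; exact: open_nbhs_nbhs.
  rewrite (EG _ Wy) /= /y0 cfunK// -[RHS]/(f p + (\sum_j ((fun y : 'rV[R]_N => y 0 j - y0 0 j) * G j)) y).
  by congr (_ + _); rewrite fct_sumE; apply: eq_bigr => j _; rewrite rowBE.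
rewrite /partial (near_eq_derive _ E2) deriveD; first last.
- by have [] := is_derive_sum D.
- exact: derivable_cst.
rewrite derive_cst add0r Es (bigD1 i)//= big1.
  by rewrite subrr scale0r add0r addr0 mxE !eqxx subr0 /GRing.scale /= mulr1.
move=> j ji; rewrite subrr scale0r add0r mxE (negbTE ji) andbF subr0.
by rewrite scaler0.
Unshelve. all: by end_near. Qed.

Lemma tcoord_inj c p : atlas c -> cdom c p -> injective (@tcoord c p).
Proof.
move=> ac cp v w vw; apply: tangent_ext => f sf.
by rewrite (tangent_expand v ac cp sf) (tangent_expand w ac cp sf) vw.
Qed.

(** Set to 0 away from the chart, so that [ptan c u], the coordinate field with constant components
    u, is a field on all of M. *)
Definition chart_der c (u : 'rV[R]_N) q : (M -> R) -> R^o := fun f =>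
  if `[< [/\ atlas c, cdom c q & smooth_at f q] >] then 'D_u (f \o cinv c) (cfun c q) else 0.

Lemma chart_der_valP c u q : chart_der c u q \in derivations q.
Proof.
apply/asboolP; rewrite /chart_der.
have [[ac cq]|nac] := pselect (atlas c /\ cdom c q); last first.
  have E f : `[< [/\ atlas c, cdom c q & smooth_at f q] >] = false
    by apply/asboolP => -[? ? _]; apply: nac.
  by split => *; rewrite ?E// ?mulr0 ?addr0.
have E f : smooth_at f q ->
  (if `[< [/\ atlas c, cdom c q & smooth_at f q] >] then 'D_u (f \o cinv c) (cfun c q) else 0)
   = 'D_u (f \o cinv c) (cfun c q) by move=> sf; rewrite asboolT.
have d f : smooth_at f q -> derivable (f \o cinv c) (cfun c q) u.
  move=> sf; have [V [oV Vp Vc Hf]] := smooth_at_inv ac cq sf.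
  exact: (Ck_derivable (Hf 1%N)).
split.
- by move=> f nf; rewrite asboolF// => -[].
- move=> f g sf fg; have sg := smooth_ext fg sf; rewrite E// E//.
  have H := cinv_cont (cfun_cod cq); rewrite /prop_for /continuous_at cfunK// in H.
  by apply: near_eq_derive; exact: (H _ fg).
- move=> a f g sf sg; rewrite (E f)// (E g)// E; last exact: smooth_lin.
  have := @deriveD _ _ _ (a \*: (f \o cinv c)) (g \o cinv c) (cfun c q) u.
  by move=> ->; [rewrite deriveZ//; exact: d|apply: derivableZ; exact: d|exact: d].
- move=> f g sf sg; rewrite (E f)// (E g)// E; last exact: smooth_mul.
  have := @deriveM _ _ (f \o cinv c) (g \o cinv c) (cfun c q) u (d _ sf) (d _ sg).
  by rewrite /= cfunK// => ->.
Qed.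

Definition ptan c (u : 'rV[R]_N) : vfield M := fun q => Tangent (chart_der_valP c u q).

Lemma ptanE c u q f : atlas c -> cdom c q -> smooth_at f q ->
  ptan c u q f = 'D_u (f \o cinv c) (cfun c q).
Proof. by move=> ac cq sf; rewrite /= /chart_der asboolT. Qed.

Lemma tcoord_ptan c u q : atlas c -> cdom c q -> tcoord c (ptan c u q) = u.
Proof.
move=> ac cq; apply/rowP => i; rewrite [LHS]mxE ptanE//; last exact: smooth_coord.
have [_ <-] := is_derive_coord (cfun c q) u i.
apply: near_eq_derive; near=> y; rewrite /coord /= cinvK//; near: y.
by apply: open_nbhs_nbhs; split; [exact: ccod_open|exact: cfun_cod].
Unshelve. all: by end_near. Qed.

Lemma ptan_tcoord c q (v : tangent q) : atlas c -> cdom c q -> ptan c (tcoord c v) q = v.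
Proof. by move=> ac cq; apply: (tcoord_inj ac cq); rewrite tcoord_ptan. Qed.

Lemma vsmooth_ext (X Y : vfield M) p : (\forall q \near p, X q = Y q) ->
  vsmooth_at X p -> vsmooth_at Y p.
Proof.
move=> XY sX f sf; apply: smooth_ext (sX f sf).
by apply: filterS XY => q ->.
Qed.

Lemma smooth_partial c p f i : atlas c -> cdom c p -> smooth_at f p ->
  smooth_at (fun q => partial i (f \o cinv c) (cfun c q)) p.
Proof.
move=> ac cp sf; have [V [oV Vp Vc Hf]] := smooth_at_inv ac cp sf.
apply: (smooth_at_chart ac cp oV Vp) => k.
apply: (@Ck_ext _ _ _ _ (partial i (f \o cinv c))) => //.
  by move=> y Vy /=; rewrite cinvK//; exact: Vc.
by apply: Ck_partial; exact: Hf.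
Qed.

Lemma vsmooth_coords c p (X : vfield M) : atlas c -> cdom c p ->
  (forall i, smooth_at (fun q => X q (coord c i)) p) -> vsmooth_at X p.
Proof.
move=> ac cp sX f sf.
apply: (@smooth_ext _ _ _ (fun q => \sum_i X q (coord c i) * partial i (f \o cinv c) (cfun c q))).
  have H1 : \forall q \near p, cdom c q by apply: open_nbhs_nbhs; split => //; exact: cdom_open.
  have H2 := smooth_near sf.
  near=> q; rewrite (tangent_expand (c := c)) //; last 2 first.
  - by near: q.
  - by near: q.
  by apply: eq_bigr => i _; rewrite mxE.
by apply: smooth_sum => i _; apply: smooth_mul => //; exact: smooth_partial.
Unshelve. all: by end_near. Qed.

Lemma vsmooth_coord c p (X : vfield M) i : atlas c -> cdom c p -> vsmooth_at X p ->
  smooth_at (fun q => X q (coord c i)) p.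
Proof. by move=> ac cp sX; apply: sX; exact: smooth_coord. Qed.

Lemma vsmooth_near (X : vfield M) p : vsmooth_at X p -> \forall q \near p, vsmooth_at X q.
Proof.
move=> sX; have [c ac cp] := atlas_cover p.
have H1 : \forall q \near p, cdom c q by apply: open_nbhs_nbhs; split => //; exact: cdom_open.
have H2 : \forall q \near p, forall i, smooth_at (fun q => X q (coord c i)) q.
  by apply: filter_forall => i; apply: smooth_near; exact: vsmooth_coord.
near=> q; apply: (vsmooth_coords (c := c)) => //; by near: q.
Unshelve. all: by end_near. Qed.

Lemma vsmooth_ptan c u q : atlas c -> cdom c q -> vsmooth_at (ptan c u) q.
Proof.
move=> ac cq; apply: (vsmooth_coords ac cq) => i.
apply: (@smooth_ext _ _ _ (fun=> u 0 i)); last exact: smooth_cst.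
have H1 : \forall q' \near q, cdom c q' by apply: open_nbhs_nbhs; split => //; exact: cdom_open.
apply: filterS H1 => q' cq'; have := tcoord_ptan u ac cq' => /rowP /(_ i).
by rewrite mxE.
Qed.

Lemma vfield_extension p (v : tangent p) : exists X : vfield M, vsmooth_at X p /\ X p = v.
Proof.
have [c ac cp] := atlas_cover p; exists (ptan c (tcoord c v)).
by split; [exact: vsmooth_ptan|exact: ptan_tcoord].
Qed.

Definition vadd (X Y : vfield M) : vfield M := fun q => X q + Y q.
Definition vscale (f : M -> R) (X : vfield M) : vfield M := fun q => f q *: X q.

Lemma vsmooth_add X Y p : vsmooth_at X p -> vsmooth_at Y p -> vsmooth_at (vadd X Y) p.
Proof. by move=> sX sY f sf; apply: smooth_add; [exact: sX|exact: sY]. Qed.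

Lemma vsmooth_scale f X p : smooth_at f p -> vsmooth_at X p -> vsmooth_at (vscale f X) p.
Proof. by move=> sf sX h sh; apply: smooth_mul => //; exact: sX. Qed.

Lemma vsmooth_sum (I : Type) (r : seq I) (P : pred I) (F : I -> vfield M) p :
  (forall i, P i -> vsmooth_at (F i) p) ->
  vsmooth_at (fun q => \sum_(i <- r | P i) F i q) p.
Proof.
move=> HF f sf.
have -> : (fun q => (\sum_(i <- r | P i) F i q : tangent q) f) = (fun q => \sum_(i <- r | P i) F i q f).
  by apply/funext => q; rewrite tangent_sumE.
by apply: smooth_sum => i Pi; exact: HF.
Qed.

Lemma bracketE X Y p f : vsmooth_at X p -> vsmooth_at Y p -> smooth_at f p ->
  bracket X Y p f = X p (fun q => Y q f) - Y p (fun q => X q f).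
Proof. by move=> sX sY sf; rewrite /= /bracket_val asboolT. Qed.

Lemma vsmooth_bracket X Y p : vsmooth_at X p -> vsmooth_at Y p -> vsmooth_at (bracket X Y) p.
Proof.
move=> sX sY f sf.
apply: (@smooth_ext _ _ _ (fun q => X q (fun q => Y q f) - Y q (fun q => X q f))).
  have H1 := vsmooth_near sX; have H2 := vsmooth_near sY; have H3 := smooth_near sf.
  by near=> q; rewrite bracketE//; near: q.
by apply: smooth_sub; [apply: sX; exact: sY|apply: sY; exact: sX].
Unshelve. all: by end_near. Qed.

Lemma bracket_near X Y X' Y' p : vsmooth_at X p -> vsmooth_at Y p ->
  (\forall q \near p, X q = X' q) -> (\forall q \near p, Y q = Y' q) ->
  bracket X Y p = bracket X' Y' p.
Proof.
move=> sX sY XX YY; have sX' := vsmooth_ext XX sX; have sY' := vsmooth_ext YY sY.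
apply: tangent_ext => f sf; rewrite !bracketE// -(nbhs_singleton XX) -(nbhs_singleton YY).
congr (_ - _); apply: tangent_near; [exact: sY| |exact: sX|].
- by apply: filterS YY => q ->.
- by apply: filterS XX => q ->.
Qed.

End Tangents.

(** * Tensoriality *)

Section Tensoriality.
Variables (R : realType) (N : nat) (M : manifold R N).
Implicit Types (X Y Z : vfield M) (f : M -> R) (p q : M).

Lemma bracketC X Y p : bracket X Y p = - bracket Y X p.
Proof.
have [[sX sY]|n] := pselect (vsmooth_at X p /\ vsmooth_at Y p); last first.
  have E A B : ~ (vsmooth_at A p /\ vsmooth_at B p) -> bracket A B p = 0.
    move=> nAB; apply: tangent_ext => f sf; rewrite tangent0E /= /bracket_val asboolF//.
    by case=> _ a b; apply: nAB.
  by rewrite !E ?oppr0// => -[a b]; apply: n.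
by apply: tangent_ext => f sf; rewrite tangentNE !bracketE// opprB.
Qed.

Lemma bracket_linr f X Y Z p : smooth_at f p -> vsmooth_at X p -> vsmooth_at Y p ->
  vsmooth_at Z p -> bracket Z (vadd (vscale f X) Y) p =
  f p *: bracket Z X p + Z p f *: X p + bracket Z Y p.
Proof.
move=> sf sX sY sZ; apply: tangent_ext => h sh.
have sfX := vsmooth_scale sf sX.
rewrite bracketE//; last exact: vsmooth_add.
rewrite !tangentDE !tangentZE !bracketE//.
have -> : (fun q => vadd (vscale f X) Y q h) = (fun q => f q * X q h + Y q h) by [].
have sXh := sX _ sh; have sYh := sY _ sh; have sZh := sZ _ sh.
rewrite tangent_add// ?tangent_mul//; last exact: smooth_mul.
by ring.
Qed.

Lemma frame_expand c X p : atlas c -> cdom c p -> 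
  X p = \sum_i X p (coord c i) *: ptan c (delta_mx 0 i) p.
Proof.
move=> ac cp; apply: (tcoord_inj ac cp); rewrite linear_sum [LHS]matrix_sum_delta big_ord1.
by apply: eq_bigr => i _; rewrite linearZ/= tcoord_ptan// !mxE.
Qed.

(** Locality replaces a field by its expansion in the coordinate frame near p, and linearity over
    germs then leaves only the components at p. *)
Lemma tensorial (U : lmodType R) p (T : vfield M -> U) :
  (forall X Y, vsmooth_at X p -> (\forall q \near p, X q = Y q) -> T X = T Y) ->
  (forall f X Y, smooth_at f p -> vsmooth_at X p -> vsmooth_at Y p ->
     T (vadd (vscale f X) Y) = f p *: T X + T Y) ->
  forall X Y, vsmooth_at X p -> vsmooth_at Y p -> X p = Y p -> T X = T Y.
Proof.
move=> loc lin.
pose z : vfield M := fun q => 0.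
have sz : vsmooth_at z p.
  by have [X [sX _]] := vfield_extension (0 : tangent p); 
     apply: vsmooth_ext (vsmooth_scale (smooth_cst 0 p) sX);
     apply: (@filterE _ _ (nbhs_filter p)) => q; rewrite /vscale scale0r.
have T0 : T z = 0.
  have := lin (fun=> 1) z z (smooth_cst 1 p) sz sz; rewrite scale1r.
  rewrite (loc (vadd _ z) z) => [/eqP||].
  - by rewrite -subr_eq0 opprD addrA subrr sub0r oppr_eq0 => /eqP.
  - by apply: vsmooth_add => //; apply: vsmooth_scale => //; exact: smooth_cst.
  - by apply: (@filterE _ _ (nbhs_filter p)) => q; rewrite /vadd /vscale scaler0 addr0.
have [c ac cp] := atlas_cover p.
pose E i := ptan c (delta_mx 0 i).
have sE i : vsmooth_at (E i) p by exact: vsmooth_ptan.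
have expand Z : vsmooth_at Z p -> T Z = \sum_i Z p (coord c i) *: T (E i).
  move=> sZ; pose F i q := Z q (coord c i).
  have sF i : smooth_at (F i) p by exact: vsmooth_coord.
  have -> : T Z = T (fun q => \sum_i F i q *: E i q).
    apply: loc => //; have H : \forall q \near p, cdom c q.
      by apply: open_nbhs_nbhs; split => //; exact: cdom_open.
    by apply: filterS H => q cq; rewrite [LHS](frame_expand (c := c)).
  have K (r : seq 'I_N) : T (fun q => \sum_(i <- r) F i q *: E i q) = \sum_(i <- r) F i p *: T (E i).
    elim: r => [|i r IH].
      by rewrite big_nil -T0; congr T; apply: functional_extensionality_dep => q; rewrite big_nil.
    rewrite big_cons -IH -lin//; last first.
      by apply: vsmooth_sum => j _; exact: vsmooth_scale.
    by congr T; apply: functional_extensionality_dep => q; rewrite big_cons.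
  exact: K.
by move=> X Y sX sY XY; rewrite !expand// XY.
Qed.

Lemma oneform_near (eta : oneform M) X Y p : (\forall q \near p, X q = Y q) ->
  \forall q \near p, eta q (X q) = eta q (Y q).
Proof. by apply: filterS => q ->. Qed.

Lemma d1_near (eta : oneform M) X Y X' Y' p : smooth_oneform eta ->
  vsmooth_at X p -> vsmooth_at Y p ->
  (\forall q \near p, X q = X' q) -> (\forall q \near p, Y q = Y' q) ->
  d1 eta X Y p = d1 eta X' Y' p.
Proof.
move=> se sX sY eX eY; have [_ sE] := se p.
rewrite /d1 (bracket_near sX sY eX eY) -(nbhs_singleton eX) -(nbhs_singleton eY).
rewrite (tangent_near _ (sE _ sX) (oneform_near eta eX)).
by rewrite (tangent_near _ (sE _ sY) (oneform_near eta eY)).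
Qed.

Lemma d1_linr (eta : oneform M) f X Y Z p : smooth_oneform eta -> smooth_at f p ->
  vsmooth_at X p -> vsmooth_at Y p -> vsmooth_at Z p ->
  d1 eta Z (vadd (vscale f X) Y) p = f p * d1 eta Z X p + d1 eta Z Y p.
Proof.
move=> se sf sX sY sZ; have [_ sE] := se p.
have L q (a : R) v w : eta q (a *: v + w) = a * eta q v + eta q w by case: (se q) => h _; exact: h.
have LD v w : eta p (v + w) = eta p v + eta p w by rewrite -[X in eta p (X + _)]scale1r L mul1r.
have e0 : eta p 0 = 0 by have /eqP := LD 0 0; rewrite addr0 -subr_eq0 opprD addrA subrr sub0r oppr_eq0 => /eqP.
have LZ a v : eta p (a *: v) = a * eta p v by rewrite -[a *: v]addr0 L e0 addr0.
rewrite /d1 bracket_linr// !LD !LZ.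
have -> : (fun q => eta q (vadd (vscale f X) Y q)) = (fun q => f q * eta q (X q) + eta q (Y q)).
  by apply/funext => q; rewrite /vadd /vscale L.
rewrite tangent_add//; [|exact: smooth_mul sf (sE _ sX)|exact: sE].
rewrite tangent_mul//; last exact: sE.
by rewrite /vadd /vscale tangentDE tangentZE; field.
Qed.

Lemma d1C (eta : oneform M) X Y p : smooth_oneform eta -> d1 eta X Y p = - d1 eta Y X p.
Proof.
move=> se; have L (a : R) v w : eta p (a *: v + w) = a * eta p v + eta p w by case: (se p) => h _; exact: h.
have e0 : eta p 0 = 0 by have /eqP := L 1 0 0; rewrite scale1r addr0 mul1r -subr_eq0 opprD addrA subrr sub0r oppr_eq0 => /eqP.
have eN v : eta p (- v) = - eta p v by rewrite -[- v]addr0 -scaleN1r L e0 addr0 mulN1r.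
by rewrite /d1 (bracketC X) eN; ring.
Qed.

Lemma d1_tensor (eta : oneform M) X Y X' Y' p : smooth_oneform eta ->
  vsmooth_at X p -> vsmooth_at Y p -> vsmooth_at X' p -> vsmooth_at Y' p ->
  X p = X' p -> Y p = Y' p -> d1 eta X Y p = d1 eta X' Y' p.
Proof.
move=> se sX sY sX' sY' eX eY.
have nr (Z : vfield M) : \forall q \near p, Z q = Z q by exact: (@filterE _ _ (nbhs_filter p)).
have r Z A B : vsmooth_at Z p -> vsmooth_at A p -> vsmooth_at B p -> A p = B p ->
    d1 eta Z A p = d1 eta Z B p.
  move=> sZ; apply: (@tensorial R^o p (fun Y => d1 eta Z Y p)).
    by move=> A' B' sA AB; exact: d1_near.
  by move=> f A' B' sf sA sB; exact: d1_linr.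
by rewrite (r X Y Y')// d1C// (r Y' X X')// -d1C.
Qed.

Lemma tapp_near (T : tensor11 M) X Y p : (\forall q \near p, X q = Y q) ->
  \forall q \near p, tapp T X q = tapp T Y q.
Proof. by apply: filterS => q e; rewrite /tapp e. Qed.

Section Nijenhuis.
Variable T : tensor11 M.
Arguments T : clear implicits.
Hypothesis sT : smooth_tensor11 T.
Let T_lin p : linear (T p). Proof. by case: (sT p). Qed.
Let T_D p v w : T p (v + w) = T p v + T p w.
Proof. by rewrite -[X in T p (X + _)]scale1r T_lin scale1r. Qed.
Let T_0 p : T p 0 = 0.
Proof. by have := @T_D p 0 0; rewrite addr0 => /eqP; rewrite -subr_eq0 opprD addrA subrr sub0r oppr_eq0 => /eqP. Qed.
Let T_Z p a v : T p (a *: v) = a *: T p v.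
Proof. by rewrite -[a *: v]addr0 T_lin T_0 addr0. Qed.
Let T_N p v : T p (- v) = - T p v.
Proof. by rewrite -scaleN1r T_Z scaleN1r. Qed.
Let sT' X p : vsmooth_at X p -> vsmooth_at (tapp T X) p.
Proof. by case: (sT p) => _; exact. Qed.

Lemma nijenhuis_near X Y X' Y' p : vsmooth_at X p -> vsmooth_at Y p ->
  (\forall q \near p, X q = X' q) -> (\forall q \near p, Y q = Y' q) ->
  nijenhuis T X Y p = nijenhuis T X' Y' p.
Proof.
move=> sX sY eX eY; rewrite /nijenhuis.
by rewrite (bracket_near sX sY eX eY) (bracket_near (sT' sX) (sT' sY) (tapp_near T eX) (tapp_near T eY))
  (bracket_near (sT' sX) sY (tapp_near T eX) eY) (bracket_near sX (sT' sY) eX (tapp_near T eY)).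
Qed.

Lemma nijenhuis_linr f X Y Z p : smooth_at f p ->
  vsmooth_at X p -> vsmooth_at Y p -> vsmooth_at Z p ->
  nijenhuis T Z (vadd (vscale f X) Y) p = f p *: nijenhuis T Z X p + nijenhuis T Z Y p.
Proof.
move=> sf sX sY sZ.
have E : tapp T (vadd (vscale f X) Y) = vadd (vscale f (tapp T X)) (tapp T Y).
  by apply: functional_extensionality_dep => q; rewrite /tapp /vadd /vscale T_lin.
rewrite /nijenhuis E !bracket_linr//; try exact: sT'.
rewrite /tapp !(T_D, T_Z).
by apply: tangent_ext => h sh; rewrite !(tangentDE, tangentZE, tangentNE); ring.
Qed.

Lemma nijenhuisC X Y p : nijenhuis T X Y p = - nijenhuis T Y X p.
Proof.
rewrite /nijenhuis (bracketC X Y) (bracketC (tapp T X) (tapp T Y)) (bracketC (tapp T X) Y)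
  (bracketC X (tapp T Y)) !T_N.
by rewrite !opprD !opprK addrAC.
Qed.

Lemma nijenhuis_tensor X Y X' Y' p :
  vsmooth_at X p -> vsmooth_at Y p -> vsmooth_at X' p -> vsmooth_at Y' p ->
  X p = X' p -> Y p = Y' p -> nijenhuis T X Y p = nijenhuis T X' Y' p.
Proof.
move=> sX sY sX' sY' eX eY.
have nr (Z : vfield M) : \forall q \near p, Z q = Z q by exact: (@filterE _ _ (nbhs_filter p)).
have r Z A B : vsmooth_at Z p -> vsmooth_at A p -> vsmooth_at B p -> A p = B p ->
    nijenhuis T Z A p = nijenhuis T Z B p.
  move=> sZ; apply: (@tensorial _ p (fun Y => nijenhuis T Z Y p)).
    by move=> A' B' sA AB; exact: nijenhuis_near.
  by move=> f A' B' sf sA sB; exact: nijenhuis_linr.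
by rewrite (r X Y Y')// nijenhuisC (r Y' X X')// -nijenhuisC.
Qed.

End Nijenhuis.

End Tensoriality.

(** * Smooth maps *)

Section SmoothMaps.
Variables (R : realType) (N1 N2 : nat) (M1 : manifold R N1) (M2 : manifold R N2).
Implicit Types (F : M1 -> M2) (p q : M1).

Lemma smooth_map_coords F p (c : chart R N2 M2) : {for p, continuous F} -> atlas c ->
  cdom c (F p) -> (forall i, smooth_at (fun q => coord c i (F q)) p) -> smooth_map_at F p.
Proof.
move=> cF ac cFp sF; split => // h sh.
have [V [oV Vp Vc Hh]] := smooth_at_inv ac cFp sh.
apply: (@smooth_ext _ _ _ ((h \o cinv c) \o (fun q => cfun c (F q)))).
  have H : \forall q \near p, cdom c (F q).
    by apply: (cF (cdom c)); apply: open_nbhs_nbhs; split => //; exact: cdom_open.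
  by apply: filterS H => q cq /=; rewrite cfunK.
exact: (smooth_comp (F := fun q => cfun c (F q)) sF oV Vp Hh).
Qed.

Lemma tmapE F p (v : tangent p) h : smooth_map_at F p -> smooth_at h (F p) ->
  tmap F v h = v (h \o F).
Proof. by move=> sF sh; rewrite /= /tmap_val asboolT. Qed.

Lemma tmap_linear F p : linear (@tmap _ _ _ _ _ F p).
Proof.
move=> a u v; apply: tangent_ext => f sf.
have [sF|nF] := pselect (smooth_map_at F p); first by rewrite tangentDE tangentZE !tmapE.
rewrite tangentDE tangentZE /= /tmap_val asboolF; last by case.
by rewrite mulr0 addr0.
Qed.

HB.instance Definition _ F p :=
  GRing.isLinear.Build R (tangent p) (tangent (F p)) _ (@tmap _ _ _ _ _ F p) (@tmap_linear F p).

(** The hypothesis gives continuity at p alone. At nearby points it is recovered from the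
    coordinates of F, which are smooth there and hence continuous. *)
Lemma smooth_map_near F p : smooth_map_at F p -> \forall q \near p, smooth_map_at F q.
Proof.
move=> [cF sF]; have [c ac cFp] := atlas_cover (F p).
have H1 : \forall q \near p, cdom c (F q).
  by apply: (cF (cdom c)); apply: open_nbhs_nbhs; split => //; exact: cdom_open.
have H2 : \forall q \near p, forall i, smooth_at (fun q => coord c i (F q)) q.
  by apply: filter_forall => i; apply: smooth_near; apply: (sF (coord c i)); exact: smooth_coord.
have H3 := near_join H1.
near=> q.
have cq : cdom c (F q) by near: q.
have sq : forall i, smooth_at (fun q => coord c i (F q)) q by near: q.
apply: (smooth_map_coords (c := c)) => //.
have c1 : {for q, continuous (cinv c \o (fun q => cfun c (F q)))}.
  apply: continuous_comp; last exact: cinv_cont (cfun_cod cq).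
  apply: (rV_cvgP (FF := nbhs_filter q)) => i; exact: smooth_at_cont (sq i).
have E : \forall q' \near q, (cinv c \o (fun q => cfun c (F q))) q' = F q'.
  have H : \forall q' \near q, cdom c (F q') by near: q.
  by apply: filterS H => q' cq' /=; rewrite cfunK.
rewrite /prop_for /continuous_at -(nbhs_singleton E).
exact: cvg_trans (near_eq_cvg E) c1.
Unshelve. all: by end_near. Qed.

Definition related F p (X : vfield M1) (Y : vfield M2) :=
  \forall q \near p, tmap F (X q) = Y (F q).

Lemma related_der F p X Y h : smooth_map_at F p -> related F p X Y ->
  smooth_at h (F p) -> \forall q \near p, X q (h \o F) = Y (F q) h.
Proof.
move=> sF XY sh.
have H1 := smooth_map_near sF.
have H2 : \forall q \near p, smooth_at h (F q).
  by apply: (sF.1 (fun y => smooth_at h y)); exact: smooth_near.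
near=> q; rewrite -tmapE; [|by near: q|by near: q].
by congr (Defs.tval _ _); near: q.
Unshelve. all: by end_near. Qed.

Lemma bracket_related F p X1 X2 Y1 Y2 : smooth_map_at F p ->
  vsmooth_at X1 p -> vsmooth_at X2 p -> vsmooth_at Y1 (F p) -> vsmooth_at Y2 (F p) ->
  related F p X1 Y1 -> related F p X2 Y2 ->
  tmap F (bracket X1 X2 p) = bracket Y1 Y2 (F p).
Proof.
move=> sF sX1 sX2 sY1 sY2 r1 r2; apply: tangent_ext => h sh.
have shF : smooth_at (h \o F) p by case: sF => _; exact.
rewrite tmapE// !bracketE//.
have E1 := related_der sF r1 sh; have E2 := related_der sF r2 sh.
rewrite (tangent_near (X1 p) (sX2 _ shF) E2) (tangent_near (X2 p) (sX1 _ shF) E1).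
rewrite -(nbhs_singleton r1) -(nbhs_singleton r2) !tmapE//; [exact: sY1|exact: sY2].
Qed.

End SmoothMaps.

(** * Almost contact metric structures over a Lie-Rinehart algebra *)

Section AlmostContactAlgebra.
Variables (O : comPzRingType) (V : lmodType O).
Hypothesis reduced : forall a : O, a * a = 0 -> a = 0.

(** Stated over any commutative ring because it is used twice: over R in one tangent space, and over
    the functions on an open set for its fields. Positivity of g is replaced by nondegeneracy, which
    makes sense over both. *)
Record acm_alg (phi : V -> V) (xi : V) (eta : V -> O) (g : V -> V -> O) : Prop := AcmAlg {
  aa_phi : linear phi;
  aa_eta : forall (a : O) X Y, eta (a *: X + Y) = a * eta X + eta Y;
  aa_gC : forall X Y, g X Y = g Y X;
  aa_g : forall (a : O) X Y Z, g (a *: X + Y) Z = a * g X Z + g Y Z;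
  aa_ndeg : forall X, (forall Y, g X Y = 0) -> X = 0;
  aa_phi2 : forall X, phi (phi X) = - X + eta X *: xi;
  aa_etaxi : eta xi = 1;
  aa_gphi : forall X Y, g (phi X) (phi Y) = g X Y - eta X * eta Y }.

Variables (phi : V -> V) (xi : V) (eta : V -> O) (g : V -> V -> O).
Hypothesis A : acm_alg phi xi eta g.

Lemma aphiD X Y : phi (X + Y) = phi X + phi Y.
Proof. by rewrite -[X in phi (X + _)]scale1r (aa_phi A) scale1r. Qed.
Lemma aphi0 : phi 0 = 0.
Proof. by have := aphiD 0 0; rewrite addr0 => /eqP; rewrite -subr_eq0 opprD addrA subrr sub0r oppr_eq0 => /eqP. Qed.
Lemma aphiZ a X : phi (a *: X) = a *: phi X.
Proof. by rewrite -[a *: X]addr0 (aa_phi A) aphi0 addr0. Qed.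
Lemma aphiN X : phi (- X) = - phi X.
Proof. by rewrite -scaleN1r aphiZ scaleN1r. Qed.
Lemma aphiB X Y : phi (X - Y) = phi X - phi Y.
Proof. by rewrite aphiD aphiN. Qed.

Lemma aetaD X Y : eta (X + Y) = eta X + eta Y.
Proof. by rewrite -[X in eta (X + _)]scale1r (aa_eta A) mul1r. Qed.
Lemma aeta0 : eta 0 = 0.
Proof. by have := aetaD 0 0; rewrite addr0 => /eqP; rewrite -subr_eq0 opprD addrA subrr sub0r oppr_eq0 => /eqP. Qed.
Lemma aetaZ a X : eta (a *: X) = a * eta X.
Proof. by rewrite -[a *: X]addr0 (aa_eta A) aeta0 addr0. Qed.
Lemma aetaN X : eta (- X) = - eta X.
Proof. by rewrite -scaleN1r aetaZ mulN1r. Qed.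
Lemma aetaB X Y : eta (X - Y) = eta X - eta Y.
Proof. by rewrite aetaD aetaN. Qed.

Lemma agDl X Y Z : g (X + Y) Z = g X Z + g Y Z.
Proof. by rewrite -[X in g (X + _)]scale1r (aa_g A) mul1r. Qed.
Lemma ag0l Z : g 0 Z = 0.
Proof. by have := agDl 0 0 Z; rewrite addr0 => /eqP; rewrite -subr_eq0 opprD addrA subrr sub0r oppr_eq0 => /eqP. Qed.
Lemma agZl a X Z : g (a *: X) Z = a * g X Z.
Proof. by rewrite -[a *: X]addr0 (aa_g A) ag0l addr0. Qed.
Lemma agNl X Z : g (- X) Z = - g X Z.
Proof. by rewrite -scaleN1r agZl mulN1r. Qed.
Lemma agBl X Y Z : g (X - Y) Z = g X Z - g Y Z.
Proof. by rewrite agDl agNl. Qed.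
Lemma agDr X Y Z : g Z (X + Y) = g Z X + g Z Y.
Proof. by rewrite (aa_gC A) agDl !(aa_gC A Z). Qed.
Lemma ag0r Z : g Z 0 = 0.
Proof. by rewrite (aa_gC A) ag0l. Qed.
Lemma agZr a X Z : g Z (a *: X) = a * g Z X.
Proof. by rewrite (aa_gC A) agZl (aa_gC A Z). Qed.
Lemma agNr X Z : g Z (- X) = - g Z X.
Proof. by rewrite (aa_gC A) agNl (aa_gC A Z). Qed.
Lemma agBr X Y Z : g Z (X - Y) = g Z X - g Z Y.
Proof. by rewrite agDr agNr. Qed.
Lemma ag_ext X Y : (forall Z, g Z X = g Z Y) -> X = Y.
Proof.
move=> H; apply/eqP; rewrite -subr_eq0; apply/eqP; apply: (aa_ndeg A) => Z.
by rewrite agBl (aa_gC A X) (aa_gC A Y) H subrr.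
Qed.

(** From phi^2 xi = 0 the vector phi xi is a multiple of xi, and the coefficient squares to zero;
    this is where reducedness enters. *)
Lemma aphi_xi : phi xi = 0.
Proof.
have p2 : phi (phi xi) = 0 by rewrite (aa_phi2 A) (aa_etaxi A) scale1r addNr.
have [a e1] : exists a, phi xi = a *: xi.
  exists (eta (phi xi)); have := aa_phi2 A (phi xi); rewrite p2 aphi0 => /esym/eqP.
  by rewrite addrC subr_eq0 eq_sym => /eqP.
have a2 : a * a = 0.
  have := p2; rewrite e1 aphiZ e1 scalerA => /(congr1 eta).
  by rewrite !aetaZ (aa_etaxi A) mulr1 aeta0.
by rewrite e1 (reduced a2) scale0r.
Qed.

Lemma ag_xi X : g X xi = eta X.
Proof.
have := aa_gphi A X xi; rewrite aphi_xi ag0r (aa_etaxi A) mulr1 => /esym/eqP.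
by rewrite subr_eq0 => /eqP.
Qed.

Lemma aeta_phi X : eta (phi X) = 0.
Proof.
have := aa_phi2 A (phi X); rewrite (aa_phi2 A X) aphiD aphiN aphiZ aphi_xi scaler0 addr0.
move=> /eqP; rewrite -subr_eq0 opprD addrA subrr sub0r oppr_eq0 => /eqP /(congr1 eta).
by rewrite aetaZ (aa_etaxi A) mulr1 aeta0.
Qed.

Lemma ag_phi X Y : g (phi X) Y = - g X (phi Y).
Proof.
have := aa_gphi A X (phi Y); rewrite (aa_phi2 A) agDr agNr agZr ag_xi !aeta_phi.
by rewrite !mulr0 addr0 subr0 => /eqP; rewrite eqr_oppLR => /eqP.
Qed.

End AlmostContactAlgebra.

(** * Exterior and Nijenhuis calculus over a Lie-Rinehart algebra *)

Section LieRinehart.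
Variables (O : comPzRingType) (V : lmodType O).
Variables (der : V -> O -> O) (br : V -> V -> V).

(** Faithfulness of the action, [lr_ext], turns skew-symmetry, the Leibniz rule and the Jacobi
    identity of [br] into consequences of [lr_br]. *)
Record lie_rinehart : Prop := LieRinehart {
  lr_reduced : forall a : O, a * a = 0 -> a = 0;
  lr_derD : forall X a b, der X (a + b) = der X a + der X b;
  lr_derM : forall X a b, der X (a * b) = a * der X b + b * der X a;
  lr_addl : forall X Y a, der (X + Y) a = der X a + der Y a;
  lr_scale : forall a X b, der (a *: X) b = a * der X b;
  lr_br : forall X Y a, der (br X Y) a = der X (der Y a) - der Y (der X a);
  lr_ext : forall X Y, (forall a, der X a = der Y a) -> X = Y }.

Hypothesis H : lie_rinehart.

Lemma lr_der0 X : der X 0 = 0.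
Proof. by have := lr_derD H X 0 0; rewrite addr0 => /eqP; rewrite -subr_eq0 opprD addrA subrr sub0r oppr_eq0 => /eqP. Qed.
Lemma lr_derN X a : der X (- a) = - der X a.
Proof.
have := lr_derD H X a (- a); rewrite subrr lr_der0 => /esym/eqP.
by rewrite addrC addr_eq0 => /eqP.
Qed.
Lemma lr_derB X a b : der X (a - b) = der X a - der X b.
Proof. by rewrite (lr_derD H) lr_derN. Qed.
Lemma lr_der1 X : der X 1 = 0.
Proof.
have := lr_derM H X 1 1; rewrite !mul1r => /eqP.
by rewrite -subr_eq0 opprD addrA subrr sub0r oppr_eq0 => /eqP.
Qed.
Lemma lr_zero a : der 0 a = 0.
Proof. by have := lr_scale H 0 0 a; rewrite scale0r mul0r. Qed.
Lemma lr_opp X a : der (- X) a = - der X a.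
Proof. by rewrite -scaleN1r (lr_scale H) mulN1r. Qed.

Lemma brC X Y : br X Y = - br Y X.
Proof. by apply: (lr_ext H) => a; rewrite lr_opp !(lr_br H) opprB. Qed.
Lemma brDr X Y Z : br X (Y + Z) = br X Y + br X Z.
Proof.
apply: (lr_ext H) => a.
by rewrite (lr_addl H) !(lr_br H) !(lr_addl H) (lr_derD H) opprD addrACA.
Qed.
Lemma brZr X (a : O) Y : br X (a *: Y) = a *: br X Y + der X a *: Y.
Proof.
apply: (lr_ext H) => b.
by rewrite (lr_addl H) !(lr_scale H) !(lr_br H) !(lr_scale H) (lr_derM H) mulrBr addrAC (mulrC (der Y b)).
Qed.
Lemma brZl X (a : O) Y : br (a *: Y) X = a *: br Y X - der X a *: Y.
Proof. by rewrite brC brZr opprD -scalerN -brC. Qed.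
Lemma br0r X : br X 0 = 0.
Proof. by apply: (lr_ext H) => a; rewrite (lr_br H) !lr_zero lr_der0 subrr. Qed.
Lemma br0l X : br 0 X = 0.
Proof. by rewrite brC br0r oppr0. Qed.
Lemma brNr X Y : br X (- Y) = - br X Y.
Proof. by rewrite -scaleN1r brZr scaleN1r lr_derN lr_der1 oppr0 scale0r addr0. Qed.
Lemma brXX X : br X X = 0.
Proof. by apply: (lr_ext H) => a; rewrite (lr_br H) lr_zero subrr. Qed.
Lemma jacobi X Y Z : br X (br Y Z) = br (br X Y) Z + br Y (br X Z).
Proof.
apply: (lr_ext H) => a.
rewrite (lr_addl H) (lr_br H) (lr_br H (br X Y)) (lr_br H Y (br X Z)).
by rewrite !(lr_br H) !lr_derB; ring.
Qed.

(* twice the exterior derivative of a 1-form, thrice that of a 2-form *)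
Definition te (eta : V -> O) X Y := der X (eta Y) - der Y (eta X) - eta (br X Y).
Definition te2 (w : V -> V -> O) X Y Z :=
  der X (w Y Z) + der Y (w Z X) + der Z (w X Y)
  - w (br X Y) Z - w (br Y Z) X - w (br Z X) Y.
Definition nij (phi : V -> V) X Y :=
  phi (phi (br X Y)) + br (phi X) (phi Y) - phi (br (phi X) Y) - phi (br X (phi Y)).

Section OneForm.
Variable eta : V -> O.
Hypothesis eta_lin : forall (a : O) X Y, eta (a *: X + Y) = a * eta X + eta Y.

Let eD X Y : eta (X + Y) = eta X + eta Y.
Proof. by rewrite -[X in eta (X + _)]scale1r eta_lin mul1r. Qed.
Let e0 : eta 0 = 0.
Proof. by have := eD 0 0; rewrite addr0 => /eqP; rewrite -subr_eq0 opprD addrA subrr sub0r oppr_eq0 => /eqP. Qed.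
Let eZ a X : eta (a *: X) = a * eta X.
Proof. by rewrite -[a *: X]addr0 eta_lin e0 addr0. Qed.
Let eN X : eta (- X) = - eta X.
Proof. by rewrite -scaleN1r eZ mulN1r. Qed.

Lemma teC X Y : te eta X Y = - te eta Y X.
Proof. by rewrite /te (brC X) eN; ring. Qed.

Lemma te_linr (a : O) X Y Z : te eta Z (a *: X + Y) = a * te eta Z X + te eta Z Y.
Proof.
by rewrite /te eta_lin (lr_derD H) (lr_derM H) (lr_addl H) (lr_scale H) brDr brZr !eD !eZ; ring.
Qed.

(** This is d d eta = 0: the second derivatives cancel through [lr_br], the double brackets through
    the Jacobi identity. *)
Lemma te_closed X Y Z : te2 (te eta) X Y Z = 0.
Proof.
have J := jacobi X Y Z.
have : eta (br X (br Y Z)) = eta (br (br X Y) Z) + eta (br Y (br X Z)) by rewrite J eD.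
rewrite (brC X Z) brNr eN (brC X (br Y Z)) eN (brC Y (br Z X)) eN opprK => E.
rewrite /te2 /te !lr_derB !(lr_br H).
have E' : eta (br (br X Y) Z) = - eta (br (br Y Z) X) - eta (br (br Z X) Y) by rewrite E; ring.
by rewrite E'; ring.
Qed.

End OneForm.

Section Tensor.
Variable phi : V -> V.
Hypothesis phi_lin : linear phi.

Let pD X Y : phi (X + Y) = phi X + phi Y.
Proof. by rewrite -[X in phi (X + _)]scale1r phi_lin scale1r. Qed.
Let p0 : phi 0 = 0.
Proof. by have := pD 0 0; rewrite addr0 => /eqP; rewrite -subr_eq0 opprD addrA subrr sub0r oppr_eq0 => /eqP. Qed.
Let pZ a X : phi (a *: X) = a *: phi X.
Proof. by rewrite -[a *: X]addr0 phi_lin p0 addr0. Qed.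
Let pN X : phi (- X) = - phi X.
Proof. by rewrite -scaleN1r pZ scaleN1r. Qed.

End Tensor.

End LieRinehart.

(** * Identities of three quasi-Sasakian structures *)

Section ThreeStructures.
Variables (O : comPzRingType) (V : lmodType O).
Variables (der : V -> O -> O) (br : V -> V -> V).
Hypothesis H : lie_rinehart der br.
Variables (T : Type) (t0 : T) (s : T -> T).
Variables (phi : T -> V -> V) (xi : T -> V) (eta : T -> V -> O) (g : V -> V -> O).

(* s is the cyclic permutation of the three indices. *)
Record three_qs : Prop := ThreeQS {
  tq_s3 : forall a, s (s (s a)) = a;
  tq_acm : forall a, acm_alg (phi a) (xi a) (eta a) g;
  tq_phi1 : forall a v, phi (s (s a)) v = phi a (phi (s a) v) - eta (s a) v *: xi a;
  tq_phi2 : forall a v, phi (s (s a)) v = - phi (s a) (phi a v) + eta a v *: xi (s a);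
  tq_xi1 : forall a, xi (s (s a)) = phi a (xi (s a));
  tq_xi2 : forall a, xi (s (s a)) = - phi (s a) (xi a);
  tq_eta1 : forall a v, eta (s (s a)) v = eta a (phi (s a) v);
  tq_eta2 : forall a v, eta (s (s a)) v = - eta (s a) (phi a v);
  tq_normal : forall a X Y, nij br (phi a) X Y + te der br (eta a) X Y *: xi a = 0;
  tq_closed : forall a X Y Z, te2 der br (fun v w => g v (phi a w)) X Y Z = 0 }.

Hypothesis Q : three_qs.

Local Notation teta a := (te der br (eta a)).
Let A := tq_acm Q.
Let red := lr_reduced H.
Let s3 := tq_s3 Q.

Let pD a := aphiD (A a).
Let pZ a := aphiZ (A a).
Let pN a := aphiN (A a).
Let pB a := aphiB (A a).
Let p0 a := aphi0 (A a).
Let pxi a : phi a (xi a) = 0 := aphi_xi red (A a).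
Let eD a := aetaD (A a).
Let eZ a := aetaZ (A a).
Let eN a := aetaN (A a).
Let eB a := aetaB (A a).
Let e0 a := aeta0 (A a).
Let exi a : eta a (xi a) = 1 := aa_etaxi (A a).
Let ephi a X : eta a (phi a X) = 0 := aeta_phi red (A a) X.
Let p2 a X : phi a (phi a X) = - X + eta a X *: xi a := aa_phi2 (A a) X.

Let mE := (agDl (A t0), agBl (A t0), agNl (A t0), agZl (A t0), agDr (A t0), agBr (A t0),
  agNr (A t0), agZr (A t0), ag0l (A t0), ag0r (A t0)).
Let m_ext := ag_ext (A t0).
Let mC := aa_gC (A t0).
Let mxi a X : g X (xi a) = eta a X := ag_xi red (A a) X.
Let mphi a X Y : g (phi a X) Y = - g X (phi a Y) := ag_phi red (A a) X Y.

(* Faithfulness of the action on O reduces identities in V to ring identities. *)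
Local Ltac vring := apply: (lr_ext H) => ?;
  rewrite !(lr_addl H, lr_scale H, lr_opp H, lr_zero H); ring.

Lemma eta_xi_s a : eta a (xi (s a)) = 0.
Proof. by have := tq_eta2 Q (s a) (xi (s a)); rewrite s3 pxi e0 oppr0. Qed.
Lemma eta_xi_ss a : eta a (xi (s (s a))) = 0.
Proof. by have := tq_eta1 Q (s a) (xi (s (s a))); rewrite s3 pxi e0. Qed.

Lemma phi_xi_s a : phi a (xi (s a)) = xi (s (s a)).
Proof. by rewrite (tq_xi1 Q). Qed.
Lemma phi_xi_ss a : phi a (xi (s (s a))) = - xi (s a).
Proof. by have := tq_xi2 Q (s (s a)); rewrite !s3 => ->; rewrite opprK. Qed.

(** Apply [eta a] to normality at ([xi a], X): every Nijenhuis term is killed by [phi a] or by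
    [eta a]. *)
Lemma te_xi a X : teta a (xi a) X = 0.
Proof.
have /(congr1 (eta a)) := tq_normal Q a (xi a) X.
rewrite /nij pxi !(br0l H) p0 subr0 addr0 eD eB !ephi eZ exi e0 mulr1 subrr add0r.
by [].
Qed.

Lemma eta_br_xi a X : eta a (br (xi a) X) = der (xi a) (eta a X).
Proof.
have := te_xi a X; rewrite /te exi (lr_der1 H) subr0 => /eqP.
by rewrite subr_eq0 => /eqP.
Qed.

(** Normality at ([xi a], X) puts the Lie derivative of [phi a] along [xi a] in the kernel of
    [phi a]; its [eta a] component vanishes as well, and the square of [phi a] is minus the identity
    on the kernel of [eta a]. *)
Lemma br_xi_phi a X : br (xi a) (phi a X) = phi a (br (xi a) X).
Proof.
have := tq_normal Q a (xi a) X.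
rewrite te_xi scale0r addr0 /nij pxi !(br0l H) p0 subr0 addr0 -pB => E.
have := p2 a (phi a (br (xi a) X) - br (xi a) (phi a X)).
rewrite E p0 eB ephi eta_br_xi ephi (lr_der0 H) subrr scale0r addr0 => /esym/eqP.
by rewrite oppr_eq0 subr_eq0 => /eqP ->.
Qed.

(** Under [eta a], normality retains only the bracket of [phi a X] and [phi a Y] and the d eta
    term. *)
Lemma te_phi2 a X Y : teta a (phi a X) (phi a Y) = teta a X Y.
Proof.
have /(congr1 (eta a)) := tq_normal Q a X Y.
rewrite /nij !eD !eN !ephi eZ exi e0 mulr1 !oppr0 !addr0 add0r => /eqP.
rewrite addr_eq0 => /eqP E.
by rewrite {1}/te !ephi !(lr_der0 H) E; ring.
Qed.

Let te_lr a := te_linr H (aa_eta (A a)).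
Let te_C a X Y : teta a X Y = - teta a Y X := teC H (aa_eta (A a)) X Y.
Lemma te_r0 a X : teta a X 0 = 0.
Proof. by have := te_lr a 1 0 0 X; rewrite scale1r addr0 mul1r => /eqP; rewrite -subr_eq0 opprD addrA subrr sub0r oppr_eq0 => /eqP. Qed.
Lemma te_rZ a X t Y : teta a X (t *: Y) = t * teta a X Y.
Proof. by rewrite -[t *: Y]addr0 te_lr te_r0 addr0. Qed.

Lemma te_phiC a X Y : teta a (phi a X) Y = - teta a X (phi a Y).
Proof.
rewrite -te_phi2 p2 te_C addrC te_lr (te_C a (phi a Y) (xi a)) te_xi oppr0 mulr0 add0r.
rewrite -[- X]scaleN1r te_rZ (te_C a (phi a Y) X); ring.
Qed.

(** The Lie derivative of g along Z. *)
Definition lieg Z X Y := der Z (g X Y) - g (br Z X) Y - g X (br Z Y).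

Lemma lieg_linr Z X (t : O) Y Y' : lieg Z X (t *: Y + Y') = t * lieg Z X Y + lieg Z X Y'.
Proof.
by rewrite /lieg !(brDr H, brZr H) !mE (lr_derD H) (lr_derM H); ring.
Qed.

Lemma closed_expand a X Y Z :
  der X (g Y (phi a Z)) + der Y (g Z (phi a X)) + der Z (g X (phi a Y))
  = g (br X Y) (phi a Z) + g (br Y Z) (phi a X) + g (br Z X) (phi a Y).
Proof. by apply/eqP; rewrite -subr_eq0 !opprD !addrA; apply/eqP; exact: (tq_closed Q a X Y Z). Qed.

(** Closedness of Phi_a with first argument [xi a] kills the Lie derivative of g on pairs (X, phi_a
    Y); every Y is the sum of such a vector and a multiple of [xi a]. *)
Lemma killing a X Y : lieg (xi a) X Y = 0.
Proof.
have K X' Y' : lieg (xi a) X' (phi a Y') = 0.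
  have := closed_expand a (xi a) X' Y'.
  rewrite pxi !mE (lr_der0 H) (mC (xi a)) mxi ephi (lr_der0 H) !addr0.
  rewrite (brC H Y') mE -mphi -br_xi_phi (mC _ X') /lieg => ->.
  ring.
have -> : Y = (-1) *: phi a (phi a Y) + (eta a Y *: xi a + 0) by rewrite p2; vring.
rewrite !lieg_linr K {2}/lieg !mE (lr_der0 H) /lieg (brXX H) !mE !mxi (br0r H) !mE eta_br_xi; ring.
Qed.

Lemma der_xi_g a X Y : der (xi a) (g X Y) = g (br (xi a) X) Y + g X (br (xi a) Y).
Proof. by have := killing a X Y; rewrite /lieg => /eqP; rewrite -addrA -opprD subr_eq0 => /eqP. Qed.

(* The Lie derivative of phi_b along xi_a, for (a, b, c) a cyclic permutation. *)
Definition psi c Y := locked (br (xi (s c)) (phi (s (s c)) Y) - phi (s (s c)) (br (xi (s c)) Y)).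

Lemma psiE c Y : psi c Y = br (xi (s c)) (phi (s (s c)) Y) - phi (s (s c)) (br (xi (s c)) Y).
Proof. by rewrite /psi -lock. Qed.

(** Cartan's formula for the closed form Phi_b and the field xi_a, with (a, b, c) cyclic: the
    contraction is eta_c, and since xi_a is Killing the Lie derivative of Phi_b is g(., psi_c .). *)
Lemma psi_te c X Y : g X (psi c Y) = teta c X Y.
Proof.
have e : phi (s (s c)) (xi (s c)) = - xi c by have := phi_xi_ss (s (s c)); rewrite !s3.
have := closed_expand (s (s c)) (xi (s c)) X Y.
rewrite e der_xi_g (mC (xi _) (phi _ X)) mphi e !mE !mxi opprK (brC H Y) !mE -mphi.
rewrite psiE /te !mE !(lr_derN H) (mC (phi _ _)) => E.
apply/eqP; rewrite -subr_eq0; apply/eqP.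
move/eqP: E; rewrite -subr_eq0 => /eqP <-; ring.
Qed.

Lemma psiE2 c Y : psi c Y = phi (s c) (br (xi (s (s c))) Y) - br (xi (s (s c))) (phi (s c) Y).
Proof.
apply: m_ext => X; rewrite psi_te.
have e : phi (s c) (xi (s (s c))) = xi c by rewrite phi_xi_s s3.
have := closed_expand (s c) (xi (s (s c))) X Y.
rewrite e der_xi_g (mC (xi _) (phi _ X)) mphi e !mE !mxi (brC H Y) !mE -mphi.
rewrite /te !(lr_derN H) (mC (phi _ _)) => E.
apply/eqP; rewrite -subr_eq0; apply/eqP.
move/eqP: E; rewrite -subr_eq0 => /eqP <-; ring.
Qed.

Lemma psi_skew c X Y : g X (psi c Y) = - g (psi c X) Y.
Proof. by rewrite (mC (psi c X)) !psi_te te_C. Qed.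
Lemma psi_lin c : linear (psi c).
Proof. by move=> t X Y; apply: m_ext => Z; rewrite !mE !psi_te te_lr. Qed.
Lemma psiZ c t X : psi c (t *: X) = t *: psi c X.
Proof. by apply: m_ext => Z; rewrite !mE !psi_te te_rZ. Qed.
Lemma psiD c X Y : psi c (X + Y) = psi c X + psi c Y.
Proof. by rewrite -[X in psi c (X + _)]scale1r psi_lin scale1r. Qed.
Lemma psiN c X : psi c (- X) = - psi c X.
Proof. by rewrite -scaleN1r psiZ scaleN1r. Qed.
Lemma psi0 c : psi c 0 = 0.
Proof. by have := psiZ c 0 0; rewrite !scale0r. Qed.

Lemma psi_phi c X : psi c (phi c X) = phi c (psi c X).
Proof.
by apply: m_ext => Z; rewrite psi_te -[RHS]opprK -mphi psi_te te_phiC opprK.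
Qed.
Lemma psi_xi c : psi c (xi c) = 0.
Proof. by apply: m_ext => Z; rewrite psi_te te_C te_xi oppr0 mE. Qed.
Lemma eta_psi c X : eta c (psi c X) = 0.
Proof. by rewrite -mxi mC psi_te te_xi. Qed.

Definition ff c := eta c (br (xi (s c)) (xi (s (s c)))).

(* psi_c xi_c = 0 and [xi_a, xi_a] = 0 leave phi_b [xi_a, xi_c] = 0. *)
Lemma br_xi_s a : br (xi a) (xi (s a)) = ff (s (s a)) *: xi (s (s a)).
Proof.
have K c : phi (s (s c)) (br (xi c) (xi (s c))) = 0.
  have := psi_xi (s c); rewrite psiE2 s3.
  have -> : phi (s (s c)) (xi (s c)) = - xi c by have := phi_xi_ss (s (s c)); rewrite !s3.
  by rewrite (brNr H) (brXX H) oppr0 subr0.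
have := p2 (s (s a)) (br (xi a) (xi (s a))).
rewrite K p0 /ff s3 => /esym/eqP; rewrite addrC subr_eq0 => /eqP E.
exact: esym.
Qed.

Lemma br_xi_ss a : br (xi a) (xi (s (s a))) = - ff (s a) *: xi (s a).
Proof. by rewrite (brC H) -{2}(s3 a) br_xi_s s3 scaleNr. Qed.

(** Invariance of [phi (s b)] along its own Reeb field, tested on [xi (s (s b))], compares two of
    the brackets of Reeb fields. *)
Lemma ff_s a : ff (s a) = ff a.
Proof.
suff E b : ff (s (s b)) = ff b by rewrite -(E (s a)) s3.
have := br_xi_phi (s b) (xi (s (s b))).
rewrite phi_xi_s s3 br_xi_s s3 pZ.
have -> : br (xi (s b)) (xi b) = - (ff (s (s b)) *: xi (s (s b))) by rewrite (brC H) br_xi_s.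
have -> : phi (s b) (xi b) = - xi (s (s b)) by have := phi_xi_ss (s b); rewrite s3.
move=> /(congr1 (eta (s (s b)))).
by rewrite eN !eZ eN exi !mulr1 mulrN mulr1 => /oppr_inj.
Qed.

Lemma br_xi1 a : br (xi a) (xi (s a)) = ff a *: xi (s (s a)).
Proof. by rewrite br_xi_s !ff_s. Qed.
Lemma br_xi2 a : br (xi a) (xi (s (s a))) = - ff a *: xi (s a).
Proof. by rewrite br_xi_ss ff_s. Qed.

Lemma psi_xi1 c : psi c (xi (s c)) = ff c *: xi (s (s c)).
Proof.
rewrite psiE2 pxi (br0r H) subr0.
have -> : br (xi (s (s c))) (xi (s c)) = - (ff (s c) *: xi c) by rewrite (brC H) br_xi1 s3.
have -> : xi (s (s c)) = - phi (s c) (xi c) by have := phi_xi_ss (s c); rewrite s3 => ->; rewrite opprK.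
by rewrite pN pZ scalerN ff_s.
Qed.
Lemma psi_xi2 c : psi c (xi (s (s c))) = - ff c *: xi (s c).
Proof.
rewrite psiE pxi (br0r H) sub0r br_xi1 pZ.
by rewrite phi_xi_s !s3 ff_s scaleNr.
Qed.

Definition hor X := forall a, eta a X = 0.

Hypothesis T3 : forall a b : T, [\/ a = b, a = s b | a = s (s b)].

Lemma hor3 b X : eta b X = 0 -> eta (s b) X = 0 -> eta (s (s b)) X = 0 -> hor X.
Proof. by move=> h1 h2 h3 a; case: (T3 a b) => ->. Qed.

(** The field [xi a] is Killing and its brackets with the Reeb fields stay in their span, so it
    preserves the orthogonal complement of this span. *)
Lemma hor_br a X : hor X -> hor (br (xi a) X).
Proof.
move=> hX; apply: (@hor3 a).
- by rewrite eta_br_xi hX (lr_der0 H).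
- have := der_xi_g a X (xi (s a)).
  by rewrite mxi hX (lr_der0 H) br_xi1 !mE !mxi hX mulr0 addr0.
- have := der_xi_g a X (xi (s (s a))).
  by rewrite mxi hX (lr_der0 H) br_xi2 !mE !mxi hX mulr0 addr0.
Qed.

Lemma ffE a b : ff a = ff b.
Proof. by case: (T3 a b) => ->; rewrite ?ff_s. Qed.

Lemma etaxi_ss a : eta (s a) (xi a) = 0.
Proof. by have := eta_xi_ss (s a); rewrite s3. Qed.
Lemma etaxi_s a : eta (s (s a)) (xi a) = 0.
Proof. by have := eta_xi_s (s (s a)); rewrite s3. Qed.

Definition hpart b X := X - eta b X *: xi b - eta (s b) X *: xi (s b) - eta (s (s b)) X *: xi (s (s b)).
Lemma hor_hpart b X : hor (hpart b X).
Proof.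
have h := (eB, eZ, exi, eta_xi_s, eta_xi_ss, etaxi_s, etaxi_ss).
by rewrite /hpart; apply: (@hor3 b); rewrite !h; ring.
Qed.
Lemma hpartE b X : X = hpart b X + (eta b X *: xi b + (eta (s b) X *: xi (s b) + eta (s (s b)) X *: xi (s (s b)))).
Proof. by rewrite /hpart; vring. Qed.

(** In the Jacobi identity for the three Reeb fields each double bracket is a derivative of f times
    one of them; the [eta a] component isolates the derivative along [xi a]. *)
Lemma der_ff_xi c a : der (xi a) (ff c) = 0.
Proof.
have := jacobi H (xi a) (xi (s a)) (xi (s (s a))).
rewrite !br_xi1 br_xi2 s3 (ffE (s a) a) !(brZr H) (brZl H) !(brXX H) (lr_derN H) !scaler0 !sub0r !add0r.
move=> /(congr1 (eta a)).
by rewrite eD eN !eZ exi eta_xi_s eta_xi_ss !mulr0 mulr1 oppr0 addr0 (ffE a c).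
Qed.

(** For horizontal Y, the Jacobi identity of Y, xi_a and xi_b has eta_c component Y(f): all other
    terms are horizontal by [hor_br]. *)
Lemma der_ff c X : der X (ff c) = 0.
Proof.
suff K Y : hor Y -> der Y (ff c) = 0.
  have := hpartE c X; move: (hpart c X) (hor_hpart c X) => Y hY ->.
  by rewrite !(lr_addl H) !(lr_scale H) !der_ff_xi !mulr0 !addr0; exact: K.
move=> hY; have := jacobi H Y (xi (s c)) (xi (s (s c))).
rewrite br_xi1 s3 (ffE (s c) c) (brZr H) => /(congr1 (eta c)).
rewrite !eD !eZ exi mulr1.
have hb a Z : hor Z -> hor (br Z (xi a)) by move=> hZ b; rewrite (brC H) eN hor_br// oppr0.
by rewrite (hb _ _ hY) (hb _ _ (hb _ _ hY)) (hor_br _ (hb _ _ hY)) mulr0 !add0r.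
Qed.

Lemma hor_phi a X : hor X -> hor (phi a X).
Proof.
move=> hX; apply: (@hor3 a); first exact: ephi.
- by have := tq_eta2 Q a X; rewrite hX => /esym/eqP; rewrite oppr_eq0 => /eqP.
- by have := tq_eta1 Q (s (s a)) X; rewrite !s3 hX.
Qed.

Lemma hor_psi c X : hor X -> hor (psi c X).
Proof.
move=> hX; apply: (@hor3 c); first exact: eta_psi.
- by rewrite -mxi mC psi_skew psi_xi1 !mE mC mxi hX mulr0 oppr0.
- by rewrite -mxi mC psi_skew psi_xi2 !mE mC mxi hX mulr0 oppr0.
Qed.

Lemma phi1h a X : hor X -> phi (s (s a)) X = phi a (phi (s a) X).
Proof. by move=> hX; rewrite (tq_phi1 Q) hX scale0r subr0. Qed.
Lemma phi2h a X : hor X -> phi (s (s a)) X = - phi (s a) (phi a X).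
Proof. by move=> hX; rewrite (tq_phi2 Q) hX scale0r addr0. Qed.
Lemma p2h a X : hor X -> phi a (phi a X) = - X.
Proof. by move=> hX; rewrite p2 hX scale0r addr0. Qed.

(* With c = s (s a): differentiating phi_c = phi_a phi_b along xi_a. *)
Lemma psi_rot a X : hor X -> psi (s a) X = - phi a (psi (s (s a)) X).
Proof.
move=> hX; rewrite (psiE2 (s a)) (psiE (s (s a))) !s3 (phi1h a hX) (phi1h a (hor_br a hX)) br_xi_phi pB.
by vring.
Qed.
Lemma psi_rot2 a X : hor X -> psi (s (s a)) X = phi a (psi (s a) X).
Proof. by move=> hX; rewrite (psi_rot a hX) pN p2h ?opprK//; exact: hor_psi. Qed.
(** As for [psi_rot], now differentiating phi_b = phi_c phi_a along xi_a. *)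
Lemma psi_rot3 a X : hor X -> psi (s (s a)) X = - psi (s a) (phi a X).
Proof.
move=> hX; have := @phi1h (s (s a)); rewrite !s3 => E2.
have hb := hor_br a hX.
rewrite (psiE2 (s a)) (psiE (s (s a))) !s3 (E2 X)// (E2 (br _ X))// -br_xi_phi.
by vring.
Qed.
Lemma psi_rot4 a X : hor X -> psi (s a) X = psi (s (s a)) (phi a X).
Proof.
move=> hX; rewrite psi_rot3 ?p2h ?psiN ?opprK//; exact: hor_phi.
Qed.
(** Rotating the index shows that phi_c psi_c is on H one endomorphism for all c. *)
Lemma phi_psiE a X : hor X -> phi (s a) (psi (s a) X) = phi (s (s a)) (psi (s (s a)) X).
Proof.
move=> hX; by rewrite (psi_rot a hX) pN (phi2h _ (hor_psi _ hX)).
Qed.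

Lemma psi_sk c X Y : g X (psi c Y) = - g Y (psi c X).
Proof. by rewrite psi_skew mC. Qed.
Lemma phi_sk a X Y : g X (phi a Y) = - g Y (phi a X).
Proof. by rewrite -mphi mC. Qed.

Local Ltac rlin E := apply/eqP; rewrite -subr_eq0; apply/eqP; move/eqP: E;
  rewrite -subr_eq0 => /eqP E;
  first [by rewrite -[RHS]E; ring | by rewrite -[RHS]oppr0 -[in RHS]E; ring
       | by rewrite -[RHS]E; vring | by rewrite -[RHS]oppr0 -[in RHS]E; vring].

Lemma te_closed_psi c X Y Z :
  der X (g Y (psi c Z)) + der Y (g Z (psi c X)) + der Z (g X (psi c Y))
  = g (br X Y) (psi c Z) + g (br Y Z) (psi c X) + g (br Z X) (psi c Y).
Proof.
have := te_closed H (aa_eta (A c)) X Y Z; rewrite /te2 -!psi_te => E.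
by apply/eqP; rewrite -subr_eq0 !opprD !addrA; apply/eqP.
Qed.

(** Cartan's formula for d eta_a, whose contraction with [xi a] is 0; as [xi a] is Killing,
    invariance of the form is invariance of [psi a]. *)
Lemma lie_psi a Y : br (xi a) (psi a Y) = psi a (br (xi a) Y).
Proof.
apply: m_ext => X.
have E := te_closed_psi a (xi a) X Y.
rewrite (psi_sk _ (xi a) X) psi_xi der_xi_g (psi_sk _ (br Y (xi a)) X) (brC H Y (xi a)) psiN !mE in E.
by rewrite oppr0 !(lr_der0 H) in E; rlin E.
Qed.

(** With b = s a and c = s b, contracting 2 d eta_b with xi_a gives f eta_c, and f has zero
    derivative; hence the Lie derivative of 2 d eta_b along xi_a is f times 2 d eta_c. *)
Lemma lie_psi_s a Y : br (xi a) (psi (s a) Y) = psi (s a) (br (xi a) Y) + ff a *: psi (s (s a)) Y.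
Proof.
apply: m_ext => X.
have e : psi (s a) (xi a) = - ff a *: xi (s (s a)).
  by have := psi_xi2 (s a); rewrite s3 !ff_s.
have E := te_closed_psi (s a) (xi a) X Y.
rewrite (psi_sk _ (xi a) X) e der_xi_g (psi_sk _ (br Y (xi a)) X) (brC H Y (xi a)) psiN !mE in E.
rewrite !mxi !(lr_derN H) !(lr_derM H) !(lr_derN H) !der_ff in E.
rewrite !mE (psi_te (s (s a))) /te; rlin E.
Qed.

(** Differentiate phi_a psi_a = phi_b psi_b along xi_a. The left side is invariant; the right side
    gives psi_c psi_b from phi_b and f phi_b psi_c from psi_b. *)
Lemma psi_psi_h a X : hor X -> psi (s (s a)) (psi (s a) X) = - ff a *: phi (s a) (psi (s (s a)) X).
Proof.
move=> hX.
have hb := hor_br a hX.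
have E1 : br (xi a) (phi a (psi a X)) = br (xi a) (phi (s a) (psi (s a) X)).
  by have := phi_psiE (s (s a)) hX; rewrite s3 => ->.
have E2 := phi_psiE (s (s a)) hb; rewrite s3 in E2.
move: E1; rewrite br_xi_phi lie_psi E2.
have E3 := psiE (s (s a)) (psi (s a) X); rewrite !s3 in E3.
have -> : br (xi a) (phi (s a) (psi (s a) X)) =
   psi (s (s a)) (psi (s a) X) + phi (s a) (br (xi a) (psi (s a) X)) by rewrite E3; vring.
rewrite lie_psi_s pD pZ => E.
by rlin E.
Qed.

(** Evaluate [psi_psi_h] at phi_a X, with a = s c and b = s a; the rotation rules turn psi_b phi_a
    into -psi_c, psi_c phi_a into psi_b, and phi_b psi_b into phi_c psi_c. *)
Lemma psi2_h c X : hor X -> psi c (psi c X) = ff c *: phi c (psi c X).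
Proof.
move=> hX; have hp := hor_phi (s c) hX.
have := psi_psi_h (s c) hp; rewrite s3.
have := psi_rot4 (s c) hp; rewrite s3 p2h// psiN => ->.
have := psi_rot4 (s c) hX; rewrite s3 => <-.
have := phi_psiE (s c) hX; rewrite s3 => ->.
by rewrite ff_s psiN scaleNr => /oppr_inj.
Qed.

Lemma psi2 c X : psi c (psi c X) = ff c *: phi c (psi c X).
Proof.
have := hpartE c X; move: (hpart c X) (hor_hpart c X) => Y hY ->.
rewrite !(psiD, psiZ, pD, pZ, psi_xi, psi_xi1, psi_xi2, psi0, p0) psi2_h// phi_xi_s phi_xi_ss.
by vring.
Qed.

(* The closed form d eta_c - (f / 2) Phi_c has kernel {Z | psi_c Z = f phi_c Z}. *)
Lemma leaf_involutive c X Y : psi c X = ff c *: phi c X -> psi c Y = ff c *: phi c Y ->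
  psi c (br X Y) = ff c *: phi c (br X Y).
Proof.
move=> hX hY; apply: m_ext => Z.
have E2 := te_closed_psi c X Y Z; have E1 := closed_expand c X Y Z.
rewrite (psi_sk _ Y Z) (psi_sk _ _ Z) hX hY !mE !(lr_derM H, lr_derN H) !der_ff in E2.
rewrite (phi_sk _ Y Z) (phi_sk _ _ Z) !(lr_derN H) in E1.
(* Since f has zero derivative, subtracting f times the closedness of Phi_c expresses closedness of
   the combined form; X and Y lie in its kernel, so only the term in [X, Y] survives. *)
move: E2 (congr1 (fun t => ff c * t) E1) => /=.
set l2 := (X in X = _ -> _); set r2 := (X in _ = X -> _) => E2.
set l1 := (X in X = _ -> _); set r1 := (X in _ = X -> _) => {}E1.
have E : l2 - l1 = r2 - r1 by rewrite E1 E2.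
by rewrite /l2 /l1 /r2 /r1 in E; rewrite !mE; rlin E.
Qed.

(** The fields of E^{4m}; through [psi_te], vanishing of [psi c X] is vanishing of the contraction
    of d eta_c with X. *)
Definition transverse X := hor X /\ forall c, psi c X = 0.

Lemma transverse1 c X : hor X -> psi c X = 0 -> transverse X.
Proof.
move=> hX h; split=> // b; case: (T3 b c) => -> //.
  by have := psi_rot2 (s (s c)) hX; rewrite !s3 h p0.
by have := psi_rot (s c) hX; rewrite !s3 h p0 oppr0.
Qed.

(** The kernel of closed forms is stable under brackets, and eta_a of the bracket is minus 2 d
    eta_a(X, Y) = 0. *)
Lemma transverse_involutive X Y : transverse X -> transverse Y -> transverse (br X Y).
Proof.
move=> [hX pX] [hY pY]; split.
  move=> a; have := psi_te a X Y; rewrite pY mE /te hX hY !(lr_der0 H) subrr sub0r.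
  by move=> /esym/eqP; rewrite oppr_eq0 => /eqP.
move=> c; apply: m_ext => Z; have E := te_closed_psi c X Y Z.
rewrite (psi_sk _ Y Z) (psi_sk _ _ Z) pX pY !mE oppr0 !(lr_der0 H) !addr0 in E.
by rewrite mE -[LHS]opprK -E oppr0.
Qed.

Lemma transverse_phi a X : transverse X -> transverse (phi a X).
Proof.
by move=> [hX pX]; apply: (@transverse1 a); [exact: hor_phi|rewrite psi_phi pX p0].
Qed.

(* Hitchin's argument: closedness of the three 2-forms makes L_Z g and all L_Z phi_a vanish. *)
Section Basic.
Variable Z : V.
Hypothesis orth : forall X, transverse X -> g X Z = 0.

(** Closedness of Phi_a on (Z, X, Y): the terms pairing Z with a transverse field drop, including
    the one in [X, Y]. What remains says that the Lie derivative of Phi_a along Z vanishes on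
    E^{4m}. *)
Lemma lieg_phi a X Y : transverse X -> transverse Y ->
  lieg Z X (phi a Y) = - g X (br Z (phi a Y) - phi a (br Z Y)).
Proof.
move=> tX tY; have E := closed_expand a Z X Y.
have o W : transverse W -> g W (phi a Z) = 0.
  by move=> tW; rewrite phi_sk mC orth ?oppr0//; exact: transverse_phi.
rewrite (phi_sk a Z X) !o// in E; last exact: transverse_involutive.
rewrite oppr0 !(lr_der0 H) (phi_sk _ _ X) (brC H Y) pN in E.
by rewrite /lieg !mE in E *; rlin E.
Qed.

(** Write D_i for the Lie derivative of phi_i along Z. Since phi_c = phi_a phi_b, [lieg_phi] for c
    on (X, Y) and for a on (X, phi_b Y) have equal left sides, so g(X, phi_a D_b Y) = 0. By skewness
    and [lieg_phi] for b this is the claim on (phi_a X, phi_b Y), and such pairs exhaust E^{4m}. *)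
Lemma lieg_transverse X Y : transverse X -> transverse Y -> lieg Z X Y = 0.
Proof.
suff K X' Y' : transverse X' -> transverse Y' -> lieg Z (phi t0 X') (phi (s t0) Y') = 0.
  move=> tX tY.
  have := K _ _ (transverse_phi t0 tX) (transverse_phi (s t0) tY).
  rewrite !p2h; [|by case: tY|by case: tX].
  by rewrite /lieg !(brNr H) !mE !(lr_derN H) => <-; ring.
move=> tX tY.
have := lieg_phi (s (s t0)) tX tY.
have tb := transverse_phi (s t0) tY.
have hb : hor Y' by case: tY.
rewrite (phi1h t0 hb) (lieg_phi t0 tX tb) (tq_phi1 Q) !mE mxi => E.
have hX : hor X' by case: tX.
rewrite (lieg_phi (s t0) (transverse_phi t0 tX) tY) !mE !mphi.
by rewrite hX mulr0 in E; rlin E.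
Qed.

Lemma lie_phi_transverse a X Y : transverse X -> transverse Y ->
  g X (br Z (phi a Y) - phi a (br Z Y)) = 0.
Proof.
move=> tX tY; have := lieg_phi a tX tY; rewrite lieg_transverse//; last exact: transverse_phi.
by move=> /esym/eqP; rewrite oppr_eq0 => /eqP.
Qed.

End Basic.

End ThreeStructures.

(** * Fields on a chart domain *)

Section OpenSections.
Variables (R : realType) (N : nat) (M : manifold R N).

Lemma vsmooth_zero (p : M) : vsmooth_at (fun q => 0 : tangent q) p.
Proof.
move=> f sf; apply: (@smooth_ext _ _ _ (fun=> 0)); last exact: smooth_cst.
by apply: (@filterE _ _ (nbhs_filter p)) => x; rewrite tangent0E.
Qed.

(** Lying inside one chart domain, [W] carries coordinate functions that separate tangent vectors;
    this is what makes the action of fields on functions faithful. *)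
Record chart_open := ChartOpen {
  co_set :> M -> Prop;
  co_chart : chart R N M;
  co_atlas : atlas co_chart;
  co_open : open (co_set : set M);
  co_sub : forall q, co_set q -> cdom co_chart q }.

Variable W : chart_open.

Lemma co_near q : W q -> \forall x \near q, W x.
Proof. by move=> Wq; apply: open_nbhs_nbhs; split => //; exact: co_open. Qed.

(* Smooth functions and fields on W, extended by 0. *)
Record fnW := FnW {
  fnv :> M -> R;
  fn_smooth : forall q, W q -> smooth_at fnv q;
  fn_out : forall q, ~ W q -> fnv q = 0 }.

Record vfW := VfW {
  vfv :> forall q : M, tangent q;
  vf_smooth : forall q, W q -> vsmooth_at vfv q;
  vf_out : forall q, ~ W q -> vfv q = 0 }.

Lemma fn_eq (f g : fnW) : (forall q, W q -> f q = g q) -> f = g.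
Proof.
case: f g => [f sf f0] [g sg g0] /= E.
have {}E : f = g.
  by apply/funext => q; have [Wq|nW] := pselect (W q); [exact: E|rewrite f0// g0].
by subst g; congr FnW; exact: Prop_irrelevance.
Qed.

Lemma vf_eq (X Y : vfW) : (forall q, W q -> X q = Y q) -> X = Y.
Proof.
case: X Y => [f sf f0] [g sg g0] /= E.
have {}E : f = g.
  by apply: functional_extensionality_dep => q; have [Wq|nW] := pselect (W q); [exact: E|rewrite f0// g0].
by subst g; congr VfW; exact: Prop_irrelevance.
Qed.

(** Cutting to zero outside [W] turns equality on [W] into Leibniz equality, as the ring and module
    axioms demand. *)
Definition cut (f : M -> R) : M -> R := fun q => if `[< W q >] then f q else 0.
Definition vcut (X : vfield M) : vfield M := fun q => if `[< W q >] then X q else 0.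

Lemma cutE f q : W q -> cut f q = f q.
Proof. by move=> Wq; rewrite /cut asboolT. Qed.
Lemma vcutE X q : W q -> vcut X q = X q.
Proof. by move=> Wq; rewrite /vcut asboolT. Qed.
Lemma cut_near f q : W q -> \forall x \near q, f x = cut f x.
Proof. by move=> /co_near; apply: filterS => x Wx; rewrite cutE. Qed.
Lemma vcut_near X q : W q -> \forall x \near q, X x = vcut X x.
Proof. by move=> /co_near; apply: filterS => x Wx; rewrite vcutE. Qed.

Lemma cut_smooth f : (forall q, W q -> smooth_at f q) -> forall q, W q -> smooth_at (cut f) q.
Proof. by move=> sf q Wq; apply: smooth_ext (cut_near f Wq) (sf _ Wq). Qed.
Lemma vcut_smooth X : (forall q, W q -> vsmooth_at X q) -> forall q, W q -> vsmooth_at (vcut X) q.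
Proof. by move=> sf q Wq; apply: vsmooth_ext (vcut_near X Wq) (sf _ Wq). Qed.
Lemma cut_out f q : ~ W q -> cut f q = 0.
Proof. by move=> nW; rewrite /cut asboolF. Qed.
Lemma vcut_out X q : ~ W q -> vcut X q = 0.
Proof. by move=> nW; rewrite /vcut asboolF. Qed.

Definition fn_cut f sf := FnW (@cut_smooth f sf) (@cut_out f).
Definition vf_cut X sX := VfW (@vcut_smooth X sX) (@vcut_out X).

Definition fn_zero := FnW (fun q _ => smooth_cst 0 q) (fun q _ => erefl : (fun=> 0 : R) q = 0).
Program Definition fn_add (f g : fnW) := @FnW (fun q => f q + g q) _ _.
Next Obligation. move=> * /=; by apply: smooth_add; exact: fn_smooth. Qed.
Next Obligation. move=> * /=; by rewrite !fn_out// addr0. Qed.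
Program Definition fn_opp (f : fnW) := @FnW (fun q => - f q) _ _.
Next Obligation. move=> * /=; by apply: smooth_opp; exact: fn_smooth. Qed.
Next Obligation. move=> * /=; by rewrite !fn_out// oppr0. Qed.
Program Definition fn_mul (f g : fnW) := @FnW (fun q => f q * g q) _ _.
Next Obligation. move=> * /=; by apply: smooth_mul; exact: fn_smooth. Qed.
Next Obligation. move=> * /=; by rewrite !fn_out// mulr0. Qed.
Definition fn_cst (a : R) := @fn_cut (fun=> a) (fun q _ => smooth_cst a q).

Definition vf_zero := VfW (fun q _ => @vsmooth_zero q) (fun q _ => erefl : (fun q => 0 : tangent q) q = 0).
Program Definition vf_add (X Y : vfW) := @VfW (vadd X Y) _ _.
Next Obligation. move=> * /=; by apply: vsmooth_add; exact: vf_smooth. Qed.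
Next Obligation. move=> * /=; by rewrite /vadd !vf_out// addr0. Qed.
Program Definition vf_scale (f : fnW) (X : vfW) := @VfW (vscale f X) _ _.
Next Obligation. move=> * /=; by apply: vsmooth_scale; [exact: fn_smooth|exact: vf_smooth]. Qed.
Next Obligation. move=> * /=; by rewrite /vscale !vf_out// scaler0. Qed.
Program Definition vf_opp (X : vfW) := @VfW (vscale (fun=> -1) X) _ _.
Next Obligation. move=> * /=; by apply: vsmooth_scale; [exact: smooth_cst|exact: vf_smooth]. Qed.
Next Obligation. move=> * /=; by rewrite /vscale !vf_out// scaler0. Qed.

HB.instance Definition _ := gen_eqMixin fnW.
HB.instance Definition _ := gen_choiceMixin fnW.
HB.instance Definition _ := gen_eqMixin vfW.
HB.instance Definition _ := gen_choiceMixin vfW.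

Fact fn_addA : associative fn_add.
Proof. by move=> f g h; apply: fn_eq => q _ /=; rewrite addrA. Qed.
Fact fn_addC : commutative fn_add.
Proof. by move=> f g; apply: fn_eq => q _ /=; rewrite addrC. Qed.
Fact fn_add0 : left_id fn_zero fn_add.
Proof. by move=> f; apply: fn_eq => q _ /=; rewrite add0r. Qed.
Fact fn_addN : left_inverse fn_zero fn_opp fn_add.
Proof. by move=> f; apply: fn_eq => q _ /=; rewrite addNr. Qed.
HB.instance Definition _ := GRing.isZmodule.Build fnW fn_addA fn_addC fn_add0 fn_addN.

Fact fn_mulA : associative fn_mul.
Proof. by move=> f g h; apply: fn_eq => q _ /=; rewrite mulrA. Qed.
Fact fn_mulC : commutative fn_mul.
Proof. by move=> f g; apply: fn_eq => q _ /=; rewrite mulrC. Qed.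
Fact fn_mul1 : left_id (fn_cst 1) fn_mul.
Proof. by move=> f; apply: fn_eq => q Wq /=; rewrite cutE// mul1r. Qed.
Fact fn_mulD : left_distributive fn_mul fn_add.
Proof. by move=> f g h; apply: fn_eq => q _ /=; rewrite mulrDl. Qed.
HB.instance Definition _ := GRing.Zmodule_isComPzRing.Build fnW fn_mulA fn_mulC fn_mul1 fn_mulD.

Fact vf_addA : associative vf_add.
Proof. by move=> f g h; apply: vf_eq => q _ /=; rewrite /vadd addrA. Qed.
Fact vf_addC : commutative vf_add.
Proof. by move=> f g; apply: vf_eq => q _ /=; rewrite /vadd addrC. Qed.
Fact vf_add0 : left_id vf_zero vf_add.
Proof. by move=> f; apply: vf_eq => q _ /=; rewrite /vadd add0r. Qed.
Fact vf_addN : left_inverse vf_zero vf_opp vf_add.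
Proof. by move=> f; apply: vf_eq => q _ /=; rewrite /vadd /vscale scaleN1r addNr. Qed.
HB.instance Definition _ := GRing.isZmodule.Build vfW vf_addA vf_addC vf_add0 vf_addN.

Fact vf_scaleA (a b : fnW) (X : vfW) : vf_scale a (vf_scale b X) = vf_scale (a * b) X.
Proof. by apply: vf_eq => q _ /=; rewrite /vscale scalerA. Qed.
Fact vf_scale1 : left_id 1 vf_scale.
Proof. by move=> X; apply: vf_eq => q Wq /=; rewrite /vscale cutE// scale1r. Qed.
Fact vf_scaleDr : right_distributive vf_scale +%R.
Proof. by move=> a X Y; apply: vf_eq => q _ /=; rewrite /vadd /vscale scalerDr. Qed.
Fact vf_scaleDl (X : vfW) : {morph vf_scale^~ X : a b / a + b}.
Proof. by move=> a b; apply: vf_eq => q _ /=; rewrite /vadd /vscale scalerDl. Qed.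
HB.instance Definition _ := GRing.Zmodule_isLmodule.Build fnW vfW vf_scaleA vf_scale1 vf_scaleDr vf_scaleDl.

Program Definition derW (X : vfW) (a : fnW) : fnW := @FnW (fun q => X q a) _ _.
Next Obligation. move=> * /=; by apply: vf_smooth => //; exact: fn_smooth. Qed.
Next Obligation. move=> * /=; by rewrite vf_out// tangent0E. Qed.

Program Definition brW (X Y : vfW) : vfW := @VfW (bracket X Y) _ _.
Next Obligation. move=> * /=; by apply: vsmooth_bracket; exact: vf_smooth. Qed.
Next Obligation.
move=> X Y q nW /=; apply: tangent_ext => f sf; rewrite tangent0E /= /bracket_val.
by case: ifP => // _; rewrite !vf_out// !tangent0E subrr.
Qed.

Lemma lie_rinehartW : lie_rinehart derW brW.
Proof.
split.
- move=> a aa; apply: fn_eq => q Wq /=.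
  have := congr1 (fun f : fnW => f q) aa => /= /eqP; rewrite mulf_eq0 orbb => /eqP.
  by [].
- by move=> X a b; apply: fn_eq => q Wq /=; rewrite tangent_add//; exact: fn_smooth.
- by move=> X a b; apply: fn_eq => q Wq /=; rewrite tangent_mul//; exact: fn_smooth.
- by move=> X Y a; apply: fn_eq => q Wq.
- by move=> a X b; apply: fn_eq => q Wq.
- move=> X Y a; apply: fn_eq => q Wq /=; rewrite -bracketE//; [exact: vf_smooth..|exact: fn_smooth].
- move=> X Y XY; apply: vf_eq => q Wq.
  have cq := co_sub Wq; apply: (tcoord_inj (co_atlas W) cq).
  apply/rowP => i; rewrite !mxE.
  have sc x : W x -> smooth_at (coord (co_chart W) i) x.
    by move=> Wx; apply: smooth_coord; [exact: co_atlas|exact: co_sub].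
  have := congr1 (fun f : fnW => f q) (XY (fn_cut sc)) => /= E.
  by rewrite !(tangent_near _ (sc q Wq) (cut_near _ Wq)).
Qed.

End OpenSections.

Definition rot3 : 'I_3 -> 'I_3 := @ordS 3.

Lemma rot3K a : rot3 (rot3 (rot3 a)) = a.
Proof. by case: a => [[|[|[|//]]] h]; apply: val_inj. Qed.

Lemma rot3P (a b : 'I_3) : [\/ a = b, a = rot3 b | a = rot3 (rot3 b)].
Proof.
by case: a b => [[|[|[|//]]] h] [[|[|[|//]]] h'];
  [constructor 1|constructor 3|constructor 2|constructor 2|constructor 1|constructor 3
  |constructor 3|constructor 2|constructor 1]; apply: val_inj.
Qed.

Lemma rot3_inj : injective rot3.
Proof. by move=> a b /(congr1 (rot3 \o rot3)) /=; rewrite !rot3K. Qed.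

Definition rot3_perm : 'S_3 := perm rot3_inj.

Lemma rot3_even : odd_perm rot3_perm = false.
Proof.
have E : (rot3_perm * rot3_perm * rot3_perm = 1)%g.
  by apply/permP => a; rewrite !permM perm1 !permE rot3K.
by have := congr1 (@odd_perm _) E; rewrite !odd_permM odd_perm1 addbb.
Qed.

(** Links the relations stated over even permutations to the cyclic form used in the algebra: every
    rotation is such a permutation, having order dividing three. *)
Lemma even_rot3 (a : 'I_3) : exists s : 'S_3,
  [/\ ~~ odd_perm s, s (inord 0) = a, s (inord 1) = rot3 a & s (inord 2) = rot3 (rot3 a)].
Proof.
have e1 : inord 1 = rot3 (inord 0) by apply: val_inj; rewrite /= !inordK.
have e2 : inord 2 = rot3 (rot3 (inord 0)) by apply: val_inj; rewrite /= !inordK.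
case: (rot3P a (inord 0)) => ->.
- by exists 1%g; rewrite odd_perm1 !perm1 e2 e1.
- by exists rot3_perm; rewrite rot3_even !permE e1 e2.
- by exists (rot3_perm * rot3_perm)%g; rewrite odd_permM rot3_even !permM !permE e1 e2.
Qed.

(** * The given structure as a model of the algebra *)

Section Structure.
Variables (R : realType) (N : nat) (M : manifold R N) (S : acm3 M).

(** The 3-quasi-Sasakian conditions freed from the dimension 4n + 3; the dimension comes back in the
    final rank count. *)
Record quasi3 : Prop := Quasi3 {
  q3_rel : three_contact_relations S;
  q3_qs : forall a, quasi_Sasakian (acm_of S a) }.

Hypothesis Q : quasi3.

Local Notation phi := (phi3 S).
Local Notation xi := (xi3 S).
Local Notation eta := (eta3 S).
Local Notation g := (g3 S).

Lemma q3_acm a : almost_contact_metric (acm_of S a).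
Proof. by case: (q3_qs Q a). Qed.

Lemma phi_smooth a : smooth_tensor11 (phi a). Proof. by case: (q3_acm a). Qed.
Lemma xi_smooth a : vsmooth (xi a). Proof. by case: (q3_acm a). Qed.
Lemma eta_smooth a : smooth_oneform (eta a). Proof. by case: (q3_acm a). Qed.
Lemma g_riem : riemannian_metric g. Proof. by case: (q3_acm ord0). Qed.
Lemma acm_pt a p :
  [/\ forall v, phi a p (phi a p v) = - v + eta a p v *: xi a p,
      eta a p (xi a p) = 1
    & forall v w, g p (phi a p v) (phi a p w) = g p v w - eta a p v * eta a p w].
Proof. by case: (q3_acm a) => _ _ _ _; exact. Qed.

Lemma relP a p :
  [/\ forall v, phi (rot3 (rot3 a)) p v = phi a p (phi (rot3 a) p v) - eta (rot3 a) p v *: xi a p,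
      forall v, phi (rot3 (rot3 a)) p v = - phi (rot3 a) p (phi a p v) + eta a p v *: xi (rot3 a) p,
      xi (rot3 (rot3 a)) p = phi a p (xi (rot3 a) p) /\ xi (rot3 (rot3 a)) p = - phi (rot3 a) p (xi a p)
    & forall v, eta (rot3 (rot3 a)) p v = eta a p (phi (rot3 a) p v) /\
                eta (rot3 (rot3 a)) p v = - eta (rot3 a) p (phi a p v)].
Proof.
have [s [es s0 s1 s2]] := even_rot3 a.
have := q3_rel Q; case: S => ph x et gg /= /(_ s es p) /=.
by rewrite s0 s1 s2.
Qed.

Lemma phi_lin a p : linear (phi a p). Proof. by case: (phi_smooth a p). Qed.
Lemma vsmooth_phi a X p : vsmooth_at X p -> vsmooth_at (tapp (phi a) X) p.
Proof. by case: (phi_smooth a p) => _; exact. Qed.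
Lemma eta_lin a p (t : R) v w : eta a p (t *: v + w) = t * eta a p v + eta a p w.
Proof. by case: (eta_smooth a p) => h _; exact: h. Qed.
Lemma smooth_eta a X p : vsmooth_at X p -> smooth_at (fun q => eta a q (X q)) p.
Proof. by case: (eta_smooth a p) => _; exact. Qed.
Lemma smooth_g X Y p : vsmooth_at X p -> vsmooth_at Y p -> smooth_at (fun q => g q (X q) (Y q)) p.
Proof. by case: (g_riem p) => _ _ _; exact. Qed.
Lemma g_sym p v w : g p v w = g p w v. Proof. by case: (g_riem p). Qed.
Lemma g_lin p (t : R) u v w : g p (t *: u + v) w = t * g p u w + g p v w.
Proof. by rewrite !(g_sym _ w); case: (g_riem p) => _ h _ _; exact: h. Qed.

Lemma real_reduced (a : R) : a * a = 0 -> a = 0.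
Proof. by move=> /eqP; rewrite mulf_eq0 orbb => /eqP. Qed.

Lemma acm_alg_pt a p : acm_alg (phi a p) (xi a p) (eta a p) (g p).
Proof.
have [h1 h2 h3] := acm_pt a p; split => //.
- exact: phi_lin.
- exact: eta_lin.
- exact: g_sym.
- exact: g_lin.
- move=> X h; apply/eqP/negP => /negP X0; have [_ _ /(_ X X0)] := g_riem p.
  by rewrite h ltxx.
Qed.

Variable W : chart_open M.

Program Definition phiW a (X : vfW W) : vfW W := @VfW _ _ _ W (tapp (phi a) X) _ _.
Next Obligation. by move=> a X q Wq; apply: vsmooth_phi; exact: vf_smooth. Qed.
Next Obligation. by move=> a X q nW; rewrite /tapp vf_out// (aphi0 (acm_alg_pt a q)). Qed.
Program Definition etaW a (X : vfW W) : fnW W := @FnW _ _ _ W (fun q => eta a q (X q)) _ _.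
Next Obligation. by move=> a X q Wq; apply: smooth_eta; exact: vf_smooth. Qed.
Next Obligation. by move=> a X q nW; rewrite /= vf_out// (aeta0 (acm_alg_pt a q)). Qed.
Program Definition gW (X Y : vfW W) : fnW W := @FnW _ _ _ W (fun q => g q (X q) (Y q)) _ _.
Next Obligation. by move=> X Y q Wq; apply: smooth_g; exact: vf_smooth. Qed.
Next Obligation. by move=> X Y q nW; rewrite /= vf_out// (ag0l (acm_alg_pt ord0 q)). Qed.
Definition xiW a : vfW W := vf_cut (fun q (_ : W q) => @xi_smooth a q).

Lemma acm_algW a : acm_alg (phiW a) (xiW a) (etaW a) gW.
Proof.
split.
- by move=> f X Y; apply: vf_eq => q Wq /=; rewrite /tapp /vadd /vscale phi_lin.
- by move=> f X Y; apply: fn_eq => q Wq /=; rewrite /tapp /vadd /vscale eta_lin.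
- by move=> X Y; apply: fn_eq => q Wq /=; rewrite g_sym.
- by move=> f X Y Z; apply: fn_eq => q Wq /=; rewrite /tapp /vadd /vscale g_lin.
- move=> X h; apply: vf_eq => q Wq /=.
  have := congr1 (fun f : fnW W => f q) (h X) => /= h0.
  apply/eqP/negP => /negP X0; have [_ _ /(_ _ X0)] := g_riem q.
  by rewrite h0 ltxx.
- move=> X; apply: vf_eq => q Wq /=; have [h _ _] := acm_pt a q.
  by rewrite /tapp h /vadd /vscale scaleN1r vcutE.
- by apply: fn_eq => q Wq /=; have [_ h _] := acm_pt a q; rewrite !vcutE ?cutE.
- by move=> X Y; apply: fn_eq => q Wq /=; have [_ _ h] := acm_pt a q; rewrite /tapp h.
Qed.

Lemma three_qsW : three_qs (@derW _ _ _ W) (@brW _ _ _ W) rot3 phiW xiW etaW gW.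
Proof.
split.
- exact: rot3K.
- exact: acm_algW.
- move=> a X; apply: vf_eq => q Wq /=; have [h _ _ _] := relP a q.
  by rewrite /tapp h /vadd /vscale scaleN1r vcutE.
- move=> a X; apply: vf_eq => q Wq /=; have [_ h _ _] := relP a q.
  by rewrite /tapp h /vadd /vscale scaleN1r vcutE.
- by move=> a; apply: vf_eq => q Wq /=; have [_ _ [h _] _] := relP a q; rewrite /tapp !vcutE.
- move=> a; apply: vf_eq => q Wq /=; have [_ _ [_ h] _] := relP a q.
  by rewrite /tapp /vscale scaleN1r !vcutE.
- by move=> a X; apply: fn_eq => q Wq /=; have [_ _ _ h] := relP a q; have [h1 h2] := h (X q); rewrite /tapp h1.
- by move=> a X; apply: fn_eq => q Wq /=; have [_ _ _ h] := relP a q; have [h1 h2] := h (X q); rewrite /tapp h2.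
- move=> a X Y; apply: vf_eq => q Wq /=.
  have [_ h _] := q3_qs Q a; have := h q X Y (vf_smooth X Wq) (vf_smooth Y Wq).
  rewrite /nijenhuis /vadd /vscale /tapp !scaleN1r vcutE//= /d1 /=.
  move=> <-; congr (_ + _ *: _).
  by rewrite mulrA divff// mul1r.
- move=> a X Y Z; apply: fn_eq => q Wq /=.
  have [_ _ h] := q3_qs Q a.
  have := h q X Y Z (vf_smooth X Wq) (vf_smooth Y Wq) (vf_smooth Z Wq).
  rewrite /d2 /fundamental_form /= => /eqP; rewrite mulf_eq0 invr_eq0 pnatr_eq0 /= => /eqP.
  by [].
Qed.

End Structure.

(** * From identities of fields to identities of tensors *)

Section Pointwise.
Variables (R : realType) (N : nat) (M : manifold R N) (S : acm3 M).
Hypothesis Q : quasi3 S.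

Local Notation phi := (phi3 S).
Local Notation xi := (xi3 S).
Local Notation eta := (eta3 S).
Local Notation g := (g3 S).
Local Notation s := rot3.

Lemma chart_open_exists p (P : M -> Prop) : (\forall q \near p, P q) ->
  exists W : chart_open M, W p /\ forall q, W q -> P q.
Proof.
move=> H; have := H : nbhs p P; rewrite nbhsE => -[U [oU Up] UP].
have [c ac cp] := atlas_cover p.
have oUc : open (U `&` cdom c) by apply: openI => //; exact: cdom_open.
have sub q : (U `&` cdom c) q -> cdom c q by case.
by exists (ChartOpen ac oUc sub); split => // q [/UP].
Qed.

Section OnW.
Variable W : chart_open M.
Definition psiW c (X : vfW W) : vfW W := psi (@brW _ _ _ W) s (@phiW _ _ _ _ Q W) (xiW Q W) c X.
Definition ffW c : fnW W := ff (@brW _ _ _ W) s (xiW Q W) (@etaW _ _ _ _ Q W) c.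

(** The Lie derivative applied to a field, before it is known to depend on the value of the field at
    the point alone. *)
Definition psi_form c (X : vfield M) : vfield M := fun p =>
  bracket (xi (s c)) (tapp (phi (s (s c))) X) p - phi (s (s c)) p (bracket (xi (s c)) X p).

Lemma nbhs_refl (X : vfield M) (p : M) : \forall q \near p, X q = X q.
Proof. exact: (@filterE _ _ (nbhs_filter p)). Qed.

Lemma br_xiW a (X : vfW W) q : W q -> bracket (vcut W (xi a)) X q = bracket (xi a) X q.
Proof.
move=> Wq; apply/esym/bracket_near; [exact: xi_smooth|exact: vf_smooth|exact: vcut_near|].
exact: nbhs_refl.
Qed.

Lemma psiWE c (X : vfW W) q : W q -> psiW c X q = psi_form c X q.
Proof.
move=> Wq; rewrite /psiW psiE /psi_form /= /vadd /vscale scaleN1r /tapp.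
by rewrite -(@br_xiW (s c) (phiW Q (s (s c)) X) q Wq) -(@br_xiW (s c) X q Wq).
Qed.

Lemma ffWE c q : W q -> ffW c q = eta c q (bracket (xi (s c)) (xi (s (s c))) q).
Proof.
move=> Wq; rewrite /ffW /ff /=; congr (eta c q _).
rewrite (@br_xiW (s c) (xiW Q W (s (s c))) q Wq).
by apply/esym/bracket_near; [exact: xi_smooth|exact: xi_smooth|exact: nbhs_refl|exact: vcut_near].
Qed.
End OnW.

Lemma fields3 p X Y Z : vsmooth_at X p -> vsmooth_at Y p -> vsmooth_at Z p ->
  exists (W : chart_open M) (X' Y' Z' : vfW W), W p /\
    forall q, W q -> [/\ X' q = X q, Y' q = Y q & Z' q = Z q].
Proof.
move=> sX sY sZ.
have H : \forall q \near p, [/\ vsmooth_at X q, vsmooth_at Y q & vsmooth_at Z q].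
  have h1 := vsmooth_near sX; have h2 := vsmooth_near sY; have h3 := vsmooth_near sZ.
  by near=> q; split; near: q.
have [W [Wp HW]] := chart_open_exists H.
have sX' q : W q -> vsmooth_at X q by case/HW.
have sY' q : W q -> vsmooth_at Y q by case/HW.
have sZ' q : W q -> vsmooth_at Z q by case/HW.
exists W, (vf_cut sX'), (vf_cut sY'), (vf_cut sZ'); split => // q Wq.
by split; rewrite /= vcutE.
Unshelve. all: by end_near. Qed.

Lemma eqW_near (W : chart_open M) (X X' : vfield M) p : W p -> (forall q, W q -> X' q = X q) ->
  \forall q \near p, X q = X' q.
Proof. by move=> Wp E; apply: filterS (co_near Wp) => q /E. Qed.

Lemma psi_form_near c X Y p : vsmooth_at X p -> (\forall q \near p, X q = Y q) ->
  psi_form c X p = psi_form c Y p.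
Proof.
move=> sX XY; rewrite /psi_form.
rewrite (bracket_near (@xi_smooth _ _ _ _ Q (s c) p) sX (nbhs_refl _ _) XY).
by rewrite (bracket_near (@xi_smooth _ _ _ _ Q (s c) p) (vsmooth_phi Q _ sX) (nbhs_refl _ _) (tapp_near _ XY)).
Qed.

Lemma psi_form_te c X Y p : vsmooth_at X p -> vsmooth_at Y p ->
  g p (X p) (psi_form c Y p) = 2 * d1 (eta c) X Y p.
Proof.
move=> sX sY; have [W [X' [Y' [Z' [Wp E]]]]] := fields3 sX sY sY.
have E1 q : W q -> X' q = X q by case/E.
have E2 q : W q -> Y' q = Y q by case/E.
have := congr1 (fun f : fnW W => f p) (psi_te (lie_rinehartW W) ord0 (three_qsW Q W) c X' Y') => /=.
rewrite -/(psiW c Y') psiWE// E1// (psi_form_near c sY (eqW_near Wp E2)) => ->.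
rewrite (d1_near (eta_smooth Q c) sX sY (eqW_near Wp E1) (eqW_near Wp E2)) /d1 mulrA divff// mul1r.
by rewrite (E1 p Wp).
Qed.

Definition ext p (v : tangent p) : vfield M := sval (cid (vfield_extension v)).
Lemma ext_smooth p (v : tangent p) : vsmooth_at (ext v) p.
Proof. by rewrite /ext; case: cid => X []. Qed.
Lemma extE p (v : tangent p) : ext v p = v.
Proof. by rewrite /ext; case: cid => X []. Qed.

Definition psiT c : tensor11 M := fun p v => locked (psi_form c (ext v) p).
Arguments psiT c p v : clear implicits.

Lemma g_ext p (v w : tangent p) : (forall u, g p u v = g p u w) -> v = w.
Proof. exact: (ag_ext (acm_alg_pt Q ord0 p)). Qed.

(** Metric products with [psi_form] are values of d eta, which is tensorial; nondegeneracy of g then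
    gives independence of the extension. *)
Lemma psiTE c X p : vsmooth_at X p -> psiT c p (X p) = psi_form c X p.
Proof.
move=> sX; apply: g_ext => u; rewrite /psiT -lock -{1 2}(extE u).
rewrite !psi_form_te//; try exact: ext_smooth.
congr (2 * _); apply: d1_tensor => //; try exact: ext_smooth.
- exact: eta_smooth.
- exact: extE.
Qed.

Lemma psiT_te c X Y p : vsmooth_at X p -> vsmooth_at Y p ->
  g p (X p) (psiT c p (Y p)) = 2 * d1 (eta c) X Y p.
Proof. by move=> sX sY; rewrite psiTE// psi_form_te. Qed.

Lemma psiT_smooth c : smooth_tensor11 (psiT c).
Proof.
move=> p; split.
  move=> t v w; apply: g_ext => u; rewrite -{1 2}(extE u).
  pose X := vadd (vscale (fun=> t) (ext v)) (ext w).
  have su := ext_smooth u; have sv := ext_smooth v; have sw := ext_smooth w.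
  have sX : vsmooth_at X p by apply: vsmooth_add => //; apply: vsmooth_scale => //; exact: smooth_cst.
  have -> : t *: v + w = X p by rewrite /X /vadd /vscale !extE.
  rewrite psiT_te// d1_linr//; [|exact: eta_smooth|exact: smooth_cst].
  rewrite (agDr (acm_alg_pt Q ord0 p)) (agZr (acm_alg_pt Q ord0 p)) -{2}(extE v) -{2}(extE w).
  by rewrite !psiT_te//; ring.
move=> X sX; apply: (@vsmooth_ext _ _ _ (psi_form c X)).
  by have H := vsmooth_near sX; apply: filterS H => q sq; rewrite /tapp psiTE.
rewrite /psi_form; apply: (@vsmooth_ext _ _ _ (vadd (bracket (xi (s c)) (tapp (phi (s (s c))) X))
   (vscale (fun=> -1) (tapp (phi (s (s c))) (bracket (xi (s c)) X))))).
  by apply: (@filterE _ _ (nbhs_filter p)) => q; rewrite /vadd /vscale scaleN1r.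
apply: vsmooth_add.
  by apply: vsmooth_bracket; [exact: xi_smooth|exact: vsmooth_phi].
apply: vsmooth_scale; first exact: smooth_cst.
by apply: vsmooth_phi => //; apply: vsmooth_bracket => //; exact: xi_smooth.
Qed.

Lemma psiTWE (W : chart_open M) c (X : vfW W) q : W q -> psiW c X q = psiT c q (X q).
Proof. by move=> Wq; rewrite psiWE// psiTE//; exact: vf_smooth. Qed.

(** The index is immaterial by [ffE]; fixing it once makes f a single globally defined smooth
    function. *)
Definition fT p : R := eta ord0 p (bracket (xi (s ord0)) (xi (s (s ord0))) p).

Lemma ffWT (W : chart_open M) c q : W q -> ffW W c q = fT q.
Proof.
move=> Wq; have := ffE (lie_rinehartW W) ord0 (three_qsW Q W) rot3P c ord0.
by move=> /(congr1 (fun f : fnW W => f q)); rewrite -/(ffW W c) -/(ffW W _) => ->; rewrite ffWE.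
Qed.

Lemma W_exists p : exists W : chart_open M, W p.
Proof.
have [W [Wp _]] := chart_open_exists (@filterE _ _ (nbhs_filter p) (fun=> True) (fun=> I)).
by exists W.
Qed.

Lemma smooth_fT p : smooth_at fT p.
Proof.
by apply: (smooth_eta Q); apply: vsmooth_bracket; exact: xi_smooth.
Qed.

Lemma field1 p (v : tangent p) : exists (W : chart_open M) (X : vfW W), W p /\ X p = v.
Proof.
have sv := ext_smooth v; have [W [X [Y [Z [Wp E]]]]] := fields3 sv sv sv.
by exists W, X; split => //; case: (E p Wp) => -> _ _; exact: extE.
Qed.

Lemma fT_const p (v : tangent p) : v fT = 0.
Proof.
have [W [X [Wp <-]]] := field1 v.
have := der_ff (lie_rinehartW W) ord0 (three_qsW Q W) rot3P ord0 X.
rewrite -/(ffW W _); have e q : W q -> ffW W ord0 q = fT q := @ffWT W ord0 q.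
move: (ffW W ord0) e => fw e /(congr1 (fun f : fnW W => f p)) /= <-.
apply: tangent_near; first exact: smooth_fT.
by apply: filterS (co_near Wp) => q Wq; rewrite e.
Qed.

Lemma psiT_skew c p v w : g p v (psiT c p w) = - g p w (psiT c p v).
Proof.
rewrite -{1 2}(extE v) -{1 2}(extE w) !psiT_te//; try exact: ext_smooth.
by rewrite d1C ?mulrN//; exact: eta_smooth.
Qed.
Lemma psiT_lin c p : linear (psiT c p). Proof. by case: (psiT_smooth c p). Qed.

Lemma psiT_phi c p v : psiT c p (phi c p v) = phi c p (psiT c p v).
Proof.
have [W [X [Wp <-]]] := field1 v.
have := psi_phi (lie_rinehartW W) ord0 (three_qsW Q W) c X.
by move=> /(congr1 (fun X : vfW W => X p)) /=; rewrite /tapp -!/(psiW _ _) !psiTWE.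
Qed.

Lemma psiT_xi c p : psiT c p (xi c p) = 0.
Proof.
have [W Wp] := W_exists p.
have := psi_xi (lie_rinehartW W) ord0 (three_qsW Q W) c.
by move=> /(congr1 (fun X : vfW W => X p)) /=; rewrite -!/(psiW _ _) !psiTWE//= vcutE.
Qed.
Lemma psiT_xi1 c p : psiT c p (xi (s c) p) = fT p *: xi (s (s c)) p.
Proof.
have [W Wp] := W_exists p.
have := psi_xi1 (lie_rinehartW W) ord0 (three_qsW Q W) c.
rewrite -/(ffW W _); have := ffWT c Wp; move: (ffW W c) => fw e.
move=> /(congr1 (fun X : vfW W => X p)) /=; rewrite -!/(psiW _ _) !psiTWE//=.
by rewrite /vscale e !vcutE.
Qed.
Lemma psiT_xi2 c p : psiT c p (xi (s (s c)) p) = - fT p *: xi (s c) p.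
Proof.
have [W Wp] := W_exists p.
have := psi_xi2 (lie_rinehartW W) ord0 (three_qsW Q W) c.
rewrite -/(ffW W _); have := ffWT c Wp; move: (ffW W c) => fw e.
move=> /(congr1 (fun X : vfW W => X p)) /=; rewrite -!/(psiW _ _) !psiTWE//=.
by rewrite /vscale /= e !vcutE.
Qed.
Lemma psiT2 c p v : psiT c p (psiT c p v) = fT p *: phi c p (psiT c p v).
Proof.
have [W [X [Wp <-]]] := field1 v.
have := psi2 (lie_rinehartW W) ord0 (three_qsW Q W) rot3P c X.
rewrite -/(ffW W _); have := ffWT c Wp; move: (ffW W c) => fw e.
move=> /(congr1 (fun X : vfW W => X p)) /=; rewrite -!/(psiW _ _) !psiTWE//=.
by rewrite /vscale /tapp e !psiTWE.
Qed.

End Pointwise.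
Arguments psiT {R N M} S c p v.
Arguments fT {R N M} S p.

(** * The splitting of the tangent bundle *)

Section Splitting.
Variables (R : realType) (N : nat) (M : manifold R N) (S : acm3 M).
Hypothesis Q : quasi3 S.

Local Notation phi := (phi3 S).
Local Notation xi := (xi3 S).
Local Notation eta := (eta3 S).
Local Notation g := (g3 S).
Local Notation s := rot3.
Local Notation psi := (psiT S).
Local Notation f := (fT S).
Hypothesis f0 : forall p, f p != 0.

Let A a p := acm_alg_pt Q a p.
Let phiE a p := (aphiD (A a p), aphiB (A a p), aphiN (A a p), aphiZ (A a p), aphi0 (A a p)).
Let etaE a p := (aetaD (A a p), aetaB (A a p), aetaN (A a p), aetaZ (A a p), aeta0 (A a p)).
Let gE p := (agDl (A ord0 p), agBl (A ord0 p), agNl (A ord0 p), agZl (A ord0 p), agDr (A ord0 p),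
  agBr (A ord0 p), agNr (A ord0 p), agZr (A ord0 p), ag0l (A ord0 p), ag0r (A ord0 p)).
Let gC p v w : g p v w = g p w v := g_sym Q v w.
Let phi_sk a p v w : g p (phi a p v) w = - g p v (phi a p w).
Proof. exact: (ag_phi (@real_reduced R) (A a p)). Qed.
Let g_xi a p v : g p v (xi a p) = eta a p v.
Proof. exact: (ag_xi (@real_reduced R) (A a p)). Qed.
Let phi_xi a p : phi a p (xi a p) = 0.
Proof. exact: (aphi_xi (@real_reduced R) (A a p)). Qed.
Let eta_phi a p v : eta a p (phi a p v) = 0.
Proof. exact: (aeta_phi (@real_reduced R) (A a p)). Qed.
Let phi2 a p v : phi a p (phi a p v) = - v + eta a p v *: xi a p.
Proof. by have [h _ _] := acm_pt Q a p. Qed.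
Let eta_xi a p : eta a p (xi a p) = 1.
Proof. by have [_ h _] := acm_pt Q a p. Qed.

Lemma psiTD c p v w : psi c p (v + w) = psi c p v + psi c p w.
Proof. by rewrite -[X in psi c p (X + _)]scale1r psiT_lin// scale1r. Qed.
Lemma psiT0 c p : psi c p 0 = 0.
Proof. by have /eqP := psiTD c 0 (0 : tangent p); rewrite addr0 -subr_eq0 opprD addrA subrr sub0r oppr_eq0 => /eqP. Qed.
Lemma psiTZ c p (t : R) v : psi c p (t *: v) = t *: psi c p v.
Proof. by rewrite -[t *: v]addr0 psiT_lin// psiT0 addr0. Qed.
Lemma psiTN c p v : psi c p (- v) = - psi c p v.
Proof. by rewrite -scaleN1r psiTZ scaleN1r. Qed.
Let psE c p := (@psiTD c p, @psiTN c p, @psiTZ c p, @psiT0 c p).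

Lemma eta_psiT c p v : eta c p (psi c p v) = 0.
Proof. by rewrite -g_xi gC psiT_skew// psiT_xi// gE oppr0. Qed.

Definition horT p (v : tangent p) := forall a, eta a p v = 0.
Definition trT p (v : tangent p) := horT v /\ forall c, psi c p v = 0.

(** Removing the Reeb components of an arbitrary extension gives a field that is horizontal on all
    of [W], as the identities on [hor] fields require. *)
Lemma horT_hpart p (v : tangent p) : horT v -> exists (W : chart_open M) (X : vfW W),
  [/\ W p, X p = v & hor (@etaW _ _ _ _ Q W) X].
Proof.
move=> hv; have [W [X [Wp E]]] := field1 v.
exists W, (hpart s (xiW Q W) (@etaW _ _ _ _ Q W) ord0 X); split => //; last first.
  exact: (hor_hpart (lie_rinehartW W) (three_qsW Q W) rot3P).
rewrite /hpart /= /vadd /vscale /= /vscale /= /vscale /= E !hv !scale0r !scaler0.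
by rewrite !addr0.
Qed.

Lemma psiT_rot a p v : horT v -> psi (s a) p v = - phi a p (psi (s (s a)) p v).
Proof.
move=> hv; have [W [X [Wp <- hX]]] := horT_hpart hv.
have := psi_rot (lie_rinehartW W) ord0 (three_qsW Q W) rot3P a hX.
move=> /(congr1 (fun X : vfW W => X p)) /=; rewrite -!/(psiW _ _ _) psiTWE// /vscale /tapp scaleN1r.
by rewrite psiTWE.
Qed.

Lemma trT1 c p v : horT v -> psi c p v = 0 -> trT v.
Proof.
move=> hv h; have h2 : psi (s (s c)) p v = 0.
  by have := psiT_rot (s c) hv; rewrite rot3K h phiE oppr0.
split=> // b; case: (rot3P b c) => -> //.
by rewrite psiT_rot// h2 phiE oppr0.
Qed.

Lemma horT_phi a p v : horT v -> horT (phi a p v).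
Proof.
move=> hv b; case: (rot3P b a) => ->; first exact: eta_phi.
- have [_ _ _ h] := relP Q a p; have [_ h2] := h v; rewrite hv in h2.
  by apply/eqP; rewrite -oppr_eq0 -h2.
- have [_ _ _ h] := relP Q (s (s a)) p; have [h2 _] := h v.
  by rewrite !rot3K hv in h2.
Qed.

Lemma trT_phi a p v : trT v -> trT (phi a p v).
Proof.
by move=> [hv pv]; apply: (@trT1 a); [exact: horT_phi|rewrite psiT_phi// pv phiE].
Qed.

Definition PT c : tensor11 M := fun p v =>
  (f p)^-1 *: phi c p (psi c p v) + v - eta c p v *: xi c p.
Arguments PT c p v : clear implicits.

Lemma PT_lin c p : linear (PT c p).
Proof.
move=> t v w; rewrite /PT !psE !phiE !etaE.
by apply: tangent_ext => h sh; rewrite !(tangentDE, tangentZE, tangentNE); ring.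
Qed.

Lemma PT_smooth c : smooth_tensor11 (PT c).
Proof.
move=> p; split; first exact: PT_lin.
move=> X sX.
have s1 : vsmooth_at (vscale (fun q => (f q)^-1) (tapp (phi c) (tapp (psi c) X))) p.
  apply: vsmooth_scale; first by apply: smooth_inv => //; exact: smooth_fT.
  by apply: vsmooth_phi => //; case: (psiT_smooth Q c p) => _; exact.
have s2 : vsmooth_at (vscale (fun q => - eta c q (X q)) (xi c)) p.
  by apply: vsmooth_scale; [apply: smooth_opp; exact: smooth_eta|exact: xi_smooth].
apply: vsmooth_ext (vsmooth_add (vsmooth_add s1 sX) s2).
by apply: (@filterE _ _ (nbhs_filter p)) => q; rewrite /vadd /vscale /tapp /PT scaleNr.
Qed.

Lemma PT_self c p v w : g p (PT c p v) w = g p v (PT c p w).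
Proof.
rewrite /PT !gE phi_sk (gC (psi c p v)) psiT_skew// psiT_phi// (gC (xi c p)) !g_xi; ring.
Qed.

Lemma PT_id c p v : trT v -> PT c p v = v.
Proof. by move=> [hv pv]; rewrite /PT hv pv phiE scaler0 scale0r subr0 add0r. Qed.

Lemma eta_xi_next c p : eta c p (xi (s c) p) = 0.
Proof.
have [_ _ _ h] := relP Q (s c) p; have [_] := h (xi (s c) p).
by rewrite rot3K phi_xi etaE oppr0.
Qed.
Lemma eta_xi_prev c p : eta c p (xi (s (s c)) p) = 0.
Proof.
have [_ _ _ h] := relP Q (s c) p; have [+ _] := h (xi (s (s c)) p).
by rewrite rot3K phi_xi etaE.
Qed.

(** That psi_c annihilates the image is the relation psi_c^2 = f phi_c psi_c. The remaining eta_b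
    vanish because P is self-adjoint and kills the Reeb fields. *)
Lemma PT_tr c p v : trT (PT c p v).
Proof.
have h0 : psi c p (PT c p v) = 0.
  rewrite /PT !psE psiT_xi// psiT_phi// psiT2// phiE phi2 eta_psiT scale0r addr0 scaler0 oppr0 addr0.
  by rewrite scalerA mulVf// scale1r addNr.
apply: (@trT1 c) => // b.
case: (rot3P b c) => ->.
- by rewrite /PT !etaE eta_phi eta_xi; ring.
- rewrite -g_xi PT_self /PT psiT_xi1// phiE.
  have -> : phi c p (xi (s (s c)) p) = - xi (s c) p.
    by have [_ _ [_ h] _] := relP Q (s (s c)) p; rewrite !rot3K in h; rewrite h opprK.
  by rewrite eta_xi_next scale0r subr0 scalerN scalerN scalerA mulVf// scale1r addNr gE.
- rewrite -g_xi PT_self /PT psiT_xi2// phiE.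
  have -> : phi c p (xi (s c) p) = xi (s (s c)) p by have [_ _ [-> _] _] := relP Q c p.
  by rewrite eta_xi_prev scale0r subr0 scalerA mulrN mulVf// scaleN1r addNr gE.
Qed.

(** The distribution E^{4l+3}, described as the orthogonal complement of E^{4m}. This form involves
    no choice of index, so it can be tested with any [PT c]. *)
Definition DT p (v : tangent p) := forall w, trT w -> g p v w = 0.

Lemma DT_P c p v : DT v <-> PT c p v = 0.
Proof.
split=> [hv|hv w tw]; last by rewrite -(PT_id c tw) -PT_self hv gE.
by apply: (g_ext Q) => u; rewrite gC PT_self hv ?gE//; exact: PT_tr.
Qed.

Lemma DT_psi c p v : DT v <-> psi c p v = f p *: phi c p v.
Proof.
split.
  move=> /(DT_P c) /(congr1 (phi c p)).
  rewrite /PT !phiE phi2 eta_psiT scale0r addr0 phi_xi scaler0 subr0 => /(congr1 (fun x => f p *: x)).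
  rewrite scalerDr scalerA mulfV// scale1r scaler0 => /eqP; rewrite addrC subr_eq0 => /eqP.
  by [].
move=> h; apply/(DT_P c); rewrite /PT h phiE scalerA mulVf// scale1r phi2.
by rewrite addrAC addrK addNr.
Qed.

Lemma DT_phi a p v : DT v -> DT (phi a p v).
Proof. by move=> dv w tw; rewrite phi_sk dv ?oppr0//; exact: trT_phi. Qed.

Lemma DT_xi a p : DT (xi a p).
Proof. by move=> w [hw _]; rewrite gC g_xi hw. Qed.

(** The contraction of d eta_a with v vanishes exactly when psi_a v = 0, and on H one index suffices
    by [trT1]. *)
Lemma distE4mE p v : distE4m S p v <-> trT v.
Proof.
split.
  move=> [hv [a kv]]; apply: (@trT1 a) => //; apply: (g_ext Q) => u.
  have su := ext_smooth u; have sv := ext_smooth v.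
  rewrite -{1}(extE u) -{1}(extE v) psiT_te// d1C; last exact: eta_smooth.
  by rewrite (kv _ _ sv su (extE v)) oppr0 mulr0 gE.
move=> [hv pv]; split => //; exists ord0 => X Y sX sY XE.
have := psiT_te Q ord0 sY sX; rewrite XE pv gE d1C; last exact: eta_smooth.
by move=> /esym/eqP; rewrite mulf_eq0 pnatr_eq0 /= oppr_eq0 => /eqP.
Qed.

Lemma distE4l3E p v : distE4l3 S p v <-> DT v.
Proof.
split.
  move=> [u [w [[hu ou] [cc ->] ->]]] z tz; rewrite gE ou ?add0r; last exact/distE4mE.
  rewrite gC; elim/big_rec: _ => [|i x _ IH]; first by rewrite gE.
  by rewrite !gE IH g_xi; case: tz => -> _; rewrite mulr0 addr0.
(* [w] is the vertical part of v; the difference lies in E^{4l} because Reeb fields are orthogonal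
   to E^{4m}. *)
move=> dv; pose w := \sum_(a < 3) eta a p v *: xi a p.
have vw : @distV _ _ M S p w by exists (fun a => eta a p v).
have hw a : eta a p w = eta a p v.
  rewrite /w (bigD1 a)//= !etaE eta_xi mulr1 [X in _ + X](_ : _ = 0) ?addr0//.
  elim/big_rec: _ => [|i x ia IH]; first by rewrite etaE.
  rewrite !etaE IH addr0; case: (rot3P i a) ia => -> //; first by rewrite eqxx.
    by rewrite eta_xi_next mulr0.
  by rewrite eta_xi_prev mulr0.
have gw z : trT z -> g p z w = 0.
  move=> [hz _]; rewrite /w; elim/big_rec: _ => [|i x _ IH]; first by rewrite gE.
  by rewrite !gE IH g_xi hz mulr0 addr0.
clearbody w; exists (v - w), w; split => //; last by rewrite subrK.
split; first by move=> a; rewrite (aetaB (A a p)) hw subrr.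
by move=> z /distE4mE tz; rewrite !gE (dv z)// (gC w z) gw// subrr.
Qed.

Lemma DT_involutive p X Y : vsmooth_at X p -> vsmooth_at Y p ->
  (\forall q \near p, DT (X q)) -> (\forall q \near p, DT (Y q)) -> DT (bracket X Y p).
Proof.
move=> sX sY dX dY.
have H : \forall q \near p, [/\ vsmooth_at X q, vsmooth_at Y q, DT (X q) & DT (Y q)].
  by have h1 := vsmooth_near sX; have h2 := vsmooth_near sY; near=> q; split; near: q.
have [W [Wp HW]] := chart_open_exists H.
have sX' q : W q -> vsmooth_at X q by case/HW.
have sY' q : W q -> vsmooth_at Y q by case/HW.
pose X' := vf_cut sX'; pose Y' := vf_cut sY'.
have K (Z : vfW W) : (forall q, W q -> DT (Z q)) -> psiW Q ord0 Z = ffW Q W ord0 *: phiW Q ord0 Z.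
  move=> dZ; apply: vf_eq => q Wq; rewrite psiTWE//.
  have := dZ q Wq => /(DT_psi ord0) ->.
  have := ffWT Q ord0 Wq; move: (ffW Q W ord0) => fw e.
  by rewrite /= /vscale e.
have dX' q : W q -> DT (X' q) by move=> Wq; rewrite /= vcutE//; case: (HW q Wq).
have dY' q : W q -> DT (Y' q) by move=> Wq; rewrite /= vcutE//; case: (HW q Wq).
have := leaf_involutive (lie_rinehartW W) ord0 (three_qsW Q W) rot3P (K _ dX') (K _ dY').
rewrite -/(psiW Q ord0 _) -/(ffW Q W ord0); have := ffWT Q ord0 Wp; move: (ffW Q W ord0) => fw e.
move=> /(congr1 (fun X : vfW W => X p)); rewrite psiTWE// /= /vscale e /tapp => E.
rewrite (bracket_near sX sY (vcut_near X Wp) (vcut_near Y Wp)).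
exact/(DT_psi ord0).
Unshelve. all: by end_near. Qed.

(** Evaluates at p the algebraic statements of the section [Basic]; their orthogonality hypothesis
    is the definition of [DT]. *)
Lemma hitchin p Z X Y : vsmooth_at Z p -> vsmooth_at X p -> vsmooth_at Y p ->
  (\forall q \near p, DT (Z q)) -> (\forall q \near p, trT (X q)) -> (\forall q \near p, trT (Y q)) ->
  Z p (fun q => g q (X q) (Y q)) = g p (bracket Z X p) (Y p) + g p (X p) (bracket Z Y p) /\
  forall a, g p (X p) (bracket Z (tapp (phi a) Y) p - phi a p (bracket Z Y p)) = 0.
Proof.
move=> sZ sX sY dZ tX tY.
have H : \forall q \near p, [/\ vsmooth_at Z q /\ vsmooth_at X q, vsmooth_at Y q, DT (Z q), trT (X q) & trT (Y q)].
  have h1 := vsmooth_near sX; have h2 := vsmooth_near sY; have h3 := vsmooth_near sZ.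
  by near=> q; split; [split|..]; near: q.
have [W [Wp HW]] := chart_open_exists H.
have sX' q : W q -> vsmooth_at X q by case/HW => -[].
have sY' q : W q -> vsmooth_at Y q by case/HW.
have sZ' q : W q -> vsmooth_at Z q by case/HW => -[].
pose X' := vf_cut sX'; pose Y' := vf_cut sY'; pose Z' := vf_cut sZ'.
have K (V : vfW W) : (forall q, W q -> trT (V q)) ->
    transverse (@brW _ _ _ W) s (@phiW _ _ _ _ Q W) (xiW Q W) (@etaW _ _ _ _ Q W) V.
  move=> tV; split; first by move=> a; apply: fn_eq => q Wq /=; case: (tV q Wq).
  move=> c; apply: vf_eq => q Wq; rewrite -/(psiW Q c _) psiTWE//=.
  by case: (tV q Wq).
have tX' : transverse (@brW _ _ _ W) s (@phiW _ _ _ _ Q W) (xiW Q W) (@etaW _ _ _ _ Q W) X'.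
  by apply: K => q Wq; rewrite /= vcutE//; case: (HW q Wq).
have tY' : transverse (@brW _ _ _ W) s (@phiW _ _ _ _ Q W) (xiW Q W) (@etaW _ _ _ _ Q W) Y'.
  by apply: K => q Wq; rewrite /= vcutE//; case: (HW q Wq).
have o (V : vfW W) : transverse (@brW _ _ _ W) s (@phiW _ _ _ _ Q W) (xiW Q W) (@etaW _ _ _ _ Q W) V ->
    gW Q V Z' = 0.
  move=> [hV pV]; apply: fn_eq => q Wq /=; rewrite vcutE// gC.
  have [_ _ dq _ _] := HW q Wq; apply: dq; split.
    by move=> a; have := congr1 (fun h : fnW W => h q) (hV a).
  by move=> c; have := congr1 (fun h : vfW W => h q) (pV c); rewrite -/(psiW Q c _) psiTWE.
have nX := vcut_near X Wp; have nY := vcut_near Y Wp; have nZ := vcut_near Z Wp.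
have npY a : \forall q \near p, tapp (phi a) Y q = phiW Q a Y' q.
  by apply: filterS nY => q /= e; rewrite /tapp e.
have eX : X p = X' p by rewrite /= vcutE.
have eY : Y p = Y' p by rewrite /= vcutE.
have eZ : Z p = Z' p by rewrite /= vcutE.
rewrite (bracket_near sZ sX nZ nX) (bracket_near sZ sY nZ nY) eX eY; split.
  have := lieg_transverse (lie_rinehartW W) ord0 (three_qsW Q W) rot3P o tX' tY'.
  move=> /(congr1 (fun h : fnW W => h p)) /= /eqP; rewrite -addrA -opprD subr_eq0 => /eqP <-.
  rewrite -[vcut W Z p]eZ; apply: tangent_near; first exact: (smooth_g Q).
  by near=> q; congr (g q _ _); near: q.
move=> a; rewrite (bracket_near sZ (vsmooth_phi Q a sY) nZ (npY a)).
have := lie_phi_transverse (lie_rinehartW W) ord0 (three_qsW Q W) rot3P o a tX' tY'.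
move=> /(congr1 (fun h : fnW W => h p)) /=; rewrite /vadd /vscale /= scaleN1r.
by [].
Unshelve. all: by end_near. Qed.

End Splitting.
Arguments PT {R N M} S c p v.

(** * Pfaffians and the rank *)

Section Pfaffian.
Variable R : fieldType.

Lemma ev_subproof r (k : 'I_r) : (k * 2 < r * 2)%N.
Proof. by have := ltn_ord k; lia. Qed.
Lemma od_subproof r (k : 'I_r) : (k * 2 + 1 < r * 2)%N.
Proof. by have := ltn_ord k; lia. Qed.
Definition ev r (k : 'I_r) : 'I_(r * 2) := Ordinal (ev_subproof k).
Definition od r (k : 'I_r) : 'I_(r * 2) := Ordinal (od_subproof k).

Definition pfterm r (G : 'I_(r * 2) -> 'I_(r * 2) -> R) (s : 'S_(r * 2)) : R :=
  (-1) ^+ s * \prod_(k < r) G (s (ev k)) (s (od k)).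
(* 2^r r! times the Pfaffian when G is alternating. *)
Definition pf r G : R := \sum_(s : 'S_(r * 2)) @pfterm r G s.

Lemma ev_inj r : injective (@ev r).
Proof. by move=> i j /(congr1 val) /= /eqP; rewrite eqn_pmul2r// => /eqP; exact: val_inj. Qed.
Lemma od_inj r : injective (@od r).
Proof. by move=> i j /(congr1 val) /= /eqP; rewrite eqn_add2r eqn_pmul2r// => /eqP; exact: val_inj. Qed.
Lemma ev_od r (i j : 'I_r) : ev i != od j.
Proof.
apply/negP => /eqP /(congr1 (odd \o val)) /=.
by rewrite oddD !oddM /= !andbF.
Qed.

Lemma evodP r (i : 'I_(r * 2)) : exists k, i = ev k \/ i = od k.
Proof.
have kr : (i %/ 2 < r)%N by rewrite ltn_divLR.
exists (Ordinal kr); have := divn_eq i 2; have := ltn_pmod i (isT : (0 < 2)%N).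
case: (i %% 2)%N => [|[|//]] _ E; [left|right]; apply: val_inj; rewrite /= {1}E ?addn0//.
Qed.

Lemma prod_evod r (u : 'I_(r * 2) -> R) :
  \prod_i u i = \prod_(k < r) (u (ev k) * u (od k)).
Proof.
elim: r u => [|r IH] u; first by rewrite !big_ord0.
have -> : \prod_(i < r.+1 * 2) u i = u (ev ord0) * (u (od ord0) *
   \prod_(i < r * 2) u (lift ord0 (lift ord0 i) : 'I_(r.+1 * 2))).
  rewrite (big_ord_recl (r * 2).+1) (big_ord_recl (r * 2)) /=.
  by congr (u _ * (u _ * _)); apply: val_inj.
rewrite big_ord_recl IH mulrA; congr (_ * _); apply: eq_bigr => k _.
by congr (u _ * u _); apply: val_inj.
Qed.

Lemma lift_perm_onto n (s : 'S_n.+1) : s ord0 = ord0 -> exists t : 'S_n, s = lift_perm ord0 ord0 t.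
Proof.
move=> s0; pose h k := odflt k (unlift ord0 (s (lift ord0 k))).
have hK k : lift ord0 (h k) = s (lift ord0 k).
  rewrite /h; have := neq_lift ord0 k.
  by rewrite -(inj_eq (@perm_inj _ s)) s0 => /unlift_some[? ? ->].
have hI : injective h.
  by move=> i j ij; apply: (@lift_inj _ ord0); apply: (@perm_inj _ s); rewrite -!hK ij.
exists (perm hI); apply/permP => i; case: (unliftP ord0 i) => [k|] ->.
  by rewrite lift_perm_lift permE hK.
by rewrite lift_perm_id.
Qed.

Lemma lift_perm_inj n : injective (@lift_perm n ord0 ord0).
Proof.
move=> s t st; apply/permP => k; apply: (@lift_inj _ ord0).
by rewrite -(lift_perm_lift ord0 ord0 s) st lift_perm_lift.
Qed.

Lemma sum_fix0 n (K : 'S_n.+1 -> R) :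
  \sum_(s : 'S_n.+1 | s ord0 == ord0) K s = \sum_(t : 'S_n) K (lift_perm ord0 ord0 t).
Proof.
pose l' (s : 'S_n.+1) := odflt (1%g : 'S_n) [pick t : 'S_n | lift_perm ord0 ord0 t == s].
rewrite (reindex_onto (@lift_perm n ord0 ord0) l') /=.
  apply: eq_bigl => t; rewrite lift_perm_id eqxx /= /l'.
  case: pickP => [u /eqP /lift_perm_inj ->|/(_ t)]; rewrite ?eqxx //.
move=> s /eqP s0; have [t ->] := lift_perm_onto s0; rewrite /l'.
by case: pickP => [u /eqP ->|/(_ t)] //; rewrite eqxx.
Qed.

Section Expansion.
Variables (r : nat) (G : 'I_(r.+1 * 2) -> 'I_(r.+1 * 2) -> R).
Hypothesis Gsk : forall i j, G i j = - G j i.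
Let z : 'I_(r.+1 * 2) := ev ord0.
Let o : 'I_(r.+1 * 2) := od ord0.

Definition block_swap b : 'S_(r.+1 * 2) := (tperm z (ev b) * tperm o (od b))%g.

Lemma pfterm_swap b s : pfterm G (block_swap b * s)%g = pfterm G s.
Proof.
rewrite /pfterm !odd_permM !odd_tperm (inj_eq (@ev_inj _)) (inj_eq (@od_inj _)).
rewrite addbb /=; congr (_ * _).
rewrite [RHS](reindex_inj (@perm_inj _ (tperm ord0 b))); apply: eq_bigr => k _ /=.
rewrite !permM /z /o -(inj_tperm _ _ _ (@ev_inj _)).
rewrite (tpermD (x := od ord0)) 1?eq_sym ?ev_od//.
rewrite (tpermD (x := ev ord0)) ?ev_od// -(inj_tperm _ _ _ (@od_inj _)).
by [].
Qed.

Lemma pfterm_flip s : pfterm G (tperm z o * s)%g = pfterm G s.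
Proof.
rewrite /pfterm odd_permM odd_tperm ev_od signr_addb expr1 -mulrA mulN1r -mulrN.
congr (_ * _); rewrite (bigD1 ord0)//= [RHS](bigD1 ord0)//= !permM tpermL tpermR Gsk mulNr opprK; congr (_ * _).
apply: eq_bigr => k k0; rewrite !permM !tpermD ?ev_od//.
- by rewrite (inj_eq (@od_inj _)) eq_sym.
- by rewrite (inj_eq (@ev_inj _)) eq_sym.
- by rewrite eq_sym ev_od.
Qed.

(** Exchanging blocks and flipping a pair change no term, and some such move brings any position to
    the first one; so the [r.+1 * 2] possible positions of the index z contribute equally. *)
Lemma pf_fix : pf G = (\sum_(s : 'S_(r.+1 * 2) | s z == z) pfterm G s) *+ (r.+1 * 2).
Proof.
rewrite /pf (partition_big (fun s : 'S_(r.+1 * 2) => (s^-1)%g z) xpredT)//=.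
rewrite -[X in _ *+ X]card_ord -sumr_const; apply: eq_bigr => i _.
have [c [cz Tc]] : exists c : 'S_(r.+1 * 2), c z = i /\ forall s, pfterm G (c * s)%g = pfterm G s.
  have [k [->|->]] := evodP i.
    exists (block_swap k); split; last exact: pfterm_swap.
    by rewrite permM tpermL tpermD// eq_sym ev_od.
  exists (tperm z o * block_swap k)%g; split; last first.
    by move=> s; rewrite -mulgA pfterm_flip pfterm_swap.
  have -> : (tperm z o * block_swap k)%g z = block_swap k o by rewrite permM tpermL.
  rewrite /block_swap permM; have -> : tperm z (ev k) o = o by rewrite tpermD// ev_od.
  by rewrite tpermL.
rewrite [RHS](reindex_inj (mulgI c)); apply: eq_big => s; last by rewrite Tc.
by rewrite permM cz (canF_eq (permKV s)).
Qed.

Hypothesis G0 : forall j, j != o -> G z j = 0.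

(** Expansion along the row of z when its only possibly nonzero entry is at the partner o; the other
    permutations fixing z have a zero factor. *)
Lemma pf_expand : pf G = (G z o * pf (fun i j => G (lift ord0 (lift ord0 i)) (lift ord0 (lift ord0 j)))) *+ (r.+1 * 2).
Proof.
rewrite pf_fix; congr (_ *+ _).
have -> : \sum_(s : 'S_(r.+1 * 2) | s z == z) pfterm G s
  = \sum_(s : 'S_(r * 2).+2 | s ord0 == ord0) @pfterm r.+1 G s.
  by apply: eq_bigl => s; congr (s _ == _); apply: val_inj.
rewrite sum_fix0 (bigID (fun t : 'S_(r * 2).+1 => t ord0 == ord0)) /= [X in _ + X]big1 ?addr0; last first.
  move=> t t0; rewrite /pfterm big_ord_recl.
  have -> : (lift_perm ord0 ord0 t : 'S_(r.+1 * 2)) (ev ord0) = z.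
    by rewrite (_ : ev ord0 = ord0) ?lift_perm_id; apply: val_inj.
  have -> : (lift_perm ord0 ord0 t : 'S_(r.+1 * 2)) (od ord0) = lift ord0 (t ord0).
    by rewrite (_ : od ord0 = lift ord0 ord0) ?lift_perm_lift//; apply: val_inj.
  by rewrite G0 ?mul0r ?mulr0.
rewrite sum_fix0 /pf big_distrr /=; apply: eq_bigr => t _.
rewrite /pfterm big_ord_recl.
set L := (lift_perm ord0 ord0 (lift_perm ord0 ord0 t) : 'S_(r.+1 * 2)).
have L0 : L (ev ord0) = z by rewrite /L (_ : ev ord0 = ord0) ?lift_perm_id; apply: val_inj.
have L1 : L (od ord0) = o.
  rewrite /L (_ : od ord0 = lift ord0 ord0) ?lift_perm_lift ?lift_perm_id; last exact: val_inj.
  by apply: val_inj.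
have L2 k : L (ev (lift ord0 k)) = lift ord0 (lift ord0 (t (ev k))).
  by rewrite /L (_ : ev (lift ord0 k) = lift ord0 (lift ord0 (ev k))) ?lift_perm_lift; last exact: val_inj.
have L3 k : L (od (lift ord0 k)) = lift ord0 (lift ord0 (t (od k))).
  by rewrite /L (_ : od (lift ord0 k) = lift ord0 (lift ord0 (od k))) ?lift_perm_lift; last exact: val_inj.
rewrite L0 L1 mulrCA; congr (_ * (_ * _)); first by rewrite !odd_lift_perm.
by apply: eq_bigr => k _; rewrite L2 L3.
Qed.

End Expansion.

(** Expanding the entries of Y C Y^T writes the sum as a combination of determinants of size 2 r
    with rows indexed by only rho values; by the pigeonhole principle each has two equal rows. *)
Lemma pf_low_rank r rho (Y : 'M[R]_(r * 2, rho)) (C : 'M[R]_rho) : (rho < r * 2)%N ->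
  pf (fun i j => (Y *m C *m Y^T) i j) = 0.
Proof.
move=> lt; rewrite /pf /pfterm.
under eq_bigr => s _.
  under eq_bigr => k _.
    rewrite (_ : (Y *m C *m Y^T) (s (ev k)) (s (od k)) =
      \sum_(ab : 'I_rho * 'I_rho) Y (s (ev k)) ab.1 * Y (s (od k)) ab.2 * C ab.1 ab.2).
      over.
    rewrite mxE -(pair_bigA _ (fun a b => Y (s (ev k)) a * Y (s (od k)) b * C a b)) exchange_big /=.
    apply: eq_bigr => b _; rewrite !mxE big_distrl /=; apply: eq_bigr => a _.
    by rewrite mulrAC.
  rewrite bigA_distr_bigA /= big_distrr /=.
  over.
rewrite exchange_big /= big1 // => h _.
under eq_bigr do rewrite big_split /= mulrA.
rewrite -big_distrl /= [X in X * _](_ : _ = 0) ?mul0r//.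
have [u [u1 u2]] : exists u : 'I_(r * 2) -> 'I_rho, (forall k, u (ev k) = (h k).1) /\ (forall k, u (od k) = (h k).2).
  have hd (i : 'I_(r * 2)) : (i %/ 2 < r)%N by rewrite ltn_divLR.
  have he (k : 'I_r) (i : 'I_(r * 2)) : (i %/ 2)%N = k -> Ordinal (hd i) = k by move=> e; apply: val_inj.
  exists (fun i : 'I_(r * 2) => if odd i then (h (Ordinal (hd i))).2 else (h (Ordinal (hd i))).1).
  split=> k.
    rewrite (he k); last by rewrite /= mulnK.
    by rewrite /= oddM andbF.
  rewrite (he k); last by rewrite /= divnMDl// addn0.
  by rewrite /= oddD oddM andbF.
have [i [j ij uij]] : exists i, exists2 j, i != j & u i = u j.
  apply/injectivePn/negP => /injectiveP /leq_card; rewrite !card_ord leqNgt.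
  by rewrite lt.
rewrite -[RHS](determinant_alternate (A := \matrix_(i, j) Y j (u i)) ij); last by move=> k; rewrite !mxE uij.
apply: eq_bigr => s _; congr (_ * _).
under [RHS]eq_bigr do rewrite mxE.
by rewrite prod_evod; apply: eq_bigr => k _; rewrite u1 u2.
Qed.

(** A skew B factors as K^T C K, where K is a basis of its row space, so a small rank falls under
    [pf_low_rank]. *)
Lemma pf_rank r n (B : 'M[R]_n) (X : 'M[R]_(r * 2, n)) : B^T = - B ->
  pf (fun i j => (X *m B *m X^T) i j) != 0 -> (r * 2 <= \rank B)%N.
Proof.
move=> Bsk; rewrite leqNgt; apply: contra => lt; apply/eqP.
have [K [K' [L [KK BE]]]] : exists (K : 'M[R]_(\rank B, n)) (K' : 'M[R]_(n, \rank B)) (L : 'M[R]_(n, \rank B)),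
    K *m K' = 1%:M /\ B = L *m K.
  by exists (row_base B), (pinvmx (row_base B)), (col_base B); rewrite mulmxVp ?row_base_free ?mulmx_base.
have E : B = K^T *m (K'^T *m B *m K') *m K.
  have BK : B *m K' = L.
    by rewrite -[RHS]mulmx1 -KK mulmxA; congr (_ *m _); exact: BE.
  have E1 : B *m K' *m K = B by rewrite BK -BE.
  have E2 : K^T *m K'^T *m B = B.
    by apply: (can_inj trmxK); rewrite !trmx_mul !trmxK Bsk mulNmx mulmxA E1.
  by rewrite !mulmxA E2 E1.
have := pf_low_rank (X *m K^T) (K'^T *m B *m K') lt.
by rewrite trmx_mul trmxK -!mulmxA => <-; do 3 f_equal; rewrite {1}E !mulmxA.
Qed.

(** Symplectic Gram-Schmidt: split off a pair u, v with B(u, v) = 1, which lowers the rank by at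
    most 2, and induct on the rest. The bound admits rank 2 r - 1, so that an odd value is caught
    too. *)
Lemma pf_exists r n (B : 'M[R]_n) : (forall k, (k.+1%:R : R) != 0) -> B^T = - B -> (r * 2 <= (\rank B).+1)%N ->
  exists X : 'M[R]_(r * 2, n), pf (fun i j => (X *m B *m X^T) i j) != 0.
Proof.
move=> cR; have c0 := cR 1; elim: r B => [|r IH] B Bsk rB.
  exists 0; rewrite /pf (bigD1 1%g)//= big1; last by move=> t /negP[]; apply/eqP/permP => -[].
  by rewrite addr0 /pfterm big_ord0 odd_perm1 mulr1 oner_neq0.
have [i [j Bij]] : exists i j, B i j != 0.
  have : B != 0 by apply: contraTneq rB => ->; rewrite mxrank0.
  by move=> /matrix0Pn.
pose u : 'rV[R]_n := delta_mx 0 i; pose v : 'rV[R]_n := (B i j)^-1 *: delta_mx 0 j.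
pose a := B *m u^T; pose b := B *m v^T.
have sk (x y : 'rV[R]_n) : (x *m B *m y^T) 0 0 = - (y *m B *m x^T) 0 0 :> R.
  rewrite -[in LHS](mxE trmx_key (fun i j => (x *m B *m y^T) j i)).
  by rewrite -/(trmx _) !trmx_mul trmxK Bsk mulNmx mulmxN mulmxA mxE.
have E11 (m : 'M[R]_1) : m = (m 0 0)%:M by exact: mx11_scalar.
have uu : u *m a = 0.
  rewrite [LHS]E11 /a mulmxA; have /eqP := sk u u; rewrite -addr_eq0 -mulr2n -mulr_natr mulf_eq0 (negPf c0) orbF.
  by move=> /eqP ->; rewrite raddf0.
have vv : v *m b = 0.
  rewrite [LHS]E11 /b mulmxA; have /eqP := sk v v; rewrite -addr_eq0 -mulr2n -mulr_natr mulf_eq0 (negPf c0) orbF.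
  by move=> /eqP ->; rewrite raddf0.
have uv : u *m b = 1%:M.
  rewrite [LHS]E11 /b mulmxA -rowE /v linearZ/= -scalemxAr mxE trmx_delta -colE !mxE.
  by rewrite mulVf.
have vu : v *m a = - 1%:M.
  by rewrite [LHS]E11 /a mulmxA sk -mulmxA uv mxE raddfN.
have uB : u *m B = - a^T by rewrite /a trmx_mul trmxK Bsk mulmxN opprK.
have vB : v *m B = - b^T by rewrite /b trmx_mul trmxK Bsk mulmxN opprK.
have bE : B *m v^T = b by [].
clearbody a b u v.
(* Acting on rows, [P] kills u and v and projects onto their B-orthogonal; [B'] is the form B pulled
   back by [P]. *)
pose P := 1%:M - b *m u + a *m v.
pose B' := B + b *m a^T - a *m b^T.
have PB : P *m B = B'.
  by rewrite /P mulmxDl mulmxBl mul1mx -!mulmxA uB vB !mulmxN opprK.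
have tD (Y Z : 'M[R]_n) : (Y + Z)^T = Y^T + Z^T by exact: linearD.
have tN (Y : 'M[R]_n) : (- Y)^T = - Y^T by exact: linearN.
have B'sk : B'^T = - B'.
  by rewrite /B' !tD tN !trmx_mul !trmxK Bsk !opprD !opprK addrAC.
have uB' : u *m B' = 0.
  by rewrite /B' mulmxBr mulmxDr !mulmxA uu uv uB mul1mx mul0mx subr0 addNr.
have vB' : v *m B' = 0.
  by rewrite /B' mulmxBr mulmxDr !mulmxA vv vu vB mulNmx mul1mx mul0mx addr0 opprK addNr.
have B'u x : x *m B' = 0 -> B' *m x^T = 0.
  by move=> xB; apply: (can_inj trmxK); rewrite trmx_mul trmxK B'sk mulmxN xB oppr0 trmx0.
have PBP : P *m B *m P^T = B'.
  rewrite PB /P !tD tN trmx1 !trmx_mul mulmxDr mulmxBr mulmx1 !mulmxA.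
  by rewrite (B'u _ _ uB') (B'u _ _ vB') !mul0mx subr0 addr0.
have rB' : (r * 2 <= (\rank B').+1)%N.
  have rk (x y : 'cV[R]_n) : (\rank (x *m y^T) <= 1)%N.
    by apply: leq_trans (mxrankM_maxl _ _) (rank_leq_col _).
  have : (\rank B <= \rank B' + 1 + 1)%N.
    have -> : B = B' + a *m b^T + (- b) *m a^T by rewrite /B' mulNmx subrK addrK.
    apply: leq_trans (mxrank_add _ _) _; apply: leq_add; last exact: rk.
    by apply: leq_trans (mxrank_add _ _) _; apply: leq_add; last exact: rk.
  by move: rB; rewrite mulSn; lia.
have [X' X'0] := IH B' B'sk rB'.
pose X : 'M[R]_(r.+1 * 2, n) := col_mx u (col_mx v (X' *m P)).
exists X.
have XE m (Y : 'M[R]_(m, n)) x y : (Y *m B *m Y^T) x y = (row x Y *m B *m (row y Y)^T) 0 0 :> R.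
  by rewrite tr_row -row_mul !mxE; apply: eq_bigr => k _; rewrite !mxE.
have rz : row (ev ord0 : 'I_(r.+1 * 2)) X = u.
  apply/rowP => k; rewrite mxE -(col_mxEu u (col_mx v (X' *m P)) 0 k).
  by congr (_ _ _); apply: val_inj.
have ro : row (od ord0 : 'I_(r.+1 * 2)) X = v.
  apply/rowP => k; rewrite mxE -(col_mxEu v (X' *m P) 0 k) -(col_mxEd u (col_mx v (X' *m P))).
  by congr (_ _ _); apply: val_inj.
have rl k : row (lift ord0 (lift ord0 k) : 'I_(r.+1 * 2)) X = row k (X' *m P).
  apply/rowP => t; rewrite mxE [RHS]mxE -(col_mxEd v (X' *m P) k t) -(col_mxEd u (col_mx v (X' *m P))).
  by congr (_ _ _); apply: val_inj.
have uP : u *m B *m P^T = 0.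
  by apply: (can_inj trmxK); rewrite !trmx_mul trmxK Bsk mulNmx mulmxN mulmxA PB B'u ?oppr0 ?trmx0.
rewrite pf_expand.
- rewrite -mulr_natr !mulf_neq0//.
  + by rewrite XE rz ro -mulmxA bE uv mxE eqxx oner_neq0.
  + rewrite (_ : (fun x y => _) = fun x y => (X' *m B' *m X'^T) x y)//.
    apply/funext => x; apply/funext => y; rewrite XE !rl -(XE _ (X' *m P)).
    by rewrite -PBP trmx_mul !mulmxA.
  + exact: (cR (r * 2).+1).
- by move=> x y; rewrite !XE sk.
- move=> x xo; rewrite XE rz.
  case: (unliftP ord0 x) xo => [y|] ->.
    case: (unliftP ord0 y) => [k|] ->.
      by rewrite rl row_mul trmx_mul mulmxA uP mul0mx mxE.
    by move=> /negP[]; apply/eqP/val_inj.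
  move=> _; rewrite (_ : ord0 = ev ord0 :> 'I_(r.+1 * 2)); last exact: val_inj.
  rewrite rz; have /eqP := sk u u; rewrite -addr_eq0 -mulr2n -mulr_natr mulf_eq0 (negPf c0) orbF.
  by move=> /eqP.
Qed.

End Pfaffian.

(** * Powers of d eta as Pfaffians *)

Section TensorMatrix.
Variables (R : realType) (N : nat) (M : manifold R N).

Lemma tangent_frame (c : chart R N M) p (v : tangent p) : atlas c -> cdom c p ->
  v = \sum_i tcoord c v 0 i *: ptan c (delta_mx 0 i) p.
Proof.
move=> ac cp; apply: (tcoord_inj ac cp); rewrite linear_sum [LHS]matrix_sum_delta big_ord1.
by apply: eq_bigr => i _; rewrite linearZ/= tcoord_ptan.
Qed.

Definition dmat (T : tensor11 M) (c : chart R N M) p : 'M[R]_N :=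
  \matrix_(i, j) tcoord c (T p (ptan c (delta_mx 0 i) p)) 0 j.

Lemma linear_sumE (V W : lmodType R) (h : V -> W) (I : Type) (r : seq I) (P : pred I)
  (a : I -> R) (u : I -> V) : linear h ->
  h (\sum_(i <- r | P i) a i *: u i) = \sum_(i <- r | P i) a i *: h (u i).
Proof.
move=> hl; have h0 : h 0 = 0.
  have /eqP := hl 1 0 0; rewrite !scale1r addr0 -subr_eq0 opprD addrA subrr sub0r oppr_eq0.
  by move=> /eqP.
by elim/big_rec2: _ => // i y1 y2 _ <-; rewrite hl.
Qed.

Lemma dmatE (T : tensor11 M) c p (v : tangent p) : linear (T p) -> atlas c -> cdom c p ->
  tcoord c (T p v) = tcoord c v *m dmat T c p.
Proof.
move=> Tl ac cp; rewrite {1}(tangent_frame v ac cp) (linear_sumE _ _ _ _ Tl) linear_sum.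
apply/rowP => j; rewrite summxE mxE; apply: eq_bigr => i _.
by rewrite linearZ/= rowZE [dmat _ _ _ _ _]mxE.
Qed.

(** In the recursion, the permutation of the inner power is absorbed into the sum over the outer
    one, so all (2 r)! inner terms agree and contribute a nonzero constant. *)
Lemma wedge_exp_pf (eta : oneform M) r : exists2 k : R, k != 0 &
  forall Xs p, @wedge_exp R N M (form_d1 eta) r Xs p = k * pf (fun i j => d1 eta (Xs i) (Xs j) p).
Proof.
elim: r => [|r [k k0 IH]].
  exists 1; first exact: oner_neq0.
  move=> Xs p; rewrite /= mul1r /pf (bigD1 1%g)//= big1; last first.
    by move=> t /negP[]; apply/eqP/permP => -[].
  by rewrite addr0 /pfterm big_ord0 odd_perm1 mulr1.
have fk m : (m`!%:R : R) != 0 by rewrite pnatr_eq0 -lt0n fact_gt0.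
exists (((2 + r * 2)`!%:R)^-1 * (k * (r * 2)`!%:R)); first by rewrite !mulf_neq0// invr_eq0.
move=> Xs p; rewrite /= /wedge -mulrA; congr (_ * _).
pose G i j := d1 eta (Xs i) (Xs j) p.
have E (s : 'S_(2 + r * 2)) :
    (-1) ^+ odd_perm s * form_d1 eta (fun i => Xs (s (lshift (r * 2) i))) p
      * @wedge_exp R N M (form_d1 eta) r (fun j => Xs (s (rshift 2 j))) p
    = k * \sum_(t : 'S_(r * 2)) @pfterm R r.+1 G
        ((lift_perm ord0 ord0 (lift_perm ord0 ord0 t) : 'S_(r.+1 * 2)) * s)%g.
  rewrite IH mulrCA; congr (_ * _); rewrite /pf big_distrr /=; apply: eq_bigr => t _.
  rewrite /pfterm big_ord_recl.
  set L := (lift_perm ord0 ord0 (lift_perm ord0 ord0 t) : 'S_(r.+1 * 2)).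
  have L0 : L (ev ord0) = lshift (r * 2) (ord0 : 'I_2).
    by rewrite /L (_ : ev ord0 = ord0) ?lift_perm_id; apply: val_inj.
  have L1 : L (od ord0) = lshift (r * 2) (ord_max : 'I_2).
    rewrite /L (_ : od ord0 = lift ord0 ord0) ?lift_perm_lift ?lift_perm_id; last exact: val_inj.
    by apply: val_inj.
  have L2 i : L (ev (lift ord0 i)) = rshift 2 (t (ev i)).
    rewrite /L (_ : ev (lift ord0 i) = lift ord0 (lift ord0 (ev i))) ?lift_perm_lift; last exact: val_inj.
    exact: val_inj.
  have L3 i : L (od (lift ord0 i)) = rshift 2 (t (od i)).
    rewrite /L (_ : od (lift ord0 i) = lift ord0 (lift ord0 (od i))) ?lift_perm_lift; last exact: val_inj.
    exact: val_inj.
  rewrite !permM L0 L1 odd_permM signr_addb.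
  have -> : odd_perm L = odd_perm t by rewrite /L !odd_lift_perm.
  have -> : \prod_(i < r) G ((L * s)%g (ev (lift ord0 i))) ((L * s)%g (od (lift ord0 i))) =
      \prod_(i < r) G (s (rshift 2 (t (ev i)))) (s (rshift 2 (t (od i)))).
    by apply: eq_bigr => i _; rewrite !permM L2 L3.
  by rewrite mulrACA [(-1) ^+ _ * (-1) ^+ _]mulrC.
rewrite (eq_bigr _ (fun s _ => E s)) -big_distrr /= -mulrA; congr (_ * _).
rewrite exchange_big /= (eq_bigr (fun=> @pf R r.+1 G)); last first.
  by move=> t _; rewrite /pf [RHS](reindex_inj (mulgI (lift_perm ord0 ord0 (lift_perm ord0 ord0 t) : 'S_(r.+1 * 2)))).
by rewrite sumr_const card_Sn mulr_natl.
Qed.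

End TensorMatrix.

(** * The rank of d eta and of the projector *)

Section Rank.
Variables (R : realType) (N : nat) (M : manifold R N) (S : acm3 M).
Hypothesis Q : quasi3 S.
Variable r : nat.
Hypothesis r_gt0 : (0 < r)%N.
Hypothesis nz : forall p, nonzero_form_at
  (wedge (form1 (eta3 S ord0)) (@wedge_exp R N M (form_d1 (eta3 S ord0)) r)) p.
Hypothesis z : forall p, ~ nonzero_form_at (@wedge_exp R N M (form_d1 (eta3 S ord0)) r.+1) p.

Local Notation eta := (eta3 S ord0).
Local Notation psi := (psiT S ord0).
Local Notation g := (g3 S).

Section AtPoint.
Variables (p : M) (c : chart R N M).
Hypotheses (ac : atlas c) (cp : cdom c p).

(** By [psiT_te] this is the Gram matrix of d eta in the coordinate frame. *)
Definition d1mat : 'M[R]_N :=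
  \matrix_(i, j) (2^-1 * g p (ptan c (delta_mx 0 i) p) (psi p (ptan c (delta_mx 0 j) p))).

Let gD := agDl (acm_alg_pt Q ord0 p).
Let gZ := agZl (acm_alg_pt Q ord0 p).
Let g0 := ag0l (acm_alg_pt Q ord0 p).

Lemma g_suml (I : Type) (s : seq I) (a : I -> R) (u : I -> tangent p) w :
  g p (\sum_(i <- s) a i *: u i) w = \sum_(i <- s) a i * g p (u i) w.
Proof. by elim/big_rec2: _ => [|i y1 y2 _ <-]; rewrite ?g0// gD gZ. Qed.

Lemma d1mat_form (v w : tangent p) :
  (tcoord c v *m d1mat *m (tcoord c w)^T) 0 0 = 2^-1 * g p v (psi p w).
Proof.
rewrite {2}(tangent_frame v ac cp) {2}(tangent_frame w ac cp).
rewrite (linear_sumE _ _ _ _ (psiT_lin Q ord0 (p := p))) g_suml -mulmxA mxE big_distrr /=.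
apply: eq_bigr => i _; rewrite mulrCA; congr (_ * _).
rewrite mxE (g_sym Q) g_suml big_distrr /=; apply: eq_bigr => j _.
by rewrite [d1mat _ _]mxE [_^T _ _]mxE (g_sym Q) mulrCA mulrC.
Qed.

Lemma d1matE (X Y : vfield M) : vsmooth_at X p -> vsmooth_at Y p ->
  d1 eta X Y p = (tcoord c (X p) *m d1mat *m (tcoord c (Y p))^T) 0 0.
Proof.
by move=> sX sY; rewrite d1mat_form psiT_te// mulrA mulVf// mul1r.
Qed.

Lemma d1mat_skew : d1mat^T = - d1mat.
Proof. by apply/matrixP => i j; rewrite !mxE psiT_skew// mulrN. Qed.

Lemma gram_pf k (Xs : 'I_k -> vfield M) : (forall i, vsmooth_at (Xs i) p) ->
  (fun i j => d1 eta (Xs i) (Xs j) p) =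
  (fun i j => ((\matrix_i tcoord c (Xs i p)) *m d1mat *m (\matrix_i tcoord c (Xs i p))^T) i j).
Proof.
move=> sX; apply/funext => i; apply/funext => j; rewrite d1matE//.
rewrite [RHS]mxE [LHS]mxE; apply: eq_bigr => a _; rewrite !mxE; congr (_ * _).
by apply: eq_bigr => b _; rewrite !mxE.
Qed.

(** Vanishing of the power r + 1 bounds the rank above through [pf_exists]; nonvanishing of eta
    wedge the power r forces that power to be nonzero, which bounds it below through [pf_rank]. *)
Lemma d1mat_rank : \rank d1mat = (r * 2)%N.
Proof.
apply/eqP; rewrite eqn_leq; apply/andP; split.
  rewrite leqNgt; apply/negP => lt.
  have cR k : (k.+1%:R : R) != 0 by rewrite pnatr_eq0.
  have rk : (r.+1 * 2 <= (\rank d1mat).+1)%N by rewrite mulSn; lia.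
  have [X X0] := pf_exists cR d1mat_skew rk.
  pose Xs i := ptan c (row i X).
  have sX i : vsmooth_at (Xs i) p by exact: vsmooth_ptan.
  apply: (z (p := p)); exists Xs; split=> //.
  have [k k0 E] := wedge_exp_pf eta r.+1.
  rewrite E mulf_neq0// gram_pf//; move: X0.
  rewrite (_ : \matrix_i _ = X)//; apply/row_matrixP => i.
  by rewrite rowK tcoord_ptan.
have [Xs [sX nX]] := nz p.
have [Ys [sY nY]] : exists Ys : 'I_(r * 2) -> vfield M, (forall i, vsmooth_at (Ys i) p) /\
    @wedge_exp R N M (form_d1 eta) r Ys p != 0.
  apply: contrapT => H; move/eqP: nX; apply; rewrite /wedge big1 ?mulr0// => s _.
  have [->|e] := eqVneq (@wedge_exp R N M (form_d1 eta) r (fun j => Xs (s (rshift 1 j))) p) 0.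
    by rewrite mulr0.
  by case: H; exists (fun j => Xs (s (rshift 1 j))).
have [k k0 E] := wedge_exp_pf eta r.
move: nY; rewrite E mulf_eq0 negb_or => /andP[_].
rewrite gram_pf//; exact: pf_rank d1mat_skew.
Qed.

(** If f = 0 then psi^2 = 0, and skewness gives g(psi v, psi v) = -g(v, psi^2 v) = 0 up to the order
    of arguments. Positivity makes psi zero, against the rank 2 r > 0. *)
Lemma fT_neq0 : fT S p != 0.
Proof.
apply/negP => /eqP f0; have := d1mat_rank; rewrite (_ : d1mat = 0) ?mxrank0; first by lia.
apply/matrixP => i j; rewrite !mxE.
have -> : psi p (ptan c (delta_mx 0 j) p) = 0; last by rewrite (ag0r (acm_alg_pt Q ord0 p)) mulr0.
set v := ptan _ _ _; apply/eqP/negP => /negP v0.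
have [_ _ /(_ _ v0)] := g_riem Q p.
by rewrite psiT_skew// psiT2// f0 scale0r (ag0r (acm_alg_pt Q ord0 p)) oppr0 ltxx.
Qed.

End AtPoint.

Lemma fT_nz p : fT S p != 0.
Proof. by have [c ac cp] := atlas_cover p; exact: fT_neq0 ac cp. Qed.

Section ProjectorRank.
Variables (p : M) (c : chart R N M).
Hypotheses (ac : atlas c) (cp : cdom c p).
Local Notation P := (PT S ord0).
Local Notation xi := (xi3 S ord0).
Local Notation mP := (dmat P c p).

Let Pl : linear (P p) := @PT_lin _ _ _ _ Q ord0 p.

Lemma d1mat_ker (v : tangent p) : tcoord c v *m d1mat p c = 0 <-> psi p v = 0.
Proof.
split=> h.
  apply: (g_ext Q) => w; rewrite (ag0r (acm_alg_pt Q ord0 p)) psiT_skew//.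
  have := d1mat_form ac cp v w; rewrite h mul0mx mxE => /esym/eqP.
  by rewrite mulf_eq0 invr_eq0 pnatr_eq0 /= => /eqP ->; rewrite oppr0.
apply/rowP => j; rewrite [RHS]mxE.
have := d1mat_form ac cp v (ptan c (delta_mx 0 j) p).
rewrite psiT_skew// h (ag0r (acm_alg_pt Q ord0 p)) oppr0 mulr0 tcoord_ptan// trmx_delta -colE mxE.
by [].
Qed.

Lemma dmatP_idem : mP *m mP = mP.
Proof.
apply/row_matrixP => i; rewrite row_mul.
have -> : row i mP = tcoord c (P p (ptan c (delta_mx 0 i) p)) by apply/rowP => j; rewrite !mxE.
by rewrite -(dmatE _ Pl ac cp) (PT_id Q ord0 (PT_tr Q fT_nz ord0 _)).
Qed.

(** On the kernel of d eta the projector is v - eta(v) xi, so this kernel is the direct sum of the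
    image of P and the line of xi. *)
Lemma dmatP_rank : (\rank mP + (r * 2 + 1) = N)%N.
Proof.
have x0 : tcoord c (xi p) != 0.
  apply/eqP => h; have xi0 : xi p = 0 by apply: (tcoord_inj ac cp); rewrite h linear0.
  have [_ h1 _] := acm_pt Q ord0 p; move/eqP: h1.
  by rewrite xi0 (aeta0 (acm_alg_pt Q ord0 p)) eq_sym oner_eq0.
have xP : tcoord c (xi p) *m mP = 0.
  rewrite -dmatE// (_ : P p (xi p) = 0) ?linear0//.
  exact/(DT_P Q fT_nz ord0)/DT_xi.
have K : (kermx (d1mat p c) :=: mP + tcoord c (xi p))%MS.
  apply/eqmxP/andP; split.
    apply/rV_subP => u /sub_kermxP; rewrite -(tcoord_ptan u ac cp) => /d1mat_ker h.
    move: (ptan c u p) h => v h.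
    have -> : v = P p v + eta p v *: xi p.
      by rewrite /PT h (aphi0 (acm_alg_pt Q ord0 p)) scaler0 add0r subrK.
    rewrite linearD linearZ/= dmatE//.
    by apply: addmx_sub_adds; [exact: submxMl|exact: scalemx_sub].
  rewrite addsmx_sub; apply/andP; split; last first.
    by apply/sub_kermxP/d1mat_ker; exact: psiT_xi.
  apply/row_subP => i; apply/sub_kermxP.
  have -> : row i mP = tcoord c (P p (ptan c (delta_mx 0 i) p)) by apply/rowP => j; rewrite !mxE.
  by apply/d1mat_ker; have [_] := PT_tr Q fT_nz ord0 (ptan c (delta_mx 0 i) p); exact.
have dis : (mP :&: tcoord c (xi p))%MS = 0.
  apply/eqP/rowV0P => v; rewrite sub_capmx => /andP[/submxP[w ->] /submxP[a E]].
  by rewrite -dmatP_idem mulmxA E -mulmxA xP mulmx0.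
have := mxrank_ker (d1mat p c); rewrite K mxrank_disjoint_sum// rank_rV x0 d1mat_rank// => E.
by have := rank_leq_row (d1mat p c); rewrite d1mat_rank//; move: E; lia.
Qed.

End ProjectorRank.

End Rank.

(** * Integrability *)

Section Euclidean.
Variables (R : realType) (q : nat).

Definition rat_ball (xe : 'rV[rat]_q * rat) : set 'rV[R]_q :=
  [set y | `|y - map_mx ratr xe.1| < ratr xe.2].

Lemma rV_second_countable : @second_countable 'rV[R]_q.
Proof.
exists (range rat_ball).
  by apply: sub_countable (card_image_le _ _) _; exact: countableP.
split.
  by move=> _ [xe _ <-]; exact: ball_open'.
move=> x A /= nA; have : nbhs x A by exact: nA.
rewrite -nbhs_ballE => -[e /= e0 eA].
have [d] := rat_in_itvoo (divr_gt0 e0 (ltr0n R 2)); rewrite in_itv /= => /andP[d0 de].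
have [y yx] : exists y : 'rV[rat]_q, forall i, `|x 0 i - ratr (y 0 i)| < ratr d / 2.
  have H i : exists z : rat, `|x 0 i - ratr z| < ratr d / 2.
    have [|z] := @rat_in_itvoo R (x 0 i - ratr d / 2) (x 0 i + ratr d / 2).
      by rewrite ltrD2l gtrN// divr_gt0.
    by rewrite in_itv /= => /andP[z1 z2]; exists z; rewrite ltr_norml; apply/andP; split; lra.
  have [h hP] := choice H; exists (\row_i h i) => i.
  by rewrite mxE.
have xy : `|x - map_mx ratr y| < ratr d.
  apply: rV_norm_lt => // i; rewrite !mxE; apply: lt_trans (yx i) _.
  by rewrite ltr_pdivrMr// ltr_pMr// ltr1n.
exists (rat_ball (y, d)); first by split; [exists (y, d)|].
move=> z /= zy; apply: eA; rewrite -ball_normE /=.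
rewrite (_ : x - z = (x - map_mx ratr y) - (z - map_mx ratr y)); last first.
  by rewrite opprB addrA subrK.
apply: le_lt_trans (ler_normB _ _) _; rewrite [e]splitr.
by apply: ltrD; [exact: lt_trans de|exact: lt_trans de].
Qed.

Definition id_chart : chart R q 'rV[R]_q.
Proof.
by apply: (@Chart R q 'rV[R]_q setT setT id id) => //; try exact: openT; move=> x _; exact: cvg_id.
Defined.

Definition euclidean : manifold R q.
Proof.
apply: (@Manifold R q 'rV[R]_q [set id_chart]).
- exact: norm_hausdorff.
- exact: rV_second_countable.
- by move=> p; exists id_chart.
- by move=> c c' -> -> i k; exact: Ck_coord.
Defined.

End Euclidean.

(* A diffeomorphism of ]-e, e[ onto the line, which makes a cube a copy of R^q. *)
Section Stretch.
Variables (R : realType) (e : R).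
Hypothesis e0 : 0 < e.
Definition stretch (t : R) : R := t * (e ^+ 2 - t ^+ 2)^-1.

Lemma stretch_den t : `|t| < e -> 0 < e ^+ 2 - t ^+ 2.
Proof. by move=> te; rewrite subr_gt0 -(real_normK (num_real t)) ltrXn2r// ltW. Qed.

Lemma stretch_inj t u : `|t| < e -> `|u| < e -> stretch t = stretch u -> t = u.
Proof.
move=> te ue E.
have dt := stretch_den te; have du := stretch_den ue.
have {E} : t * (e ^+ 2 - u ^+ 2) = u * (e ^+ 2 - t ^+ 2).
  move: E; rewrite /stretch => /(congr1 (fun x => x * (e ^+ 2 - t ^+ 2) * (e ^+ 2 - u ^+ 2))).
  by rewrite mulfVK ?lt0r_neq0// => ->; rewrite mulrAC mulfVK// lt0r_neq0.
move=> E; have : (t - u) * (e ^+ 2 + t * u) = 0 by rewrite -[RHS](subrr (t * (e ^+ 2 - u ^+ 2))) {2}E; ring.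
move=> /eqP; rewrite mulf_eq0 subr_eq0 => /orP[/eqP//|/eqP tu].
have : `|t * u| < e ^+ 2 by rewrite normrM expr2 ltr_pM.
have -> : t * u = - e ^+ 2 by lra.
by rewrite normrN ger0_norm ?sqr_ge0// ltxx.
Qed.

Lemma stretch_surj b : exists2 t, `|t| < e & stretch t = b.
Proof.
pose D := Num.sqrt (1 + (2 * b * e) ^+ 2).
have D2 : D ^+ 2 = 1 + (2 * b * e) ^+ 2 by rewrite sqr_sqrtr// addr_ge0// sqr_ge0.
have Dg : `|2 * b * e| < D.
  by rewrite -sqrtr_sqr ltr_sqrt ?ltrDr// ltr_pwDl// sqr_ge0.
have D0 : 0 < 1 + D by rewrite addr_gt0//; exact: le_lt_trans Dg.
(* The root of b (e^2 - t^2) = t in rationalised form, which also covers b = 0. *)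
pose t := 2 * b * e * e / (1 + D).
have te : `|t| < e.
  rewrite -(ltr_pM2r D0) -{1}(gtr0_norm D0) -normrM mulfVK ?lt0r_neq0// normrM (gtr0_norm e0) mulrC.
  by rewrite ltr_pM2l//; apply: lt_trans Dg _; rewrite ltrDr.
exists t => //; have D1 : 1 + D != 0 by rewrite lt0r_neq0.
rewrite /stretch; apply: (canLR (mulfK (lt0r_neq0 (stretch_den te)))).
apply/eqP; rewrite -subr_eq0.
have -> : t - b * (e ^+ 2 - t ^+ 2) = b * e ^+ 2 * (1 + (2 * b * e) ^+ 2 - D ^+ 2) / (1 + D) ^+ 2.
  by rewrite /t; clearbody D; field.
by rewrite D2 subrr mulr0 mul0r.
Qed.

End Stretch.

Lemma smooth_Csmooth (R : realType) (N : nat) (M : manifold R N) (c : chart R N M) (f : M -> R) :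
  atlas c -> (forall q, cdom c q -> smooth_at f q) -> Csmooth (ccod c) (f \o cinv c).
Proof.
move=> ac sf k; apply: Ck_local => x cx.
have cp := cinv_dom cx; have [V [oV Vx _ H]] := smooth_at_inv ac cp (sf _ cp).
by rewrite cinvK// in Vx; exists V.
Qed.

Lemma row_basis_exists (F : fieldType) m n d (A : 'M[F]_(m, n)) : \rank A = d ->
  exists2 C : 'M[F]_(d, n), row_free C & (C :=: A)%MS.
Proof. by move=> <-; exists (row_base A); [exact: row_base_free|exact: eq_row_base]. Qed.

(** * Frobenius' theorem for the kernel of a projector *)

Section KernelFoliation.
Variables (R : realType) (N q : nat) (M : manifold R N) (P : tensor11 M).
Arguments P : clear implicits.
Hypothesis sP : smooth_tensor11 P.
Hypothesis idP : forall p v, P p (P p v) = P p v.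
Hypothesis rkP : forall c p, atlas c -> cdom c p -> \rank (dmat P c p) = q.
Hypothesis involutive : forall p X Y, vsmooth_at X p -> vsmooth_at Y p ->
  (\forall x \near p, P x (X x) = 0) -> (\forall x \near p, P x (Y x) = 0) ->
  P p (bracket X Y p) = 0.

Let lP p : linear (P p). Proof. by case: (sP p). Qed.

Variable c : chart R N M.
Hypothesis ac : atlas c.

Definition cmat (y : 'rV[R]_N) := dmat P c (cinv c y).

Lemma cmat_smooth m : Ckmx m (ccod c) cmat.
Proof.
move=> i j; apply: (@Ck_ext _ _ _ _ ((fun x => P x (ptan c (delta_mx 0 i) x) (coord c j)) \o cinv c)).
- exact: ccod_open.
- by move=> y cy; rewrite /= /cmat !mxE.
apply: smooth_Csmooth => // x cx; apply: vsmooth_coord => //.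
have [_ H] := sP x; apply: H; exact: vsmooth_ptan.
Qed.

Lemma cmat_idem y : ccod c y -> cmat y *m cmat y = cmat y.
Proof.
move=> cy; have cp := cinv_dom cy; apply/row_matrixP => i; rewrite row_mul.
have -> : row i (cmat y) = tcoord c (P (cinv c y) (ptan c (delta_mx 0 i) (cinv c y))).
  by apply/rowP => j; rewrite !mxE.
by rewrite -(dmatE _ (@lP _) ac cp) idP.
Qed.

Lemma cmat_rank y : ccod c y -> \rank (cmat y) = q.
Proof. by move=> cy; apply: rkP => //; exact: cinv_dom. Qed.

(** The kernel gets a local frame in echelon form, A X = 1. Brackets of its rows have zero
    X-components, because those components are constant, and lie in the kernel by involutivity; so
    they vanish. *)
Lemma kernel_foliation x0 : ccod c x0 ->
  exists k (A : 'rV[R]_N -> 'M[R]_(k, N)) V X C (Y : 'M[R]_(N, q)) rho U r g,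
  [/\ foliated A V x0 X C Y rho U r g, U x0,
      V `<=` ccod c,
      [/\ C *m X = 0, C *m Y = 1%:M, forall z : 'rV[R]_N, z *m X = 0 -> z = z *m Y *m C & (k + q = N)%N]
    & forall y, V y -> A y *m X = 1%:M /\ (A y :=: kermx (cmat y))%MS].
Proof.
move=> cx0; pose P0 := cmat x0.
have P00 : P0 *m P0 = P0 by exact: cmat_idem.
have [K [C [fK fC KP CP [KE CE kq]]]] : exists (K : 'M[R]_(\rank (kermx P0), N)) (C : 'M[R]_(q, N)),
  [/\ row_free K, row_free C, K *m P0 = 0, C *m P0 = C & [/\ forall z : 'M[R]_N, z *m P0 = 0 -> (z <= K)%MS,
    forall z : 'M[R]_N, z *m P0 = z -> (z <= C)%MS & (\rank (kermx P0) + q = N)%N]].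
  have [C fC CE] := row_basis_exists (cmat_rank cx0).
  exists (row_base (kermx P0)), C; split => //; first exact: row_base_free.
  - by apply/sub_kermxP; rewrite eq_row_base.
  - have /submxP[a ->] : (C <= P0)%MS by rewrite CE.
    by rewrite -mulmxA P00.
  - split.
    + by move=> z /sub_kermxP zk; rewrite eq_row_base.
    + by move=> z <-; rewrite CE submxMl.
    + rewrite mxrank_ker cmat_rank// subnK//.
      by rewrite -(cmat_rank cx0) rank_leq_row.
set k := \rank (kermx P0) in K fK KP KE kq *.
(* [X] and [Y] give coordinates on the kernel and on the image of [P0], spanned by the rows of K and
   C. *)
pose X := (1%:M - P0) *m pinvmx K; pose Y := P0 *m pinvmx C.
have KX : K *m X = 1%:M by rewrite /X mulmxA mulmxBr mulmx1 KP subr0 mulmxVp.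
have KY : K *m Y = 0 by rewrite /Y mulmxA KP mul0mx.
have CX : C *m X = 0 by rewrite /X mulmxA mulmxBr mulmx1 CP subrr mul0mx.
have CY : C *m Y = 1%:M by rewrite /Y mulmxA CP mulmxVp.
have XK : X *m K = 1%:M - P0.
  by rewrite /X mulmxKpV// KE// mulmxBl mul1mx P00 subrr.
have YC : Y *m C = P0 by rewrite /Y mulmxKpV// CE.
have XKYC : X *m K + Y *m C = 1%:M by rewrite XK YC subrK.
pose D y := K *m (1%:M - cmat y) *m X.
(* The basis K of the kernel at [x0] is projected to the kernel at y and renormalised by [D y],
   invertible near [x0], so that A X = 1. *)
pose A y := invmx (D y) *m (K *m (1%:M - cmat y)).
have D0 : D x0 \in unitmx by rewrite /D mulmxBr mulmx1 KP subr0 KX unitmx1.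
have sB m : Ckmx m (ccod c) (fun y => K *m (1%:M - cmat y)).
  apply: Ckmx_mul; [exact: ccod_open|exact: Ckmx_cst|].
  move=> i j; apply: (@Ck_ext _ _ _ _ (fun y => (1%:M : 'M[R]_N) i j - cmat y i j)); first exact: ccod_open.
    by move=> y _; rewrite !mxE.
  by apply: Ck_sub_fun; [exact: ccod_open|exact: Ck_cst|exact: cmat_smooth].
have sD m : Ckmx m (ccod c) D by apply: Ckmx_mul; [exact: ccod_open|exact: sB|exact: Ckmx_cst].
have nr : \forall y \near x0, ccod c y /\ D y \in unitmx.
  have h1 : \forall y \near x0, ccod c y by apply: open_nbhs_nbhs; split => //; exact: ccod_open.
  have h2 := unitmx_near (ccod_open (c := c)) cx0 (sD 0%N) D0.
  by near=> y; split; near: y.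
have := nr : nbhs x0 (fun y => ccod c y /\ D y \in unitmx); rewrite nbhsE => -[V [oV Vx0] VH].
have Vc : V `<=` ccod c by move=> y /VH[].
have sA m : Ckmx m V A.
  apply: Ckmx_mul => //.
    by apply: Ckmx_inv => //; [move=> y /VH[]|move=> i j; exact: Ck_sub (sD m i j)].
  by move=> i j; exact: Ck_sub (sB m i j).
have AX y : V y -> A y *m X = 1%:M by move=> /VH[_ Dy]; rewrite /A -mulmxA -/(D y) mulVmx.
have AP y : V y -> A y *m cmat y = 0.
  move=> Vy; rewrite /A -!mulmxA mulmxBl mul1mx cmat_idem ?subrr ?mulmx0//; exact: Vc.
have Ak y : V y -> (A y :=: kermx (cmat y))%MS.
  move=> Vy; apply/eqmxP; rewrite -mxrank_leqif_eq; last by apply/sub_kermxP; exact: AP.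
  have cy := Vc _ Vy; have -> : \rank (kermx (cmat y)) = k.
    by rewrite /k !mxrank_ker !cmat_rank.
  rewrite eqn_leq rank_leq_row /=.
  have := mxrankM_maxl (A y) X; rewrite AX// mxrank1.
  by [].
have comm y (u e : 'rV[R]_k) j : V y ->
    'D_(u *m A y) (fun y => (e *m A y) 0 j) y = 'D_(e *m A y) (fun y => (u *m A y) 0 j) y.
  move=> Vy; have cy := Vc _ Vy; pose p := cinv c y; have cp : cdom c p by exact: cinv_dom.
  pose F (u : 'rV[R]_k) : vfield M := fun x => ptan c (u *m A (cfun c x)) x.
  have nV : \forall x \near p, cdom c x /\ V (cfun c x).
    apply: open_nbhs_nbhs; split; first exact: open_chart_preimage.
    by split => //; rewrite /p cinvK.
  have FE u' i x : cdom c x -> F u' x (coord c i) = (u' *m A (cfun c x)) 0 i.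
    by move=> cx; have := tcoord_ptan (u' *m A (cfun c x)) ac cx => /rowP /(_ i); rewrite mxE.
  have FT u' x : cdom c x -> tcoord c (F u' x) = u' *m A (cfun c x) by move=> cx; exact: tcoord_ptan.
  have FP u' x h : cdom c x -> smooth_at h x ->
      F u' x h = 'D_(u' *m A (cfun c x)) (h \o cinv c) (cfun c x) by move=> cx sh; exact: ptanE.
  clearbody F.
  have FEy u' i z : V z -> F u' (cinv c z) (coord c i) = (u' *m A z) 0 i.
    by move=> Vz; rewrite FE ?cinvK//; [exact: Vc|exact: cinv_dom (Vc _ Vz)].
  have sF u' : vsmooth_at (F u') p.
    apply: (vsmooth_coords ac cp) => i; apply: (smooth_at_chart (V := V) ac cp oV); first by rewrite /p cinvK.
    move=> m; apply: (@Ck_ext _ _ _ _ (fun z => (u' *m A z) 0 i)) => //.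
      by move=> z Vz; rewrite -FEy.
    exact: (Ckmx_mul oV (Ckmx_cst m V u') (sA m)).
  have PF u' : \forall x \near p, P x (F u' x) = 0.
    apply: filterS nV => x [cx Vx]; apply: (tcoord_inj ac cx); rewrite linear0.
    rewrite (dmatE _ (@lP _) ac cx) FT// -mulmxA.
    have -> : dmat P c x = cmat (cfun c x) by rewrite /cmat cfunK.
    by rewrite AP ?mulmx0.
  pose w := tcoord c (bracket (F u) (F e) p).
  have wP : w *m cmat y = 0.
    by rewrite /cmat -/p -(dmatE _ (@lP _) ac cp) involutive// linear0.
  (* The linear function [G] with coefficients from column l of X has constant derivative along each
     frame field, so the bracket annihilates it. *)
  have wX : w *m X = 0.
    apply/rowP => l; rewrite [RHS]mxE mxE.
    pose G x := \sum_i X i l * coord c i x.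
    have sG x : cdom c x -> smooth_at G x.
      by move=> cx; apply: smooth_sum => i _; apply: smooth_scale; exact: smooth_coord.
    have FG u' x : cdom c x -> V (cfun c x) -> F u' x G = u' 0 l.
      move=> cx Vx; rewrite /G tangent_sum; last by move=> i _; apply: smooth_scale; exact: smooth_coord.
      have -> : u' 0 l = (u' *m A (cfun c x) *m X) 0 l by rewrite -mulmxA AX// mulmx1.
      rewrite [RHS]mxE; apply: eq_bigr => i _.
      by rewrite tangent_scale ?FE// 1?mulrC//; exact: smooth_coord.
    have FG0 u' u'' : F u'' p (fun x => F u' x G) = 0.
      rewrite -(tangent_cst (F u'' p) (u' 0 l)); apply: tangent_near; first by apply: sF; exact: sG.
      by apply: filterS nV => x [cx Vx]; rewrite FG.
    have : bracket (F u) (F e) p G = 0 by rewrite bracketE ?FG0 ?subrr//; exact: sG.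
    rewrite /G tangent_sum; last by move=> i _; apply: smooth_scale; exact: smooth_coord.
    move=> E0; rewrite -[RHS]E0; apply: eq_bigr => i _.
    by rewrite tangent_scale; [rewrite mxE mulrC|exact: smooth_coord].
  have w0 : w = 0.
    have : (w <= A y)%MS by rewrite (Ak y Vy); apply/sub_kermxP.
    by move=> /submxP[a E]; move: wX; rewrite E -mulmxA AX// mulmx1 => ->; rewrite mul0mx.
  have : w 0 j = 0 by rewrite w0 mxE.
  rewrite mxE bracketE//; last exact: smooth_coord.
  have FD u' u'' : F u'' p (fun x => F u' x (coord c j)) = 'D_(u'' *m A y) (fun y => (u' *m A y) 0 j) y.
    rewrite FP//; last by apply: (sF u'); exact: smooth_coord.
    rewrite /p cinvK//; apply: near_eq_derive.
    by apply: filterS (open_nbhs_nbhs (conj oV Vy)) => z Vz; rewrite -FEy.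
  by rewrite !FD => /eqP; rewrite subr_eq0 => /eqP.
have [rho [U [r [g [fol Ux0]]]]] := foliation_exists oV Vx0 sA CX CY XKYC AX comm.
exists k, A, V, X, C, Y, rho, U, r, g; split => //.
  split => // z zX.
  by rewrite -[LHS]mulmx1 -XKYC mulmxDr (mulmxA z X) zX mul0mx add0r (mulmxA z Y).
by move=> y Vy; split; [exact: AX|exact: Ak].
Unshelve. all: by end_near. Qed.

(** The map reads off the slice coordinates of the retraction. The slice is a cube, stretched onto
    R^q so that the base is the Euclidean manifold. *)
Lemma kernel_submersion p0 : cdom c p0 ->
  exists (U : set M) (pi : M -> euclidean R q),
    U p0 /\ defining_submersion (fun p => [set v | P p v = 0]) U pi.
Proof.
move=> cp0; have cx0 := cfun_cod cp0.
have [k [A [V [X [C [Y [rho [U0 [r [g [fol Ux0 Vc [CX CY zE kq] AE]]]]]]]]]]] := kernel_foliation cx0.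
have [rho0 oU0 U0V sr slice idr path0 path1 pathP pathD leaf trans] := fol.
set x0 := cfun c p0 in cx0 Ux0 fol slice idr pathD *.
have [CB CB0 CBP] := mulmx_bound C.
(* Slice coordinates b with |b| < e give points x0 + b C within rho of [x0], where the retraction is
   the identity on the slice. *)
pose e := rho / (CB + 1).
have CB1 : 0 < CB + 1 by rewrite ltr_wpDl.
have e0 : 0 < e by rewrite divr_gt0.
have eC (b : 'rV[R]_q) : `|b| < e -> `|b *m C| < rho.
  move=> be; apply: le_lt_trans (CBP b) _; have [->|b0] := eqVneq b 0.
    by rewrite normr0 mulr0.
  apply: (@lt_trans _ _ ((CB + 1) * `|b|)).
    by rewrite ltr_pM2r ?normr_gt0// ltrDl.
  by rewrite mulrC -ltr_pdivlMr.
pose psi (x : 'rV[R]_N) : 'rV[R]_q := (r x - x0) *m Y.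
pose U := [set p | cdom c p /\ (U0 `&` [set x | `|psi x| < e]) (cfun c p)].
pose pi (p : M) : euclidean R q := \row_i stretch e (psi (cfun c p) 0 i).
have piE (p : M) i : (pi p : 'rV[R]_q) 0 i = stretch e (psi (cfun c p) 0 i) by rewrite mxE.
have spsi i : Csmooth U0 (fun x => psi x 0 i).
  move=> m; apply: (@Ck_ext _ _ _ _ (fun x => (r x *m Y) 0 i - (x0 *m Y) 0 i)) => //.
    by move=> x _; rewrite /psi mulmxBl [RHS]mxE [X in _ = _ + X]mxE.
  by apply: Ck_sub_fun => //; [apply: Ck_mulmx => // j; exact: sr|exact: Ck_cst].
have cpsi x : U0 x -> {for x, continuous psi}.
  move=> Ux; apply: (rV_cvgP (FF := nbhs_filter x)) => i.
  exact: (Ck_cont (spsi i 0%N)).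
have oU1 : open (U0 `&` [set x | `|psi x| < e]).
  rewrite openE => x [Ux px]; have h1 : \forall y \near x, U0 y by exact: open_nbhs_nbhs.
  have h2 : \forall y \near x, `|psi y - 0| < e.
    apply: (cpsi x Ux [set b | `|b - 0| < e]); apply: open_nbhs_nbhs; split; first exact: ball_open'.
    by rewrite /= subr0.
  by near=> y; split; [|rewrite /= -[psi y]subr0]; near: y.
have oU : open U by exact: open_chart_preimage.
have rE x : U0 x -> r x = x0 + psi x *m C.
  by move=> /slice[/zE rx _]; rewrite /psi -rx addrC subrK.
exists U, pi; split.
  split => //; split => //=; rewrite /psi.
  have [_ ->] : U0 x0 /\ r x0 = x0 by apply: idr; rewrite subrr ?mul0mx ?normr0.
  by rewrite subrr mul0mx normr0.
pose h i (p : M) : R := psi (cfun c p) 0 i.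
have hpsi p i : U p -> smooth_at (h i) p.
  move=> [cp [Ux px]]; apply: (smooth_at_chart (c := c) (V := U0)) => // m.
  by apply: Ck_ext (spsi i m) => // x Ux'; rewrite /h /= cinvK//; exact/Vc/U0V.
have hlt p i : U p -> `|h i p| < e.
  by move=> [_ [_ px]]; apply: le_lt_trans px; exact: norm_coord.
have spi p i : U p -> smooth_at (fun p => pi p 0 i) p.
  move=> Up; have [cp [Ux px]] := Up; have sh := hpsi p i Up.
  apply: (@smooth_ext _ _ _ (fun p => h i p * (e ^+ 2 - h i p * h i p)^-1)).
    by apply: (@filterE _ _ (nbhs_filter p)) => x; rewrite mxE.
  apply: smooth_mul => //; apply: smooth_inv; last by rewrite -expr2 lt0r_neq0// stretch_den// hlt.
  by apply: smooth_sub; [exact: smooth_cst|exact: smooth_mul].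
have smpi p : U p -> smooth_map_at pi p.
  move=> Up; apply: (@smooth_map_coords _ _ _ M (euclidean R q) pi p (id_chart R q)) => //.
    apply: (rV_cvgP (FF := nbhs_filter p)) => i; exact: smooth_at_cont (spi p i Up).
  by move=> i; exact: spi.
have onto (b : euclidean R q) : exists z, [/\ U0 z, `|psi z| < e, r z = z & pi (cinv c z) = b].
  have H i : exists t, `|t| < e /\ stretch e t = (b : 'rV[R]_q) 0 i.
    by have [t] := stretch_surj e0 ((b : 'rV[R]_q) 0 i); exists t.
  have [t tP] := choice H; pose tr : 'rV[R]_q := \row_i t i.
  have te : `|tr| < e by apply: rV_norm_lt => // i; rewrite mxE; case: (tP i).
  pose z := x0 + tr *m C.
  have zx : z - x0 = tr *m C by rewrite /z addrC addKr.
  have [Uz rz] : U0 z /\ r z = z.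
    by apply: idr; rewrite zx; [rewrite -mulmxA CX mulmx0|exact: eC].
  have pz : psi z = tr by rewrite /psi rz zx -mulmxA CY mulmx1.
  exists z; split => //; first by rewrite pz.
  apply/rowP => i; rewrite mxE cinvK ?pz ?mxE; last exact/Vc/U0V.
  by case: (tP i).
split => //.
- move=> p Up; have [cp [Ux px]] := Up; have cx := Vc _ (U0V _ Ux).
  set x := cfun c p in Ux px cx.
  pose J := jac r x *m Y.
  have vh (v : tangent p) i : v (h i) = (tcoord c v *m J) 0 i.
    rewrite -{1}(ptan_tcoord v ac cp) ptanE//; last exact: hpsi.
    have D := jac_mulmx Y (tcoord c v) i oU0 (fun j => sr j 1%N) Ux.
    rewrite /J mulmxA -(@derive_val _ _ _ _ _ _ _ D) -/x.
    transitivity ('D_(tcoord c v) (fun y => (r y *m Y) 0 i - (x0 *m Y) 0 i) x).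
      apply: near_eq_derive; apply: filterS (open_nbhs_nbhs (conj oU0 Ux)) => y Uy.
      by rewrite /h /= cinvK; [rewrite /psi mulmxBl [LHS]mxE [X in _ + X = _]mxE|exact/Vc/U0V].
    have [d1 _] := D; have -> : (fun y => (r y *m Y) 0 i - (x0 *m Y) 0 i) = (fun y => (r y *m Y) 0 i) - cst ((x0 *m Y) 0 i) by [].
    by rewrite deriveB// derive_cst subr0.
  (* The derivative of [stretch] at h, obtained from pi (e^2 - h^2) = h by the product rule. *)
  pose w i := (1 + 2 * h i p * pi p 0 i) / (e ^+ 2 - h i p ^+ 2).
  have vpi (v : tangent p) i : tmap pi v (coord (id_chart R q : chart R q (euclidean R q)) i) = w i * v (h i).
    rewrite tmapE; [|exact: smpi|exact: smooth_coord].
    have sp := spi p i Up; have sh := hpsi p i Up.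
    have dn : e ^+ 2 - h i p ^+ 2 != 0 by rewrite lt0r_neq0// stretch_den// hlt.
    have E : v (h i) = v (fun x => pi x 0 i * (e ^+ 2 - h i x * h i x)).
      apply: tangent_near => //.
      have H : \forall y \near p, U y by exact: open_nbhs_nbhs.
      apply: filterS H => y Uy; rewrite mxE /stretch -/(h i y) -expr2 mulfVK// lt0r_neq0// stretch_den//.
      exact: hlt.
    have shh : smooth_at (fun x => h i x * h i x) p by exact: smooth_mul.
    have Ed : v (fun x => e ^+ 2 - h i x * h i x) = - (2 * h i p * v (h i)).
      by rewrite tangent_sub//; [rewrite tangent_cst tangent_mul//; ring|exact: smooth_cst].
    have E3 : (e ^+ 2 - h i p ^+ 2) * v (fun x => pi x 0 i) = (1 + 2 * h i p * pi p 0 i) * v (h i).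
      have : v (h i) = pi p 0 i * - (2 * h i p * v (h i)) + (e ^+ 2 - h i p * h i p) * v (fun x => pi x 0 i).
        rewrite -Ed {1}E tangent_mul//.
        by apply: smooth_sub => //; exact: smooth_cst.
      move/eqP; rewrite -subr_eq0 => /eqP E4; apply/eqP; rewrite -subr_eq0; apply/eqP.
      by rewrite -[RHS]oppr0 -[in RHS]E4; ring.
    by rewrite /w mulrAC -E3 mulrAC mulfV// mul1r.
  have w0 i : w i != 0.
    have lt := hlt p i Up; have dn : e ^+ 2 - h i p ^+ 2 != 0 by rewrite lt0r_neq0// stretch_den.
    rewrite /w mulf_neq0 ?invr_eq0// [pi p 0 i]mxE /stretch -/(h i p).
    have -> : 1 + 2 * h i p * (h i p / (e ^+ 2 - h i p ^+ 2)) = (e ^+ 2 + h i p ^+ 2) / (e ^+ 2 - h i p ^+ 2).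
      by field.
    by rewrite mulf_neq0 ?invr_eq0// lt0r_neq0// ltr_wpDr ?sqr_ge0 ?exprn_gt0.
  have tp (v : tangent p) i : tcoord (id_chart R q : chart R q (euclidean R q)) (tmap pi v) 0 i = w i * (tcoord c v *m J) 0 i.
    by rewrite mxE vpi vh.
  have CJ : C *m J \in unitmx by rewrite /J mulmxA; exact: trans.
  have AJ : A x *m J = 0.
    rewrite /J mulmxA (_ : A x *m jac r x = 0) ?mul0mx//.
    apply/row_matrixP => i; rewrite row_mul row0 rowE; apply/rowP => j.
    rewrite (jacE _ _ oU0 (fun j => sr j 1%N) Ux) mxE.
    by rewrite (@derive_val _ _ _ _ _ _ _ (leaf x _ j Ux)).
  have [AX AK] := AE x (U0V _ Ux).
  have rJ : \rank J = q.
    apply/eqP; rewrite eqn_leq rank_leq_col /=.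
    by rewrite -{1}(mxrank_unit CJ) mxrankM_maxr.
  have KA : (kermx J <= A x)%MS.
    have sub : (A x <= kermx J)%MS by apply/sub_kermxP.
    rewrite -(mxrank_leqif_sup sub).2 mxrank_ker rJ AK mxrank_ker cmat_rank//.
  split.
    rewrite eqEsubset; split => // ww _.
    pose om := \row_i ((w i)^-1 * tcoord (id_chart R q : chart R q (euclidean R q)) ww 0 i).
    exists (ptan c (om *m invmx (C *m J) *m C) p) => //.
    apply: (@tcoord_inj _ _ (euclidean R q) (id_chart R q)) => //.
    apply/rowP => i; by rewrite tp tcoord_ptan// -(mulmxA _ C) mulmxKV// [om _ _]mxE mulrA mulfV// mul1r.
  rewrite eqEsubset; split => v /= hv.
    apply: (@tcoord_inj _ _ (euclidean R q) (id_chart R q)) => //.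
    apply/rowP => i; rewrite linear0 tp.
    have : (tcoord c v <= A x)%MS.
      rewrite AK; apply/sub_kermxP.
      by rewrite /cmat /x cfunK// -(dmatE _ (@lP _) ac cp) hv linear0.
    by move=> /submxP[a ->]; rewrite -mulmxA AJ mulmx0 !mxE mulr0.
  have : (tcoord c v <= A x)%MS.
    apply: submx_trans KA; apply/sub_kermxP/rowP => i; rewrite [RHS]mxE.
    have := tp v i; rewrite hv linear0 mxE => /esym/eqP; rewrite mulf_eq0 (negPf (w0 i)) /= => /eqP.
    by [].
  rewrite AK => /sub_kermxP; rewrite /cmat /x cfunK// -(dmatE _ (@lP _) ac cp) => h0.
  by apply: (tcoord_inj ac cp); rewrite linear0.
- rewrite eqEsubset; split => // b _.
  have [z [Uz pz rz bz]] := onto b; have cz := Vc _ (U0V _ Uz).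
  by exists (cinv c z); [split; [exact: cinv_dom|rewrite cinvK]|exact: bz].
- move=> b; have [z [Uz pz rz bz]] := onto b; have cz := Vc _ (U0V _ Uz).
  set F := U `&` pi @^-1` [set b].
  (* Each point of the fibre is joined, inside the fibre, to the one slice point over b; the fibre
     is a union of connected paths through that point. *)
  pose path p := (fun s : R => cinv c (g (cfun c p) s)) @` `[0, 1]%classic.
  have -> : F = \bigcup_(p in F) path p.
    rewrite eqEsubset; split.
      move=> p Fp; exists p => //; exists 0; first by rewrite /= in_itv /= lexx ler01.
      by case: Fp => -[cp [Ux _]] _; rewrite path0// cfunK.
    move=> _ [p [[cp [Ux px]] pb] [s s01 <-]]; rewrite /= in_itv /= in s01.
    have [Us rs] := pathP _ _ Ux s01; have cs := Vc _ (U0V _ Us).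
    have ps : psi (g (cfun c p) s) = psi (cfun c p) by rewrite /psi rs.
    split; first by split; [exact: cinv_dom|rewrite cinvK//; split => //=; rewrite ps].
    by rewrite -pb /=; apply/rowP => i; rewrite !piE cinvK// ps.
  apply: bigcup_connected.
    exists (cinv c z) => p [[cp [Ux px]] pb]; exists 1; first by rewrite /= in_itv /= lexx ler01.
    rewrite path1// rE//; congr (cinv c _).
    have -> : psi (cfun c p) = psi z.
      apply/rowP => i; apply: (@stretch_inj R e).
      - by apply: le_lt_trans px; exact: norm_coord.
      - by apply: le_lt_trans pz; exact: norm_coord.
      by have := congr1 (fun y : 'rV[R]_q => y 0 i) pb; rewrite -bz /= !piE cinvK.
    by rewrite -rE// rz.
  move=> p [[cp [Ux px]] pb]; apply: connected_continuous_connected; first exact: segment_connected.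
  apply: continuous_in_subspaceT => s; rewrite inE /= in_itv /= => s01.
  apply: (@continuous_comp _ _ _ (g (cfun c p)) (cinv c)).
    exact: (has_deriv_cont (pathD _ Ux) s01).
  apply: cinv_cont; apply/Vc/U0V; exact: (pathP _ _ Ux s01).1.
Unshelve. all: by end_near. Qed.

End KernelFoliation.

(** * Leaves *)

Section SmoothMatrices.
Variables (R : realType) (N : nat) (M : manifold R N).

Definition mxsmooth_at m n (G : M -> 'M[R]_(m, n)) p := forall i j, smooth_at (fun q => G q i j) p.

Lemma mxsmooth_mul m n k (A : M -> 'M[R]_(m, n)) (B : M -> 'M[R]_(n, k)) p :
  mxsmooth_at A p -> mxsmooth_at B p -> mxsmooth_at (fun q => A q *m B q) p.
Proof.
move=> sA sB i j; have -> : (fun q => (A q *m B q) i j) = (fun q => \sum_k A q i k * B q k j).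
  by apply/funext => q; rewrite mxE.
by apply: smooth_sum => l _; apply: smooth_mul.
Qed.

Lemma mxsmooth_cst m n (A : 'M[R]_(m, n)) p : mxsmooth_at (fun=> A) p.
Proof. by move=> i j; exact: smooth_cst. Qed.

Lemma smooth_det m (A : M -> 'M[R]_m) p : mxsmooth_at A p -> smooth_at (fun q => \det (A q)) p.
Proof.
move=> sA; rewrite /determinant; apply: smooth_sum => s _; apply: smooth_scale.
by apply: smooth_prod => i _; exact: sA.
Qed.

Lemma mxunit_near m (A : M -> 'M[R]_m) p : mxsmooth_at A p -> A p \in unitmx ->
  \forall q \near p, A q \in unitmx.
Proof.
move=> sA; rewrite unitmxE unitfE => d0.
have c := smooth_at_cont (smooth_det sA).
by near=> q; rewrite unitmxE unitfE; near: q; apply: cvgr_neq0 d0; exact: c.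
Unshelve. all: by end_near. Qed.

Lemma mxsmooth_inv m (A : M -> 'M[R]_m) p : mxsmooth_at A p -> A p \in unitmx ->
  mxsmooth_at (fun q => invmx (A q)) p.
Proof.
move=> sA uA i j.
apply: (@smooth_ext _ _ _ (fun q => (\det (A q))^-1 * cofactor (A q) j i)).
  by apply: filterS (mxunit_near sA uA) => q uq; rewrite /invmx uq !mxE.
apply: smooth_mul.
  by apply: smooth_inv; [exact: smooth_det|rewrite -unitfE -unitmxE].
apply: smooth_scale; apply: smooth_det => a b.
have -> : (fun q => row' j (col' i (A q)) a b) = (fun q => A q (lift j a) (lift i b)).
  by apply/funext => q; rewrite !mxE.
exact: sA.
Qed.

End SmoothMatrices.

Lemma der0_locally_const (R : realType) (N : nat) (M : manifold R N) (h : M -> R) p :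
  (forall q, smooth_at h q) -> (forall q (v : tangent q), v h = 0) -> \forall q \near p, h q = h p.
Proof.
move=> smh h0; have sh := smh p; have [c ac cp] := atlas_cover p.
have [V [oV Vp Vc Hh]] := smooth_at_inv ac cp sh.
have [r r0 rV] := open_ball_in oV Vp.
have H : \forall q \near p, cdom c q /\ [set y | `|y - cfun c p| < r] (cfun c q).
  apply: open_nbhs_nbhs; split; first by apply: open_chart_preimage; exact: ball_open'.
  by split => //=; rewrite subrr normr0.
apply: filterS H => q [cq qr].
pose w := cfun c q - cfun c p.
have inV (t : R) : 0 <= t <= 1 -> V (cfun c p + t *: w).
  move=> /andP[t0 t1]; apply: rV => /=; rewrite addrC addKr normrZ ger0_norm//.
  by apply: le_lt_trans qr; rewrite ler_piMl.
have [t t01 E] := @ray_mvt R 'rV[R]_N (h \o cinv c) (cfun c p) w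
  (fun t t01 => Ck_derivable (Hh 1%N) (inV t t01)).
have Vt := inV t t01; have ct := Vc _ Vt.
have {}E : h q - h p = 'D_w (h \o cinv c) (cfun c p + t *: w).
  by rewrite -E /w addrCA subrr addr0 /= !cfunK.
apply/eqP; rewrite -subr_eq0 E; apply/eqP.
have := h0 (cinv c (cfun c p + t *: w)) (ptan c w _).
by rewrite ptanE// ?cinvK//; exact: cinv_dom.
Qed.

Lemma locally_const_connected (T : topologicalType) (R : realType) (h : T -> R) :
  connected [set: T] -> (forall p, \forall q \near p, h q = h p) -> forall p q, h p = h q.
Proof.
move=> cT lc p q; pose B := [set x | h x = h p].
suff : B = setT by move=> BT; have : B q by rewrite BT.
have oB : open B.
  rewrite openE => x xB; rewrite /interior; apply: filterS (lc x) => y yx.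
  by rewrite /B /= yx; exact: xB.
have oBC : open (~` B).
  rewrite openE => x /= xB; rewrite /interior; apply: filterS (lc x) => y yx; by rewrite /B /= yx.
apply: cT; first by exists p.
  by exists B => //; rewrite setTI.
by exists B; [rewrite -[B]setCK; exact: open_closedC|rewrite setTI].
Qed.

(** * Pulling back along smooth maps *)

Section Immersion.
Variables (R : realType) (N d : nat) (M : manifold R N) (L : manifold R d) (F : L -> M) (p : L).
Hypothesis sF : smooth_map_at F p.

Lemma smooth_pull h : smooth_at h (F p) -> smooth_at (h \o F) p.
Proof. by case: sF => _; exact. Qed.

Lemma near_pull (A : M -> Prop) : (\forall y \near F p, A y) -> \forall q \near p, A (F q).
Proof. by move=> H; case: sF => cF _; exact: (cF A H). Qed.

Section Charts.
Variables (c : chart R d L) (c' : chart R N M).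
Hypotheses (ac : atlas c) (cp : cdom c p) (ac' : atlas c') (cp' : cdom c' (F p)).

Definition jmat (q : L) : 'M[R]_(d, N) := \matrix_i tcoord c' (tmap F (ptan c (delta_mx 0 i) q)).

Lemma jmatE q (v : tangent q) : cdom c q -> tcoord c' (tmap F v) = tcoord c v *m jmat q.
Proof.
move=> cq.
rewrite {1}(tangent_frame v ac cq) !linear_sum/= mulmx_sum_row; apply: eq_bigr => i _.
by rewrite !linearZ/= rowK.
Qed.

Lemma tmap_coord_smooth (X : vfield L) j : vsmooth_at X p ->
  smooth_at (fun q => tmap F (X q) (coord c' j)) p.
Proof.
move=> sX; have sc : smooth_at (coord c' j) (F p) by exact: smooth_coord.
apply: (@smooth_ext _ _ _ (fun q => X q (coord c' j \o F))); last by apply: sX; exact: smooth_pull.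
near=> q; rewrite tmapE//; near: q; [exact: smooth_map_near|exact: (near_pull (smooth_near sc))].
Unshelve. all: by end_near.
Qed.

Lemma jmat_free : injective (@tmap _ _ _ _ _ F p) -> row_free (jmat p).
Proof.
move=> iF; rewrite -kermx_eq0; apply/rowV0P => u /sub_kermxP; rewrite -(tcoord_ptan u ac cp) -jmatE// => h.
have : tmap F (ptan c u p) = 0 by apply: (tcoord_inj ac' cp'); rewrite h linear0.
by rewrite -(linear0 (tmap F (p := p))) => /iF ->; rewrite linear0.
Qed.

Lemma jmat_smooth : mxsmooth_at jmat p.
Proof.
move=> i j; have -> : (fun q => jmat q i j) = (fun q => tmap F (ptan c (delta_mx 0 i) q) (coord c' j)).
  by apply/funext => q; rewrite !mxE.
by apply: tmap_coord_smooth; exact: vsmooth_ptan.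
Qed.

(* A left inverse of the Jacobian turns smoothness of the image components into smoothness. *)
Lemma vsmooth_immersion (X : vfield L) : injective (@tmap _ _ _ _ _ F p) ->
  (forall j, smooth_at (fun q => tmap F (X q) (coord c' j)) p) -> vsmooth_at X p.
Proof.
move=> iF sX; pose Z := pinvmx (jmat p).
have JZ : jmat p *m Z = 1%:M by rewrite mulmxVp//; exact: jmat_free.
have sJZ : mxsmooth_at (fun q => jmat q *m Z) p.
  by apply: mxsmooth_mul; [exact: jmat_smooth|exact: mxsmooth_cst].
have uJZ : jmat p *m Z \in unitmx by rewrite JZ unitmx1.
have nu := mxunit_near sJZ uJZ.
have nc : \forall q \near p, cdom c q by apply: open_nbhs_nbhs; split => //; exact: cdom_open.
apply: (vsmooth_coords ac cp) => i.
apply: (@smooth_ext _ _ _ (fun q => (tcoord c' (tmap F (X q)) *m Z *m invmx (jmat q *m Z)) 0 i)).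
  near=> q; have cq : cdom c q by near: q.
  rewrite jmatE// -(mulmxA _ (jmat q)) mulmxK; last by near: q.
  by rewrite mxE.
have sX' : mxsmooth_at (fun q => tcoord c' (tmap F (X q))) p.
  move=> a b; rewrite (ord1 a); have -> : (fun q => tcoord c' (tmap F (X q)) 0 b) = (fun q => tmap F (X q) (coord c' b)).
    by apply/funext => q; rewrite mxE.
  exact: sX.
apply: (mxsmooth_mul (mxsmooth_mul sX' (mxsmooth_cst Z p)) (mxsmooth_inv sJZ uJZ)).
Unshelve. all: by end_near. Qed.

Lemma pull_frame : \forall q \near p, cdom c' (F q).
Proof. by apply: near_pull; apply: open_nbhs_nbhs; split => //; exact: cdom_open. Qed.

Lemma pull_tensor_smooth (T : tensor11 M) (X : vfield L) j : smooth_tensor11 T -> vsmooth_at X p ->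
  smooth_at (fun q => T (F q) (tmap F (X q)) (coord c' j)) p.
Proof.
move=> sT sX.
apply: (@smooth_ext _ _ _ (fun q => \sum_k tmap F (X q) (coord c' k) *
   ((fun y => T y (ptan c' (delta_mx 0 k) y) (coord c' j)) \o F) q)).
  apply: filterS pull_frame => q cq; have [Tl _] := sT (F q).
  rewrite [in RHS](tangent_frame (tmap F (X q)) ac' cq) (linear_sumE _ _ _ _ Tl) tangent_sumE.
  by apply: eq_bigr => k _; rewrite tangentZE [tcoord _ _ _ _]mxE.
apply: smooth_sum => k _; apply: smooth_mul; first exact: tmap_coord_smooth.
apply: smooth_pull; apply: vsmooth_coord => //.
by have [_ H] := sT (F p); apply: H; exact: vsmooth_ptan.
Qed.

End Charts.

Lemma pull_oneform_smooth (e : oneform M) (X : vfield L) : smooth_oneform e -> vsmooth_at X p ->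
  smooth_at (fun q => e (F q) (tmap F (X q))) p.
Proof.
move=> se sX; have [c' ac' cp'] := atlas_cover (F p).
apply: (@smooth_ext _ _ _ (fun q => \sum_k tmap F (X q) (coord c' k) *
   ((fun y => e y (ptan c' (delta_mx 0 k) y)) \o F) q)).
  apply: filterS (pull_frame cp') => q cq; have [el _] := se (F q).
  rewrite [in RHS](tangent_frame (tmap F (X q)) ac' cq) (@linear_sumE _ _ R^o _ _ _ _ _ _ el).
  by apply: eq_bigr => k _; rewrite [tcoord _ _ _ _]mxE.
apply: smooth_sum => k _; apply: smooth_mul; first exact: tmap_coord_smooth.
by apply: smooth_pull; have [_ H] := se (F p); apply: H; exact: vsmooth_ptan.
Qed.

Lemma pull_metric_smooth (g : bilform M) (X Y : vfield L) : riemannian_metric g ->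
  vsmooth_at X p -> vsmooth_at Y p ->
  smooth_at (fun q => g (F q) (tmap F (X q)) (tmap F (Y q))) p.
Proof.
move=> rg sX sY; have [c' ac' cp'] := atlas_cover (F p).
apply: (@smooth_ext _ _ _ (fun q => \sum_k tmap F (X q) (coord c' k) *
   \sum_l (tmap F (Y q) (coord c' l) *
   ((fun y => g y (ptan c' (delta_mx 0 k) y) (ptan c' (delta_mx 0 l) y)) \o F) q))).
  apply: filterS (pull_frame cp') => q cq; have [gs gl _ _] := rg (F q).
  rewrite [in RHS](tangent_frame (tmap F (X q)) ac' cq) gs (@linear_sumE _ _ R^o _ _ _ _ _ _ (gl _)).
  apply: eq_bigr => k _; rewrite [tcoord _ _ _ _]mxE gs; congr (_ * _).
  rewrite [in RHS](tangent_frame (tmap F (Y q)) ac' cq) (@linear_sumE _ _ R^o _ _ _ _ _ _ (gl _)).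
  by apply: eq_bigr => l _; rewrite [tcoord _ _ _ _]mxE.
apply: smooth_sum => k _; apply: smooth_mul; first exact: tmap_coord_smooth.
apply: smooth_sum => l _; apply: smooth_mul; first exact: tmap_coord_smooth.
by apply: smooth_pull; have [_ _ _ H] := rg (F p); apply: H; exact: vsmooth_ptan.
Qed.

End Immersion.

(** A chosen preimage under the tangent map, 0 if there is none: unique for an immersion, determined
    up to the kernel for a submersion. *)
Definition lift (R : realType) (N1 N2 : nat) (M1 : manifold R N1) (M2 : manifold R N2) (F : M1 -> M2) p
    (w : tangent (F p)) : tangent p :=
  if pselect (exists v, tmap F v = w) is left H then sval (cid H) else 0.

Lemma lift_ex (R : realType) (N1 N2 : nat) (M1 : manifold R N1) (M2 : manifold R N2) (F : M1 -> M2) p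
  (w : tangent (F p)) : (exists v, tmap F v = w) -> tmap F (lift w) = w.
Proof. by move=> H; rewrite /lift; case: pselect => [H'|//]; case: cid. Qed.

Lemma DT_extension (R : realType) (N : nat) (M : manifold R N) (S : acm3 M) (Q : quasi3 S)
    (f0 : forall p, fT S p != 0) p (v : tangent p) : DT S v ->
  exists Z : vfield M, [/\ vsmooth_at Z p, Z p = v & forall y, DT S (Z y)].
Proof.
move=> dv; exists (fun y => ext v y - PT S ord0 y (ext v y)); split.
- have se := ext_smooth v; have [_ sP] := PT_smooth Q f0 ord0 p.
  have H := vsmooth_add se (vsmooth_scale (smooth_cst (-1) _) (sP _ se)).
  by apply: vsmooth_ext H; apply: (@filterE _ _ (nbhs_filter _)) => y; rewrite /vadd /vscale /tapp scaleN1r.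
- by rewrite extE; have /(DT_P Q f0 ord0) -> := dv; rewrite subr0.
move=> y; apply/(DT_P Q f0 ord0).
have PD u w : PT S ord0 y (u - w) = PT S ord0 y u - PT S ord0 y w.
  by rewrite addrC -scaleN1r (PT_lin Q) scaleN1r addrC.
by rewrite PD (PT_id Q ord0 (PT_tr Q f0 ord0 _)) subrr.
Qed.

(** * The structure induced on a leaf *)

Section Leaf.
Variables (R : realType) (N d : nat) (M : manifold R N) (S : acm3 M).
Hypothesis Q : quasi3 S.
Hypothesis f0 : forall p, fT S p != 0.
Variables (L : manifold R d) (F : L -> M).
Hypothesis cL : connected [set: L].
Hypothesis sF : smooth_map F.
Hypothesis iF : forall p, injective (@tmap _ _ _ _ _ F p).
Hypothesis rF : forall p, range (@tmap _ _ _ _ _ F p) = [set w | DT S w].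

Local Notation phi := (phi3 S).
Local Notation xi := (xi3 S).
Local Notation eta := (eta3 S).
Local Notation g := (g3 S).

Lemma liftP p (w : tangent (F p)) : DT S w -> tmap F (lift w) = w.
Proof.
move=> dw; have H : exists v, tmap F v = w.
  have : range (@tmap _ _ _ _ _ F p) w by rewrite rF.
  by case=> v _ <-; exists v.
exact: lift_ex.
Qed.

Lemma tmap_DT p (v : tangent p) : DT S (tmap F v).
Proof.
have : range (@tmap _ _ _ _ _ F p) (tmap F v) by exists v.
by rewrite rF.
Qed.

Definition leaf_structure : acm3 L :=
  {| phi3 := fun a p v => lift (phi a (F p) (tmap F v));
     xi3 := fun a p => lift (xi a (F p));
     eta3 := fun a p v => eta a (F p) (tmap F v);
     g3 := fun p v w => g (F p) (tmap F v) (tmap F w) |}.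

Local Notation S' := leaf_structure.

Lemma leaf_phiE a p (v : tangent p) : tmap F (phi3 S' a p v) = phi a (F p) (tmap F v).
Proof. by apply: liftP; apply: (DT_phi Q); exact: tmap_DT. Qed.
Lemma leaf_xiE a p : tmap F (xi3 S' a p) = xi a (F p).
Proof. by apply: liftP; exact: DT_xi. Qed.

Lemma leaf_induced : induced_structure F S S'.
Proof. by move=> p; split => // [a v|a]; [exact: leaf_phiE|exact: leaf_xiE]. Qed.

Lemma leaf_acm a : almost_contact_metric (acm_of S' a).
Proof.
rewrite /almost_contact_metric /acm_of; split.
- move=> p; split.
    move=> t v w; apply: iF; rewrite !(linearD, linearZ)/= !leaf_phiE !(linearD, linearZ)/=.
    by rewrite (phi_lin Q a).
  move=> X sX; have [c ac cp] := atlas_cover p; have [c' ac' cp'] := atlas_cover (F p).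
  apply: (vsmooth_immersion (sF p) ac cp ac' cp' (@iF p)) => j.
  have -> : (fun q => tmap F (tapp (phi3 S' a) X q) (coord c' j)) =
            (fun q => phi a (F q) (tmap F (X q)) (coord c' j)).
    by apply/funext => q; rewrite /tapp leaf_phiE.
  exact: (pull_tensor_smooth (sF p) ac' cp' j (phi_smooth Q a)).
- move=> p; have [c ac cp] := atlas_cover p; have [c' ac' cp'] := atlas_cover (F p).
  apply: (vsmooth_immersion (sF p) ac cp ac' cp' (@iF p)) => j.
  have -> : (fun q => tmap F (xi3 S' a q) (coord c' j)) = (fun q => xi a q (coord c' j)) \o F.
    by apply/funext => q; rewrite leaf_xiE.
  by apply: (smooth_pull (sF _)); apply: vsmooth_coord => //; exact: xi_smooth.
- move=> p; split.
    by move=> t v w /=; rewrite linearD linearZ/= (eta_lin Q).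
  by move=> X sX; apply: (pull_oneform_smooth (sF p)) => //; exact: eta_smooth.
- move=> p; split => [v w|v t w1 w2|v v0|X Y sX sY] /=.
  + exact: g_sym.
  + by rewrite linearD linearZ/= (agDr (acm_alg_pt Q ord0 _)) (agZr (acm_alg_pt Q ord0 _)).
  + have [_ _ + _] := g_riem Q (F p); apply; apply: contra v0 => /eqP.
    by rewrite -(linear0 (tmap F (p := p))) => /iF ->.
  + by apply: (pull_metric_smooth (sF p)) => //; exact: g_riem.
- move=> p; have [h1 h2 h3] := acm_pt Q a (F p); split => [v||v w].
  + by apply: iF; rewrite !leaf_phiE h1 !(linearD, linearN, linearZ)/= leaf_xiE.
  + by rewrite /= leaf_xiE.
  + by rewrite /= !leaf_phiE h3.
Qed.

Lemma three_contact_relationsP (s : 'S_3) p : ~~ odd_perm s ->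
  let a := s (inord 0) in let b := s (inord 1) in let c := s (inord 2) in
  [/\ forall v, phi c p v = phi a p (phi b p v) - eta b p v *: xi a p,
      forall v, phi c p v = - phi b p (phi a p v) + eta a p v *: xi b p,
      xi c p = phi a p (xi b p) /\ xi c p = - phi b p (xi a p)
    & forall v, eta c p v = eta a p (phi b p v) /\
                eta c p v = - eta b p (phi a p v)].
Proof. by move=> es; have := q3_rel Q; case: S => ph x et gg /= /(_ s es p). Qed.

Lemma leaf_rel : three_contact_relations S'.
Proof.
move=> s es a b c p; have [] := three_contact_relationsP (F p) es.
rewrite -/a -/b -/c => h1 h2 [h3 h4] h5; clearbody a b c.
have lE a' q (v : tangent q) : tmap F (lift (phi a' (F q) (tmap F v))) = phi a' (F q) (tmap F v).
  exact: leaf_phiE.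
have xE a' q : tmap F (lift (p := q) (xi a' (F q))) = xi a' (F q) by exact: leaf_xiE.
split=> [v|v||v].
- by apply: iF; rewrite linearD linearN linearZ/= !lE h1 xE.
- by apply: iF; rewrite !(linearD, linearN, linearZ)/= !lE h2 xE.
- by split; apply: iF; rewrite ?linearN/= lE !xE.
- by have [h6 h7] := h5 (tmap F v); split; rewrite /= lE.
Qed.

(** Related pairs of fields carry brackets from the leaf to M. As the identities to prove are
    tensorial, checking them on such fields is enough. *)
Lemma leaf_fields p (v : tangent p) : exists X X', [/\ vsmooth_at X p, X p = v, vsmooth_at X' (F p),
  forall y, DT S (X' y) & forall q, tmap F (X q) = X' (F q)].
Proof.
have [X' [sX' X'v dX']] := DT_extension Q f0 (tmap_DT v).
pose X : vfield L := fun q => lift (X' (F q)).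
have XX' q : tmap F (X q) = X' (F q) by exact: liftP.
exists X, X'; split => //.
  have [c ac cp] := atlas_cover p; have [c' ac' cp'] := atlas_cover (F p).
  apply: (vsmooth_immersion (sF p) ac cp ac' cp' (@iF p)) => j.
  have -> : (fun q => tmap F (X q) (coord c' j)) = (fun y => X' y (coord c' j)) \o F.
    by apply/funext => q; rewrite XX'.
  by apply: (smooth_pull (sF _)); exact: vsmooth_coord.
by apply: iF; rewrite XX'.
Qed.

Lemma leaf_related (X : vfield L) X' p : (forall q, tmap F (X q) = X' (F q)) -> related F p X X'.
Proof. by move=> h; apply: (@filterE _ _ (nbhs_filter p)). Qed.

Lemma leaf_phi_smooth a p X : vsmooth_at X p -> vsmooth_at (tapp (phi3 S' a) X) p.
Proof. by have [sT _ _ _ _] := leaf_acm a; case: (sT p) => _; exact. Qed.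

Lemma leaf_d1 a p X Y X' Y' : vsmooth_at X p -> vsmooth_at Y p ->
  vsmooth_at X' (F p) -> vsmooth_at Y' (F p) ->
  (forall q, tmap F (X q) = X' (F q)) -> (forall q, tmap F (Y q) = Y' (F q)) ->
  d1 (eta3 S' a) X Y p = d1 (eta a) X' Y' (F p).
Proof.
move=> sX sY sX' sY' hX hY.
have br := bracket_related (sF p) sX sY sX' sY' (leaf_related p hX) (leaf_related p hY).
rewrite /d1 /= br; congr (_ * (_ - _ - _)).
  have -> : (fun q => eta a (F q) (tmap F (Y q))) = (fun y => eta a y (Y' y)) \o F.
    by apply/funext => q; rewrite hY.
  by rewrite -hX tmapE//; exact: (smooth_eta Q).
have -> : (fun q => eta a (F q) (tmap F (X q))) = (fun y => eta a y (X' y)) \o F.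
  by apply/funext => q; rewrite hX.
by rewrite -hY tmapE//; exact: (smooth_eta Q).
Qed.

Lemma leaf_normal a : normal_acm (acm_of S' a).
Proof.
move=> p X0 Y0 sX0 sY0.
have [sT _ se _ _] := leaf_acm a.
have [X [X' [sX XE sX' dX hX]]] := leaf_fields (X0 p).
have [Y [Y' [sY YE sY' dY hY]]] := leaf_fields (Y0 p).
rewrite /= (nijenhuis_tensor sT sX0 sY0 sX sY (esym XE) (esym YE)).
rewrite (d1_tensor se sX0 sY0 sX sY (esym XE) (esym YE)).
apply: iF; rewrite linear0 /= /nijenhuis.
have hp (Z : vfield L) Z' : (forall q, tmap F (Z q) = Z' (F q)) ->
    forall q, tmap F (tapp (phi3 S' a) Z q) = tapp (phi a) Z' (F q).
  by move=> h q; rewrite /tapp leaf_phiE h.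
have B Z W Z' W' : vsmooth_at Z p -> vsmooth_at W p -> vsmooth_at Z' (F p) -> vsmooth_at W' (F p) ->
    (forall q, tmap F (Z q) = Z' (F q)) -> (forall q, tmap F (W q) = W' (F q)) ->
    tmap F (bracket Z W p) = bracket Z' W' (F p).
  by move=> sZ sW sZ' sW' hZ hW; apply: bracket_related => //; exact: leaf_related.
have spX := leaf_phi_smooth a sX; have spY := leaf_phi_smooth a sY.
have spX' := vsmooth_phi Q a sX'; have spY' := vsmooth_phi Q a sY'.
rewrite !(linearD, linearN, linearZ)/= !leaf_phiE leaf_xiE.
rewrite (B _ _ _ _ sX sY sX' sY' hX hY) (B _ _ _ _ spX spY spX' spY' (hp _ _ hX) (hp _ _ hY)).
rewrite (B _ _ _ _ spX sY spX' sY' (hp _ _ hX) hY) (B _ _ _ _ sX spY sX' spY' hX (hp _ _ hY)).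
rewrite (leaf_d1 a sX sY sX' sY' hX hY).
by have [_ n _] := q3_qs Q a; exact: (n (F p) X' Y' sX' sY').
Qed.

Lemma leaf_fT_const p q : fT S (F p) = fT S (F q).
Proof.
have sm x : smooth_at (fT S \o F) x by apply: (smooth_pull (sF _)); exact: smooth_fT.
apply: (@locally_const_connected _ _ (fT S \o F) cL) => x.
apply: der0_locally_const => // y v.
by rewrite -tmapE//; [exact: fT_const|exact: smooth_fT].
Qed.

(** On vectors tangent to the leaf [psiT a] is f times [phi a] by [DT_psi]; connectedness of the
    leaf lets f be read at [p0]. *)
Lemma leaf_sasakian p0 a : alpha_Sasakian (2^-1 * fT S (F p0)) (acm_of S' a).
Proof.
split; [by rewrite mulf_neq0 ?invr_eq0|exact: leaf_acm|exact: leaf_normal|].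
move=> p X0 Y0 sX0 sY0; have [_ _ se _ _] := leaf_acm a.
have [X [X' [sX XE sX' dX hX]]] := leaf_fields (X0 p).
have [Y [Y' [sY YE sY' dY hY]]] := leaf_fields (Y0 p).
rewrite /= (d1_tensor se sX0 sY0 sX sY (esym XE) (esym YE)) (leaf_d1 a sX sY sX' sY' hX hY).
rewrite /fundamental_form /= leaf_phiE -XE -YE hX hY (leaf_fT_const p0 p).
have E := psiT_te Q a sX' sY'.
have -> : d1 (eta a) X' Y' (F p) = 2^-1 * g (F p) (X' (F p)) (psiT S a (F p) (Y' (F p))).
  by rewrite E mulrA mulVf// mul1r.
have /(DT_psi Q f0 a) -> := dY (F p).
by rewrite (agZr (acm_alg_pt Q ord0 _)) mulrA.
Qed.

End Leaf.

Lemma smooth_map_comp (R : realType) (n1 n2 n3 : nat) (M1 : manifold R n1) (M2 : manifold R n2)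
    (M3 : manifold R n3) (F : M1 -> M2) (G : M2 -> M3) p :
  smooth_map_at F p -> smooth_map_at G (F p) -> smooth_map_at (G \o F) p.
Proof.
move=> [cF sF] [cG sG]; split; first exact: continuous_comp.
by move=> h /sG /sF.
Qed.

Lemma smooth_map_euclidean (R : realType) (n m : nat) (M : manifold R n) (F : M -> euclidean R m) p :
  (forall i, smooth_at (fun q => (F q : 'rV[R]_m) 0 i) p) -> smooth_map_at F p.
Proof.
move=> sF; apply: (@smooth_map_coords _ _ _ M (euclidean R m) F p (id_chart R m)) => //.
by apply: (rV_cvgP (FF := nbhs_filter p)) => i; exact: smooth_at_cont (sF i).
Qed.

Lemma smooth_Csmooth_on (R : realType) (N : nat) (M : manifold R N) (c : chart R N M) (O : set M) (f : M -> R) :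
  atlas c -> (forall q, cdom c q -> O q -> smooth_at f q) ->
  Csmooth [set y | ccod c y /\ O (cinv c y)] (f \o cinv c).
Proof.
move=> ac sf k; apply: Ck_local => x [cx Ox].
have cp := cinv_dom cx; have [V [oV Vx _ H]] := smooth_at_inv ac cp (sf _ cp Ox).
by rewrite cinvK// in Vx; exists V.
Qed.

(** * The space of leaves *)

Section Submersion.
Variables (R : realType) (N q : nat) (M : manifold R N) (B : manifold R q) (pi : M -> B) (p : M).
Hypothesis spi : smooth_map_at pi p.
Hypothesis rpi : range (@tmap _ _ _ _ _ pi p) = setT.

Section Charts.
Variables (c : chart R N M) (c' : chart R q B).
Hypotheses (ac : atlas c) (cp : cdom c p) (ac' : atlas c') (cp' : cdom c' (pi p)).

Local Notation J := (jmat pi c c' p).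

Lemma jmat_right_inverse : exists C : 'M[R]_(q, N), C *m J = 1%:M.
Proof.
have H (i : 'I_q) : exists u : 'rV[R]_N, u *m J = delta_mx 0 i.
  have : range (@tmap _ _ _ _ _ pi p) (ptan c' (delta_mx 0 i) (pi p)) by rewrite rpi.
  by move=> [v _ E]; exists (tcoord c v); rewrite -jmatE// E tcoord_ptan.
have [u uP] := choice H.
exists (\matrix_i u i); apply/row_matrixP => i.
by rewrite row_mul rowK uP rowE mulmx1.
Qed.

Variable C : 'M[R]_(q, N).
Hypothesis CJ : C *m J = 1%:M.

(* At p this map has the identity as its Jacobian, and composed with J it gives pi. *)
Definition straight (y : M) : 'rV[R]_N := cfun c' (pi y) *m C + cfun c y *m (1%:M - J *m C).

Lemma straightJ y : straight y *m J = cfun c' (pi y).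
Proof.
by rewrite /straight mulmxDl -!mulmxA CJ mulmxBl mul1mx -mulmxA CJ !mulmx1 subrr mulmx0 addr0.
Qed.

Lemma straight_sum y j : straight y 0 j =
  \sum_l C l j * (coord c' l \o pi) y + \sum_l (1%:M - J *m C) l j * coord c l y.
Proof.
by rewrite /straight mxE; congr (_ + _); rewrite mxE; apply: eq_bigr => l _; rewrite mulrC.
Qed.

Lemma straight_smooth y j : smooth_map_at pi y -> cdom c y -> cdom c' (pi y) ->
  smooth_at (fun y => straight y 0 j) y.
Proof.
move=> sy cy cy'; rewrite (_ : (fun y => straight y 0 j) = (fun y => \sum_l C l j * (coord c' l \o pi) y +
    \sum_l (1%:M - J *m C) l j * coord c l y)); last by apply/funext => z; exact: straight_sum.
apply: smooth_add; apply: smooth_sum => l _; apply: smooth_scale; last exact: smooth_coord.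
by apply: smooth_pull => //; exact: smooth_coord.
Qed.

Lemma straight_jac i j : ptan c (delta_mx 0 i) p (fun y => straight y 0 j) = (1%:M : 'M[R]_N) i j.
Proof.
rewrite (_ : (fun y => straight y 0 j) = (fun y => \sum_l C l j * (coord c' l \o pi) y +
    \sum_l (1%:M - J *m C) l j * coord c l y)); last by apply/funext => z; exact: straight_sum.
have s1 l : smooth_at (coord c' l \o pi) p by apply: smooth_pull => //; exact: smooth_coord.
have s2 l : smooth_at (coord c l) p by exact: smooth_coord.
rewrite tangent_add; [|by apply: smooth_sum => l _; exact: smooth_scale..].
rewrite !tangent_sum; [|by move=> l _; exact: smooth_scale..].
rewrite (eq_bigr (fun l => J i l * C l j)); last first.
  move=> l _; rewrite tangent_scale// mulrC; congr (_ * _).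
  by rewrite !mxE tmapE//; exact: smooth_coord.
rewrite [X in _ + X](_ : _ = (1%:M - J *m C) i j).
  rewrite [X in _ + X]mxE [X in _ + (_ + X)]mxE [X in _ + (_ - X)]mxE; ring.
have D l : ptan c (delta_mx 0 i) p (fun y => (1%:M - J *m C) l j * coord c l y) =
    (1%:M - J *m C) l j * (l == i)%:R.
  rewrite tangent_scale//; congr (_ * _).
  by have := tcoord_ptan (delta_mx 0 i) ac cp => /rowP /(_ l); rewrite !mxE eqxx.
rewrite (eq_bigr _ (fun l _ => D l)) (bigD1 i)//= big1 ?addr0 ?eqxx ?mulr1// => l li.
by rewrite (negPf li) mulr0.
Qed.

(** [inverse_right] provides K with straight after K equal to the identity, and [local_injective]
    makes it a left inverse near p too; [O] travels along by shrinking the domain. *)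
Lemma straight_inverse (O : set M) : (\forall y \near p, O y) ->
  exists (K : euclidean R N -> M), [/\ K (straight p) = p,
   \forall z \near straight p, [/\ smooth_map_at K z, O (K z), cdom c' (pi (K z)) & cfun c' (pi (K z)) = z *m J] &
   \forall y \near p, K (straight y) = y].
Proof.
move=> nO.
have nG : \forall y \near p, [/\ cdom c y, smooth_map_at pi y, cdom c' (pi y) & O y].
  have h1 : \forall y \near p, cdom c y by apply: open_nbhs_nbhs; split => //; exact: cdom_open.
  have h2 := smooth_map_near spi; have h3 := pull_frame spi cp'.
  by near=> y; split; near: y.
have : nbhs p (fun y => [/\ cdom c y, smooth_map_at pi y, cdom c' (pi y) & O y]) by exact: nG.
rewrite nbhsE => -[G [oG Gp] GH].
pose V := [set x | ccod c x /\ G (cinv c x)].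
have oV : open V by exact: open_chart_img.
have Vp : V (cfun c p) by split; [exact: cfun_cod|rewrite cfunK].
pose h (x : 'rV[R]_N) := straight (cinv c x).
have sh j : Csmooth V (fun x => h x 0 j).
  apply: (smooth_Csmooth_on (f := fun y => straight y 0 j) ac) => y cy Gy.
  by have [? ? ? _] := GH _ Gy; exact: straight_smooth.
have jh : jac h (cfun c p) = 1%:M.
  apply/matrixP => i j; rewrite mxE -straight_jac ptanE//.
  exact: straight_smooth.
have uh : jac h (cfun c p) \in unitmx by rewrite jh unitmx1.
have [W [k [oW Wz sk k0 kP]]] := inverse_right oV Vp sh uh.
have [U1 [oU1 U1p U1V inj]] := local_injective oV Vp sh uh.
have hp : h (cfun c p) = straight p by rewrite /h cfunK.
rewrite hp in Wz k0.
exists (fun z => cinv c (k z)); split; first by rewrite k0 cfunK.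
  apply: filterS (open_nbhs_nbhs (conj oW Wz)) => z Wz'.
  have [[ck Gk] hk] := kP _ Wz'; have [dk sk' dk' Ok] := GH _ Gk.
  have ckz : {for z, continuous k} by apply: (rV_cvgP (FF := nbhs_filter z)) => i; exact: Ck_cont (sk i 0%N) Wz'.
  split => //.
    apply: (@smooth_map_coords _ _ _ (euclidean R N) M _ z c) => //.
      by apply: (@continuous_comp _ _ _ k (cinv c)) => //; exact: cinv_cont.
    move=> i; apply: (@smooth_at_chart _ _ (euclidean R N) (id_chart R N) z _ W) => //.
    move=> m; apply: Ck_ext (sk i m) => // x Wx /=; rewrite /coord cinvK//.
    by case: (kP _ Wx) => -[].
  by have := congr1 (mulmx^~ J) hk; rewrite /h straightJ => <-.
have cst_ : {for p, continuous straight}.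
  by apply: (rV_cvgP (FF := nbhs_filter p)) => j; apply: smooth_at_cont; exact: straight_smooth.
have n1 : \forall y \near p, W (straight y).
  by apply: (cst_ W); exact: open_nbhs_nbhs.
have n2 : \forall y \near p, U1 (k (straight y)).
  have ck : {for straight p, continuous k} by apply: (rV_cvgP (FF := nbhs_filter _)) => i; exact: Ck_cont (sk i 0%N) Wz.
  have cks : {for p, continuous (k \o straight)} by exact: continuous_comp.
  by apply: (cks U1); rewrite /= k0; exact: open_nbhs_nbhs.
have n3 : \forall y \near p, U1 (cfun c y).
  by have cc := cfun_cont cp; apply: (cc U1); exact: open_nbhs_nbhs.
near=> y.
have cy : cdom c y by near: y; apply: filterS nG => y [].
have Wy : W (straight y) by near: y.
have [_ E] := kP _ Wy.
rewrite -[RHS](cfunK cy); congr (cinv c _); apply: inj; [by near: y|by near: y|].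
by rewrite E /h cfunK.
Unshelve. all: by end_near. Qed.

End Charts.

(* Constancy along the fibres is constancy of f o K along the kernel of J. *)
Lemma submersion_section : exists sg : B -> M, [/\ sg (pi p) = p, smooth_map_at sg (pi p),
  \forall b \near pi p, pi (sg b) = b &
  forall f, (\forall y \near p, smooth_at f y /\ forall v : tangent y, tmap pi v = 0 -> v f = 0) ->
    \forall y \near p, f y = f (sg (pi y))].
Proof.
have [c ac cp] := atlas_cover p; have [c' ac' cp'] := atlas_cover (pi p).
have [C CJ] := jmat_right_inverse ac cp ac' cp'.
set J := jmat pi c c' p in CJ.
pose z0 := straight c c' C p.
have z0J : z0 *m J = cfun c' (pi p) by exact: straightJ.
have nS : \forall y \near p, smooth_map_at pi y by exact: smooth_map_near.
have [K [K0 KP KH]] := straight_inverse ac cp ac' cp' CJ nS.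
rewrite -/z0 -/J in K0 KP KH.
(* In straightened coordinates pi is z |-> z J, and this is its affine section through [z0], since C
   J = 1. *)
pose G (b : B) : euclidean R N := z0 + (cfun c' b - cfun c' (pi p)) *m C.
have G0 : G (pi p) = z0 by rewrite /G subrr mul0mx addr0.
have sG : smooth_map_at G (pi p).
  apply: smooth_map_euclidean => i.
  rewrite (_ : (fun b => G b 0 i) = (fun b => z0 0 i + \sum_l C l i * (coord c' l b - coord c' l (pi p)))).
    apply: smooth_add; first exact: smooth_cst.
    apply: smooth_sum => l _; apply: smooth_scale; apply: smooth_sub; last exact: smooth_cst.
    exact: smooth_coord.
  apply/funext => b; rewrite /G mxE; congr (_ + _); rewrite mxE; apply: eq_bigr => l _.
  by rewrite mulrC !mxE.
have nG := near_pull sG (A := fun z => [/\ smooth_map_at K z, smooth_map_at pi (K z), cdom c' (pi (K z)) & cfun c' (pi (K z)) = z *m J]).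
rewrite G0 in nG; have {}nG := nG KP.
have GJ b : (G b : 'rV[R]_N) *m J = cfun c' b.
  by rewrite /G mulmxDl -mulmxA CJ mulmx1 z0J addrC subrK.
exists (K \o G); split.
- by rewrite /= G0.
- apply: smooth_map_comp => //; rewrite G0.
  by have [] := nbhs_singleton KP.
- have nc : \forall b \near pi p, cdom c' b by apply: open_nbhs_nbhs; split => //; exact: cdom_open.
  near=> b => /=.
  have [_ _ dG EG] : [/\ smooth_map_at K (G b), smooth_map_at pi (K (G b)), cdom c' (pi (K (G b))) & cfun c' (pi (K (G b))) = (G b : 'rV[R]_N) *m J].
    by near: b.
  by rewrite -[LHS](cfunK dG) EG GJ cfunK//; near: b.
- move=> f nf.
  have cK : {for z0, continuous K} by have [[]] := nbhs_singleton KP.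
  have nf' : \forall z \near z0, smooth_at f (K z) /\ forall v : tangent (K z), tmap pi v = 0 -> v f = 0.
    by apply: (cK (fun y => smooth_at f y /\ forall v : tangent y, tmap pi v = 0 -> v f = 0)); rewrite K0.
  have nK2 := near_join KP.
  have : nbhs z0 (fun z => [/\ smooth_map_at K z, smooth_map_at pi (K z) /\ cdom c' (pi (K z)), \forall w \near z, cfun c' (pi (K w)) = w *m J,
      smooth_at f (K z) & forall v : tangent (K z), tmap pi v = 0 -> v f = 0]).
    near=> z.
    have [? ? ? _] : [/\ smooth_map_at K z, smooth_map_at pi (K z), cdom c' (pi (K z)) & cfun c' (pi (K z)) = z *m J] by near: z.
    have [? ?] : smooth_at f (K z) /\ forall v : tangent (K z), tmap pi v = 0 -> v f = 0 by near: z.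
    split => //.
    have : \forall w \near z, [/\ smooth_map_at K w, smooth_map_at pi (K w), cdom c' (pi (K w)) & cfun c' (pi (K w)) = w *m J] by near: z.
    by apply: filterS => w [].
  rewrite nbhsE => -[V0 [oO Oz] OH].
  have [r r0 rO] := open_ball_in oO Oz.
  have r20 : 0 < r / 2 by rewrite divr_gt0.
  pose H y := straight c c' C y.
  have cH : {for p, continuous H}.
    by apply: (rV_cvgP (FF := nbhs_filter p)) => j; apply: smooth_at_cont; exact: straight_smooth.
  have n1 : \forall y \near p, `|H y - z0| < r / 2.
    apply: (cH [set z | `|z - z0| < r / 2]); apply: open_nbhs_nbhs; split; first exact: ball_open'.
    by rewrite /= subrr normr0.
  have n2 : \forall y \near p, `|(G (pi y) : 'rV[R]_N) - z0| < r / 2.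
    have [cGp _] := sG; have [cpi _] := spi.
    have cGpi : {for p, continuous (fun y => G (pi y) : 'rV[R]_N)} by exact: (continuous_comp cpi cGp).
    apply: (cGpi [set z : 'rV[R]_N | `|z - z0| < r / 2]); rewrite G0; apply: open_nbhs_nbhs; split; first exact: ball_open'.
    by rewrite /= subrr normr0.
  near=> y => /=.
  have Ky : K (H y) = y by near: y.
  have b1 : `|H y - z0| < r / 2 by near: y.
  have b2 : `|(G (pi y) : 'rV[R]_N) - z0| < r / 2 by near: y.
  pose w0 := (G (pi y) : 'rV[R]_N); pose e := H y - w0.
  (* Both ends of the segment have the same image under J, so K sends the segment into one fibre of
     pi, along which f has zero derivative. *)
  have eJ : e *m J = 0 by rewrite /e mulmxBl straightJ// /w0 GJ subrr.
  have inO (t : R) : 0 <= t <= 1 -> V0 (w0 + t *: e).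
    move=> /andP[t0 t1]; apply: rO.
    have -> : w0 + t *: e - z0 = (1 - t) *: (w0 - z0) + t *: (H y - z0).
      by rewrite /e; apply/rowP => i; rewrite !mxE; ring.
    apply: le_lt_trans (ler_normD _ _) _; rewrite !normrZ (ger0_norm t0) ger0_norm ?subr_ge0//.
    rewrite [r]splitr; apply: le_lt_trans (ltrD b2 b1); apply: lerD; apply: ler_piMl => //.
    by rewrite gerBl.
  have sfK z : V0 z -> smooth_at (f \o K : euclidean R N -> R) z.
    by move=> /OH[sK _ _ sf _]; exact: smooth_pull.
  have [|t t01 E] := @ray_mvt R 'rV[R]_N (f \o K) w0 e.
    move=> t t01; have [V [oV Vt _ HV]] := smooth_at_inv (c := id_chart R N : chart R N (euclidean R N)) (erefl _) I (sfK _ (inO t t01)).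
    exact: Ck_derivable (HV 1%N) Vt.
  have [sK [sp dK] nw sf vf] := OH _ (inO t t01).
  rewrite -[in LHS]Ky; apply/eqP; rewrite -subr_eq0.
  rewrite -[X in X - _]/((f \o K) (H y)) -[X in _ - X]/((f \o K) w0).
  rewrite -(_ : w0 + e = H y); last by rewrite /e addrC subrK.
  rewrite E; apply/eqP.
  pose u := @ptan R N (euclidean R N) (id_chart R N) e (w0 + t *: e).
  have <- : u (f \o K) = 'D_e (f \o K) (w0 + t *: e).
    exact: (@ptanE R N (euclidean R N) (id_chart R N) e (w0 + t *: e) _ (erefl _) I (sfK _ (inO t t01))).
  rewrite -(tmapE u sK sf); apply: vf.
  apply: (tcoord_inj ac' dK); rewrite linear0; apply/rowP => j; rewrite [RHS]mxE [LHS]mxE.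
  have sj : smooth_at (coord c' j) (pi (K (w0 + t *: e))) by exact: smooth_coord.
  rewrite tmapE// tmapE//; last exact: smooth_pull.
  have -> : u ((coord c' j \o pi) \o K) = u (fun z : 'rV[R]_N => \sum_i J i j * coord (id_chart R N : chart R N (euclidean R N)) i z).
    apply: tangent_near; first by apply: smooth_pull => //; exact: smooth_pull.
    by apply: filterS nw => z /= Ez; rewrite /coord Ez mxE; apply: eq_bigr => i _; rewrite mulrC.
  have si i : smooth_at (coord (id_chart R N : chart R N (euclidean R N)) i) (w0 + t *: e) by exact: smooth_coord.
  rewrite tangent_sum; last by move=> i _; exact: smooth_scale.
  have := tcoord_ptan (c := id_chart R N : chart R N (euclidean R N)) e (q := w0 + t *: e) (erefl _) I => /rowP ue.
  have := congr1 (fun x : 'rV[R]_q => x 0 j) eJ; rewrite !mxE => E0; rewrite -[RHS]E0.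
  apply: eq_bigr => i _; rewrite tangent_scale// mulrC; congr (_ * _).
  by rewrite -ue mxE.
Unshelve. all: by end_near. Qed.

(** A matrix C with C J(p) = 1 leaves C J(y) invertible nearby; correcting by its inverse solves u
    J(y) = Y smoothly in y. *)
Lemma submersion_lift (Y : vfield B) : vsmooth_at Y (pi p) ->
  exists Z, vsmooth_at Z p /\ \forall y \near p, tmap pi (Z y) = Y (pi y).
Proof.
move=> sY; have [c ac cp] := atlas_cover p; have [c' ac' cp'] := atlas_cover (pi p).
have [C CJ] := jmat_right_inverse ac cp ac' cp'.
have sJ : mxsmooth_at (jmat pi c c') p by exact: jmat_smooth.
have sCJ : mxsmooth_at (fun y => C *m jmat pi c c' y) p by apply: mxsmooth_mul => //; exact: mxsmooth_cst.
have uCJ : C *m jmat pi c c' p \in unitmx by rewrite CJ unitmx1.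
have nu := mxunit_near sCJ uCJ.
have nc : \forall y \near p, cdom c y by apply: open_nbhs_nbhs; split => //; exact: cdom_open.
have nc' := pull_frame spi cp'.
pose u y := tcoord c' (Y (pi y)) *m invmx (C *m jmat pi c c' y) *m C.
have su : mxsmooth_at u p.
  apply: mxsmooth_mul; last exact: mxsmooth_cst.
  apply: mxsmooth_mul; last exact: mxsmooth_inv.
  move=> a b; rewrite (_ : (fun y => tcoord c' (Y (pi y)) a b) = (fun b' => Y b' (coord c' b)) \o pi); last first.
    by apply/funext => y; rewrite (ord1 a) mxE.
  by apply: smooth_pull => //; exact: vsmooth_coord.
exists (fun y => ptan c (u y) y); split.
  apply: (vsmooth_coords ac cp) => i; apply: (@smooth_ext _ _ _ (fun y => u y 0 i)); last exact: su.
  by apply: filterS nc => y cy; have := tcoord_ptan (u y) ac cy => /rowP/(_ i) <-; rewrite mxE.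
near=> y.
have cy : cdom c y by near: y.
have cy' : cdom c' (pi y) by near: y.
apply: (tcoord_inj ac' cy'); rewrite (@jmatE _ _ _ _ _ pi c c' ac)// tcoord_ptan// /u -mulmxA mulmxKV//.
by near: y.
Unshelve. all: by end_near. Qed.

End Submersion.

(** Constancy is assumed locally within A, so a level set and its complement are both relatively
    open. *)
Lemma fibre_constant (R : realType) (T : topologicalType) (A : set T) (f : T -> R) :
  connected A -> (forall x, A x -> \forall y \near x, A y -> f y = f x) ->
  forall x y, A x -> A y -> f x = f y.
Proof.
move=> cA lc x y Ax Ay.
pose E := [set z | A z /\ f z = f x].
suff EA : E = A by move: Ay; rewrite -EA => -[].
apply: cA; first by exists x.
- exists (interior [set z | A z -> f z = f x]); first exact: open_interior.
  rewrite eqEsubset; split => z.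
    by move=> [Az zx]; split => //; rewrite /interior; apply: filterS (lc z Az) => w wz Aw /=; rewrite wz.
  by move=> [Az /interior_subset h]; split => //; exact: h.
- exists (~` (interior [set z | A z -> f z != f x])); first by apply: open_closedC; exact: open_interior.
  rewrite eqEsubset; split => z.
    by move=> [Az zx]; split => // /interior_subset /= /(_ Az); rewrite zx eqxx.
  move=> [Az h]; split => //; apply: contrapT => zx; apply: h; rewrite /interior.
  by apply: filterS (lc z Az) => w wz Aw /=; rewrite wz//; apply/eqP.
Qed.

(** * Descent of the structure to the base *)

Section Base.
Variables (R : realType) (N q : nat) (M : manifold R N) (S : acm3 M).
Hypothesis Q : quasi3 S.
Hypothesis f0 : forall p, fT S p != 0.
Variables (B : manifold R q) (U : set M) (pi : M -> B).
Hypothesis oU : open U.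
Hypothesis spi : forall p, U p -> smooth_map_at pi p.
Hypothesis rpi : forall p, U p -> range (@tmap _ _ _ _ _ pi p) = setT.
Hypothesis kpi : forall p (v : tangent p), U p -> tmap pi v = 0 <-> DT S v.
Hypothesis opi : forall b, exists2 p, U p & pi p = b.
Hypothesis cpi : forall b, connected (U `&` pi @^-1` [set b]).

Local Notation phi := (phi3 S).
Local Notation xi := (xi3 S).
Local Notation eta := (eta3 S).
Local Notation g := (g3 S).
Local Notation P := (PT S ord0).

Let A a p := acm_alg_pt Q a p.
Let gE p := (agDl (A ord0 p), agBl (A ord0 p), agNl (A ord0 p), agZl (A ord0 p), agDr (A ord0 p),
  agBr (A ord0 p), agNr (A ord0 p), agZr (A ord0 p), ag0l (A ord0 p), ag0r (A ord0 p)).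

Lemma U_near p : U p -> \forall y \near p, U y.
Proof. by move=> Up; apply: open_nbhs_nbhs. Qed.

Lemma PTB p (u w : tangent p) : P p (u - w) = P p u - P p w.
Proof. by rewrite addrC -scaleN1r (PT_lin Q) scaleN1r addrC. Qed.

Lemma PT_compl p (v : tangent p) : DT S (v - P p v).
Proof. by apply/(DT_P Q f0 ord0); rewrite PTB (PT_id Q ord0 (PT_tr Q f0 ord0 _)) subrr. Qed.

Lemma tmap_PT p (v : tangent p) : U p -> tmap pi (P p v) = tmap pi v.
Proof.
move=> Up; have /(kpi _ Up) := PT_compl v; rewrite linearB /= => /eqP; rewrite subr_eq0 => /eqP.
by [].
Qed.

(** Projecting to E^{4m} removes the arbitrariness of [lift] and gives the unique transverse
    preimage. *)
Definition hlift p (w : tangent (pi p)) : tangent p := P p (lift w).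

Lemma hliftK p (w : tangent (pi p)) : U p -> tmap pi (hlift w) = w.
Proof.
move=> Up; rewrite /hlift tmap_PT// lift_ex//.
have : range (@tmap _ _ _ _ _ pi p) w by rewrite rpi.
by case=> v _ <-; exists v.
Qed.

Lemma hlift_tr p (w : tangent (pi p)) : trT S (hlift w).
Proof. exact: (PT_tr Q f0). Qed.

Lemma hlift_tmap p (v : tangent p) : U p -> hlift (tmap pi v) = P p v.
Proof.
move=> Up; apply/eqP; rewrite -subr_eq0 /hlift -PTB; apply/eqP/(DT_P Q f0 ord0)/(kpi _ Up).
by rewrite linearB /= lift_ex ?subrr//; exists v.
Qed.

Lemma hlift_tmap_tr p (v : tangent p) : U p -> trT S v -> hlift (tmap pi v) = v.
Proof. by move=> Up tv; rewrite hlift_tmap// (PT_id Q). Qed.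

Lemma hlift_linear p : U p -> linear (@hlift p).
Proof.
move=> Up t v w; rewrite -{1}(hliftK v Up) -{1}(hliftK w Up) -linearZ -linearD hlift_tmap//= (PT_lin Q).
by rewrite !(PT_id Q ord0 (hlift_tr _)).
Qed.

Lemma hlift_smooth (Y : vfield B) p : U p -> vsmooth_at Y (pi p) ->
  vsmooth_at (fun y => hlift (Y (pi y))) p.
Proof.
move=> Up sY; have [Z [sZ ZY]] := submersion_lift (spi Up) (rpi Up) sY.
have [_ sP] := PT_smooth Q f0 ord0 p.
apply: vsmooth_ext (sP _ sZ); have nU := U_near Up.
near=> y; have Uy : U y by near: y.
by rewrite /tapp -hlift_tmap//; congr (hlift _); near: y.
Unshelve. all: by end_near. Qed.

Lemma pull_near (K : B -> Prop) p : U p -> (\forall b \near pi p, K b) -> \forall y \near p, K (pi y).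
Proof. by move=> Up; exact: (near_pull (spi Up)). Qed.

Lemma vertical_der p (Z : vfield M) h : U p -> (\forall y \near p, DT S (Z y)) -> smooth_at h (pi p) ->
  \forall y \near p, Z y (h \o pi) = 0.
Proof.
move=> Up dZ sh; have nU := U_near Up; have nh := pull_near Up (smooth_near sh).
near=> y; have Uy : U y by near: y.
have sy : smooth_at h (pi y) by near: y.
rewrite -(tmapE (Z y) (spi Uy) sy) (_ : tmap pi (Z y) = 0) ?tangent0E//.
by apply/(kpi _ Uy); near: y.
Unshelve. all: by end_near. Qed.

(* [Z, X] is vertical: on functions pulled back from the base, Z vanishes and X is again such a function. *)
Lemma bracket_vertical p (Z X : vfield M) (Y : vfield B) : U p -> vsmooth_at Z p -> vsmooth_at X p ->
  vsmooth_at Y (pi p) -> (\forall y \near p, DT S (Z y)) -> (\forall y \near p, tmap pi (X y) = Y (pi y)) ->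
  DT S (bracket Z X p).
Proof.
move=> Up sZ sX sY dZ XY; apply/(kpi _ Up); apply: tangent_ext => h sh.
rewrite tangent0E tmapE//; last exact: spi.
have shp : smooth_at (h \o pi) p by exact: (smooth_pull (spi Up) sh).
rewrite bracketE//.
rewrite (_ : Z p _ = Z p ((fun b => Y b h) \o pi)); last first.
  apply: tangent_near; first exact: sX.
  exact: (related_der (spi Up) XY sh).
rewrite (nbhs_singleton (vertical_der Up dZ (sY _ sh))) sub0r.
rewrite (tangent_near (X p) (g := fun=> 0)) ?tangent_cst ?oppr0//; first exact: sZ.
exact: vertical_der.
Qed.

(** [gfun] and [phifun] encode g and phi_a on horizontal lifts as scalar functions, comparable at
    different points of a fibre; testing against a function h on the base makes the value of an
    endomorphism scalar. *)
Definition gfun (Y1 Y2 : vfield B) y : R := g y (hlift (Y1 (pi y))) (hlift (Y2 (pi y))).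
Definition phifun a (Y : vfield B) h y : R := tmap pi (phi a y (hlift (Y (pi y)))) h.

Lemma gfun_smooth Y1 Y2 p : U p -> vsmooth_at Y1 (pi p) -> vsmooth_at Y2 (pi p) -> smooth_at (gfun Y1 Y2) p.
Proof.
by move=> Up s1 s2; have [_ _ _ H] := g_riem Q p; apply: H; exact: hlift_smooth.
Qed.

Lemma phifunE a (Y : vfield B) (h : B -> R) p : U p -> smooth_at h (pi p) ->
  \forall y \near p, tapp (phi a) (fun y => hlift (Y (pi y))) y (h \o pi) = phifun a Y h y.
Proof.
move=> Up sh; have nU := U_near Up; have nh := pull_near Up (smooth_near sh).
near=> y; have Uy : U y by near: y.
by rewrite /phifun tmapE//; [exact: spi|near: y].
Unshelve. all: by end_near. Qed.

Lemma phifun_smooth a Y h p : U p -> vsmooth_at Y (pi p) -> smooth_at h (pi p) -> smooth_at (phifun a Y h) p.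
Proof.
move=> Up sY sh; apply: (smooth_ext (phifunE a Y Up sh)).
apply: (vsmooth_phi Q a (hlift_smooth Up sY)); exact: (smooth_pull (spi Up) sh).
Qed.

Lemma near_tr (p : M) (Y : vfield B) : \forall y \near p, trT S (hlift (Y (pi y))).
Proof. by apply: (@filterE _ _ (nbhs_filter p)) => y; exact: hlift_tr. Qed.

Lemma near_hliftK p (Y : vfield B) : U p -> \forall y \near p, tmap pi (hlift (Y (pi y))) = Y (pi y).
Proof. by move=> Up; apply: filterS (U_near Up) => y Uy; exact: hliftK. Qed.

(** By [hitchin] the derivative is a sum of metric products of a bracket with a transverse lift, and
    such brackets are vertical by [bracket_vertical]. *)
Lemma gfun_vertical Y1 Y2 p (v : tangent p) : U p -> vsmooth_at Y1 (pi p) -> vsmooth_at Y2 (pi p) ->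
  DT S v -> v (gfun Y1 Y2) = 0.
Proof.
move=> Up s1 s2 dv; have [Z [sZ <- dZ]] := DT_extension Q f0 dv.
have dZ' : \forall y \near p, DT S (Z y) by apply: (@filterE _ _ (nbhs_filter p)).
have h1 := hlift_smooth Up s1; have h2 := hlift_smooth Up s2.
have [-> _] := hitchin Q sZ h1 h2 dZ' (near_tr p Y1) (near_tr p Y2).
rewrite (bracket_vertical Up sZ h1 s1 dZ' (near_hliftK Y1 Up) (hlift_tr _)) add0r.
rewrite (g_sym Q).
exact: (bracket_vertical Up sZ h2 s2 dZ' (near_hliftK Y2 Up) (hlift_tr _)).
Qed.

(** By [hitchin] the bracket of Z with phi_a X differs from phi_a [Z, X] by something orthogonal to
    E^{4m}, and the latter is vertical. So [Z, phi_a X] kills pulled-back functions, as Z does. *)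
Lemma phifun_vertical a Y h p (v : tangent p) : U p -> vsmooth_at Y (pi p) -> smooth_at h (pi p) ->
  DT S v -> v (phifun a Y h) = 0.
Proof.
move=> Up sY sh dv; have [Z [sZ <- dZ]] := DT_extension Q f0 dv.
have dZ' : \forall y \near p, DT S (Z y) by apply: (@filterE _ _ (nbhs_filter p)).
have sX := hlift_smooth Up sY; have shp := smooth_pull (spi Up) sh.
set X := (fun y : M => hlift (Y (pi y))) in sX.
have spX := vsmooth_phi Q a sX.
rewrite (tangent_near (Z p) (g := fun y => tapp (phi a) X y (h \o pi))); [|exact: phifun_smooth|]; last first.
  by apply: filterS (phifunE a Y Up sh) => y <-.
have dXZ : DT S (bracket Z (tapp (phi a) X) p).
  move=> w tw; rewrite -[w](extE w).
  have nt : \forall y \near p, trT S (tapp P (ext w) y).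
    by apply: (@filterE _ _ (nbhs_filter p)) => y; exact: (PT_tr Q f0).
  have [_ sP] := PT_smooth Q f0 ord0 p.
  have [_ /(_ a)] := hitchin Q sZ (sP _ (ext_smooth w)) sX dZ' nt (near_tr p Y).
  rewrite /tapp extE (PT_id Q ord0 tw) => E.
  have dphi := DT_phi Q a (bracket_vertical Up sZ sX sY dZ' (near_hliftK Y Up)).
  by rewrite (g_sym Q) -[bracket _ _ _](subrK (phi a p (bracket Z X p))) gE E add0r (g_sym Q) dphi.
have : bracket Z (tapp (phi a) X) p (h \o pi) = 0.
  have /(kpi _ Up) E := dXZ.
  by rewrite -(tmapE _ (spi Up) sh) E tangent0E.
rewrite bracketE// => /eqP; rewrite subr_eq0 => /eqP ->.
rewrite (tangent_near _ (g := fun=> 0)) ?tangent_cst//; first exact: sZ.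
exact: vertical_der.
Qed.

Lemma basic_section p : U p -> exists sg : B -> M, [/\ sg (pi p) = p, smooth_map_at sg (pi p) &
  \forall b \near pi p, U (sg b) /\ pi (sg b) = b].
Proof.
move=> Up; have [sg [s0 ss sK _]] := submersion_section (spi Up) (rpi Up).
exists sg; split => //; have nU : \forall b \near pi p, U (sg b).
  by apply: (near_pull ss); rewrite s0; exact: U_near.
by near=> b; split; near: b.
Unshelve. all: by end_near. Qed.

(** A local section through a point of the fibre gives f = f o sg o pi near it, hence local
    constancy along the fibre; connectedness of the fibre does the rest. *)
Lemma basic_constant (f : M -> R) p p' : U p -> U p' -> pi p = pi p' ->
  (forall y, U y -> pi y = pi p -> \forall z \near y, smooth_at f z /\ forall v : tangent z, DT S v -> v f = 0) ->
  f p = f p'.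
Proof.
move=> Up Up' E H; apply: (fibre_constant (@cpi (pi p))); [|by split|by split].
move=> x [Ux /= xp]; have [sg [s0 _ _]] := submersion_section (spi Ux) (rpi Ux).
have nU := U_near Ux.
have H' : \forall y \near x, smooth_at f y /\ forall v : tangent y, tmap pi v = 0 -> v f = 0.
  near=> y; have Uy : U y by near: y.
  have [sy vy] : smooth_at f y /\ forall v : tangent y, DT S v -> v f = 0 by near: y; exact: H.
  by split => // v /(kpi _ Uy); exact: vy.
move=> /(_ f H'); apply: filterS => y ->.
by move=> [Uy /= yp]; rewrite yp -xp s0.
Unshelve. all: by end_near. Qed.

Lemma gfun_constant Y1 Y2 p p' : U p -> U p' -> pi p = pi p' ->
  vsmooth_at Y1 (pi p) -> vsmooth_at Y2 (pi p) -> gfun Y1 Y2 p = gfun Y1 Y2 p'.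
Proof.
move=> Up Up' E s1 s2; apply: basic_constant => // y Uy yp; rewrite -yp in s1 s2.
have n1 := pull_near Uy (vsmooth_near s1); have n2 := pull_near Uy (vsmooth_near s2); have nU := U_near Uy.
near=> z; have Uz : U z by near: z.
have s1z : vsmooth_at Y1 (pi z) by near: z.
have s2z : vsmooth_at Y2 (pi z) by near: z.
by split; [exact: gfun_smooth|move=> v; exact: gfun_vertical].
Unshelve. all: by end_near. Qed.

Lemma phifun_constant a Y h p p' : U p -> U p' -> pi p = pi p' ->
  vsmooth_at Y (pi p) -> smooth_at h (pi p) -> phifun a Y h p = phifun a Y h p'.
Proof.
move=> Up Up' E s1 s2; apply: basic_constant => // y Uy yp; rewrite -yp in s1 s2.
have n1 := pull_near Uy (vsmooth_near s1); have n2 := pull_near Uy (smooth_near s2); have nU := U_near Uy.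
near=> z; have Uz : U z by near: z.
have s1z : vsmooth_at Y (pi z) by near: z.
have s2z : smooth_at h (pi z) by near: z.
by split; [exact: phifun_smooth|move=> v; exact: phifun_vertical].
Unshelve. all: by end_near. Qed.

Definition pt b : M := sval (cid2 (opi b)).
Lemma ptU b : U (pt b). Proof. by rewrite /pt; case: cid2. Qed.
Lemma ptK b : pi (pt b) = b. Proof. by rewrite /pt; case: cid2. Qed.

(* The structure on the base is read off at one point of each fibre, in a chart around the base point. *)
Definition baseJ a : tensor11 B := fun b w => let c := sval (cid2 (atlas_cover b)) in
  ptan c (\row_i phifun a (ext w) (coord c i) (pt b)) b.
Definition baseh : bilform B := fun b v w => gfun (ext v) (ext w) (pt b).

Lemma baseJE a p (w : tangent (pi p)) : U p -> baseJ a w = tmap pi (phi a p (hlift w)).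
Proof.
move=> Up; rewrite /baseJ; case: cid2 => c /= ac cp; apply: (tcoord_inj ac cp); rewrite tcoord_ptan//.
apply/rowP => i; rewrite [LHS]mxE [RHS]mxE -(@phifun_constant a (ext w) (coord c i) p (pt (pi p))) ?ptK//.
- by rewrite /phifun extE.
- exact: ptU.
- exact: ext_smooth.
- exact: smooth_coord.
Qed.

Lemma basehE p (v w : tangent (pi p)) : U p -> baseh v w = g p (hlift v) (hlift w).
Proof.
move=> Up; rewrite /baseh -(@gfun_constant (ext v) (ext w) p (pt (pi p))) ?ptK//.
- by rewrite /gfun !extE.
- exact: ptU.
- exact: ext_smooth.
- exact: ext_smooth.
Qed.

Lemma baseJ_tmap a p (v : tangent p) : U p -> baseJ a (tmap pi v) = tmap pi (phi a p v).
Proof.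
move=> Up; rewrite baseJE// hlift_tmap//; apply/eqP; rewrite -subr_eq0 -linearB /=; apply/eqP/(kpi _ Up).
have -> : phi a p (P p v) - phi a p v = - phi a p (v - P p v).
  by move: (P p v) => w; rewrite (aphiB (A a p)) opprB.
move=> w tw; rewrite gE; apply/eqP; rewrite oppr_eq0; apply/eqP.
exact: (DT_phi Q a (PT_compl v)).
Qed.

Lemma baseh_tmap p (v w : tangent p) : U p -> trT S w -> baseh (tmap pi v) (tmap pi w) = g p v w.
Proof.
by move=> Up tw; rewrite basehE// (hlift_tmap_tr Up tw) hlift_tmap// (PT_self Q) (PT_id Q).
Qed.

(** Near pi p the function G is F composed with a local section through p. *)
Lemma section_smooth p (F : M -> R) (G : B -> R) : U p -> smooth_at F p ->
  (forall y, U y -> G (pi y) = F y) -> smooth_at G (pi p).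
Proof.
move=> Up sF GF; have [sg [s0 ss nK]] := basic_section Up.
apply: (@smooth_ext _ _ _ (F \o sg)).
  by apply: filterS nK => b [Us e]; rewrite /= -GF// e.
by apply: (smooth_pull ss); rewrite s0.
Qed.

Lemma baseJ_smooth a : smooth_tensor11 (baseJ a).
Proof.
move=> b; have [p Up <-] := opi b; split.
  move=> t v w; rewrite !baseJE// (hlift_linear Up) (phi_lin Q a).
  by rewrite linearD linearZ.
move=> Y sY h sh; apply: (section_smooth Up (phifun_smooth a Up sY sh)) => y Uy.
by rewrite /tapp baseJE.
Qed.

Lemma baseh_metric : riemannian_metric baseh.
Proof.
move=> b; have [p Up <-] := opi b; split.
- by move=> v w; rewrite !basehE// (g_sym Q).
- by move=> v t w1 w2; rewrite !basehE// (hlift_linear Up) (agDr (A ord0 p)) (agZr (A ord0 p)).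
- move=> v v0; rewrite basehE//; have [_ _ + _] := g_riem Q p; apply.
  by apply: contra v0 => /eqP h0; rewrite -(hliftK v Up) h0 linear0.
- move=> X Y sX sY; apply: (section_smooth Up (gfun_smooth Up sX sY)) => y Uy.
  by rewrite basehE.
Qed.

Lemma related_phi a (Y : vfield B) p : U p ->
  related pi p (tapp (phi a) (fun y => hlift (Y (pi y)))) (tapp (baseJ a) Y).
Proof. by move=> Up; apply: filterS (U_near Up) => y Uy; rewrite /tapp baseJE. Qed.

Lemma base_nijenhuis a p Y1 Y2 : U p -> vsmooth_at Y1 (pi p) -> vsmooth_at Y2 (pi p) ->
  nijenhuis (baseJ a) Y1 Y2 (pi p) = 0.
Proof.
move=> Up s1 s2; have h1 := hlift_smooth Up s1; have h2 := hlift_smooth Up s2.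
have r1 := near_hliftK Y1 Up; have r2 := near_hliftK Y2 Up.
have p1 := related_phi a Y1 Up; have p2 := related_phi a Y2 Up.
have [_ sJ] := baseJ_smooth a (pi p); have sJ1 := sJ _ s1; have sJ2 := sJ _ s2.
have sp1 := vsmooth_phi Q a h1; have sp2 := vsmooth_phi Q a h2; have sp := spi Up.
rewrite /nijenhuis -(bracket_related sp h1 h2 s1 s2 r1 r2) -(bracket_related sp sp1 sp2 sJ1 sJ2 p1 p2).
rewrite -(bracket_related sp sp1 h2 sJ1 s2 p1 r2) -(bracket_related sp h1 sp2 s1 sJ2 r1 p2).
rewrite !baseJ_tmap// -linearD -!linearB /=; apply/(kpi _ Up).
have [_ n _] := q3_qs Q a; have := n p _ _ h1 h2; rewrite /= /nijenhuis => /eqP; rewrite addr_eq0 => /eqP ->.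
move=> w tw; rewrite gE gE (DT_xi Q a tw) mulr0 oppr0.
by [].
Qed.

Lemma base_closed a p X Y Z : U p -> vsmooth_at X (pi p) -> vsmooth_at Y (pi p) -> vsmooth_at Z (pi p) ->
  d2 (fun b v w => baseh v (baseJ a w)) X Y Z (pi p) = 0.
Proof.
move=> Up sX sY sZ.
pose lf (Y : vfield B) : vfield M := fun y => hlift (Y (pi y)).
have D (Y1 Y2 Y3 : vfield B) : vsmooth_at Y2 (pi p) -> vsmooth_at Y3 (pi p) ->
    Y1 (pi p) (fun b => baseh (Y2 b) (baseJ a (Y3 b))) = lf Y1 p (fun y => g y (lf Y2 y) (phi a y (lf Y3 y))).
  move=> s2 s3; have [_ sJ] := baseJ_smooth a (pi p).
  have [_ _ _ sh] := baseh_metric (pi p); have sF := sh _ _ s2 (sJ _ s3).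
  rewrite -{1}(hliftK (Y1 (pi p)) Up) tmapE//; last exact: spi.
  apply: tangent_near; first exact: (smooth_pull (spi Up) sF).
  apply: filterS (U_near Up) => y Uy /=; rewrite baseJE// basehE// hlift_tmap_tr//.
  by apply: (trT_phi Q); exact: hlift_tr.
have E (Y1 Y2 Y3 : vfield B) : vsmooth_at Y1 (pi p) -> vsmooth_at Y2 (pi p) ->
    baseh (bracket Y1 Y2 (pi p)) (baseJ a (Y3 (pi p))) = g p (bracket (lf Y1) (lf Y2) p) (phi a p (lf Y3 p)).
  move=> s1 s2; have h1 := hlift_smooth Up s1; have h2 := hlift_smooth Up s2.
  rewrite -(bracket_related (spi Up) h1 h2 s1 s2 (near_hliftK Y1 Up) (near_hliftK Y2 Up)).
  by rewrite baseJE// baseh_tmap//; apply: (trT_phi Q); exact: hlift_tr.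
rewrite /d2 !D// !E//.
have [_ _ cl] := q3_qs Q a; have := cl p (lf X) (lf Y) (lf Z).
by rewrite /d2 /fundamental_form /=; apply; exact: hlift_smooth.
Qed.

Lemma base_kahler a : kahler (baseJ a) baseh.
Proof.
have ph p (v : tangent p) : horT S v -> phi a p (phi a p v) = - v.
  by move=> hv; have [-> _ _] := acm_pt Q a p; rewrite hv scale0r addr0.
split; [exact: baseJ_smooth|exact: baseh_metric|..].
- move=> b; have [p Up <-] := opi b => v; rewrite (baseJE a v Up) baseJ_tmap// ph; last by case: (hlift_tr v).
  by rewrite linearN /= hliftK.
- move=> b; have [p Up <-] := opi b => v w.
  rewrite !baseJE// !basehE// !hlift_tmap_tr//; try by apply: (trT_phi Q); exact: hlift_tr.
  have [_ _ ->] := acm_pt Q a p; have [hv _] := hlift_tr v.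
  by rewrite hv mul0r subr0.
split=> b; have [p Up <-] := opi b; first by move=> X Y; exact: base_nijenhuis.
by move=> X Y Z; exact: base_closed.
Qed.

Lemma base_hyper_kahler : hyper_kahler baseJ baseh.
Proof.
split=> [|s es a b c x]; first exact: base_kahler.
have [p Up <-] := opi x => v; have [h1 h2 _ _] := three_contact_relationsP Q p es.
have [hv _] := hlift_tr v.
rewrite !(baseJE _ v Up) !baseJ_tmap//; split; [rewrite h1|rewrite h2]; rewrite hv scale0r.
  by rewrite subr0.
by rewrite addr0 linearN.
Qed.

Lemma base_projects : projects_to U pi S baseJ baseh.
Proof.
move=> p Up v w /(distE4mE Q) tv /(distE4mE Q) tw; split; first by move=> a; rewrite baseJ_tmap.
by rewrite baseh_tmap.
Qed.

End Base.

Theorem theorem5p6 (R : realType) (n l : nat) (hln : (l <= n)%N)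
    (M : manifold R (4 * n + 3)) (S : acm3 M)
    (hS : three_quasi_Sasakian S)
    (hrank : forall a : 'I_3, has_rank (acm_of S a) (4 * l + 3)) :
  [/\ integrable_corank (4 * (n - l)) (distE4l3 S),
      forall (L : manifold R (4 * l + 3)) (F : L -> M),
        leaf (distE4l3 S) F ->
        exists S' : acm3 L, induced_structure F S S' /\
          exists alpha : R, three_alpha_Sasakian alpha S'
    & forall (B : manifold R (4 * (n - l))) (U : set M) (pi : M -> B),
        defining_submersion (distE4l3 S) U pi ->
        exists (J : 'I_3 -> tensor11 B) (h : bilform B),
          hyper_kahler J h /\ projects_to U pi S J h].
Proof.
have Q : quasi3 S by case: hS => -[_ hrel] hqs.
have [r [rE nz z]] := hrank ord0.
(* Here 2 r + 1 = 4 l + 3, so r = 2 l + 1. *)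
have r0 : (0 < r)%N by lia.
have f0 := fT_nz Q r0 nz z.
have DE p : distE4l3 S p = [set v | DT S v].
  by rewrite eqEsubset; split => v /(distE4l3E Q).
split.
- move=> p; have [c ac cp] := atlas_cover p.
  have KE : distE4l3 S = (fun p => [set v | PT S ord0 p v = 0]).
    by apply: functional_extensionality_dep => x; rewrite DE eqEsubset; split => v /(DT_P Q f0 ord0).
  rewrite KE; exists (euclidean R (4 * (n - l))).
  apply: (kernel_submersion (PT_smooth Q f0 ord0) _ _ _ ac cp).
  + by move=> x v; rewrite (PT_id Q ord0 (PT_tr Q f0 ord0 _)).
  (* The projector has rank 4 n + 3 - (2 r + 1) = 4 (n - l), the corank of the distribution. *)
  + by move=> c' x ac' cx; have := dmatP_rank Q r0 nz z ac' cx; lia.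
  + move=> x X Y sX sY dX dY; apply/(DT_P Q f0 ord0); apply: (DT_involutive Q f0 sX sY).
      by apply: filterS dX => y /(DT_P Q f0 ord0).
    by apply: filterS dY => y /(DT_P Q f0 ord0).
- move=> L F [[p0 _] [cL _ sF iF rF] _].
  have {}rF p : range (@tmap _ _ _ _ _ F p) = [set w | DT S w] by rewrite rF DE.
  exists (leaf_structure S F); split; first exact: (leaf_induced Q rF).
  (* M may be disconnected, so the constant belongs to the leaf: it is half the value of f at a
     point of the leaf. *)
  exists (2^-1 * fT S (F p0)); split.
    by split; [exact: (leaf_acm Q sF iF rF)|exact: (leaf_rel Q iF rF)].
  exact: (leaf_sasakian Q f0 cL sF iF rF).
- move=> B U pi [oU spi rk opi cpi].
  have rpi p : U p -> range (@tmap _ _ _ _ _ pi p) = setT by move=> /rk[].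
  have kpi p (v : tangent p) : U p -> tmap pi v = 0 <-> DT S v.
    move=> /rk[_ kE]; split=> [v0|/(distE4l3E Q)]; last by rewrite kE.
    by apply/(distE4l3E Q); rewrite kE.
  have opi' b : exists2 p, U p & pi p = b by have : (pi @` U) b by rewrite opi.
  exists (baseJ S opi'), (baseh S opi'); split.
    exact: (base_hyper_kahler Q f0 oU spi rpi kpi opi' cpi).
  exact: (base_projects Q f0 oU spi rpi kpi opi' cpi).
Qed.
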